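(* Let $\omega$ be an abelian differential of the third kind having poles on a compact Riemann surface $\Sigma$, whose residues are all nonzero real numbers and whose real part is exact outside the set of poles of $\omega$. Then there exists a unique reducible metric $g$ on $\Sigma$ such that $\omega$ is one of the character 1-forms of $g$ and $g$ can be expressed by $g=f^*g_{\rm st}$, where $$f(z)=\exp\Bigl(\int^z\omega\Bigr)$$ is a multi-valued locally univalent meromorphic function on $\Sigma\setminus\{\text{poles of }\omega\}$ with monodromy in $\mathrm{U}(1)$. Suppose that the canonical divisor of $\omega$ has the form $$(\omega)=\sum_{j=1}^J(\alpha_j-1)P_j-\sum_{k=J+1}^N Q_k,$$ where the $\alpha_j$ are integers $>1$. Then the divisor $D$ represented by $g$ has the form $$D=\sum_{j=1}^J(\alpha_j-1)P_j+\sum_{k=J+1}^N\bigl(|\mathrm{Res}_{Q_k}(\omega)|-1\bigr)Q_k .$$ Moreover, $g$ is a trivial reducible metric if and only if the integral of $\omega$ over each loop in $\Sigma\setminus\{\text{poles of }\omega\}$ is $2\pi\sqrt{-1}$ times an integer; in particular, in this case each residue of $\omega$ is an integer.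
   Context: An abelian differential of the third kind is a meromorphic 1-form all of whose poles are simple. $\int^z\omega$ denotes the (multi-valued) indefinite integral of $\omega$ along paths in $\Sigma\setminus\{\text{poles of }\omega\}$. Conformal metrics: a conformal metric $g$ on $\Sigma$ has a conical singularity at $p$ with angle $2\pi\alpha>0$ if near $p$, $g=e^{2\varphi}|dz|^2$ with $z$ a local complex coordinate, $z(p)=0$, and $\varphi-(\alpha-1)\ln|z|$ continuous near $p$. $g$ represents $D=\sum_j(\alpha_j-1)P_j$ ($P_j$ is the point $p_j$ viewed as a divisor) if $g$ is smooth away from the points $p_j$ and has a conical singularity of angle $2\pi\alpha_j$ at each $p_j$. Developing maps: $\overline{\mathbb{C}}$ is the Riemann sphere with $g_{\rm st}=\frac{4|dw|^2}{(1+|w|^2)^2}$ and $\mathrm{PSU}(2)$ is its group of orientation-preserving isometries, acting by Möbius transformations. A multi-valued meromorphic function is obtained by analytic continuation of a function element along all paths; it is locally univalent if all its function elements are locally injective. Its monodromy belongs to a group $G$ of Möbius transformations if continuation along any loop replaces a function element $\mathfrak{f}$ by $L\circ\mathfrak{f}$ with $L\in G$. For a conformal metric $g$ of Gauss curvature one with finitely many conical singularities, with $\Sigma^*$ the complement of the singularities, a developing map of $g$ is a multi-valued locally univalent meromorphic function $f$ on $\Sigma^*$ with $g=f^*g_{\rm st}$; it exists, has monodromy in $\mathrm{PSU}(2)$, and is unique up to post-composition with elements of $\mathrm{PSU}(2)$. Reducible metrics: such a metric $g$ (constant curvature one, finitely many conical singularities) is reducible if the monodromy group of a developing map has at least one fixed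 point on $\overline{\mathbb{C}}$; a reducible metric is trivial if this monodromy is trivial, otherwise non-trivial. $\mathrm{U}(1)\subset\mathrm{PSU}(2)$ is the subgroup of maps $w\mapsto e^{2\sqrt{-1}\theta}w$, $\theta\in\mathbb{R}$. A developing map is multiplicative if its monodromy belongs to $\mathrm{U}(1)$. If $g$ is non-trivial reducible, a character 1-form of $g$ is $df/f$ with $f$ a multiplicative developing map (unique up to sign). If $g$ is trivial, a character 1-form is $df/f$ for any developing map $f$ of $g$. Character 1-forms are regarded as meromorphic 1-forms on $\Sigma$.
   Formalization: Local univalence of f is stated on Σ minus the poles and zeros of ω, since f is not locally injective at zeros of ω; uniqueness of g is stated for each fixed choice of the additive constant in ∫ω, since changing its real part changes the metric. *)

(* Defs.v *)
From HB Require Import structures.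
From mathcomp Require Import all_boot all_order all_algebra.
From mathcomp Require Export complex.
From mathcomp Require Import all_classical all_reals all_analysis.

Set Implicit Arguments.
Unset Strict Implicit.
Unset Printing Implicit Defensive.

Import Order.TTheory GRing.Theory Num.Theory numFieldNormedType.Exports.

Local Open Scope classical_set_scope.
Local Open Scope ring_scope.
Local Open Scope complex_scope.

(* The complex plane is R[i]; its alias R[i]^o carries the topology and the
   structure of a normed space over R[i], so that [derivable h z 1] and
   [derive1 h z] for h : R[i]^o -> R[i]^o are complex differentiability and
   the complex derivative. *)

Section ComplexAnalysis.
Variable R : realType.
Implicit Types (z : R[i]) (h : R[i]^o -> R[i]^o) (u : R[i]^o -> R).

(* `|z| lives in R[i]; this is its value in R. *)
Definition cabs z : R := complex.Re `|z|.

Definition cexp z : R[i] :=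
  (expR (complex.Re z) * cos (complex.Im z))
  +i* (expR (complex.Re z) * sin (complex.Im z)).

Definition holomorphic_at h (z0 : R[i]^o) : Prop :=
  \forall z \near z0, derivable h z 1.

(* partial derivatives in the real coordinates x, y of z = x + i y *)
Definition dx u : R[i]^o -> R := fun z => derive1 (fun t : R => u (z + t%:C)) 0.
Definition dy u : R[i]^o -> R :=
  fun z => derive1 (fun t : R => u (z + t%:C * 'i)) 0.

Fixpoint Ck (n : nat) (V : set R[i]^o) u : Prop :=
  if n is n'.+1 then
    [/\ forall z, V z -> derivable (fun t : R => u (z + t%:C)) 0 1,
        forall z, V z -> derivable (fun t : R => u (z + t%:C * 'i)) 0 1,
        Ck n' V (dx u) & Ck n' V (dy u)]
  else forall z, V z -> {for z, continuous u}.

Definition smooth_on (V : set R[i]^o) u : Prop := forall n, Ck n V u.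

(* Gauss curvature of rho |dz|^2 = e^{2 phi} |dz|^2, i.e. - e^{-2 phi} Lap phi *)
Definition gauss_curvature (rho : R[i]^o -> R) (z : R[i]^o) : R :=
  let phi := fun z' => ln (rho z') / 2 in
  - (dx (dx phi) z + dy (dy phi) z) / rho z.

(* The Riemann sphere is option R[i], with None the point at infinity. *)
Definition sphere_inv (w : option R[i]) : option R[i] :=
  if w is Some a then (if a == 0 then None else Some a^-1) else Some 0.

Definition mobius (a b c d : R[i]) (w : option R[i]) : option R[i] :=
  match w with
  | Some z => if c * z + d == 0 then None else Some ((a * z + b) / (c * z + d))
  | None => if c == 0 then None else Some (a / c)
  end.

Definition mobius_transformation : set (option R[i] -> option R[i]) :=
  [set L | exists a b c d, a * d - b * c != 0 /\ L = mobius a b c d].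

Definition U1 : set (option R[i] -> option R[i]) :=
  [set L | exists theta : R, L = omap (fun w => cexp ((2 * theta)%:C * 'i) * w)].

End ComplexAnalysis.

(* A Riemann surface is connected and Hausdorff; crd i : dom i -> R[i] are the
   charts and crd_inv i their inverses.  Compactness is a separate hypothesis. *)
Record riemannSurface (R : realType) := RiemannSurface {
  surface :> topologicalType;
  chart : Type;
  dom : chart -> set surface;
  crd : chart -> surface -> R[i];
  crd_inv : chart -> R[i] -> surface;
  dom_open : forall i, open (dom i);
  dom_cover : forall x, exists i, dom i x;
  crd_open : forall i, open (crd i @` dom i : set R[i]^o);
  crdK : forall i x, dom i x -> crd_inv i (crd i x) = x;
  crd_continuous : forall i x, dom i x ->
    {for x, continuous (crd i : surface -> R[i]^o)};
  crd_inv_continuous : forall i x, dom i x ->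
    {for crd i x, continuous (crd_inv i : R[i]^o -> surface)};
  transition_holomorphic : forall i j x, dom i x -> dom j x ->
    holomorphic_at (crd j \o crd_inv i) (crd i x);
  surface_hausdorff : hausdorff_space surface;
  surface_connected : connected [set: surface]
}.

Section Surface.
Variables (R : realType) (S : riemannSurface R).
Implicit Types (i j : chart S) (x p q : S).

(* derivative of the coordinate change z_i |-> z_j at x *)
Definition transition' i j x : R[i] :=
  derive1 (crd j \o crd_inv i : R[i]^o -> R[i]^o) (crd i x).

(* a = (z - z(p))^n h(z) near p, with h holomorphic and h(z(p)) <> 0, z = crd i.
   As 0 ^ n = 0 for n < 0, the value of a at a pole is fixed to be 0. *)
Definition has_order (a : S -> R[i]) i p (n : int) : Prop :=
  exists h : R[i]^o -> R[i]^o,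
    [/\ holomorphic_at h (crd i p), h (crd i p) != 0
      & \forall x \near p, a x = (crd i x - crd i p) ^ n * h (crd i x)].

(* The form is (form i) dz_i on dom i. *)
Record meromorphicForm := MeromorphicForm {
  form :> chart S -> S -> R[i];
  form_compat : forall i j x, dom i x -> dom j x ->
    form i x = form j x * transition' i j x;
  form_meromorphic : forall i p, dom i p ->
    (\forall x \near p, form i x = 0) \/ exists n, has_order (form i) i p n
}.

Implicit Types (w : meromorphicForm).

Definition ord_form w p (n : int) : Prop :=
  exists i, dom i p /\ has_order (w i) i p n.

Definition poles w : set S := [set p | exists n, n < 0 /\ ord_form w p n].
Definition zeros w : set S := [set p | exists n, 0 < n /\ ord_form w p n].

(* the canonical divisor (w) equals D *)
Definition canonical_divisor w (D : S -> int) : Prop :=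
  forall x, ord_form w x (D x).

Definition third_kind w : Prop :=
  forall p, poles w p -> ord_form w p (-1).

(* coefficient of (z - z(p))^-1 in the principal part plus holomorphic part *)
Definition Res w p : R[i] := xget 0 [set r : R[i] |
  exists i (N : nat) (c : nat -> R[i]) (h : R[i]^o -> R[i]^o),
    [/\ dom i p, c 0%N = r, holomorphic_at h (crd i p)
      & \forall x \near p^', w i x =
          \sum_(k < N.+1) c k * (crd i x - crd i p) ^- k.+1 + h (crd i x)]].

(* Re w = du; in a coordinate z = x + i y, Re (a dz) = Re a dx - Im a dy *)
Definition real_part_exact w : Prop :=
  exists u : S -> R, forall x i, ~ poles w x -> dom i x ->
    is_derive (0 : R) 1 (fun t : R => u (crd_inv i (crd i x + t%:C)))
      (complex.Re (w i x)) /\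
    is_derive (0 : R) 1 (fun t : R => u (crd_inv i (crd i x + t%:C * 'i)))
      (- complex.Im (w i x)).

Definition path_in (X : set S) (gamma : R -> S) p q : Prop :=
  [/\ {within `[0, 1], continuous gamma}, gamma 0 = p, gamma 1 = q
    & forall t, 0 <= t <= 1 -> X (gamma t)].

Definition local_primitive w (F : S -> R[i]) p : Prop :=
  \forall x \near p, forall i, dom i x ->
    is_derive (crd i x : R[i]^o) 1 (F \o crd_inv i : R[i]^o -> R[i]^o) (w i x).

(* The integral of w along a continuous path gamma is Phi 1 - Phi 0, where Phi
   is a primitive of w along gamma. *)
Definition path_integral w (gamma : R -> S) (v : R[i]) : Prop :=
  exists Phi : R -> R[i], v = Phi 1 - Phi 0 /\
    forall t, 0 <= t <= 1 -> exists F, local_primitive w F (gamma t) /\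
      \forall s \near within `[0, 1] (nbhs t), Phi s = F (gamma s).

Definition meromorphic_at (h : S -> option R[i]) p : Prop :=
  exists i (u : R[i]^o -> R[i]^o), [/\ dom i p, holomorphic_at u (crd i p) &
    (\forall x \near p, h x = Some (u (crd i x))) \/
    ((\forall x \near p, sphere_inv (h x) = Some (u (crd i x))) /\
     ~ (\forall x \near p, u (crd i x) = 0))].

Definition continuation (gamma : R -> S) (h k : S -> option R[i]) : Prop :=
  exists H : R -> S -> option R[i],
    [/\ forall t, 0 <= t <= 1 -> meromorphic_at (H t) (gamma t) /\
          \forall s \near within `[0, 1] (nbhs t),
            \forall x \near gamma s, H s x = H t x,
        \forall x \near gamma 0, H 0 x = h x
      & \forall x \near gamma 1, H 1 x = k x].

(* A multi-valued function is the set of its function elements: f p h means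
   that the germ of h at p is a function element of f. *)
Definition multivalued := S -> (S -> option R[i]) -> Prop.
Implicit Types (f : multivalued).

Definition multivalued_meromorphic (X : set S) f : Prop :=
  exists p h, [/\ X p, meromorphic_at h p,
    forall gamma q, path_in X gamma p q -> exists k, continuation gamma h k
  & forall q k, f q k <->
      exists gamma, path_in X gamma p q /\ continuation gamma h k].

Definition locally_univalent_on (X : set S) f : Prop :=
  forall p h, X p -> f p h -> exists2 V, nbhs p V &
    forall x y, V x -> V y -> h x = h y -> x = y.

Definition monodromy_in (X : set S) (G : set (option R[i] -> option R[i])) f :=
  forall p h gamma k, f p h -> path_in X gamma p p -> continuation gamma h k ->
    exists2 L, G L & \forall x \near p, k x = L (h x).

(* The monodromy group acting on the function element h at p; another element
   of the same multi-valued function gives a conjugate group. *)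
Definition monodromy_group (X : set S) p (h : S -> option R[i]) :=
  [set L | mobius_transformation L /\
     exists gamma, path_in X gamma p p /\ continuation gamma h (L \o h)].

(* g = (dens i) |dz_i|^2 off the finite set sing; values on sing are junk. *)
Record conformalMetric := ConformalMetric {
  dens :> chart S -> S -> R;
  sing : set S;
  sing_finite : finite_set sing;
  dens_compat : forall i j x, ~ sing x -> dom i x -> dom j x ->
    dens i x = dens j x * cabs (transition' i j x) ^+ 2;
  dens_gt0 : forall i x, ~ sing x -> dom i x -> 0 < dens i x;
  dens_smooth : forall i,
    smooth_on (crd i @` (dom i `\` sing)) (dens i \o crd_inv i)
}.

Implicit Types (g : conformalMetric).

Definition metric_eq g g' : Prop :=
  sing g = sing g' /\
  forall i x, ~ sing g x -> dom i x -> dens g i x = dens g' i x.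

(* conical singularity of angle 2 pi alpha, with e^{2 phi} = dens g i *)
Definition conical g p (alpha : R) : Prop :=
  0 < alpha /\ exists i (v : S -> R),
    [/\ dom i p, \forall x \near p, {for x, continuous v}
      & \forall x \near p^',
          ln (g i x) / 2 - (alpha - 1) * ln (cabs (crd i x - crd i p)) = v x].

(* A point of angle 2 pi has coefficient 0 in the divisor: it is an ordinary
   smooth point, not a member of sing g. *)
Definition represents g (D : S -> R) : Prop :=
  sing g = [set p | D p != 0] /\
  forall p, sing g p -> conical g p (D p + 1).

Definition conical_metric_of_curvature_one g : Prop :=
  (exists D, represents g D) /\
  forall i x, ~ sing g x -> dom i x ->
    gauss_curvature (dens g i \o crd_inv i) (crd i x) = 1.

(* Density with respect to |dz_i|^2 of the pull-back by h of
   4 |dw|^2 / (1 + |w|^2)^2; at a pole of h the coordinate 1/w is used, in which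
   the metric has the same expression. *)
Definition pullback_density i (h : S -> option R[i]) p : R :=
  let D (k : S -> option R[i]) :=
    cabs (derive1 (fun z : R[i]^o => odflt 0 (k (crd_inv i z)) : R[i]^o)
            (crd i p)) in
  if h p is Some a then 4 * D h ^+ 2 / (1 + cabs a ^+ 2) ^+ 2
  else 4 * D (@sphere_inv R \o h) ^+ 2.

(* g = f^* g_st wherever both sides are defined *)
Definition is_pullback g f : Prop :=
  forall p h i, f p h -> ~ sing g p -> dom i p ->
    dens g i p = pullback_density i h p.

Definition developing_map g f : Prop :=
  [/\ multivalued_meromorphic (~` sing g) f,
      locally_univalent_on (~` sing g) f & is_pullback g f].

Definition reducible g : Prop :=
  conical_metric_of_curvature_one g /\
  exists f p h, [/\ developing_map g f, f p h &
    exists a : option R[i],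
      forall L, monodromy_group (~` sing g) p h L -> L a = a].

Definition trivial_reducible g : Prop :=
  reducible g /\
  exists2 f, developing_map g f & monodromy_in (~` sing g) [set id] f.

Definition multiplicative g f : Prop := monodromy_in (~` sing g) (@U1 R) f.

(* w = df / f; the remaining points, where f is 0 or infinite or not defined,
   are isolated. *)
Definition is_dlog w f : Prop :=
  forall p h i a, f p h -> dom i p -> h p = Some a -> a != 0 ->
    w i p = derive1 (fun z : R[i]^o => odflt 0 (h (crd_inv i z)) : R[i]^o)
              (crd i p) / a.

Definition character_form g w : Prop :=
  (trivial_reducible g /\ exists2 f, developing_map g f & is_dlog w f) \/
  [/\ reducible g, ~ trivial_reducible g &
      exists f, [/\ developing_map g f, multiplicative g f & is_dlog w f]].

(* exp (c + int_p^z w), the integral being taken along all paths from p that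
   avoid the poles *)
Definition exp_integral w p (c : R[i]) : multivalued := fun q h =>
  exists gamma v F,
    [/\ path_in (~` poles w) gamma p q, path_integral w gamma v,
        local_primitive w F q, F q = c + v
      & \forall x \near q, h x = Some (cexp (F x))].

End Surface.

(* Main.v *)
Require Import Defs.
From HB Require Import structures.
From mathcomp Require Import all_boot all_order all_algebra.
From mathcomp Require Import complex.
From mathcomp Require Import all_classical all_reals all_analysis.
From mathcomp Require Import ring lra.

Set Implicit Arguments.
Unset Strict Implicit.
Unset Printing Implicit Defensive.

Import Order.TTheory GRing.Theory Num.Theory numFieldNormedType.Exports.

Local Open Scope classical_set_scope.
Local Open Scope ring_scope.
Local Open Scope complex_scope.

Local Notation Re := complex.Re.
Local Notation Im := complex.Im.

(** Since Re w is exact, exp (int w) has a single-valued modulus e^U, where U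
    is a potential of Re w. Hence all its branches differ by rotations of the
    sphere fixing 0 and infinity, and the pull-back g of the spherical metric
    does not depend on the branch: its density is 4 |w|^2 e^(2U) / (1 + e^(2U))^2.

    The germs of exp (int w) form a local system with structure group U(1)
    (dev_germ, dev_germ_compare). It extends to the poles of residue 1 and -1,
    where exp (int w) has a simple zero or a simple pole (pole_dev_germ), and
    its germs are locally injective off the zeros of w
    (nonsingular_univalent). So g is smooth of curvature one outside the zeros
    of w and the other poles (density_smooth, density_curvature); the formula
    for the density, together with the expansions of w and of U at these
    points, gives the cone angles (conical_zero, conical_pole), hence the
    divisor. Continuing one germ over the complement of the singularities gives
    a developing map f with df / f = w and monodromy in U(1). A monodromy map
    is a rotation on the values of f, hence fixes 0 (monodromy_fixes0), so g is
    reducible and w is one of its character forms. The pull-back condition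
    prescribes a metric off finitely many points, and the cone angles decide
    which of these are singular (spherical_metric_unique).

    If w has its periods in 2 pi i Z, then exp (int w) is single-valued off the
    poles and generates a developing map without monodromy
    (trivial_of_loops). Conversely, two developing maps of g differ by a Moebius
    transformation because the spherical density determines a holomorphic
    function up to rotations (rigidity): half its logarithm has the complex
    derivative f'' / f' - 2 f' conj(f) / (1 + |f|^2), so that f solves a second
    order differential equation. If one developing map has trivial
    monodromy, then so has exp (int w), and its periods are in 2 pi i Z
    (loops_of_trivial); around a pole this says that the residue is an integer
    (integer_residue).

    The complex analysis that this needs is built from Goursat's lemma: local
    primitives, Cauchy's formula, holomorphy of the derivative and the identity
    theorem. *)

(** * Real coordinates on the complex plane *)

Section Modulus.
Variable R : realType.
Implicit Types (z w : R[i]) (t : R).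

Lemma normE z : `|z| = (cabs z)%:C.
Proof. by rewrite /cabs normc_def. Qed.

Lemma cabsE z : cabs z = Num.sqrt ((Re z)^+2 + (Im z)^+2).
Proof. by rewrite /cabs normc_def. Qed.

Lemma cabs_ge0 z : 0 <= cabs z.
Proof. by rewrite cabsE sqrtr_ge0. Qed.

Lemma sqr_cabs z : cabs z ^+ 2 = Re z ^+ 2 + Im z ^+ 2.
Proof. by rewrite cabsE sqr_sqrtr// addr_ge0// sqr_ge0. Qed.

Lemma cabs0 : cabs (0 : R[i]) = 0.
Proof. by rewrite /cabs normr0. Qed.

Lemma cabs1 : cabs (1 : R[i]) = 1.
Proof. by rewrite /cabs normr1. Qed.

Lemma cabs_eq0 z : (cabs z == 0) = (z == 0).
Proof.
rewrite -[z == 0]normr_eq0 normE; apply/eqP/eqP => [->//|]; exact: complexI.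
Qed.

Lemma cabs_gt0 z : (0 < cabs z) = (z != 0).
Proof. by rewrite lt_def cabs_ge0 cabs_eq0 andbT. Qed.

Lemma cabsM z w : cabs (z * w) = cabs z * cabs w.
Proof. by apply: complexI; rewrite rmorphM -!normE normrM. Qed.

Lemma cabsX z n : cabs (z ^+ n) = cabs z ^+ n.
Proof. by elim: n => [|n IH]; rewrite ?expr0 ?cabs1// !exprS cabsM IH. Qed.

Lemma cabsV z : cabs z^-1 = (cabs z)^-1.
Proof.
have [->|z0] := eqVneq z 0; first by rewrite invr0 cabs0 invr0.
apply: (mulIf (_ : cabs z != 0)); first by rewrite cabs_eq0.
by rewrite -cabsM !mulVf ?cabs_eq0 ?cabs1.
Qed.

Lemma cabs_div z w : cabs (z / w) = cabs z / cabs w.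
Proof. by rewrite cabsM cabsV. Qed.

Lemma cabsN z : cabs (- z) = cabs z.
Proof. by rewrite /cabs normrN. Qed.

Lemma cabs_distC z w : cabs (z - w) = cabs (w - z).
Proof. by rewrite -cabsN opprB. Qed.

Lemma cabsD z w : cabs (z + w) <= cabs z + cabs w.
Proof.
by rewrite -lecR rmorphD -!normE; exact: ler_normD.
Qed.

Lemma cabsB z w : cabs (z - w) <= cabs z + cabs w.
Proof. by rewrite -(cabsN w) cabsD. Qed.

Lemma cabs_sub z w : cabs z - cabs w <= cabs (z - w).
Proof. by rewrite lerBlDr; have := cabsD (z - w) w; rewrite subrK. Qed.

Lemma cabs_tri z w v : cabs (z - v) <= cabs (z - w) + cabs (w - v).
Proof. by have := cabsD (z - w) (w - v); rewrite addrA subrK. Qed.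

Lemma cabsR t : cabs t%:C = `|t|.
Proof. by rewrite cabsE /= expr0n /= addr0 sqrtr_sqr. Qed.

Lemma cabs_i : cabs ('i%R : R[i]) = 1.
Proof. by rewrite cabsE /= expr0n /= add0r expr1n sqrtr1. Qed.

Lemma Re_le z : `|Re z| <= cabs z.
Proof.
rewrite cabsE -sqrtr_sqr ler_wsqrtr// lerDl sqr_ge0//.
Qed.

Lemma Im_le z : `|Im z| <= cabs z.
Proof.
by rewrite cabsE -sqrtr_sqr ler_wsqrtr// lerDr sqr_ge0.
Qed.

Lemma cabs_le z : cabs z <= `|Re z| + `|Im z|.
Proof.
rewrite {1}[z]complexE (le_trans (cabsD _ _))// cabsM !cabsR.
by rewrite cabs_i mul1r.
Qed.

Lemma ReD z w : Re (z + w) = Re z + Re w. Proof. by case: z w => [a b] [c d]. Qed.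
Lemma ImD z w : Im (z + w) = Im z + Im w. Proof. by case: z w => [a b] [c d]. Qed.
Lemma ReN z : Re (- z) = - Re z. Proof. by case: z. Qed.
Lemma ImN z : Im (- z) = - Im z. Proof. by case: z. Qed.
Lemma ReM z w : Re (z * w) = Re z * Re w - Im z * Im w.
Proof. by case: z w => [a b] [c d]. Qed.
Lemma ImM z w : Im (z * w) = Re z * Im w + Im z * Re w.
Proof. by case: z w => [a b] [c d]. Qed.
Definition ReImE := (ReD, ImD, ReN, ImN, ReM, ImM).

Lemma complex_eq z w : Re z = Re w -> Im z = Im w -> z = w.
Proof. by case: z w => [a b] [c d] /= -> ->. Qed.

End Modulus.

Section Near.
Variable R : realType.
Local Notation Co := (R[i]^o).

(** The topology of R[i]^o is that of a normed space over R[i], with radii in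
    R[i]; here it is described by radii in R. *)
Lemma nearC (z0 : Co) (P : Co -> Prop) :
  (\forall z \near z0, P z) <->
  exists2 e : R, 0 < e & forall z, cabs (z - z0) < e -> P z.
Proof.
split.
  move/nbhs_ballP => [e /= e0 Pe].
  have eE : e = (Re e)%:C by rewrite RRe_real// gtr0_real.
  exists (Re e); first by rewrite -ltcR -eE.
  move=> z ze; apply: Pe; rewrite -ball_normE /ball_ /= normE eE ltcR.
  by rewrite cabs_distC.
move=> [e e0 Pe]; apply/nbhs_ballP; exists e%:C => /=; first by rewrite ltcR.
move=> z; rewrite -ball_normE /ball_ /= normE ltcR cabs_distC; exact: Pe.
Qed.

Lemma nearC' (z0 : Co) (P : Co -> Prop) :
  (\forall z \near z0^', P z) <->
  exists2 e : R, 0 < e & forall z, cabs (z - z0) < e -> z != z0 -> P z.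
Proof. exact: (nearC z0 (fun z => z != z0 -> P z)). Qed.

Lemma nearR (t0 : R) (P : R -> Prop) :
  (\forall t \near t0, P t) <->
  exists2 e : R, 0 < e & forall t, `|t - t0| < e -> P t.
Proof.
split.
  move/nbhs_ballP => [e /= e0 Pe]; exists e => // t te; apply: Pe.
  by rewrite -ball_normE /ball_ /= distrC.
move=> [e e0 Pe]; apply/nbhs_ballP; exists e => //= t.
by rewrite -ball_normE /ball_ /= distrC; exact: Pe.
Qed.

Lemma contC (f : Co -> Co) z0 : {for z0, continuous f} <->
  forall e : R, 0 < e -> exists2 d : R, 0 < d &
    forall z, cabs (z - z0) < d -> cabs (f z - f z0) < e.
Proof.
split=> [cf e e0|H].
  have : nbhs (f z0) [set w | cabs (w - f z0) < e].
    by apply/nearC; exists e.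
  by move/cf/nearC.
move=> V /nearC[e e0 HV]; have [d d0 H'] := H _ e0.
by apply/nearC; exists d => // t /H' /HV.
Qed.

Lemma contCR (f : Co -> R) z0 : {for z0, continuous f} <->
  forall e : R, 0 < e -> exists2 d : R, 0 < d &
    forall z, cabs (z - z0) < d -> `|f z - f z0| < e.
Proof.
split=> [cf e e0|H].
  have : nbhs (f z0) [set w | `|w - f z0| < e] by apply/nearR; exists e.
  by move/cf/nearC.
move=> V /nearR[e e0 HV]; have [d d0 H'] := H _ e0.
by apply/nearC; exists d => // t /H' /HV.
Qed.

Lemma contRC (f : R -> Co) t0 : {for t0, continuous f} <->
  forall e : R, 0 < e -> exists2 d : R, 0 < d &
    forall t, `|t - t0| < d -> cabs (f t - f t0) < e.
Proof.
split=> [cf e e0|H].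
  have : nbhs (f t0) [set w | cabs (w - f t0) < e] by apply/nearC; exists e.
  by move/cf/nearR.
move=> V /nearC[e e0 HV]; have [d d0 H'] := H _ e0.
by apply/nearR; exists d => // t /H' /HV.
Qed.

Lemma cont_Re : continuous (fun z : Co => Re z : R).
Proof.
move=> z; apply/contCR => e e0; exists e => // w; apply: le_lt_trans.
by rewrite -ReN -ReD Re_le.
Qed.

Lemma cont_Im : continuous (fun z : Co => Im z : R).
Proof.
move=> z; apply/contCR => e e0; exists e => // w; apply: le_lt_trans.
by rewrite -ImN -ImD Im_le.
Qed.

Lemma cont_cabs : continuous (@cabs R : Co -> R).
Proof.
move=> z; apply/contCR => e e0; exists e => // w; apply: le_lt_trans.
by rewrite ler_norml cabs_sub andbT lerNl opprB cabs_distC cabs_sub.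
Qed.

Lemma cont_complex (T : topologicalType) (f : T -> Co) (x : T) :
  {for x, continuous (fun y => Re (f y) : R)} ->
  {for x, continuous (fun y => Im (f y) : R)} -> {for x, continuous f}.
Proof.
move=> cR cI V /nearC[e e0 HV].
have e2 : 0 < e / 2 by rewrite divr_gt0.
have near2 (a : R) : nbhs a [set u | `|u - a| < e / 2].
  by apply/nearR; exists (e / 2).
have hR : nbhs x [set y | `|Re (f y) - Re (f x)| < e / 2] by exact: cR (near2 _).
have hI : nbhs x [set y | `|Im (f y) - Im (f x)| < e / 2] by exact: cI (near2 _).
apply: filterS (filterI hR hI) => y [/= h1 h2]; apply: HV.
rewrite (le_lt_trans (cabs_le _))// !ReImE (splitr e).
by apply: ltrD.
Qed.

End Near.

Section Derivatives.
Variable R : realType.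
Local Notation Co := (R[i]^o).

(** Stated over any numFieldType, so as to serve for real and for complex
    derivatives alike. *)
Lemma is_deriveE (K : numFieldType) (V : normedModType K) (f : K^o -> V) (z : K^o) (d : V) :
  is_derive z 1 f d <->
  (fun h : K => h^-1 *: (f (h + z) - f z)) @ (0 : K)^' --> d.
Proof.
split=> [[df <-]|H].
  have := df; rewrite /derivable /derive => /cvg_ex[l hl].
  rewrite (_ : (fun h => _) = (fun h : K => h^-1 *: ((f \o shift z) (h *: (1 : K^o)) - f z))).
    by rewrite (cvg_lim _ hl)//; exact: norm_hausdorff.
  by apply/funext => h /=; rewrite /GRing.scale/= mulr1.
have E : (fun h => h^-1 *: (f (h + z) - f z)) = (fun h : K => h^-1 *: ((f \o shift z) (h *: (1 : K^o)) - f z)).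
  by apply/funext => h /=; rewrite [h%:A]mulr1.
split; first by rewrite /derivable -E; apply/cvg_ex; exists d.
by rewrite /derive -E; apply: cvg_lim => //; exact: norm_hausdorff.
Qed.

Lemma cdiffE (f : Co -> Co) (z : Co) d : is_derive z 1 f d <->
  forall e : R, 0 < e -> exists2 r : R, 0 < r & forall w, cabs (w - z) < r ->
    cabs (f w - f z - d * (w - z)) <= e * cabs (w - z).
Proof.
rewrite is_deriveE; split.
  move/cvgrPdist_le => H e e0.
  have := H e%:C; rewrite ltcR => /(_ e0) /nearC'[r r0 Hr].
  exists r => // w wr; have [->|wz] := eqVneq w z.
    by rewrite !subrr mulr0 subr0 cabs0 mulr0.
  have wz0 : w - z != 0 by rewrite subr_eq0.
  have := Hr (w - z); rewrite subr0 => /(_ wr wz0).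
  rewrite subrK normE lecR cabs_distC -ler_pdivrMr ?cabs_gt0//.
  move=> h; rewrite -cabs_div (le_trans _ h)// le_eqVlt; apply/orP; left.
  apply/eqP; congr cabs; rewrite [_ *: _]mulrC mulrBl mulfK//.
move=> H; apply/cvgrPdist_le => e e0.
have eE : e = (Re e)%:C by rewrite RRe_real// gtr0_real.
have [|r r0 Hr] := H (Re e); first by rewrite -ltcR -eE.
apply/nearC'; exists r => // h; rewrite subr0 => hr h0.
have := Hr (h + z); rewrite addrK => /(_ hr).
rewrite -ler_pdivrMr ?cabs_gt0// -cabs_div normE eE lecR cabs_distC.
by rewrite mulrBl mulfK// [_ *: _]mulrC.
Qed.

Lemma rdiffE (f : R -> R) (z : R) d : is_derive z 1 f d <->
  forall e : R, 0 < e -> exists2 r : R, 0 < r & forall w, `|w - z| < r ->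
    `|f w - f z - d * (w - z)| <= e * `|w - z|.
Proof.
rewrite (@is_deriveE _ R^o f); split.
  move/cvgrPdist_le => H e e0.
  have := H _ e0; rewrite near_withinE => /nearR[r r0 Hr].
  exists r => // w wr; have [->|wz] := eqVneq w z.
    by rewrite !subrr mulr0 subr0 normr0 mulr0.
  have wz0 : w - z != 0 by rewrite subr_eq0.
  have := Hr (w - z); rewrite subr0 => /(_ wr wz0).
  rewrite subrK distrC -ler_pdivrMr ?normr_gt0//.
  move=> h; rewrite -normf_div (le_trans _ h)// le_eqVlt; apply/orP; left.
  apply/eqP; congr (`|_|); rewrite [_ *: _]mulrC mulrBl mulfK//.
move=> H; apply/cvgrPdist_le => e e0; have [r r0 Hr] := H e e0.
rewrite near_withinE; apply/nearR; exists r => // h; rewrite subr0 => hr h0.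
have := Hr (h + z); rewrite addrK => /(_ hr).
rewrite -ler_pdivrMr ?normr_gt0// -normf_div distrC.
by rewrite mulrBl mulfK// [_ *: _]mulrC.
Qed.

End Derivatives.

(** * Differentiation rules *)

Section RealRules.
Variable R : realType.
Implicit Types (f g : R -> R) (t a b : R).

(** In the names of the rules below, rd stands for the derivative of a real
    function, cd for a complex derivative and cv for the derivative of a
    curve. *)
Lemma rd_ext f g t a : (forall s, f s = g s) -> is_derive t 1 f a -> is_derive t 1 g a.
Proof. by move=> fg; have -> : g = f by apply/funext. Qed.

Lemma rd_eq f t a b : a = b -> is_derive t 1 f a -> is_derive t 1 f b.
Proof. by move=> ->. Qed.

Lemma rdD f g t a b : is_derive t 1 f a -> is_derive t 1 g b ->
  is_derive t 1 (fun s => f s + g s) (a + b).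
Proof. by move=> df dg; exact: (is_deriveD df dg). Qed.

Lemma rdN f t a : is_derive t 1 f a -> is_derive t 1 (fun s => - f s) (- a).
Proof. by move=> df; exact: (is_deriveN df). Qed.

Lemma rdB f g t a b : is_derive t 1 f a -> is_derive t 1 g b ->
  is_derive t 1 (fun s => f s - g s) (a - b).
Proof. by move=> df dg; exact: (is_deriveB df dg). Qed.

Lemma rdM f g t a b : is_derive t 1 f a -> is_derive t 1 g b ->
  is_derive t 1 (fun s => f s * g s) (a * g t + f t * b).
Proof.
move=> df dg; have := is_deriveM df dg; apply: rd_eq.
by rewrite addrC /GRing.scale /= mulrC.
Qed.

Lemma rd_cst t a : is_derive t 1 (fun=> a) 0.
Proof. exact: is_derive_cst. Qed.

Lemma rd_id t : is_derive t 1 (fun s => s) 1.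
Proof. exact: is_derive_id. Qed.

Lemma rd_comp f g t a b : is_derive (g t) 1 f a -> is_derive t 1 g b ->
  is_derive t 1 (fun s => f (g s)) (a * b).
Proof. by move=> df dg; exact: (is_derive1_comp df dg). Qed.

Lemma rdV f t a : f t != 0 -> is_derive t 1 f a ->
  is_derive t 1 (fun s => (f s)^-1) (- a / f t ^+ 2).
Proof.
move=> f0 [df dfa]; split; first exact: (derivableV f0 df).
have := deriveV f0 df; rewrite dfa => ->.
by rewrite /GRing.scale /= mulNr mulrC mulNr.
Qed.

Lemma rd_unique f t a b : is_derive t 1 f a -> is_derive t 1 f b -> a = b.
Proof. by move=> [_ <-] [_ <-]. Qed.

Lemma rd_near f g t a : (\forall s \near t, f s = g s) ->
  is_derive t 1 f a -> is_derive t 1 g a.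
Proof. by move=> fg; apply: (near_eq_is_derive fg). Qed.

Lemma rd_shift f t a s : is_derive (s + t) 1 f a -> is_derive s 1 (fun u => f (u + t)) a.
Proof.
move=> df; rewrite -[a]mulr1; apply: (@rd_comp f (fun u => u + t)) => //.
by apply: rd_eq (rdD (rd_id _) (rd_cst _ _)); rewrite addr0.
Qed.

Lemma rd_cont f t a : is_derive t 1 f a -> {for t, continuous f}.
Proof. by case=> /derivable1_diffP/differentiable_continuous. Qed.

Lemma rd_cst_itv f a b : a <= b -> (forall t, a <= t <= b -> is_derive t 1 f 0) ->
  f a = f b.
Proof.
move=> ab df; have [t tab||c cab] := @MVT_segment R f (fun=> 0) a b ab.
- by apply: df; rewrite !ltW ?(itvP tab).
- by apply: derivable_within_continuous => t tab; have [] := df t tab.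
by rewrite mul0r => /subr0_eq.
Qed.

Lemma rd_mvt f df a b M : a <= b -> (forall t, a <= t <= b -> is_derive t 1 f (df t)) ->
  (forall t, a <= t <= b -> `|df t| <= M) -> `|f b - f a| <= M * (b - a).
Proof.
move=> ab dfP dM; have [t tab||c cab ->] := @MVT_segment R f df a b ab.
- by apply: dfP; rewrite !ltW ?(itvP tab).
- by apply: derivable_within_continuous => t tab; have [] := dfP t tab.
rewrite normrM [`|b - a|]ger0_norm ?subr_ge0// ler_wpM2r ?subr_ge0//.
by apply: dM.
Qed.

End RealRules.

Section ComplexRules.
Variable R : realType.
Local Notation Co := (R[i]^o).
Implicit Types (f g : Co -> Co) (z a b : Co).

Lemma cd_ext f g z a : (forall s, f s = g s) -> is_derive z 1 f a -> is_derive z 1 g a.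
Proof. by move=> fg; have -> : g = f by apply/funext. Qed.

Lemma cd_eq f z a b : a = b -> is_derive z 1 f a -> is_derive z 1 f b.
Proof. by move=> ->. Qed.

Lemma cd_near f g z a : (\forall s \near z, f s = g s) ->
  is_derive z 1 f a -> is_derive z 1 g a.
Proof. by move=> fg; apply: (near_eq_is_derive fg). Qed.

Lemma cd_unique f z a b : is_derive z 1 f a -> is_derive z 1 f b -> a = b.
Proof. by move=> [_ <-] [_ <-]. Qed.

Lemma cd_derive1 f z a : is_derive z 1 f a -> derive1 f z = a.
Proof. by move=> [_ <-]; rewrite derive1E. Qed.

Lemma cdP f z : derivable f z 1 -> is_derive z 1 f (derive1 f z).
Proof. by move=> df; rewrite derive1E; exact: derivableP. Qed.

Lemma cdD f g z a b : is_derive z 1 f a -> is_derive z 1 g b ->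
  is_derive z 1 (fun s => f s + g s) (a + b).
Proof. by move=> df dg; exact: (is_deriveD df dg). Qed.

Lemma cdN f z a : is_derive z 1 f a -> is_derive z 1 (fun s => - f s) (- a).
Proof. by move=> df; exact: (is_deriveN df). Qed.

Lemma cdB f g z a b : is_derive z 1 f a -> is_derive z 1 g b ->
  is_derive z 1 (fun s => f s - g s) (a - b).
Proof. by move=> df dg; exact: (is_deriveB df dg). Qed.

Lemma cdM f g z a b : is_derive z 1 f a -> is_derive z 1 g b ->
  is_derive z 1 (fun s => f s * g s) (a * g z + f z * b).
Proof.
move=> df dg; have := is_deriveM df dg; apply: cd_eq.
by rewrite addrC /GRing.scale /= mulrC.
Qed.

Lemma cd_cst z a : is_derive z 1 (fun=> a) 0.
Proof. exact: is_derive_cst. Qed.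

Lemma cd_id z : is_derive z 1 (fun s => s) 1.
Proof. exact: is_derive_id. Qed.

Lemma cdZ f z a b : is_derive z 1 f a -> is_derive z 1 (fun s => b * f s) (b * a).
Proof.
move=> df; have := cdM (cd_cst z b) df; apply: cd_eq.
by rewrite mul0r add0r.
Qed.

Lemma cdV f z a : f z != 0 -> is_derive z 1 f a ->
  is_derive z 1 (fun s => (f s)^-1) (- a / f z ^+ 2).
Proof.
move=> f0 [df dfa]; split; first exact: (derivableV f0 df).
have := deriveV f0 df; rewrite dfa => ->.
by rewrite /GRing.scale /= mulNr mulrC mulNr.
Qed.

Lemma cdX f z a n : is_derive z 1 f a ->
  is_derive z 1 (fun s => f s ^+ n) (n%:R * f z ^+ n.-1 * a).
Proof.
move=> df; elim: n => [|n IH].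
  by rewrite !mul0r; exact: cd_cst.
apply: (@cd_ext (fun s => f s * f s ^+ n)); first by move=> s; rewrite exprS.
apply: cd_eq (cdM df IH).
case: n {IH} => [|n]; first by rewrite !expr0 !mul0r mulr0 addr0 !mulr1 mul1r.
by rewrite /= -(natr1 n.+1) !exprS; ring.
Qed.

Lemma cd_cont f z a : is_derive z 1 f a -> {for z, continuous f}.
Proof. by case=> /derivable1_diffP/differentiable_continuous. Qed.

Lemma cd_comp f g z a b : is_derive (g z) 1 f a -> is_derive z 1 g b ->
  is_derive z 1 (fun s => f (g s)) (a * b).
Proof.
move=> /cdiffE df /cdiffE dg; apply/cdiffE => e e0.
set A := cabs a + 1; set B := cabs b + 1.
have A0 : 0 < A by rewrite ltr_wpDl ?cabs_ge0.
have B0 : 0 < B by rewrite ltr_wpDl ?cabs_ge0.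
have [|r1 r10 H1] := df (e / 2 / B); first by rewrite !divr_gt0.
have [|r2 r20 H2] := dg (Num.min 1 (e / 2 / A)).
  by rewrite lt_min ltr01 !divr_gt0.
exists (Num.min r2 (r1 / B)); first by rewrite lt_min r20 divr_gt0.
move=> w; rewrite lt_min ltr_pdivlMr// => /andP[wr2 wr1].
have := H2 w wr2; set d := cabs (w - z); set E := cabs (g w - _ - _) => hE.
have d0 : 0 <= d by exact: cabs_ge0.
have E1 : E <= d by rewrite (le_trans hE)// ler_piMl// ge_min lexx.
have E2 : E <= e / 2 / A * d by rewrite (le_trans hE)// ler_wpM2r// ge_min lexx orbT.
have gB : cabs (g w - g z) <= B * d.
  have -> : g w - g z = (g w - g z - b * (w - z)) + b * (w - z) by rewrite subrK.
  rewrite (le_trans (cabsD _ _))// cabsM mulrDl mul1r addrC lerD2l//.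
have H : cabs (f (g w) - f (g z) - a * (g w - g z)) <= e / 2 / B * cabs (g w - g z).
  by apply: H1; rewrite (le_lt_trans gB)// mulrC.
have -> : f (g w) - f (g z) - a * b * (w - z) =
  (f (g w) - f (g z) - a * (g w - g z)) + a * (g w - g z - b * (w - z)) by ring.
rewrite (le_trans (cabsD _ _))// cabsM (splitr e) mulrDl lerD//.
  rewrite (le_trans H)// (le_trans (ler_wpM2l _ gB)) ?divr_ge0 ?(ltW e0) ?(ltW B0)//.
  by rewrite mulrA divfK ?gt_eqF.
rewrite -/E (@le_trans _ _ (A * E))//; first by rewrite ler_wpM2r ?cabs_ge0 // lerDl.
rewrite (le_trans (ler_wpM2l (ltW A0) E2))// mulrA [A * _]mulrC divfK ?gt_eqF//.
Qed.

Lemma hol_near (f : Co -> Co) z : holomorphic_at f z ->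
  \forall w \near z, holomorphic_at f w.
Proof. by move=> h; exact: near_join. Qed.

End ComplexRules.

(** * Curves in the plane *)

Section Curves.
Variable R : realType.
Local Notation Co := (R[i]^o).
Implicit Types (c : R -> R[i]) (f : Co -> Co) (t : R) (a b d z w : R[i]).

(** The derivative of a curve in the plane is taken componentwise, so that the
    real mean value theorem applies to each component. *)
Definition cderiv c t d :=
  is_derive t 1 (fun s => Re (c s)) (Re d) /\
  is_derive t 1 (fun s => Im (c s)) (Im d).

Lemma cderivE c t d : cderiv c t d <->
  forall e : R, 0 < e -> exists2 r : R, 0 < r & forall s, `|s - t| < r ->
    cabs (c s - c t - d * (s - t)%:C) <= e * `|s - t|.
Proof.
split.
  move=> [/rdiffE dR /rdiffE dI] e e0.
  have e2 : 0 < e / 2 by rewrite divr_gt0.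
  have [r1 r10 H1] := dR _ e2; have [r2 r20 H2] := dI _ e2.
  exists (Num.min r1 r2); first by rewrite lt_min r10.
  move=> s; rewrite lt_min => /andP[/H1 h1 /H2 h2].
  rewrite (le_trans (cabs_le _))// (splitr e) mulrDl lerD//.
    by rewrite !ReImE /= mulr0 subr0.
  by rewrite !ReImE /= mulr0 add0r.
move=> H; split; apply/rdiffE => e /H[r r0 Hr]; exists r => // s /Hr;
  apply: le_trans.
  by apply: le_trans (Re_le _); rewrite !ReImE /= mulr0 subr0.
by apply: le_trans (Im_le _); rewrite !ReImE /= mulr0 add0r.
Qed.

Lemma cv_eq c t a b : a = b -> cderiv c t a -> cderiv c t b.
Proof. by move=> ->. Qed.

Lemma cv_ext c1 c2 t a : (forall s, c1 s = c2 s) -> cderiv c1 t a -> cderiv c2 t a.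
Proof. by move=> /funext ->. Qed.

Lemma cvD c1 c2 t a b : cderiv c1 t a -> cderiv c2 t b ->
  cderiv (fun s => c1 s + c2 s) t (a + b).
Proof.
move=> [h1 h2] [k1 k2]; split.
  by rewrite ReD; apply: rd_ext (rdD h1 k1) => s; rewrite ReD.
by rewrite ImD; apply: rd_ext (rdD h2 k2) => s; rewrite ImD.
Qed.

Lemma cvN c t a : cderiv c t a -> cderiv (fun s => - c s) t (- a).
Proof.
move=> [h1 h2]; split.
  by rewrite ReN; apply: rd_ext (rdN h1) => s; rewrite ReN.
by rewrite ImN; apply: rd_ext (rdN h2) => s; rewrite ImN.
Qed.

Lemma cvB c1 c2 t a b : cderiv c1 t a -> cderiv c2 t b ->
  cderiv (fun s => c1 s - c2 s) t (a - b).
Proof. by move=> h1 h2; apply: cvD h1 (cvN h2). Qed.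

Lemma cvM c1 c2 t a b : cderiv c1 t a -> cderiv c2 t b ->
  cderiv (fun s => c1 s * c2 s) t (a * c2 t + c1 t * b).
Proof.
move=> [h1 h2] [k1 k2]; split.
  apply: (@rd_ext _ (fun s => Re (c1 s) * Re (c2 s) - Im (c1 s) * Im (c2 s))).
    by move=> s; rewrite ReM.
  by apply: rd_eq (rdB (rdM h1 k1) (rdM h2 k2)); rewrite !ReImE; ring.
apply: (@rd_ext _ (fun s => Re (c1 s) * Im (c2 s) + Im (c1 s) * Re (c2 s))).
  by move=> s; rewrite ImM.
by apply: rd_eq (rdD (rdM h1 k2) (rdM h2 k1)); rewrite !ReImE; ring.
Qed.

Lemma cv_cst t a : cderiv (fun=> a) t 0.
Proof. by split; exact: rd_cst. Qed.

Lemma cv_real (u : R -> R) t (a : R) : is_derive t 1 u a ->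
  cderiv (fun s => (u s)%:C) t a%:C.
Proof. by move=> h; split => //=; exact: rd_cst. Qed.

Lemma cvZ c t a b : cderiv c t a -> cderiv (fun s => b * c s) t (b * a).
Proof.
by move=> h; apply: cv_eq (cvM (cv_cst t b) h); rewrite mul0r add0r.
Qed.

Lemma cv_line z w t : cderiv (fun s => z + s%:C * w) t w.
Proof.
apply: cv_eq (cvD (cv_cst t z) (cvM (cv_real (rd_id t)) (cv_cst t w))).
by rewrite add0r mulr0 addr0 mul1r.
Qed.

Lemma cv_comp f c t a b : is_derive (c t : Co) 1 f a -> cderiv c t b ->
  cderiv (fun s => f (c s)) t (a * b).
Proof.
move=> /cdiffE df /cderivE dg; apply/cderivE => e e0.
set A := cabs a + 1; set B := cabs b + 1.
have A0 : 0 < A by rewrite ltr_wpDl ?cabs_ge0.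
have B0 : 0 < B by rewrite ltr_wpDl ?cabs_ge0.
have [|r1 r10 H1] := df (e / 2 / B); first by rewrite !divr_gt0.
have [|r2 r20 H2] := dg (Num.min 1 (e / 2 / A)).
  by rewrite lt_min ltr01 !divr_gt0.
exists (Num.min r2 (r1 / B)); first by rewrite lt_min r20 divr_gt0.
move=> s; rewrite lt_min ltr_pdivlMr// => /andP[wr2 wr1].
have := H2 s wr2; set x := `|s - t| in wr1 wr2 *; set E := cabs (c s - _ - _) => hE.
have d0 : 0 <= x by exact: normr_ge0.
have E1 : E <= x by rewrite (le_trans hE)// ler_piMl// ge_min lexx.
have E2 : E <= e / 2 / A * x by rewrite (le_trans hE)// ler_wpM2r// ge_min lexx orbT.
have gB : cabs (c s - c t) <= B * x.
  have -> : c s - c t = (c s - c t - b * (s - t)%:C) + b * (s - t)%:C by rewrite subrK.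
  rewrite (le_trans (cabsD _ _))// cabsM cabsR mulrDl mul1r addrC lerD2l//.
have H : cabs (f (c s) - f (c t) - a * (c s - c t)) <= e / 2 / B * cabs (c s - c t).
  by apply: H1; rewrite (le_lt_trans gB)// mulrC.
have -> : f (c s) - f (c t) - a * b * (s - t)%:C =
  (f (c s) - f (c t) - a * (c s - c t)) + a * (c s - c t - b * (s - t)%:C) by ring.
rewrite (le_trans (cabsD _ _))// cabsM (splitr e) mulrDl lerD//.
  rewrite (le_trans H)// (le_trans (ler_wpM2l _ gB)) ?divr_ge0 ?(ltW e0) ?(ltW B0)//.
  by rewrite mulrA divfK ?gt_eqF.
rewrite -/E (@le_trans _ _ (A * E))//; first by rewrite ler_wpM2r ?cabs_ge0 // lerDl.
rewrite (le_trans (ler_wpM2l (ltW A0) E2))// mulrA [A * _]mulrC divfK ?gt_eqF//.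
Qed.

Lemma cv_cont c t d : cderiv c t d -> {for t, continuous (c : R -> Co)}.
Proof.
by move=> [/rd_cont h1 /rd_cont h2]; apply: cont_complex.
Qed.

(** The factor 2 comes from estimating the two components separately; the
    applications need no sharp constant. *)
Lemma cv_mvt c (d : R -> R[i]) x y M : x <= y -> (forall t, x <= t <= y -> cderiv c t (d t)) ->
  (forall t, x <= t <= y -> cabs (d t) <= M) -> cabs (c y - c x) <= 2 * M * (y - x).
Proof.
move=> xy dc dM; rewrite (le_trans (cabs_le _))//.
rewrite -mulrA mulrDl mul1r lerD// !ReImE.
  apply: (@rd_mvt _ (fun s => Re (c s)) (fun s => Re (d s))) => // t /[dup] txy.
    by move=> /dc[].
  by move=> /dM; apply: le_trans; exact: Re_le.
apply: (@rd_mvt _ (fun s => Im (c s)) (fun s => Im (d s))) => // t /[dup] txy.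
  by move=> /dc[].
by move=> /dM; apply: le_trans; exact: Im_le.
Qed.

Lemma cv_cst_itv c x y : x <= y -> (forall t, x <= t <= y -> cderiv c t 0) ->
  c x = c y.
Proof.
move=> xy dc; apply: complex_eq.
  by apply: (@rd_cst_itv _ (fun s => Re (c s))) => // t /dc[].
by apply: (@rd_cst_itv _ (fun s => Im (c s))) => // t /dc[].
Qed.

End Curves.

Section Primitives.
Variable R : realType.
Local Notation Co := (R[i]^o).
Local Notation mu := (@lebesgue_measure R).

Let prim_itv (f : R -> R) (n : nat) : continuous f ->
  exists F : R -> R, forall t : R, - n%:R < t < n%:R -> is_derive t 1 F (f t).
Proof.
move=> cf; exists (fun x => (\int[mu]_(t in [set` `[- n%:R, x]]) (f t))%R) => t /andP[tn nt].
have tn1 : t < n%:R + 1 by rewrite (lt_le_trans nt)// lerDl.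
have [|||dF vF] := @continuous_FTC1_closed _ f (- n%:R) t (n%:R + 1) tn1.
- apply: continuous_compact_integrable; first exact: segment_compact.
  exact: continuous_subspaceT.
- exact: tn.
- exact: cf.
by rewrite -vF derive1E; exact: derivableP.
Qed.

Lemma real_primitive (f : R -> R) : continuous f ->
  exists F : R -> R, forall t : R, is_derive t 1 F (f t).
Proof.
move=> cf; have /choice[F HF] := fun n => prim_itv n cf.
pose N (t : R) := (Num.truncn `|t|).+1.
have NP t n : `|t| < n%:R -> F n t - F n 0 = F (N t) t - F (N t) 0.
  move=> tn.
  have tN : `|t| < (N t)%:R by exact: truncnS_gt.
  have n0 : 0 < n%:R :> R by exact: le_lt_trans tn.
  have N0 : 0 < (N t)%:R :> R by exact: le_lt_trans tN.
  have key a b : a <= b -> `|a| < n%:R -> `|b| < n%:R -> `|a| < (N t)%:R ->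
      `|b| < (N t)%:R -> F n a - F (N t) a = F n b - F (N t) b.
    rewrite !ltr_norml => ab /andP[a1 a2] /andP[b1 b2] /andP[a3 a4] /andP[b3 b4].
    apply: (@rd_cst_itv _ (fun s => F n s - F (N t) s)) => // s /andP[as_ sb].
    rewrite -[X in is_derive _ _ _ X](subrr (f s)).
    apply: rdB; apply: HF.
      by rewrite (lt_le_trans a1)// (le_lt_trans sb).
    by rewrite (lt_le_trans a3)// (le_lt_trans sb).
  have : F n 0 - F (N t) 0 = F n t - F (N t) t.
    have [t0|t0] := leP 0 t; first by apply: key => //; rewrite normr0.
    by apply/esym; apply: key => //; rewrite ?normr0 // ltW.
  by move=> h; lra.
exists (fun t => F (N t) t - F (N t) 0) => t.
have tN : `|t| < (N t)%:R by exact: truncnS_gt.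
apply: (@rd_near _ (fun s => F (N t) s - F (N t) 0)).
  apply/nearR; exists ((N t)%:R - `|t|); first by rewrite subr_gt0.
  move=> s st; apply: NP; rewrite -(subrK t s) (le_lt_trans (ler_normD _ _))//.
  by rewrite -ltrBrDr.
have dF : is_derive t 1 (F (N t)) (f t) by apply: HF; rewrite -ltr_norml.
by apply: rd_eq (rdB dF (rd_cst _ _)); rewrite subr0.
Qed.

(** The fundamental theorem of calculus gives primitives on bounded intervals,
    which are glued to a primitive on the whole line. *)
Lemma curve_primitive (c : R -> R[i]) : continuous (c : R -> Co) ->
  exists P : R -> R[i], forall t, cderiv P t (c t).
Proof.
move=> cc.
have [|F HF] := @real_primitive (fun s => Re (c s)).
  by move=> t; apply: continuous_comp (cc t) _; exact: cont_Re.
have [|G HG] := @real_primitive (fun s => Im (c s)).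
  by move=> t; apply: continuous_comp (cc t) _; exact: cont_Im.
by exists (fun s => F s +i* G s) => t; split; [exact: HF|exact: HG].
Qed.

End Primitives.

(** * Goursat's lemma and primitives of holomorphic functions *)

Section Goursat.
Variable R : realType.
Local Notation Co := (R[i]^o).

Lemma cv_mvt_abs (c d : R -> R[i]) (x y M : R) :
  (forall t, `|t - x| <= `|y - x| -> cderiv c t (d t)) ->
  (forall t, `|t - x| <= `|y - x| -> cabs (d t) <= M) ->
  cabs (c y - c x) <= 2 * M * `|y - x|.
Proof.
move=> dc dM; have [xy|yx] := leP x y.
  have s t : x <= t <= y -> `|t - x| <= `|y - x|.
    by move=> /andP[xt ty]; rewrite !ger0_norm ?subr_ge0 // lerB.
  rewrite [`|y - x|]ger0_norm ?subr_ge0//.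
  by apply: (@cv_mvt _ _ d) => // t /s; [exact: dc|exact: dM].
have s t : y <= t <= x -> `|t - x| <= `|y - x|.
  by move=> /andP[xt ty]; rewrite !ler0_norm ?subr_le0 ?(ltW yx)//; lra.
rewrite cabs_distC distrC [`|x - y|]ger0_norm ?subr_ge0 ?(ltW yx)//.
by apply: (@cv_mvt _ _ d) (ltW yx) _ _ => // t /s; [exact: dc|exact: dM].
Qed.

Lemma nested_itv (x w : nat -> R) :
  (forall n, x n <= x n.+1) -> (forall n, x n.+1 + w n.+1 <= x n + w n) ->
  (forall n, 0 <= w n) -> exists p, forall n, x n <= p <= x n + w n.
Proof.
move=> xi xwd w0.
have mono m n : (m <= n)%N -> x m <= x n.
  by move=> /subnKC <-; elim: (n - m)%N => [|k IH]; rewrite ?addn0// addnS (le_trans IH).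
have mono' m n : (m <= n)%N -> x n + w n <= x m + w m.
  move=> /subnKC <-; elim: (n - m)%N => [|k IH]; rewrite ?addn0// addnS.
  exact: le_trans (xwd _) IH.
have ub m n : x m <= x n + w n.
  have [mn|nm] := leqP m n; first by rewrite (le_trans (mono _ _ mn))// lerDl.
  by rewrite (le_trans _ (mono' _ _ (ltnW nm)))// lerDl.
exists (sup (range x)) => n; apply/andP; split.
  apply: ub_le_sup; last by exists n.
  by exists (x 0%N + w 0%N) => _ [m _ <-].
by apply: ge_sup; [exists (x 0%N), 0%N|move=> _ [m _ <-]].
Qed.

Section Rectangle.
Variables (f : Co -> Co) (H V : R -> R -> R[i]).
Hypothesis HH : forall y t, cderiv (H y) t (f (t +i* y)).
Hypothesis HV : forall x t, cderiv (V x) t ('i * f (x +i* t)).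

(** The integral of f over the boundary of the rectangle with corners x + i y
    and x' + i y', expressed by primitives H of f along horizontal lines and
    V of i f along vertical lines. *)
Definition bdry_int x x' y y' : R[i] :=
  (H y x' - H y x) + (V x' y' - V x' y) - (H y' x' - H y' x) - (V x y' - V x y).

(** Up to a primitive A of its affine approximation at p, f is o(|z - p|), and
    A contributes nothing to the integral over a closed curve. *)
Lemma bdry_int_local (p d : Co) (e : R) : is_derive p 1 f d -> 0 < e ->
  exists2 r : R, 0 < r & forall x a y b : R, 0 <= a -> 0 <= b ->
    x <= Re p <= x + a -> y <= Im p <= y + b -> a + b < r ->
    cabs (bdry_int x (x + a) y (y + b)) <= 4 * e * (a + b) ^+ 2.
Proof.
move=> /cdiffE df e0; have [r r0 Hr] := df _ e0; exists r => // x a y b a0 b0 px py abr.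
pose A (z : Co) : Co := f p * z + d * (z - p) ^+ 2 / 2.
have dA (z : Co) : is_derive z 1 A (f p + d * (z - p)).
  have h1 := cdZ (f p) (cd_id z).
  have h2 := cdX 2 (cdB (cd_id z) (cd_cst z p)).
  apply: (@cd_ext _ (fun z => f p * z + d / 2 * (z - p) ^+ 2)).
    by move=> w; rewrite /A mulrAC.
  apply: cd_eq (cdD h1 (cdZ (d / 2) h2)).
  by rewrite mulr1 subr0 /= expr1 mulr1 mulrA divfK// pnatr_eq0.
have dom s t : x <= s <= x + a -> y <= t <= y + b ->
    cabs (f (s +i* t) - (f p + d * (s +i* t - p))) <= e * (a + b).
  move=> sx ty.
  have h : cabs (s +i* t - p) <= a + b.
    rewrite (le_trans (cabs_le _))// !ReImE /= lerD// ler_norml; apply/andP; lra.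
  have := Hr (s +i* t) (le_lt_trans h abr).
  rewrite opprD addrA => /le_trans; apply; apply: ler_wpM2l => //; exact: ltW.
have hor t : y <= t <= y + b -> cabs ((H t (x + a) - A ((x + a) +i* t)) - (H t x - A (x +i* t)))
    <= 2 * (e * (a + b)) * a.
  move=> ty; rewrite -[X in _ <= _ * X](addKr x a) [- x + _]addrC.
  apply: (@cv_mvt _ (fun s => H t s - A (s +i* t))
     (fun s => f (s +i* t) - (f p + d * (s +i* t - p)))); first by rewrite lerDl.
  - move=> s sx; apply: cvB => //.
    rewrite -[_ + _]mulr1; apply: (@cv_comp _ A (fun s => s +i* t)) => //.
    by split => /=; [exact: rd_id|exact: rd_cst].
  - by move=> s sx; apply: dom.
have ver s : x <= s <= x + a -> cabs ((V s (y + b) - A (s +i* (y + b))) - (V s y - A (s +i* y)))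
    <= 2 * (e * (a + b)) * b.
  move=> sx; rewrite -[X in _ <= _ * X](addKr y b) [- y + _]addrC.
  apply: (@cv_mvt _ (fun t => V s t - A (s +i* t))
     (fun t => 'i * (f (s +i* t) - (f p + d * (s +i* t - p))))); first by rewrite lerDl.
  - move=> t ty; rewrite mulrBr; apply: cvB => //.
    rewrite [_ * (_ + _)]mulrC; apply: (@cv_comp _ A (fun t => s +i* t)) => //.
    by split => /=; [exact: rd_cst|exact: rd_id].
  - by move=> t ty; rewrite cabsM cabs_i mul1r; apply: dom.
have xx : x <= x <= x + a by rewrite lexx lerDl.
have xx' : x <= x + a <= x + a by rewrite lexx lerDl a0.
have yy : y <= y <= y + b by rewrite lexx lerDl.
have yy' : y <= y + b <= y + b by rewrite lexx lerDl b0.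
have := ver _ xx; have := ver _ xx'; have := hor _ yy; have := hor _ yy'.
set h1 := H _ _ - _ - _; set h2 := H _ _ - _ - _; set v1 := V _ _ - _ - _; set v2 := V _ _ - _ - _.
move=> k1 k2 k3 k4.
have -> : bdry_int x (x + a) y (y + b) = h2 + v1 - h1 - v2.
  by rewrite /bdry_int /h1 /h2 /v1 /v2; ring.
rewrite (le_trans (cabsB _ _))// (le_trans (lerD (cabsB _ _) (lexx _)))//.
have := cabsD h2 v1 => k5; rewrite expr2.
have -> : 4 * e * ((a + b) * (a + b)) = 2 * (e * (a + b)) * a + 2 * (e * (a + b)) * b
  + 2 * (e * (a + b)) * a + 2 * (e * (a + b)) * b by ring.
lra.
Qed.

Lemma bdry_int_split x x' x'' y y' y'' :
  bdry_int x x'' y y'' = bdry_int x x' y y' + bdry_int x' x'' y y'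
    + bdry_int x x' y' y'' + bdry_int x' x'' y' y''.
Proof. by rewrite /bdry_int; ring. Qed.

Lemma small_pow2 (s r : R) : 0 < r -> exists n : nat, s / 2 ^+ n < r.
Proof.
move=> r0; exists (Num.truncn (s / r)).+1.
rewrite ltr_pdivrMr ?exprn_gt0// mulrC -ltr_pdivrMr//.
rewrite (lt_trans (truncnS_gt _))//.
by rewrite -natrX ltr_nat ltn_expl.
Qed.

(** If the integral over a rectangle were nonzero, repeated subdivision into
    four would give nested rectangles with sides shrinking like 2^-n and
    integrals of size at least c 4^-n, against the local estimate at their
    common point. *)
Lemma goursat_rect x0 y0 a b : 0 <= a -> 0 <= b ->
  (forall z : Co, x0 <= Re z <= x0 + a -> y0 <= Im z <= y0 + b -> derivable f z 1) ->
  bdry_int x0 (x0 + a) y0 (y0 + b) = 0.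
Proof.
move=> a0 b0 df; set E := bdry_int _ _ _ _; apply/eqP; apply: contrapT => /negP E0.
have Ep : 0 < cabs E by rewrite cabs_gt0.
pose I n (q : R * R) := bdry_int q.1 (q.1 + a / 2 ^+ n) q.2 (q.2 + b / 2 ^+ n).
pose good n q := cabs E / 4 ^+ n <= cabs (I n q).
have /choice[step stepP] : forall nq : nat * (R * R), exists q' : R * R,
    good nq.1 nq.2 -> [/\ good nq.1.+1 q',
      nq.2.1 <= q'.1 <= nq.2.1 + a / 2 ^+ nq.1.+1 &
      nq.2.2 <= q'.2 <= nq.2.2 + b / 2 ^+ nq.1.+1].
  move=> [n [x y]] /=.
  set a' := a / 2 ^+ n.+1; set b' := b / 2 ^+ n.+1.
  have ha : a / 2 ^+ n = a' + a' by rewrite /a' exprS; field; rewrite expf_neq0.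
  have hb : b / 2 ^+ n = b' + b' by rewrite /b' exprS; field; rewrite expf_neq0.
  have a'0 : 0 <= a' by rewrite divr_ge0// exprn_ge0.
  have b'0 : 0 <= b' by rewrite divr_ge0// exprn_ge0.
  have [g1|g1] := pselect (good n.+1 (x, y)); first by exists (x, y) => _; split => //=; lra.
  have [g2|g2] := pselect (good n.+1 (x + a', y)); first by exists (x + a', y) => _; split => //=; lra.
  have [g3|g3] := pselect (good n.+1 (x, y + b')); first by exists (x, y + b') => _; split => //=; lra.
  have [g4|g4] := pselect (good n.+1 (x + a', y + b')); first by exists (x + a', y + b') => _; split => //=; lra.
  exists (x, y) => g; exfalso.
  move: g g1 g2 g3 g4; rewrite /good /I /= -/a' -/b' ha hb !addrA.
  rewrite (@bdry_int_split x (x + a') _ y (y + b')).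
  set i1 := bdry_int _ _ _ _; set i2 := bdry_int _ _ _ _; set i3 := bdry_int _ _ _ _; set i4 := bdry_int _ _ _ _.
  have -> : cabs E / 4 ^+ n = 4 * (cabs E / 4 ^+ n.+1) by rewrite exprS; field; rewrite expf_neq0.
  set m := cabs E / _; move=> g /negP; rewrite -ltNge => g1 /negP; rewrite -ltNge => g2.
  move=> /negP; rewrite -ltNge => g3 /negP; rewrite -ltNge => g4.
  have := cabsD (i1 + i2 + i3) i4; have := cabsD (i1 + i2) i3; have := cabsD i1 i2.
  lra.
pose u := fix u n := if n is m.+1 then step (m, u m) else (x0, y0).
have goodu n : good n (u n).
  elim: n => [|n IH] /=; last by have [] := stepP (n, u n) IH.
  by rewrite /good /I /= !expr0 !divr1.
have ux n : (u n).1 <= (u n.+1).1 <= (u n).1 + a / 2 ^+ n.+1 by have [] := stepP (n, u n) (goodu n).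
have uy n : (u n).2 <= (u n.+1).2 <= (u n).2 + b / 2 ^+ n.+1 by have [] := stepP (n, u n) (goodu n).
have half (c : R) n : c / 2 ^+ n = c / 2 ^+ n.+1 + c / 2 ^+ n.+1.
  by rewrite exprS; field; rewrite expf_neq0.
have [||n|px pxP] := @nested_itv (fun n => (u n).1) (fun n => a / 2 ^+ n).
- by move=> n; case/andP: (ux n).
- by move=> n; rewrite (half a n); case/andP: (ux n); lra.
- by rewrite divr_ge0// exprn_ge0.
have [||n|py pyP] := @nested_itv (fun n => (u n).2) (fun n => b / 2 ^+ n).
- by move=> n; case/andP: (uy n).
- by move=> n; rewrite (half b n); case/andP: (uy n); lra.
- by rewrite divr_ge0// exprn_ge0.
have dp : derivable f (px +i* py : Co) 1.
  apply: df; first by have := pxP 0%N; rewrite /= expr0 divr1.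
  by have := pyP 0%N; rewrite /= expr0 divr1.
set S := (a + b) ^+ 2 + 1.
have S0 : 0 < S by rewrite ltr_wpDl// sqr_ge0.
have e0 : 0 < cabs E / (8 * S) by rewrite divr_gt0// mulr_gt0.
have [r r0 Hr] := bdry_int_local (cdP dp) e0.
have [n nr] := small_pow2 (a + b) r0.
have := Hr (u n).1 (a / 2 ^+ n) (u n).2 (b / 2 ^+ n).
rewrite -mulrDl => /(_ _ _ _ _ nr); rewrite !divr_ge0 ?exprn_ge0//=.
move=> /(_ isT isT (pxP n) (pyP n)).
apply/negP; rewrite -ltNge (lt_le_trans _ (goodu n))//.
have -> : 4 * (cabs E / (8 * S)) * ((a + b) / 2 ^+ n) ^+ 2 = cabs E / 4 ^+ n * ((a + b) ^+ 2 / (2 * S)).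
  have -> : (4 : R) ^+ n = (2 ^+ n) ^+ 2 by rewrite -exprM mulnC exprM; congr (_ ^+ n); ring.
  by field; rewrite expf_neq0 ?gt_eqF.
rewrite gtr_pMr ?divr_gt0 ?exprn_gt0// ltr_pdivrMr ?mulr_gt0// mul1r.
rewrite /S; have := sqr_ge0 (a + b); lra.
Qed.

End Rectangle.
End Goursat.

Section HolomorphicPrimitive.
Variable R : realType.
Local Notation Co := (R[i]^o).

Lemma cont_section_h (f : Co -> Co) (y : R) : continuous f -> continuous (fun t : R => f (t +i* y) : Co).
Proof.
move=> cf t; apply: (@continuous_comp _ _ _ (fun t : R => t +i* y : Co) f); last exact: cf.
apply: (@cv_cont _ _ _ 1); split; [exact: rd_id|exact: rd_cst].
Qed.

Lemma cont_section_v (f : Co -> Co) (x : R) : continuous f ->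
  continuous (fun t : R => 'i * f (x +i* t) : Co).
Proof.
move=> cf t; apply: (@continuous_comp _ _ _ (fun t : R => x +i* t : Co) (fun z => 'i * f z)).
  by apply: (@cv_cont _ _ _ 'i); split; [exact: rd_cst|exact: rd_id].
apply/contC => e e0; have /contC/(_ _ e0)[d d0 Hd] := cf (x +i* t).
by exists d => // z /Hd; rewrite -mulrBr cabsM cabs_i mul1r.
Qed.

(** The primitive is the integral along a horizontal and then a vertical
    segment; by the vanishing of the integrals over rectangles the order of the
    two segments can be exchanged, which gives both partial derivatives. *)
Lemma primitive_of_continuous (f : Co -> Co) (x0 x1 y0 y1 : R) : continuous f ->
  (forall z : Co, x0 < Re z < x1 -> y0 < Im z < y1 -> derivable f z 1) ->
  exists F : Co -> Co,
    forall z : Co, x0 < Re z < x1 -> y0 < Im z < y1 -> is_derive z 1 F (f z).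
Proof.
move=> cf df.
have [yy|yy] := ltP y0 y1; last first.
  by exists f => z _ /andP[h1 h2]; have := lt_trans h1 h2; rewrite ltNge yy.
have /choice[H HH] := fun y => curve_primitive (cont_section_h (y := y) cf).
have /choice[V HV] := fun x => curve_primitive (cont_section_v (x := x) cf).
pose yb := (y0 + y1) / 2.
have zero a a' b b' : x0 < a < x1 -> x0 < a' < x1 -> y0 < b < y1 -> y0 < b' < y1 ->
    bdry_int H V a a' b b' = 0.
  move=> ha ha' hb hb'.
  wlog aa' : a a' ha ha' / a <= a' => [W|].
    have [|/ltW /(W _ _ ha' ha)] := leP a a'; first exact: W.
    by rewrite /bdry_int => h; rewrite -[RHS]oppr0 -h; ring.
  wlog bb' : b b' hb hb' / b <= b' => [W|].
    have [|/ltW /(W _ _ hb' hb)] := leP b b'; first exact: W.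
    by rewrite /bdry_int => h; rewrite -[RHS]oppr0 -h; ring.
  have -> : a' = a + (a' - a) by ring.
  have -> : b' = b + (b' - b) by ring.
  apply: (@goursat_rect _ f H V HH HV); rewrite ?subr_ge0// => z hx hy.
  by apply: df; lra.
exists (fun z => H yb (Re z) + V (Re z) (Im z) - V (Re z) yb) => z zx zy.
apply/cdiffE => e e0; have e4 : 0 < e / 4 by rewrite divr_gt0.
have /contC/(_ _ e4)[r r0 Hr] := cf z.
pose r' := Num.min (r / 2) (Num.min (Num.min (Re z - x0) (x1 - Re z)) (Num.min (Im z - y0) (y1 - Im z))).
exists r'; first by rewrite /r' !lt_min; lra.
move=> w; rewrite /r' !lt_min => wz.
have := Re_le (w - z); have := Im_le (w - z); rewrite !ReImE => wI wR.
have wR' := ler_norml (Re w - Re z) (cabs (w - z)); rewrite wR in wR'.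
have wI' := ler_norml (Im w - Im z) (cabs (w - z)); rewrite wI in wI'.
have wx : x0 < Re w < x1 by lra.
have wy : y0 < Im w < y1 by lra.
have ybP : y0 < yb < y1 by rewrite /yb; lra.
have := zero _ _ _ _ zx wx ybP zy; rewrite /bdry_int.
set A := H yb (Re w); set B := H yb (Re z); set C := V (Re w) (Im z).
set D := V (Re w) yb; set E := H (Im z) (Re w); set F := H (Im z) (Re z).
set G := V (Re z) (Im z); set K := V (Re z) yb; set L := V (Re w) (Im w) => h0.
have -> : A + L - D - (B + G - K) - f z * (w - z) =
   (E - f z * (Re w)%:C - (F - f z * (Re z)%:C)) +
   (L - 'i * f z * (Im w)%:C - (C - 'i * f z * (Im z)%:C)).
  have -> : w - z = (Re w)%:C + 'i * (Im w)%:C - ((Re z)%:C + 'i * (Im z)%:C) by rewrite -!complexE.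
  have -> : A = B - C + D + E - F + G - K.
    by apply/eqP; rewrite -subr_eq0 -[X in _ == X]h0; apply/eqP; ring.
  ring.
rewrite (le_trans (cabsD _ _))//.
have small s t : `|s - Re z| <= `|Re w - Re z| -> `|t - Im z| <= `|Im w - Im z| ->
    cabs (f (s +i* t) - f z) <= e / 4.
  move=> hs ht; apply/ltW/Hr; rewrite (le_lt_trans (cabs_le _))// !ReImE/=; lra.
have k1 : cabs (E - f z * (Re w)%:C - (F - f z * (Re z)%:C)) <= 2 * (e / 4) * `|Re w - Re z|.
  apply: (@cv_mvt_abs _ (fun s => H (Im z) s - f z * s%:C) (fun s => f (s +i* Im z) - f z)).
    move=> t _; apply: cvB => //.
    by apply: cv_eq (cvZ _ (cv_real (rd_id t))); rewrite mulr1.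
  by move=> t ht; apply: small => //; rewrite subrr normr0.
have k2 : cabs (L - 'i * f z * (Im w)%:C - (C - 'i * f z * (Im z)%:C)) <= 2 * (e / 4) * `|Im w - Im z|.
  apply: (@cv_mvt_abs _ (fun s => V (Re w) s - 'i * f z * s%:C) (fun s => 'i * f (Re w +i* s) - 'i * f z)).
    move=> t _; apply: cvB => //.
    by apply: cv_eq (cvZ _ (cv_real (rd_id t))); rewrite mulr1.
  by move=> t ht; rewrite -mulrBr cabsM cabs_i mul1r; apply: small.
rewrite (le_trans (lerD k1 k2))//.
have -> : 2 * (e / 4) = e / 2 by field.
apply: (@le_trans _ _ (e / 2 * (2 * cabs (w - z)))); last by rewrite mulrA divfK.
rewrite -mulrDr ler_wpM2l ?divr_ge0 ?(ltW e0)//; lra.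
Qed.

Definition clamp (a b t : R) := Num.max a (Num.min b t).

Lemma clamp_id a b t : a <= t <= b -> clamp a b t = t.
Proof. by move=> /andP[h1 h2]; rewrite /clamp min_r// max_r. Qed.

Lemma clamp_itv a b t : a <= b -> a <= clamp a b t <= b.
Proof. by move=> ab; rewrite /clamp le_max lexx /= ge_max ab ge_min lexx. Qed.

Lemma clamp_lip a b s t : `|clamp a b s - clamp a b t| <= `|s - t|.
Proof.
rewrite /clamp; wlog st : s t / s <= t => [W|].
  have [/W //|/ltW/W] := leP s t; by rewrite distrC [X in _ <= X]distrC.
rewrite [`|s - t|]distrC [X in X <= _]distrC [`|t - s|]ger0_norm ?subr_ge0//.
rewrite ger0_norm; last first.
  by rewrite subr_ge0 ge_max !le_max lexx/=; apply/orP; right; rewrite le_min !ge_min st lexx/= orbT.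
rewrite lerBlDl ge_max; apply/andP; split.
  have : a <= Num.max a (Num.min b s) by rewrite le_max lexx.
  lra.
have : Num.min b s <= Num.max a (Num.min b s) by rewrite le_max lexx orbT.
suff : Num.min b t <= Num.min b s + (t - s) by lra.
rewrite -lerBlDr le_min; apply/andP; split.
  have : Num.min b t <= b by rewrite ge_min lexx.
  lra.
have : Num.min b t <= t by rewrite ge_min lexx orbT.
lra.
Qed.

(** Composition with the retraction of the plane onto the closed rectangle makes
    f continuous everywhere, so that it has primitives along all lines. *)
Theorem holomorphic_primitive (f : Co -> Co) (x0 x1 y0 y1 : R) :
  (forall z : Co, x0 <= Re z <= x1 -> y0 <= Im z <= y1 -> derivable f z 1) ->
  exists F : Co -> Co,
    forall z : Co, x0 < Re z < x1 -> y0 < Im z < y1 -> is_derive z 1 F (f z).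
Proof.
move=> df; have [xx|xx] := ltP x0 x1; last first.
  by exists f => z /andP[h1 h2] _; have := lt_trans h1 h2; rewrite ltNge xx.
have [yy|yy] := ltP y0 y1; last first.
  by exists f => z _ /andP[h1 h2]; have := lt_trans h1 h2; rewrite ltNge yy.
pose ret (z : Co) : Co := clamp x0 x1 (Re z) +i* clamp y0 y1 (Im z).
have cret : continuous ret.
  move=> z; apply/contC => e e0; exists (e / 2); first by rewrite divr_gt0.
  move=> w wz; rewrite (le_lt_trans (cabs_le _))// !ReImE /=.
  rewrite (le_lt_trans (lerD (clamp_lip _ _ _ _) (clamp_lip _ _ _ _)))//.
  rewrite (splitr e) ltrD// (le_lt_trans _ wz)//.
    by have := Re_le (w - z); rewrite !ReImE.
  by have := Im_le (w - z); rewrite !ReImE.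
have retE (z : Co) : x0 <= Re z <= x1 -> y0 <= Im z <= y1 -> ret z = z.
  by move=> h1 h2; rewrite /ret !clamp_id//; case: z {h1 h2}.
have [||F HF] := @primitive_of_continuous (f \o ret) x0 x1 y0 y1.
- move=> z; apply: continuous_comp; first exact: cret.
  have h := cdP (@df (ret z) (clamp_itv _ (ltW xx)) (clamp_itv _ (ltW yy))).
  exact: cd_cont h.
- move=> z zx zy.
  have d : is_derive z 1 f (derive1 f z) by apply/cdP/df; lra.
  have [] // : is_derive z 1 (f \o ret) (derive1 f z).
  apply: cd_near d.
  pose r' := Num.min (Num.min (Re z - x0) (x1 - Re z)) (Num.min (Im z - y0) (y1 - Im z)).
  apply/nearC; exists r'; first by rewrite /r' !lt_min; lra.
  move=> w; rewrite /r' !lt_min => wz.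
  have := Re_le (w - z); have := Im_le (w - z); rewrite !ReImE !ler_norml => wI wR.
  by rewrite /= retE//; lra.
exists F => z zx zy; have := HF z zx zy; rewrite /= retE//; lra.
Qed.

End HolomorphicPrimitive.

(** * The exponential map *)

Section ComplexExponential.
Variable R : realType.
Local Notation Co := (R[i]^o).
Implicit Types (z w : R[i]).

Lemma cexpD z w : cexp (z + w) = cexp z * cexp w.
Proof.
by apply: complex_eq; rewrite /cexp !ReImE /= expRD ?cosD ?sinD; ring.
Qed.

Lemma cexp0 : cexp 0 = 1 :> R[i].
Proof. by apply: complex_eq; rewrite /cexp /= expR0 ?cos0 ?sin0 ?mulr1 ?mulr0. Qed.

Lemma cabs_cexp z : cabs (cexp z) = expR (Re z).
Proof.
rewrite cabsE /= !exprMn -mulrDr cos2Dsin2 mulr1 sqrtr_sqr ger0_norm// expR_ge0.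
Qed.

Lemma cexp_neq0 z : cexp z != 0.
Proof. by rewrite -cabs_eq0 cabs_cexp gt_eqF ?expR_gt0. Qed.

Lemma cexpN z : cexp (- z) = (cexp z)^-1.
Proof.
apply: (mulIf (cexp_neq0 z)).
by rewrite -cexpD addNr cexp0 mulVf ?cexp_neq0.
Qed.

Lemma cexpB z w : cexp (z - w) = cexp z / cexp w.
Proof. by rewrite cexpD cexpN. Qed.

Lemma cabs_cexp_i (t : R) : cabs (cexp (t%:C * 'i)) = 1.
Proof. by rewrite cabs_cexp !ReImE /= mulr0 mul0r subrr expR0. Qed.

Lemma cd_cexp (z : Co) : is_derive z 1 (@cexp R : Co -> Co) (cexp z).
Proof.
have d0 (e : R) : 0 < e -> exists2 r : R, 0 < r &
    forall h : R[i], cabs h < r -> cabs (cexp h - 1 - h) <= e * cabs h.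
  move=> e0; set e1 := Num.min 1 (e / 8).
  have e10 : 0 < e1 by rewrite /e1 lt_min; lra.
  have e1e : e1 <= e / 8 by rewrite /e1 ge_min lexx orbT.
  have e11 : e1 <= 1 by rewrite /e1 ge_min lexx.
  have /rdiffE/(_ _ e10)[r1 r10 H1] := is_derive_expR (0 : R).
  have /rdiffE/(_ _ e10)[r2 r20 H2] := is_derive_sin (0 : R).
  have /rdiffE/(_ _ e10)[r3 r30 H3] := is_derive_cos (0 : R).
  exists (Num.min (Num.min (e1 / 2) r1) (Num.min r2 r3)).
    by rewrite !lt_min divr_gt0 // r10 r20 r30.
  case=> x y; rewrite !lt_min => /andP[/andP[h0 h1] /andP[h2 h3]].
  have := Re_le (x +i* y); have := Im_le (x +i* y) => /= yh xh.
  move: h0 h1 h2 h3 xh yh; set m := cabs _ => h0 h1 h2 h3 xh yh.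
  have := H1 x; rewrite subr0 (le_lt_trans xh h1) expR0 mul1r => /(_ isT) k1.
  have := H2 y; rewrite subr0 (le_lt_trans yh h2) sin0 cos0 mul1r subr0 => /(_ isT) k2.
  have := H3 y; rewrite subr0 (le_lt_trans yh h3) sin0 cos0 oppr0 mul0r subr0 => /(_ isT) k3.
  have m0 : 0 <= m by exact: cabs_ge0.
  have k4 : `|expR x - 1| <= e1.
    have -> : expR x - 1 = (expR x - 1 - x) + x by ring.
    rewrite (le_trans (ler_normD _ _))//; have : e1 * `|x| <= `|x| by rewrite ler_piMl.
    lra.
  have k5 : `|expR x| <= 2.
    by rewrite -[expR x](subrK 1) (le_trans (ler_normD _ _))// normr1; lra.
  rewrite (le_trans (cabs_le _))// !ReImE /=.
  have -> : expR x * cos y - 1 - x = (expR x - 1 - x) + expR x * (cos y - 1) by ring.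
  have -> : expR x * sin y - 0 - y = expR x * (sin y - y) + (expR x - 1) * y by ring.
  have l1 : `|expR x * (cos y - 1)| <= 2 * (e1 * m).
    by rewrite normrM ler_pM// (le_trans k3)// ler_wpM2l// ltW.
  have l2 : `|expR x * (sin y - y)| <= 2 * (e1 * m).
    by rewrite normrM ler_pM// (le_trans k2)// ler_wpM2l// ltW.
  have l3 : `|(expR x - 1) * y| <= e1 * m by rewrite normrM ler_pM.
  have l4 : `|expR x - 1 - x| <= e1 * m.
    by rewrite (le_trans k1)// ler_wpM2l// ltW.
  have := ler_normD (expR x - 1 - x) (expR x * (cos y - 1)).
  have := ler_normD (expR x * (sin y - y)) ((expR x - 1) * y).
  have l5 : e1 * m <= e / 8 * m by rewrite ler_wpM2r.
  have : 0 <= e * m by rewrite mulr_ge0// ltW.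
  have l6 : e / 8 * m = e * m / 8 by ring.
  rewrite l6 in l5.
  lra.
apply/cdiffE => e e0.
have c0 : 0 < cabs (cexp z) by rewrite cabs_gt0 cexp_neq0.
have [|r r0 Hr] := d0 (e / cabs (cexp z)); first by rewrite divr_gt0.
exists r => // w /Hr h.
have -> : cexp w - cexp z - cexp z * (w - z) = cexp z * (cexp (w - z) - 1 - (w - z)).
  have {1}-> : w = z + (w - z) by rewrite addrC subrK.
  by rewrite cexpD; ring.
rewrite cabsM (le_trans (ler_wpM2l (ltW c0) h))//.
by rewrite mulrA [cabs _ * _]mulrC divfK// gt_eqF.
Qed.

Lemma cexp_surj w : w != 0 -> exists z, cexp z = w.
Proof.
move=> w0; have m0 : 0 < cabs w by rewrite cabs_gt0.
set a := Re w / cabs w; set b := Im w / cabs w.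
have ab : a ^+ 2 + b ^+ 2 = 1.
  by rewrite !exprMn -mulrDl -sqr_cabs -exprMn divff ?gt_eqF// expr1n.
have a1 : -1 <= a <= 1.
  rewrite -ler_norml -(@expr_le1 _ 2)// real_normK ?num_real//.
  by have := sqr_ge0 b; lra.
have wE : w = (cabs w * a) +i* (cabs w * b).
  apply: complex_eq => /=; by rewrite mulrC divfK// gt_eqF.
have ca : cos (acos a) = a by apply: acosK; rewrite in_itv.
have sa : sin (acos a) = `|b|.
  by rewrite sin_acos// -ab [_ + _ - _]addrAC subrr add0r sqrtr_sqr.
have [b0|b0] := leP 0 b.
  exists (ln (cabs w) +i* acos a); rewrite /cexp /= lnK ?posrE// ca sa ger0_norm//; exact/esym.
exists (ln (cabs w) +i* (- acos a)).
rewrite /cexp /= lnK ?posrE// cosN sinN ca sa ltr0_norm// opprK; exact/esym.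
Qed.

Lemma cos_sin_2piZ (n : int) : cos (2 * pi * n%:~R) = 1 :> R /\ sin (2 * pi * n%:~R) = 0 :> R.
Proof.
have pos (k : nat) : cos (2 * pi * k%:R) = 1 :> R /\ sin (2 * pi * k%:R) = 0 :> R.
  have E : 2 * pi * k%:R = 0 + (pi *+ 2) *+ k :> R.
    by rewrite add0r -mulr_natr -[pi *+ 2]mulr_natr; ring.
  by rewrite E (periodicn (@cosD2pi R)) (periodicn (@sinD2pi R)) cos0 sin0.
case: n => k; first exact: pos.
have [c s] := pos k.+1.
by rewrite NegzE rmorphN /= mulrN cosN sinN -pmulrn c s oppr0.
Qed.

Lemma cexp_2piZ (n : int) : cexp ((2 * pi * n%:~R)%:C * 'i) = 1 :> R[i].
Proof.
rewrite /cexp !ReImE /= !(mulr0, mul0r, mulr1, subrr, addr0) expR0 !mul1r.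
by have [-> ->] := cos_sin_2piZ n.
Qed.

(** Reducing the imaginary part modulo 2 pi to [- pi, pi) leaves an angle of
    cosine 1, which is 0. *)
Lemma cexp_eq1 z : cexp z = 1 -> exists n : int, z = (2 * pi * n%:~R)%:C * 'i.
Proof.
move=> z1; have z0 : Re z = 0.
  by apply: expR_inj; rewrite expR0 -cabs_cexp z1 cabs1.
have cz : cos (Im z) = 1.
  by have := congr1 (@complex.Re R) z1; rewrite /= z0 expR0 mul1r.
have pi0 := @pi_gt0 R.
pose n := Num.floor ((Im z + pi) / (2 * pi)).
pose y := Im z - 2 * pi * n%:~R.
have cy : cos y = 1.
  by rewrite /y cosB; have [-> ->] := cos_sin_2piZ n; rewrite mulr1 mulr0 addr0.
have : n%:~R <= (Im z + pi) / (2 * pi) < (n + 1)%:~R.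
  by rewrite Num.Theory.floor_itv.
rewrite ler_pdivlMr ?mulr_gt0// ltr_pdivrMr ?mulr_gt0// rmorphD /= => /andP[n1 n2].
have y0 : y = 0.
  have [yp|yn] := leP 0 y.
    by rewrite -(@cosK _ y) ?cy ?acos1// in_itv/= yp/= /y; lra.
  apply: oppr_inj; rewrite -cosKN; first by rewrite cy acos1 oppr0.
  by rewrite (ltW yn) andbT /y; lra.
exists n; apply: complex_eq; first by rewrite !ReImE /= z0; ring.
by rewrite !ReImE /= mulr1 mul0r addr0; move: y0; rewrite /y; lra.
Qed.

Lemma cd_zero_segment (f : Co -> Co) (z w : Co) :
  (forall t : R, 0 <= t <= 1 -> is_derive (z + t%:C * (w - z) : Co) 1 f 0) -> f z = f w.
Proof.
move=> df; suff: f (z + 0%:C * (w - z)) = f (z + 1%:C * (w - z)).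
  by rewrite rmorph0 rmorph1 mul0r addr0 mul1r addrC subrK.
apply: (@cv_cst_itv _ (fun t => f (z + t%:C * (w - z)))) => // t t01.
apply: cv_eq (cv_comp (f := f) (df t t01) (cv_line _ _ _)); exact: mul0r.
Qed.

(** Integrating 1 / (1 + z) gives L, and (1 + z) exp (- L z) has derivative
    zero. *)
Lemma local_log : exists L : Co -> Co, L 0 = 0 /\
  forall z : Co, cabs z < 2^-1 -> is_derive z 1 L (1 + z)^-1 /\ cexp (L z) = 1 + z.
Proof.
have ne (z : Co) : - 2^-1 <= Re z <= 2^-1 -> 1 + z != 0.
  by move=> h; apply/eqP => /(congr1 (@complex.Re R)); rewrite ReD /=; lra.
have dinv (z : Co) : 1 + z != 0 -> is_derive z 1 (fun z => (1 + z)^-1 : Co) (- 1 / (1 + z) ^+ 2).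
  move=> h; apply: (@cdV _ (fun z => 1 + z)) => //.
  by apply: cd_eq (cdD (cd_cst z 1) (cd_id z)); rewrite add0r.
have [z zx zy|L0 HL0] := @holomorphic_primitive R (fun z => (1 + z)^-1) (- 2^-1) 2^-1 (- 2^-1) 2^-1.
  by have [] := dinv z (ne z zx).
pose L z := L0 z - L0 0.
have inR (z : Co) : cabs z < 2^-1 -> - 2^-1 < Re z < 2^-1 /\ - 2^-1 < Im z < 2^-1.
  move=> h; rewrite -!ltr_norml.
  by rewrite (le_lt_trans (Re_le _)) // (le_lt_trans (Im_le _)).
have dL (z : Co) : cabs z < 2^-1 -> is_derive z 1 L (1 + z)^-1.
  move=> /inR[h1 h2]; apply: cd_eq (cdB (HL0 z h1 h2) (cd_cst _ (L0 0))).
  by rewrite subr0.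
have L00 : L 0 = 0 by rewrite /L subrr.
exists L; split=> // z hz; split; first exact: dL.
pose g (z : Co) : Co := (1 + z) * cexp (- L z).
have : g 0 = g z.
  apply: cd_zero_segment => t /andP[t0 t1]; rewrite add0r subr0.
  set x := _ * _; have hx : cabs x < 2^-1.
    by rewrite /x cabsM cabsR ger0_norm// (le_lt_trans _ hz)// ler_piMl// cabs_ge0.
  have xne : 1 + x != 0.
    by apply: ne; have [] := inR _ hx; move=> /andP[? ?] _; rewrite !ltW.
  apply: cd_eq (cdM (cdD (cd_cst x 1) (cd_id x)) (cd_comp (cd_cexp _) (cdN (dL _ hx)))).
  by rewrite add0r mul1r mulrN [cexp _ * _]mulrC mulrN mulrA divff// mul1r subrr.
rewrite /g L00 oppr0 cexp0 addr0 mul1r cexpN => /esym h.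
by apply/(mulIf (_ : (cexp (L z))^-1 != 0)); rewrite ?invr_eq0 ?cexp_neq0// divff ?cexp_neq0 // h.
Qed.

End ComplexExponential.

(** * Cauchy's formula and the identity theorem *)

Section CauchyFormula.
Variable R : realType.
Local Notation Co := (R[i]^o).
Local Notation twopi := (2 * pi : R).

Definition circle (r : R) (t : R) : R[i] := r%:C * cexp (t%:C * 'i).

Lemma cabs_circle r t : 0 <= r -> cabs (circle r t) = r.
Proof. by move=> r0; rewrite cabsM cabs_cexp_i mulr1 cabsR ger0_norm. Qed.

Lemma cv_cexp_i (a : R[i]) t : cderiv (fun t => cexp (t%:C * a)) t (cexp (t%:C * a) * a).
Proof.
apply: (cv_comp (cd_cexp (t%:C * a))).
by apply: cv_eq (cvM (cv_real (rd_id t)) (cv_cst t a)); rewrite mul1r mulr0 addr0.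
Qed.

Lemma cv_circle r t : cderiv (circle r) t ('i * circle r t).
Proof.
by apply: cv_eq (cvZ r%:C (cv_cexp_i 'i%R t)); rewrite /circle; ring.
Qed.

Lemma twopi_gt0 : 0 < twopi. Proof. by rewrite mulr_gt0// pi_gt0. Qed.

(** A logarithm of z - a along a circle that winds around a. Since a is small
    compared with r, it differs from ln r + i t by log (1 - a / z), of modulus
    at most 1. *)
Lemma circle_log (r : R) (a : R[i]) : 0 < r -> cabs a <= r / 4 ->
  exists xi : R -> R[i], [/\ forall t, cexp (xi t) = circle r t - a,
    forall t, cderiv xi t ('i * circle r t / (circle r t - a)),
    xi twopi = xi 0 + twopi%:C * 'i &
    forall t, `|Re (xi t) - ln r| <= 1 /\ `|Im (xi t) - t| <= 1].
Proof.
move=> r0 ar; have [L [L0 HL]] := local_log R.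
pose q t : R[i] := - a / r%:C * cexp (t%:C * - 'i).
have rC : r%:C != 0 :> R[i] by rewrite -cabs_eq0 cabsR normr_eq0 gt_eqF.
have qE t : 1 + q t = (circle r t - a) / circle r t.
  rewrite mulrBl divff; last by rewrite mulf_neq0// cexp_neq0.
  by rewrite /q /circle mulrN cexpN invfM; ring.
have cq t : cabs (q t) <= 4^-1.
  rewrite cabsM cabs_div cabsN mulrN cexpN cabsV cabs_cexp_i invr1 mulr1 cabsR.
  by rewrite (ger0_norm (ltW r0)) ler_pdivrMr// mulrC.
have cq2 t : cabs (q t) < 2^-1 by rewrite (le_lt_trans (cq t))//; lra.
have Lq t : cabs (L (q t)) <= 1.
  have := @cv_mvt _ (fun s => L (s%:C * q t)) (fun s => (1 + s%:C * q t)^-1 * q t) 0 1 2^-1 ler01.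
  rewrite rmorph0 rmorph1 mul0r mul1r L0 !subr0 => H.
  have hs (s : R) : 0 <= s <= 1 -> cabs (s%:C * q t) <= 4^-1.
    move=> /andP[s0 s1]; rewrite cabsM cabsR ger0_norm//.
    by rewrite (le_trans _ (cq t))// ler_piMl// cabs_ge0.
  have H1 s : 0 <= s <= 1 -> cderiv (fun s => L (s%:C * q t)) s ((1 + s%:C * q t)^-1 * q t).
    move=> s01; apply: cv_comp; first by apply: (HL _ _).1; rewrite (le_lt_trans (hs s s01))//; lra.
    by apply: cv_eq (cvM (cv_real (rd_id s)) (cv_cst s (q t))); rewrite mul1r mulr0 addr0.
  suff H2 s : 0 <= s <= 1 -> cabs ((1 + s%:C * q t)^-1 * q t) <= 2^-1.
    by have := H H1 H2; lra.
  move=> s01; rewrite cabsM cabsV.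
  have h1 : 3 / 4 <= cabs (1 + s%:C * q t).
    have := cabs_sub 1 (- (s%:C * q t)); rewrite opprK cabsN cabs1.
    have := hs s s01; lra.
  rewrite mulrC ler_pdivrMr; last by lra.
  have := cq t; lra.
exists (fun t => (ln r)%:C + t%:C * 'i + L (q t)); split.
- move=> t; rewrite !cexpD (HL _ (cq2 t)).2 qE.
  have -> : cexp (ln r)%:C = r%:C.
    by rewrite /cexp /= cos0 sin0 mulr1 mulr0 lnK.
  by rewrite -[r%:C * _]/(circle r t) mulrC divfK// mulf_neq0// cexp_neq0.
- move=> t; have dq : cderiv q t (- 'i * q t).
    by apply: cv_eq (cvZ (- a / r%:C) (cv_cexp_i (- 'i) t)); rewrite /q; ring.
  have d1 := cv_comp (HL _ (cq2 t)).1 dq.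
  have d2 := cvD (cvD (cv_cst t (ln r)%:C) (cvM (cv_real (rd_id t)) (cv_cst t 'i%R))) d1.
  apply: cv_eq d2; rewrite add0r mul1r mulr0 addr0.
  have q1 : 1 + q t != 0.
    by rewrite -(HL _ (cq2 t)).2 cexp_neq0.
  have -> : 'i * circle r t / (circle r t - a) = 'i / (1 + q t).
    by rewrite qE invf_div -mulrA.
  by field.
- have -> : q twopi = q 0.
    rewrite /q; congr (_ * _); rewrite rmorph0 mul0r cexp0 mulrN cexpN.
    have := cexp_2piZ R 1; rewrite mulr1 => ->; exact: invr1.
  by rewrite rmorph0 mul0r addr0; ring.
- move=> t; have h1 := Lq t.
  have -> : Re ((ln r)%:C + t%:C * 'i + L (q t)) - ln r = Re (L (q t)).
    by rewrite !ReImE /=; ring.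
  have -> : Im ((ln r)%:C + t%:C * 'i + L (q t)) - t = Im (L (q t)).
    by rewrite !ReImE /=; ring.
  by split; [apply: le_trans (Re_le _) h1|apply: le_trans (Im_le _) h1].
Qed.

Section Disc.
Variables (f : Co -> Co) (rho : R).
Hypothesis rho0 : 0 < rho.
Hypothesis df : forall z : Co, cabs z < rho -> derivable f z 1.

Let r := rho / 2.
Let r0 : 0 < r. Proof. by rewrite /r divr_gt0. Qed.

Definition cauchy_kernel (a : R[i]) t := f (circle r t) * ('i * circle r t / (circle r t - a)).

(** Substituting z = a + exp xi turns f (z) dz / (z - a) into f (a + exp xi) dxi,
    which has a primitive H on a large rectangle of the xi-plane. The contour
    integral is the increment of H over the period 2 pi i; it does not depend
    on the base point, and when Re xi tends to minus infinity the integrand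
    tends to f a. *)
Lemma cauchy_formula_approx (a : Co) (e : R) : cabs a < rho / 8 -> 0 < e ->
  exists P : R -> R[i],
   (forall t, 0 <= t <= twopi -> cderiv P t (cauchy_kernel a t)) /\
   cabs (P twopi - P 0 - twopi%:C * 'i * f a) <= e.
Proof.
move=> ar e0; have [|xi [xiE dxi xiper xib]] := @circle_log r a r0.
  by rewrite /r; lra.
have p0 := twopi_gt0.
have rhop := rho0; have rp := r0.
have a_rho : cabs a < rho by lra.
have e'0 : 0 < e / (2 * twopi) by rewrite divr_gt0// mulr_gt0.
have /contC/(_ _ e'0)[d d0 Hd] := cd_cont (cdP (df a_rho)).
(* on the line Re xi = x the point a + exp xi is at distance less than d from a *)
pose x := Num.min (ln (d / 2)) (ln r - 1).
pose B := ln (3 / 4 * rho).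
have xd : expR x < d.
  rewrite (@le_lt_trans _ _ (d / 2))//; last by lra.
  rewrite -[leRHS]lnK ?posrE ?divr_gt0// ler_expR ge_min lexx//.
have rB : ln r < B by rewrite ltr_ln ?posrE// /r; lra.
have xr : x <= ln r - 1 by rewrite ge_min lexx orbT.
have [z zx zy|H HH] := @holomorphic_primitive R (fun z => f (a + cexp z)) (x - 1) B (- 2) (twopi + 2).
  have h : cabs (a + cexp z) < rho.
    rewrite (le_lt_trans (cabsD _ _))// cabs_cexp.
    have : expR (Re z) <= 3 / 4 * rho.
      by rewrite -[leRHS]lnK ?posrE ?ler_expR//; [case/andP: zx|lra].
    lra.
  have d2 : is_derive z 1 (fun z : Co => (a + cexp z : Co)) (0 + cexp z).
    exact: cdD (cd_cst _ _) (cd_cexp z).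
  by have [] := @cd_comp _ f (fun z : Co => a + cexp z) z _ _ (cdP (df h)) d2.
have xiB t : Re (xi t) < B.
  rewrite -ltr_expR lnK ?posrE; last by lra.
  rewrite -cabs_cexp xiE (le_lt_trans (cabsB _ _))// cabs_circle ?ltW//.
  by rewrite /r; lra.
have xiR t : x - 1 < Re (xi t) < B.
  by rewrite xiB andbT; have [] := xib t; rewrite ler_norml; lra.
have xiI t : t - 1 <= Im (xi t) <= t + 1.
  by have [_] := xib t; rewrite ler_norml; lra.
exists (fun t => H (xi t)); split.
  move=> t t01; have := xiI t => xit.
  have h : is_derive (xi t : Co) 1 H (f (a + cexp (xi t))) by apply: HH => //; lra.
  by apply: cv_eq (cv_comp h (dxi t)); rewrite xiE addrC subrK.
pose D (z : Co) : Co := H (z + twopi%:C * 'i) - H z.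
have dH (z : Co) : x - 1 < Re z < B -> - 2 < Im z < twopi + 2 ->
  is_derive z 1 H (f (a + cexp z)) by exact: HH.
have -> : H (xi twopi) - H (xi 0) = D x%:C.
  rewrite xiper; apply: (@cd_zero_segment _ D) => t /andP[t0 t1].
  set z : Co := _ + _.
  have zR : x - 1 < Re z < B.
    have -> : Re z = (1 - t) * Re (xi 0) + t * x by rewrite /z !ReImE /=; ring.
    have := xiR 0; move: (Re (xi 0)) => u /andP[u1 u2].
    have t1' : 0 <= 1 - t by rewrite subr_ge0.
    have h1 := ler_wpM2l t1' (ltW u1); have h2 := ler_wpM2l t1' (ltW u2).
    have xB : x < B by lra.
    have h4 := ler_wpM2l t0 (ltW xB).
    apply/andP; split; last first.
      have [tp|tn] := ltP 0 t; last by (have -> : t = 0 by lra); lra.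
      by have := xB; rewrite -(ltr_pM2l tp) => h5; lra.
    have [tp|tn] := ltP 0 t; last by (have -> : t = 0 by lra); lra.
    by lra.
  have zI : -1 <= Im z <= 1.
    have -> : Im z = (1 - t) * Im (xi 0) by rewrite /z !ReImE /=; ring.
    have := xiI 0; move: (Im (xi 0)) => u /andP[u1 u2].
    rewrite -ler_norml normrM ger0_norm ?subr_ge0//.
    rewrite -[leRHS](mulr1 1) ler_pM ?subr_ge0//; first by lra.
    by rewrite ler_norml; lra.
  have zI1 : - 2 < Im z < twopi + 2 by lra.
  have zI2 : - 2 < Im (z + twopi%:C * 'i) < twopi + 2.
    have -> : Im (z + twopi%:C * 'i) = Im z + twopi by rewrite ImD ImM /=; ring.
    by lra.
  have zR2 : x - 1 < Re (z + twopi%:C * 'i) < B.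
    by have -> : Re (z + twopi%:C * 'i) = Re z by rewrite ReD ReM /=; ring.
  have d1 := dH _ zR zI1; have d2 := dH _ zR2 zI2.
  have d3 := @cd_comp _ H (fun z => z + twopi%:C * 'i) z _ _ d2 (cdD (cd_id z) (cd_cst z (twopi%:C * 'i))).
  apply: cd_eq (cdB d3 d1).
  have := cexp_2piZ R 1; rewrite mulr1 => h.
  by rewrite addr0 mulr1 cexpD h mulr1 subrr.
have := @cv_mvt _ (fun t => H (x%:C + t%:C * 'i) - t%:C * 'i * f a)
  (fun t => f (a + cexp (x%:C + t%:C * 'i)) * 'i - 'i * f a) 0 twopi (e / (2 * twopi)) (ltW p0).
rewrite rmorph0 !mul0r addr0 !subr0 /D.
have -> : 2 * (e / (2 * twopi)) * twopi = e.
  have gen (T : R) : T != 0 -> 2 * (e / (2 * T)) * T = e by move=> T0; field.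
  by apply: gen; rewrite gt_eqF.
have -> : H (x%:C + twopi%:C * 'i) - twopi%:C * 'i * f a - H x%:C =
  H (x%:C + twopi%:C * 'i) - H x%:C - twopi%:C * 'i * f a by ring.
apply.
  move=> t t02; apply: cvB.
    apply: cv_comp; last exact: cv_line.
    apply: dH.
      have -> : Re (x%:C + t%:C * 'i) = x by rewrite ReD ReM /=; ring.
      by lra.
    have -> : Im (x%:C + t%:C * 'i) = t by rewrite ImD ImM /=; ring.
    by lra.
  apply: cv_eq (cvM (cvM (cv_real (rd_id t)) (cv_cst t 'i%R)) (cv_cst t (f a))).
  by rewrite mul1r mulr0 addr0 mulr0 addr0.
move=> t _; rewrite [f _ * 'i]mulrC -mulrBr cabsM cabs_i mul1r; apply/ltW/Hd.
rewrite addrAC subrr add0r cabs_cexp.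
by have -> : Re (x%:C + t%:C * 'i) = x by rewrite ReD ReM /=; ring.
Qed.

Theorem cauchy_formula (a : Co) (P : R -> R[i]) : cabs a < rho / 8 ->
  (forall t, 0 <= t <= twopi -> cderiv P t (cauchy_kernel a t)) ->
  P twopi - P 0 = twopi%:C * 'i * f a.
Proof.
move=> ar dP; apply/eqP; rewrite -subr_eq0 -cabs_eq0; apply/eqP/le_anti.
rewrite cabs_ge0 andbT; apply/ler_addgt0Pl => e e0; rewrite addr0.
have [P' [dP' hP']] := cauchy_formula_approx ar e0.
suff -> : P twopi - P 0 = P' twopi - P' 0 by [].
have := @cv_cst_itv _ (fun t => P t - P' t) 0 twopi (ltW twopi_gt0) _.
move=> H; have : P 0 - P' 0 = P twopi - P' twopi.
  by apply: H => t /[dup] /dP h1 /dP' h2; rewrite -(subrr (cauchy_kernel a t)); exact: cvB.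
move=> h; apply/eqP; rewrite -subr_eq0; apply/eqP.
transitivity (P twopi - P' twopi - (P 0 - P' 0)); first by ring.
by rewrite h subrr.
Qed.

End Disc.
End CauchyFormula.

Section CauchyConsequences.
Variable R : realType.
Local Notation Co := (R[i]^o).
Local Notation twopi := (2 * pi : R).

(** The integral over [0, 2 pi], through a primitive rather than a Riemann
    sum. *)
Definition circ_int (c : R -> R[i]) : R[i] :=
  let P := xget (fun=> 0) [set P | forall t, cderiv P t (c t)] in P twopi - P 0.

Lemma circ_intP (c : R -> R[i]) : continuous (c : R -> Co) ->
  exists2 P, circ_int c = P twopi - P 0 & forall t, cderiv P t (c t).
Proof.
move=> /curve_primitive[P HP].
exists (xget (fun=> 0) [set P | forall t, cderiv P t (c t)]) => //.
exact: (@xgetPex _ (fun=> 0) [set P | forall t, cderiv P t (c t)] (ex_intro _ P HP)).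
Qed.

Lemma circ_int_approx (c1 c2 c3 : R -> R[i]) (h : R[i]) (M : R) :
  continuous (c1 : R -> Co) -> continuous (c2 : R -> Co) -> continuous (c3 : R -> Co) ->
  (forall t, 0 <= t <= twopi -> cabs (c1 t - c2 t - h * c3 t) <= M) ->
  cabs (circ_int c1 - circ_int c2 - h * circ_int c3) <= 2 * M * twopi.
Proof.
move=> /circ_intP[P1 -> d1] /circ_intP[P2 -> d2] /circ_intP[P3 -> d3] hM.
have := @cv_mvt _ (fun t => P1 t - P2 t - h * P3 t) (fun t => c1 t - c2 t - h * c3 t)
  0 twopi M (ltW (twopi_gt0 R)) _ hM.
rewrite subr0 => H; have {H} := H (fun t _ => cvB (cvB (d1 t) (d2 t)) (cvZ h (d3 t))).
by congr (cabs _ <= _); ring.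
Qed.

(** For x = 1 / (z - b), y = 1 / (z - a) and h = b - a this is the first order
    expansion of 1 / (z - b) ^ n at b = a, with an error term uniform in z. *)
Lemma inv_expn_approx (B : R) (n : nat) : 0 <= B -> exists2 C : R, 0 <= C &
  forall x y h : R[i], cabs x <= B -> cabs y <= B -> x - y = h * x * y ->
  cabs (x ^+ n - y ^+ n - h * (n%:R * y ^+ n.+1)) <= C * cabs h ^+ 2.
Proof.
move=> B0; elim: n => [|n [C C0 IH]].
  exists 0 => // x y h _ _ _.
  by rewrite !expr0 subrr mul0r mulr0 subr0 cabs0 mul0r.
exists (B * C + n.+1%:R * (B * B ^+ n.+2)).
  apply: addr_ge0; first exact: mulr_ge0.
  by do 2! [apply: mulr_ge0 => //]; exact: exprn_ge0.
move=> x y h xB yB xy; have := IH x y h xB yB xy; set E := _ - _ => hE.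
have -> : x ^+ n.+1 - y ^+ n.+1 - h * (n.+1%:R * y ^+ n.+2) =
   x * E + h ^+ 2 * (n.+1%:R * (x * y ^+ n.+2)).
  have e0 : x - y - h * x * y = 0 by rewrite xy subrr.
  rewrite -[RHS]addr0 -(mulr0 (y ^+ n + n.+1%:R * h * y ^+ n.+1)) -e0 /E !exprS -(natr1 n).
  by ring.
rewrite (le_trans (cabsD _ _))// mulrDl lerD//.
  by rewrite cabsM -mulrA ler_pM ?cabs_ge0.
rewrite cabsM (cabsX h) [cabs (n.+1%:R * _)]cabsM [cabs (x * _)]cabsM (cabsX y) mulrC.
apply: ler_wpM2r; first by rewrite exprn_ge0// cabs_ge0.
have -> : cabs (n.+1%:R : R[i]) = n.+1%:R.
  by rewrite (_ : n.+1%:R = n.+1%:R%:C) ?cabsR ?ger0_norm// rmorph_nat.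
apply: ler_wpM2l => //; apply: ler_pM; rewrite ?exprn_ge0 ?cabs_ge0//.
by apply: lerXn2r; rewrite ?nnegrE ?cabs_ge0.
Qed.

Section Disc.
Variables (f : Co -> Co) (rho : R).
Hypothesis rho0 : 0 < rho.
Hypothesis df : forall z : Co, cabs z < rho -> derivable f z 1.
Local Notation r := (rho / 2).

Definition cauchy_density t : R[i] := f (circle r t) * ('i * circle r t).
Definition cauchy_power n (a : R[i]) t : R[i] :=
  cauchy_density t * (circle r t - a)^-1 ^+ n.

Lemma circle_far (a : R[i]) t : cabs a < rho / 8 ->
  cabs ((circle r t - a)^-1) <= 3 / rho.
Proof.
move=> ar; have h0 := rho0; have r0 : 0 <= r by rewrite divr_ge0// ltW.
have := cabs_sub (circle r t) a; rewrite cabs_circle // => h1.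
have h2 : rho / 3 <= cabs (circle r t - a) by lra.
rewrite cabsV -[leRHS]invrK invf_div lef_pV2 ?posrE ?divr_gt0//; lra.
Qed.

Lemma circle_neq (a : R[i]) t : cabs a < rho / 8 -> circle r t - a != 0.
Proof.
move=> ar; have h0 := rho0; have r0 : 0 <= r by rewrite divr_ge0// ltW.
rewrite -cabs_gt0.
have := cabs_sub (circle r t) a; rewrite cabs_circle //.
lra.
Qed.

Lemma cont_cauchy_power n a : cabs a < rho / 8 ->
  continuous (cauchy_power n a : R -> Co).
Proof.
move=> ar t; have h0 := rho0; have r0 : 0 <= r by rewrite divr_ge0// ltW.
have h : derivable f (circle r t : Co) 1.
  apply: df; rewrite cabs_circle //; lra.
have d1 := cvM (cv_comp (cdP h) (cv_circle r t)) (cvZ 'i%R (cv_circle r t)).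
have d2 := cvB (cv_circle r t) (cv_cst t a).
have d3 := cdX n (cdV (circle_neq t ar : (fun z : Co => z) (circle r t - a : Co) != 0) (cd_id _)).
exact: cv_cont (cvM d1 (cv_comp d3 d2)).
Qed.

Lemma cauchy_density_bound : exists2 M, 0 <= M &
  forall t, 0 <= t <= twopi -> cabs (cauchy_density t) <= M.
Proof.
have h0 := rho0; have r0 : 0 <= r by rewrite divr_ge0// ltW.
have [||t0 _ H] := @EVT_max R (fun t => cabs (cauchy_density t)) 0 twopi.
- by rewrite ltW// twopi_gt0.
- apply: continuous_subspaceT => t.
  have c0 : {for t, continuous (cauchy_density : R -> Co)}.
    have -> : cauchy_density = cauchy_power 0 0.
      by apply/funext => s; rewrite /cauchy_power expr0 mulr1.
    by apply: cont_cauchy_power; rewrite cabs0 divr_gt0.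
  exact: (continuous_comp c0 (@cont_cabs R _)).
by exists (cabs (cauchy_density t0)) => [|t tI]; [exact: cabs_ge0|apply: H; rewrite in_itv].
Qed.

(** Differentiation under the integral sign, from the uniform expansion of the
    kernel. *)
Lemma cd_cauchy_power n (a : Co) : cabs a < rho / 8 ->
  is_derive a 1 (fun a : Co => circ_int (cauchy_power n a) : Co)
    (n%:R * circ_int (cauchy_power n.+1 a)).
Proof.
move=> ar; have h0 := rho0; have r0 : 0 <= r by rewrite divr_ge0// ltW.
have [M M0 HM] := cauchy_density_bound.
have B0 : 0 <= 3 / rho by rewrite divr_ge0// ltW.
have [C C0 HC] := inv_expn_approx n B0.
have p0 := twopi_gt0 R.
apply/cdiffE => e e0.
pose D := 2 * (M * C) * twopi + 1.
have D1 : 0 <= 2 * (M * C) * twopi.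
  by apply: mulr_ge0 (ltW p0); apply: mulr_ge0 => //; exact: mulr_ge0.
have D0 : 0 < D by rewrite ltr_wpDl.
exists (Num.min (rho / 8 - cabs a) (e / D)).
  by rewrite lt_min subr_gt0 ar divr_gt0.
move=> b; rewrite lt_min => /andP[ba1 ba2].
have br : cabs b < rho / 8.
  by rewrite -(subrK a b) (le_lt_trans (cabsD _ _))// -ltrBrDr.
have -> : n%:R * circ_int (cauchy_power n.+1 a) * (b - a) =
  (b - a) * n%:R * circ_int (cauchy_power n.+1 a) by ring.
rewrite (le_trans (circ_int_approx (M := M * C * cabs (b - a) ^+ 2) _ _ _ _))//.
- exact: cont_cauchy_power.
- exact: cont_cauchy_power.
- exact: cont_cauchy_power.
- move=> t tI; have h1 := circle_neq t ar; have h2 := circle_neq t br.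
  have h3 := circle_far t ar; have h4 := circle_far t br.
  have h5 : (circle r t - b)^-1 - (circle r t - a)^-1 =
    (b - a) * (circle r t - b)^-1 * (circle r t - a)^-1.
    by field; rewrite h1 h2.
  rewrite /cauchy_power; move: h3 h4 h5; set x := (_ - b)^-1; set y := (_ - a)^-1.
  move=> h3 h4 h5; have -> : cauchy_density t * x ^+ n - cauchy_density t * y ^+ n -
    (b - a) * n%:R * (cauchy_density t * y ^+ n.+1) =
    cauchy_density t * (x ^+ n - y ^+ n - (b - a) * (n%:R * y ^+ n.+1)) by ring.
  rewrite cabsM -mulrA; apply: ler_pM; rewrite ?cabs_ge0//; first exact: HM.
  exact: HC.
have -> : 2 * (M * C * cabs (b - a) ^+ 2) * twopi =
  2 * (M * C) * twopi * cabs (b - a) * cabs (b - a) by ring.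
apply: ler_wpM2r; first exact: cabs_ge0.
move: ba2; rewrite ltr_pdivlMr// mulrC => /ltW; apply: le_trans.
by apply: ler_wpM2r; [exact: cabs_ge0|rewrite lerDl].
Qed.

Lemma cauchy_representation (a : Co) : cabs a < rho / 8 ->
  f a = (twopi%:C * 'i)^-1 * circ_int (cauchy_power 1 a).
Proof.
move=> ar; have [P -> dP] := circ_intP (cont_cauchy_power (n := 1) ar).
have ne : twopi%:C * 'i != 0 :> R[i].
  by rewrite -cabs_eq0 cabsM cabs_i mulr1 cabsR normr_eq0 gt_eqF// twopi_gt0.
rewrite (@cauchy_formula _ f rho rho0 df a P ar) ?mulKf// => t _.
apply: cv_eq (dP t); rewrite /cauchy_power /cauchy_density /cauchy_kernel; ring.
Qed.

Lemma derivable_derive1_disc (a : Co) : cabs a < rho / 8 -> derivable (derive1 f) a 1.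
Proof.
move=> ar.
have fE (b : Co) : cabs b < rho / 8 ->
    derive1 f b = (twopi%:C * 'i)^-1 * (1%:R * circ_int (cauchy_power 2 b)).
  move=> br; apply: cd_derive1.
  apply: cd_near (cdZ (twopi%:C * 'i)^-1 (cd_cauchy_power 1 br)).
  apply/nearC; exists (rho / 8 - cabs b); first by rewrite subr_gt0.
  move=> z zb; rewrite -cauchy_representation//.
  by rewrite -(subrK b z) (le_lt_trans (cabsD _ _))// -ltrBrDr.
have [] // : is_derive a 1 (derive1 f)
   ((twopi%:C * 'i)^-1 * (1%:R * (2%:R * circ_int (cauchy_power 3 a)))).
apply: cd_near (cdZ (twopi%:C * 'i)^-1 (cdZ 1%:R (cd_cauchy_power 2 ar))).
apply/nearC; exists (rho / 8 - cabs a); first by rewrite subr_gt0.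
move=> z za; rewrite -fE//.
by rewrite -(subrK a z) (le_lt_trans (cabsD _ _))// -ltrBrDr.
Qed.

Lemma cauchy_estimate (a : Co) (M : R) : cabs a < rho / 8 ->
  (forall t, 0 <= t <= twopi -> cabs (f (circle r t)) <= M) ->
  cabs (f a) <= 3 * M.
Proof.
move=> ar HM; have h0 := rho0; have r0 : 0 <= r by rewrite divr_ge0// ltW.
have p0 := twopi_gt0 R.
rewrite cauchy_representation// cabsM cabsV cabsM cabs_i mulr1 cabsR ger0_norm ?(ltW p0)//.
rewrite mulrC ler_pdivrMr//.
have [P -> dP] := circ_intP (cont_cauchy_power (n := 1) ar).
have := @cv_mvt _ P (cauchy_power 1 a) 0 twopi (M * r * (3 / rho)) (ltW p0) (fun t _ => dP t).
rewrite subr0 => H; have {H} := H _.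
have -> : 2 * (M * r * (3 / rho)) * twopi = 3 * M * twopi.
  by have gen (T : R) : 2 * (M * r * (3 / rho)) * T = 3 * M * T by field; rewrite gt_eqF.
apply=> t tI; rewrite /cauchy_power /cauchy_density expr1 cabsM.
rewrite [cabs (f _ * _)]cabsM [cabs ('i * _)]cabsM cabs_i mul1r cabs_circle//; apply: ler_pM.
- by apply: mulr_ge0 => //; exact: cabs_ge0.
- exact: cabs_ge0.
- by apply: ler_wpM2r => //; exact: HM.
- exact: circle_far.
Qed.

End Disc.

(** f / z^n is holomorphic for every n, because f vanishes near 0, and Cauchy's
    estimate for it bounds |f a| by C 2^-n. *)
Lemma vanishing_disc (f : Co -> Co) (rho eta : R) : 0 < rho -> 0 < eta ->
  (forall z : Co, cabs z < rho -> derivable f z 1) ->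
  (forall z : Co, cabs z < eta -> f z = 0) ->
  forall a : Co, cabs a < rho / 8 -> f a = 0.
Proof.
move=> rho0 eta0 df f0 a ar; have r0 : 0 <= rho / 2 by rewrite divr_ge0// ltW.
have [M M0 HM] := cauchy_density_bound rho0 df.
pose g n (z : Co) : Co := f z * z^-1 ^+ n.
have dg n (z : Co) : cabs z < rho -> derivable (g n) z 1.
  move=> zr; have [ze|ze] := ltP (cabs z) eta.
    have [] // : is_derive z 1 (g n) 0.
    apply: cd_near (cd_cst z 0).
    apply/nearC; exists (eta - cabs z); first by rewrite subr_gt0.
    move=> w wz; rewrite /g f0 ?mul0r//.
    by rewrite -(subrK z w) (le_lt_trans (cabsD _ _))// -ltrBrDr.
  have z0 : z != 0 by rewrite -cabs_gt0 (lt_le_trans eta0).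
  have d3 := cdX n (@cdV _ (fun z : Co => z) z _ z0 (cd_id _)).
  by have [] := cdM (cdP (df z zr)) d3.
have est n : cabs (f a) <= 3 * (M / (rho / 2)) / 2 ^+ n.
  have [a0|a0] := eqVneq a 0.
    by rewrite a0 f0 ?cabs0// divr_ge0 ?exprn_ge0// mulr_ge0// divr_ge0.
  have rp : 0 < rho / 2 by rewrite divr_gt0.
  have := @cauchy_estimate (g n) rho rho0 (dg n) a (M / (rho / 2) * (rho / 2)^-1 ^+ n) ar.
  have H t : 0 <= t <= 2 * pi -> cabs (g n (circle (rho / 2) t)) <= M / (rho / 2) * (rho / 2)^-1 ^+ n.
    move=> tI; rewrite cabsM cabsX cabsV cabs_circle//.
    apply: ler_wpM2r; first by rewrite exprn_ge0// invr_ge0.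
    have := HM t tI; rewrite /cauchy_density cabsM [cabs ('i * _)]cabsM cabs_i mul1r cabs_circle//.
    by rewrite ler_pdivlMr.
  move=> /(_ H); rewrite /g cabsM cabsX cabsV => {}H.
  have ap : 0 < cabs a by rewrite cabs_gt0.
  have -> : cabs (f a) = cabs (f a) * (cabs a)^-1 ^+ n * cabs a ^+ n.
    by rewrite -mulrA -exprMn mulVf ?gt_eqF// expr1n mulr1.
  rewrite (le_trans (ler_wpM2r _ H)) ?exprn_ge0 ?cabs_ge0//.
  rewrite -!mulrA; do 3! [apply: ler_wpM2l; rewrite ?invr_ge0//].
  rewrite -exprMn -exprVn; apply: lerXn2r.
  - by rewrite nnegrE mulr_ge0 ?invr_ge0 ?cabs_ge0.
  - by rewrite nnegrE.
  by rewrite mulrC ler_pdivrMr//; lra.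
apply/eqP; rewrite -cabs_eq0; apply/eqP/le_anti; rewrite cabs_ge0 andbT.
apply/ler_addgt0Pl => e e0; rewrite addr0.
have [n hn] := small_pow2 (3 * (M / (rho / 2))) e0.
exact: le_trans (est n) (ltW hn).
Qed.

Lemma derivable_translate (f : Co -> Co) (z0 z : Co) :
  derivable f (z0 + z) 1 -> derivable (fun w => f (z0 + w)) z 1.
Proof.
move=> /cdP d; have d2 := cdD (cd_cst z z0) (cd_id z).
by have [] := @cd_comp _ f (fun w => z0 + w) z _ _ d d2.
Qed.

(** Cauchy's formula represents f, hence also its derivative, as an integral that
    can be differentiated with respect to the parameter. *)
Theorem holomorphic_derive1 (f : Co -> Co) (z0 : Co) :
  holomorphic_at f z0 -> holomorphic_at (derive1 f) z0.
Proof.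
move=> /nearC[rho rho0 df].
have dg (z : Co) : cabs z < rho -> derivable (fun w => f (z0 + w)) z 1.
  by move=> zr; apply/derivable_translate/df; rewrite addrC addKr.
apply/nearC; exists (rho / 8); first by rewrite divr_gt0.
move=> z zr.
have E (w : Co) : cabs (w - z0) < rho -> derive1 (fun w => f (z0 + w)) (w - z0) = derive1 f w.
  move=> wr; apply: cd_derive1.
  have d2 := cdD (cd_cst (w - z0) z0) (cd_id (w - z0)).
  have d1 : is_derive (z0 + (w - z0)) 1 f (derive1 f w).
    by rewrite addrC subrK; apply/cdP/df.
  by apply: cd_eq (@cd_comp _ f (fun w => z0 + w) (w - z0) _ _ d1 d2); rewrite add0r mulr1.
have h := derivable_derive1_disc rho0 dg zr.
have d3 := cdB (cd_id z) (cd_cst z z0).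
have d4 := @cd_comp _ _ (fun w => w - z0) z _ _ (cdP h) d3.
have [] // : is_derive z 1 (derive1 f) (derive1 (derive1 (fun w => f (z0 + w))) (z - z0) * (1 - 0)).
apply: cd_near d4; apply/nearC; exists (rho - cabs (z - z0)); first lra.
move=> w wz; apply: E.
by rewrite -(subrK z w) -addrA (le_lt_trans (cabsD _ _))// -ltrBrDr.
Qed.

Theorem identity_theorem (f : Co -> Co) (z0 : Co) : holomorphic_at f z0 ->
  \forall w \near z0, (\forall z \near w, f z = 0) -> \forall z \near z0, f z = 0.
Proof.
move=> /nearC[rho rho0 df]; apply/nearC; exists (rho / 32); first by rewrite divr_gt0.
move=> w wz /nearC[eta eta0 f0].
have h (z : Co) : cabs z < rho / 2 -> derivable (fun z => f (w + z)) z 1.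
  move=> zr; apply/derivable_translate/df; have -> : w + z - z0 = (w - z0) + z by ring.
  by have := cabsD (w - z0) z; lra.
apply/nearC; exists (rho / 32); first by rewrite divr_gt0.
move=> z zz; have -> : z = w + (z - w) by rewrite addrC subrK.
apply: (@vanishing_disc (fun z => f (w + z)) (rho / 2) eta _ eta0 h).
- by rewrite divr_gt0.
- by move=> u ue; apply: f0; rewrite addrC addKr.
- have := cabs_tri z z0 w; rewrite (cabs_distC z0 w); lra.
Qed.

End CauchyConsequences.

(** * Paths and local systems of germs *)

Section Paths.
Variables (R : realType) (S : riemannSurface R).
Implicit Types (gamma : R -> S) (p q x y : S) (X W : set S).

Lemma near_within01 (t : R) (P : R -> Prop) :
  (\forall s \near within `[0, 1] (nbhs t), P s) <->
  exists2 d : R, 0 < d & forall s : R, 0 <= s <= 1 -> `|s - t| < d -> P s.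
Proof.
split.
  rewrite near_withinE => /nearR[d d0 H]; exists d => // s s01 st.
  by apply: H => //=; rewrite in_itv.
move=> [d d0 H]; rewrite near_withinE; apply/nearR; exists d => // s st.
by rewrite /= in_itv /= => s01; exact: H.
Qed.

Lemma within_contP gamma : {within `[0, 1], continuous gamma} <->
  forall t : R, 0 <= t <= 1 -> forall W, nbhs (gamma t) W ->
    exists2 d : R, 0 < d & forall s : R, 0 <= s <= 1 -> `|s - t| < d -> W (gamma s).
Proof.
split.
  move=> /subspace_continuousP H t t01 W HW.
  have t01' : (`[0, 1]%classic : set R) t by rewrite /= in_itv.
  by have /near_within01 := H t t01' W HW.
move=> H; apply/subspace_continuousP => t; rewrite /= in_itv /= => t01 W HW.
apply/near_within01; exact: H.
Qed.

Lemma path_near X gamma p q t W : path_in X gamma p q -> 0 <= t <= 1 ->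
  nbhs (gamma t) W ->
  exists2 d : R, 0 < d & forall s : R, 0 <= s <= 1 -> `|s - t| < d -> W (gamma s).
Proof. by move=> [/within_contP H _ _ _] t01 HW; exact: (H t t01 W HW). Qed.

(** The supremum of the initial segments on which P holds cannot be smaller
    than 1. *)
Lemma unit_interval_locally_constant (P : R -> Prop) :
  (forall t : R, 0 <= t <= 1 -> exists2 d : R, 0 < d & forall a b : R,
     0 <= a <= 1 -> 0 <= b <= 1 -> `|a - t| < d -> `|b - t| < d -> P a -> P b) ->
  P 0 -> forall t, 0 <= t <= 1 -> P t.
Proof.
move=> H P0 t1 t101.
pose A := [set a : R | 0 <= a <= t1 /\ forall s, 0 <= s <= a -> P s].
have A0 : A 0.
  split; first by rewrite lexx; case/andP: t101.
  by move=> s s0; (have -> : s = 0 by lra).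
have As : has_sup A by split; [exists 0|exists t1 => a [/andP[]]].
set m := sup A; have m0 : 0 <= m by apply: ub_le_sup => //; case: As.
have mt : m <= t1 by apply: ge_sup; [exists 0|move=> a [/andP[]]].
have m01 : 0 <= m <= 1 by lra.
have [d d0 Hd] := H m m01.
have [a [aA aP] ma] := sup_adherent d0 As.
have ma' : m - d < a by exact: ma.
have am : a <= m by apply: ub_le_sup; [case: As|].
have Pa : P a by apply: aP; lra.
have key b : a <= b -> b <= t1 -> b < m + d -> P b.
  by move=> ab bt bm; apply: (Hd a b) => //; rewrite ?ltr_norml; lra.
have [mt1|mt1] := ltP m t1; last first.
  by apply: key; lra.
exfalso; pose b := Num.min t1 (m + d / 2).
have bm : m < b by rewrite /b lt_min; lra.
have bd : b < m + d by rewrite /b gt_min; apply/orP; right; lra.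
have bt : b <= t1 by rewrite /b ge_min lexx.
have : A b.
  split; first by lra.
  move=> s s0; have [sa|sa] := leP s a; first by apply: aP; lra.
  by apply: key; lra.
by move=> Ab; have : b <= m by [apply: ub_le_sup => //; case: As]; lra.
Qed.

Definition join (T : Type) (u v : R -> T) (s : R) : T :=
  if s <= 2^-1 then u (2 * s) else v (2 * s - 1).

Lemma path_const X p : X p -> path_in X (fun=> p) p p.
Proof.
move=> Xp; split=> //; apply/within_contP => t t01 W HW; exists 1 => // s _ _.
exact: nbhs_singleton HW.
Qed.

Lemma path_sub X W gamma p q : X `<=` W -> path_in X gamma p q -> path_in W gamma p q.
Proof. by move=> XW [c g0 g1 gX]; split=> // t t01; exact/XW/gX. Qed.

Lemma path_rev X gamma p q : path_in X gamma p q ->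
  path_in X (fun s => gamma (1 - s)) q p.
Proof.
move=> [/within_contP c g0 g1 gX]; split; rewrite ?subr0 ?subrr//; last first.
  by move=> t t01; apply: gX; lra.
apply/within_contP => t t01 W HW; have [|d d0 Hd] := c (1 - t) _ W HW; first lra.
exists d => // s s01 st; apply: Hd; first lra.
have -> : 1 - s - (1 - t) = - (s - t) by ring.
by rewrite normrN.
Qed.

Lemma path_join X g1 g2 p q r : path_in X g1 p q -> path_in X g2 q r ->
  path_in X (join g1 g2) p r.
Proof.
move=> [/within_contP c1 g10 g11 X1] [/within_contP c2 g20 g21 X2]; split.
- apply/within_contP => t t01 W; rewrite /join; case: ltgtP => [th HW|th HW|->].
  + have [|d d0 Hd] := c1 (2 * t) _ W HW; first lra.
    exists (Num.min (d / 2) (2^-1 - t)); first by rewrite lt_min; lra.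
    move=> s s01; rewrite lt_min !ltr_norml => h; rewrite ifT; last by lra.
    by apply: Hd; [lra|rewrite ltr_norml; lra].
  + have [|d d0 Hd] := c2 (2 * t - 1) _ W HW; first lra.
    exists (Num.min (d / 2) (t - 2^-1)); first by rewrite lt_min; lra.
    move=> s s01; rewrite lt_min !ltr_norml => h; rewrite ifF; last by apply/negbTE; rewrite -ltNge; lra.
    by apply: Hd; [lra|rewrite ltr_norml; lra].
  + have E : 2 * 2^-1 = 1 :> R by lra.
    rewrite E => HW.
    have [|d1 d10 Hd1] := c1 1 _ W HW; first lra.
    have HW2 : nbhs (g2 0) W by rewrite g20 -g11.
    have [|d2 d20 Hd2] := c2 0 _ W HW2; first lra.
    exists (Num.min (d1 / 2) (d2 / 2)); first by rewrite lt_min; lra.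
    move=> s s01; rewrite lt_min !ltr_norml => h; case: ifPn => [sh|].
      by apply: Hd1; [lra|rewrite ltr_norml; lra].
    by rewrite -ltNge => sh; apply: Hd2; [lra|rewrite ltr_norml; lra].
- by rewrite /join ifT; [rewrite mulr0|rewrite invr_ge0].
- by rewrite /join ifF; [rewrite mulr1 (_ : 2 - 1 = 1) //; lra|apply/negbTE; rewrite -ltNge; lra].
- move=> t t01; rewrite /join; case: ifPn => [th|]; first by apply: X1; lra.
  by rewrite -ltNge => th; apply: X2; lra.
Qed.

End Paths.

Section LocalSystems.
Variables (R : realType) (S : riemannSurface R) (B : Type).
Variable E : S -> (S -> B) -> Prop.
Implicit Types (gamma : R -> S) (h k : S -> B) (H K : R -> S -> B).

Definition germ_eq (p : S) h k := \forall x \near p, h x = k x.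

Lemma germ_eq_sym p h k : germ_eq p h k -> germ_eq p k h.
Proof. by apply: filterS => x ->. Qed.

Lemma germ_eq_trans p h k l : germ_eq p h k -> germ_eq p k l -> germ_eq p h l.
Proof. by move=> h1 h2; apply: filterS2 h1 h2 => x -> ->. Qed.

Lemma germ_eq_refl p h : germ_eq p h h.
Proof. exact: nearW. Qed.

Lemma germ_eq_near p h k : germ_eq p h k -> \forall x \near p, germ_eq x h k.
Proof. by move=> e; exact: near_join. Qed.

(** E p h says that h is an admissible germ at p; with E the meromorphic germs,
    this is the condition of analytic continuation. *)
Definition continues gamma H := forall t, 0 <= t <= 1 -> E (gamma t) (H t) /\
  \forall s \near within `[0, 1] (nbhs t), germ_eq (gamma s) (H s) (H t).

Lemma continues_rev gamma H : continues gamma H ->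
  continues (fun s => gamma (1 - s)) (fun s => H (1 - s)).
Proof.
move=> c t t01; have [|e1 /near_within01[d d0 Hd]] := c (1 - t); first lra.
split=> //; apply/near_within01; exists d => // s s01 st; apply: Hd; first lra.
have -> : 1 - s - (1 - t) = - (s - t) by ring.
by rewrite normrN.
Qed.

Lemma continues_join X g1 g2 p q r H K : path_in X g1 p q -> path_in X g2 q r ->
  continues g1 H -> continues g2 K -> germ_eq q (H 1) (K 0) ->
  continues (join g1 g2) (join H K).
Proof.
move=> P1 P2 c1 c2 HK t t01; rewrite /join; case: ltgtP => [th|th|->].
- have [|e /near_within01[d d0 Hd]] := c1 (2 * t); first lra.
  split=> //; apply/near_within01.
  exists (Num.min (d / 2) (2^-1 - t)); first by rewrite lt_min; lra.
  move=> s s01; rewrite lt_min !ltr_norml => h; rewrite ifT; last by lra.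
  by rewrite ifT; [apply: Hd; [lra|rewrite ltr_norml; lra]|lra].
- have [|e /near_within01[d d0 Hd]] := c2 (2 * t - 1); first lra.
  split=> //; apply/near_within01.
  exists (Num.min (d / 2) (t - 2^-1)); first by rewrite lt_min; lra.
  move=> s s01; rewrite lt_min !ltr_norml => h; rewrite ifF; last by apply/negbTE; rewrite -ltNge; lra.
  rewrite ifF; last by apply/negbTE; rewrite -ltNge; lra.
  by apply: Hd; [lra|rewrite ltr_norml; lra].
- have E1 : 2 * 2^-1 = 1 :> R by lra.
  rewrite E1; have [|e1 /near_within01[d1 d10 Hd1]] := c1 1; first lra.
  have [|e2 /near_within01[d2 d20 Hd2]] := c2 0; first lra.
  split=> //; have q0 : g2 0 = q by case: P2.
  have nq : nbhs (g2 0) (fun x => germ_eq x (H 1) (K 0)).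
    by rewrite q0; exact: germ_eq_near.
  have [|d3 d30 Hd3] := path_near P2 _ nq; first lra.
  apply/near_within01; exists (Num.min (d1 / 2) (Num.min (d2 / 2) (d3 / 2))).
    by rewrite !lt_min; lra.
  move=> s s01; rewrite !lt_min !ltr_norml => h; case: ifPn => [sh|].
    by apply: Hd1; [lra|rewrite ltr_norml; lra].
  rewrite -ltNge => sh; apply: (@germ_eq_trans _ _ (K 0)).
    by apply: Hd2; [lra|rewrite ltr_norml; lra].
  by apply/germ_eq_sym/Hd3; [lra|rewrite ltr_norml; lra].
Qed.

Hypothesis E_uniq : forall p h k, E p h -> E p k ->
  \forall x \near p, germ_eq x h k -> germ_eq p h k.

(** The set of parameters at which H and K have the same germ is open, and closed
    by the local identity principle E_uniq. *)
Lemma continues_unique X gamma p q H K : path_in X gamma p q ->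
  continues gamma H -> continues gamma K -> germ_eq p (H 0) (K 0) ->
  forall t, 0 <= t <= 1 -> germ_eq (gamma t) (H t) (K t).
Proof.
move=> Pg cH cK e0; apply: unit_interval_locally_constant; last by case: Pg => _ -> _ _.
move=> t t01; have [EH /near_within01[d1 d10 H1]] := cH t t01.
have [EK /near_within01[d2 d20 H2]] := cK t t01.
have [d3 d30 H3] := path_near Pg t01 (E_uniq EH EK).
have [eq|neq] := pselect (germ_eq (gamma t) (H t) (K t)).
  have [d4 d40 H4] := path_near Pg t01 (germ_eq_near eq).
  exists (Num.min (Num.min d1 d2) d4); first by rewrite !lt_min d10 d20.
  move=> a b _ b01 _; rewrite !lt_min => /andP[/andP[b1 b2] b4] _.
  apply: germ_eq_trans (H1 _ b01 b1) _; apply: germ_eq_trans (H4 _ b01 b4) _.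
  exact/germ_eq_sym/H2.
exists (Num.min (Num.min d1 d2) d3); first by rewrite !lt_min d10 d20.
move=> a b a01 _; rewrite !lt_min => /andP[/andP[a1 a2] a3] _ ea.
exfalso; apply: neq; apply: (H3 a a01 a3).
apply: germ_eq_trans (germ_eq_sym (H1 _ a01 a1)) _; apply: germ_eq_trans ea _.
exact: H2.
Qed.

Variable X : set S.
Hypothesis E_triv : forall p, X p -> exists2 V, nbhs p V &
  forall x h, V x -> X x -> E x h -> exists2 k, germ_eq x k h & forall y, V y -> X y -> E y k.

(** The parameters up to which a continuation exists form an interval that can
    always be prolonged, since around each point of X every germ extends to a
    section over a fixed neighbourhood. *)
Lemma continues_exists gamma p q h : path_in X gamma p q -> E p h ->
  exists2 H, continues gamma H & H 0 = h.
Proof.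
move=> Pg Eh; have [_ g0 g1 gX] := Pg.
pose upto (a : R) := exists2 H : R -> S -> B, H 0 = h &
  forall t : R, 0 <= t <= a -> E (gamma t) (H t) /\ exists2 d : R, 0 < d &
    forall s, 0 <= s <= a -> `|s - t| < d -> germ_eq (gamma s) (H s) (H t).
suff : upto 1.
  move=> [H H0 HH]; exists H => // t t01; have [e [d d0 Hd]] := HH t t01; split=> //.
  by apply/near_within01; exists d.
apply: (unit_interval_locally_constant (P := upto)); last by rewrite ler01 lexx.
  move=> t t01; have [V nV HV] := E_triv (gX t t01).
  have [d d0 Hd] := path_near Pg t01 nV.
  exists d => // a b a01 b01 ad bd [H H0 HH].
  have [ba|ab] := leP b a.
    exists H => // s sb; have [|e [r r0 Hr]] := HH s; first lra.
    by split=> //; exists r => // u ub; apply: Hr; lra.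
  have inV s : a <= s <= b -> V (gamma s).
    by move=> sab; apply: Hd; [lra|move: ad bd; rewrite !ltr_norml; lra].
  have [|Ea _] := HH a; first lra.
  have [|k ka kV] := HV (gamma a) (H a) _ (gX _ a01) Ea; first by apply: inV; lra.
  exists (fun s => if s <= a then H s else k).
    by rewrite ifT//; case/andP: a01.
  move=> s sb; case: ltgtP => [sa|sa|->].
  - have [|e [r r0 Hr]] := HH s; first lra.
    split=> //; exists (Num.min r (a - s)); first by rewrite lt_min; lra.
    move=> u ub; rewrite lt_min !ltr_norml => h'; rewrite ifT; last lra.
    by apply: Hr; [lra|rewrite ltr_norml; lra].
  - split; first by apply: kV; [apply: inV; lra|apply: gX; lra].
    exists (s - a); first lra.
    move=> u ub; rewrite ltr_norml => h'; rewrite ifF; last by apply/negbTE; rewrite -ltNge; lra.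
    exact: germ_eq_refl.
  - have [|e [r r0 Hr]] := HH a; first lra.
    split=> //; have [r2 r20 Hr2] := path_near Pg a01 (germ_eq_near ka).
    exists (Num.min r r2); first by rewrite lt_min r0.
    move=> u ub; rewrite lt_min => /andP[ur ur2]; case: ifPn => [ua|].
      by apply: Hr => //; lra.
    by move=> _; apply: Hr2 => //; lra.
exists (fun=> h) => // t; have [-> _|t0] := eqVneq t 0; last first.
  by move=> h2; case/eqP: t0; lra.
split; first by rewrite g0.
by exists 1 => // s _ _; exact: germ_eq_refl.
Qed.

End LocalSystems.

(** * Charts and connectedness of the surface *)

Section Charts.
Variables (R : realType) (S : riemannSurface R).
Local Notation Co := (R[i]^o).
Implicit Types (i j : chart S) (x y p q : S) (X W : set S).

Lemma dom_near i x : dom i x -> \forall y \near x, dom i y.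
Proof. by move=> ix; apply: open_nbhs_nbhs; split=> //; exact: dom_open. Qed.

Lemma crd_near i x (P : Co -> Prop) : dom i x ->
  (\forall z \near (crd i x : Co), P z) -> \forall y \near x, P (crd i y).
Proof. by move=> ix; exact: (crd_continuous ix). Qed.

Lemma crd_inv_near i x (Q : S -> Prop) : dom i x ->
  (\forall y \near x, Q y) -> \forall z \near (crd i x : Co), Q (crd_inv i z).
Proof.
move=> ix HQ; apply: (crd_inv_continuous ix); rewrite /= crdK//.
Qed.

Lemma chart_image_near i x : dom i x -> \forall z \near (crd i x : Co),
  dom i (crd_inv i z) /\ crd i (crd_inv i z) = z.
Proof.
move=> ix; have : nbhs (crd i x : Co) (crd i @` dom i : set Co).
  by apply: open_nbhs_nbhs; split; [exact: crd_open|exists x].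
by apply: filterS => z [y iy <-]; rewrite crdK.
Qed.

Lemma crd_inj i x y : dom i x -> dom i y -> crd i x = crd i y -> x = y.
Proof. by move=> ix iy e; rewrite -(crdK ix) e crdK. Qed.

Lemma chart_disc i x W : dom i x -> nbhs x W -> exists2 r : R, 0 < r &
  forall z : R[i], cabs (z - crd i x) < r ->
    [/\ dom i (crd_inv i z), crd i (crd_inv i z) = z & W (crd_inv i z)].
Proof.
move=> ix nW; have [r r0 Hr] := (nearC _ _).1 (filterI (chart_image_near ix) (crd_inv_near ix nW)).
by exists r => // z /Hr [[]].
Qed.

Lemma disc_nbhs i x (r : R) : dom i x -> 0 < r ->
  \forall y \near x, dom i y /\ cabs (crd i y - crd i x) < r.
Proof.
move=> ix r0; apply: filterI (dom_near ix) _.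
by apply: (@crd_near i x (fun z => cabs (z - crd i x) < r)) => //; apply/nearC; exists r.
Qed.

Lemma cd_transition i j x : dom i x -> dom j x ->
  is_derive (crd i x : Co) 1 (crd j \o crd_inv i : Co -> Co) (transition' i j x).
Proof.
by move=> ix jx; apply: cdP; exact: nbhs_singleton (transition_holomorphic ix jx).
Qed.

Lemma cd_change i j x (F : S -> R[i]) (d : R[i]) : dom i x -> dom j x ->
  is_derive (crd i x : Co) 1 (F \o crd_inv i : Co -> Co) d ->
  is_derive (crd j x : Co) 1 (F \o crd_inv j : Co -> Co) (d * transition' j i x).
Proof.
move=> ix jx dF.
have dF' : is_derive ((crd i \o crd_inv j) (crd j x) : Co) 1 (F \o crd_inv i : Co -> Co) d.
  by rewrite /= crdK.
apply: cd_near (@cd_comp _ (F \o crd_inv i) (crd i \o crd_inv j) (crd j x) _ _ dF' (cd_transition jx ix)).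
apply: filterS (crd_inv_near jx (dom_near ix)) => z iz /=.
by rewrite crdK.
Qed.

Lemma transition_mul i j x : dom i x -> dom j x ->
  transition' i j x * transition' j i x = 1.
Proof.
move=> ix jx.
have d := @cd_change i j x (crd j) _ ix jx (cd_transition ix jx).
apply: (cd_unique d); apply: cd_near (cd_id _).
by apply: filterS (chart_image_near jx) => z [_ e] /=; rewrite e.
Qed.

Lemma transition_neq0 i j x : dom i x -> dom j x -> transition' i j x != 0.
Proof.
move=> ix jx; apply/eqP => e; have := transition_mul ix jx.
by rewrite e mul0r => /eqP; rewrite eq_sym oner_eq0.
Qed.

Lemma chart_curve_path i W (c : R -> R[i]) y z : dom i y -> dom i z ->
  c 0 = crd i y -> c 1 = crd i z -> continuous (c : R -> Co) ->
  (forall t, 0 <= t <= 1 -> [/\ dom i (crd_inv i (c t)), crd i (crd_inv i (c t)) = c t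
     & W (crd_inv i (c t))]) ->
  path_in W (crd_inv i \o c) y z.
Proof.
move=> iy iz c0 c1 cc H; split; rewrite /= ?c0 ?c1 ?crdK//; last by move=> t /H[].
apply/within_contP => t /H[it e _] V nV.
have nV' : nbhs (c t : Co) (fun z => V (crd_inv i z)).
  by rewrite -e; apply: crd_inv_near.
by have /nearR[d d0 Hd] := cc t _ nV'; exists d => // s _ /Hd.
Qed.

Lemma line_cont (z w : R[i]) : continuous (fun t : R => z + t%:C * (w - z) : Co).
Proof. by move=> t; exact: cv_cont (cv_line z (w - z) t). Qed.

Lemma segment_disc (z w z0 : R[i]) (r t : R) : cabs (z - z0) < r -> cabs (w - z0) < r ->
  0 <= t <= 1 -> cabs (z + t%:C * (w - z) - z0) < r.
Proof.
move=> zr wr /andP[t0 t1].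
have -> : z + t%:C * (w - z) - z0 = (1 - t)%:C * (z - z0) + t%:C * (w - z0).
  by rewrite rmorphB /= rmorph1; ring.
rewrite (le_lt_trans (cabsD _ _))// !cabsM !cabsR !ger0_norm ?subr_ge0//.
have h1 : (1 - t) * cabs (z - z0) <= (1 - t) * r by rewrite ler_wpM2l ?subr_ge0// ltW.
have h2 : t * cabs (w - z0) <= t * r by rewrite ler_wpM2l// ltW.
have [tp|tn] := ltP 0 t.
  by have := wr; rewrite -(ltr_pM2l tp) => h3; lra.
have -> : t = 0 by lra.
by rewrite subr0 mul1r mul0r addr0.
Qed.

Lemma locally_path_connected x W : nbhs x W -> exists2 V, nbhs x V &
  forall y z, V y -> V z -> exists gamma, path_in W gamma y z.
Proof.
move=> nW; have [i ix] := dom_cover x; have [r r0 Hr] := chart_disc ix nW.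
exists (fun y => dom i y /\ cabs (crd i y - crd i x) < r); first exact: disc_nbhs.
move=> y z [iy yr] [iz zr].
exists (crd_inv i \o (fun t => crd i y + t%:C * (crd i z - crd i y))).
apply: chart_curve_path => //.
- by rewrite rmorph0 mul0r addr0.
- by rewrite rmorph1 mul1r addrC subrK.
- exact: line_cont.
by move=> t t01; apply: Hr; apply: segment_disc.
Qed.

(** In the exponential coordinate z = exp a the punctured disc is a half-plane,
    where segments connect. *)
Lemma punctured_disc_path (z w : R[i]) (r : R) : z != 0 -> w != 0 ->
  cabs z < r -> cabs w < r -> exists c : R -> R[i],
  [/\ continuous (c : R -> Co), c 0 = z, c 1 = w &
      forall t, 0 <= t <= 1 -> c t != 0 /\ cabs (c t) < r].
Proof.
move=> /cexp_surj[a <-] /cexp_surj[b <-]; rewrite !cabs_cexp => ar br.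
exists (fun t => cexp (a + t%:C * (b - a))); split.
- by move=> t; exact: cv_cont (cv_comp (cd_cexp _) (cv_line a (b - a) t)).
- by rewrite rmorph0 mul0r addr0.
- by rewrite rmorph1 mul1r addrC subrK.
move=> t /andP[t0 t1]; split; first exact: cexp_neq0.
rewrite cabs_cexp.
have -> : Re (a + t%:C * (b - a)) = (1 - t) * Re a + t * Re b.
  by rewrite !ReImE /=; ring.
have [ab|ab] := leP (Re a) (Re b).
  apply: le_lt_trans br; rewrite ler_expR.
  have h : (1 - t) * Re a <= (1 - t) * Re b by rewrite ler_wpM2l ?subr_ge0.
  by move: h; rewrite !mulrBl !mul1r; lra.
apply: le_lt_trans ar; rewrite ler_expR.
have h : t * Re b <= t * Re a by rewrite ler_wpM2l// ltW.
by move: h; rewrite !mulrBl !mul1r; lra.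
Qed.

(** Closed and discrete, in pointwise form. *)
Definition isolated_set (Z : set S) := forall x, \forall y \near x, y != x -> ~ Z y.

Lemma punctured_path_connected x W : nbhs x W -> exists2 V, nbhs x V &
  forall y z, V y -> V z -> y != x -> z != x ->
    exists gamma, path_in (W `\ x) gamma y z.
Proof.
move=> nW; have [i ix] := dom_cover x; have [r r0 Hr] := chart_disc ix nW.
exists (fun y => dom i y /\ cabs (crd i y - crd i x) < r); first exact: disc_nbhs.
have ne y : dom i y -> y != x -> crd i y - crd i x != 0.
  by move=> iy yx; rewrite subr_eq0; apply: contra_neq yx; exact: crd_inj.
move=> y z [iy yr] [iz zr] yx zx.
have [c [cc c0 c1 cP]] := punctured_disc_path (ne _ iy yx) (ne _ iz zx) yr zr.
exists (crd_inv i \o (fun t => crd i x + c t)).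
have cc' : continuous (fun t => crd i x + c t : Co).
  move=> t; apply/contRC => e e0; have /contRC/(_ _ e0)[d d0 Hd] := cc t.
  by exists d => // s /Hd; rewrite opprD addrACA subrr add0r.
apply: chart_curve_path => //.
- by rewrite c0 addrC subrK.
- by rewrite c1 addrC subrK.
move=> t /cP[ct0 ctr]; have [|h1 h2 h3] := Hr (crd i x + c t); first by rewrite addrC addKr.
split=> //; split=> // e.
by move: h2; rewrite e => /eqP; rewrite -subr_eq0 opprD addrA subrr sub0r oppr_eq0 (negbTE ct0).
Qed.

Lemma chart_not_isolated x W : nbhs x W -> exists2 y, W y & y != x.
Proof.
move=> nW; have [i ix] := dom_cover x; have [r r0 Hr] := chart_disc ix nW.
have [|h1 h2 h3] := Hr (crd i x + (r / 2)%:C).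
  by rewrite addrC addKr cabsR ger0_norm; lra.
exists (crd_inv i (crd i x + (r / 2)%:C)) => //; apply/eqP => e.
move: h2; rewrite e => /eqP; rewrite -subr_eq0 opprD addrA subrr sub0r oppr_eq0.
by rewrite -cabs_eq0 cabsR normr_eq0 gt_eqF// divr_gt0.
Qed.

(** The points that can be reached from p form an open and closed set, because
    punctured neighbourhoods are path-connected. *)
Lemma path_connected_compl (Z : set S) p q : isolated_set Z -> ~ Z p -> ~ Z q ->
  exists gamma, path_in (~` Z) gamma p q.
Proof.
move=> isoZ Zp Zq.
pose reach x := exists gamma, path_in (~` Z) gamma p x.
have loc x : exists2 V, nbhs x V & forall y z, V y -> V z -> ~ Z y -> ~ Z z ->
    exists gamma, path_in (~` Z) gamma y z.
  have [Zx|Zx] := pselect (Z x).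
    have [V nV HV] := punctured_path_connected (isoZ x); exists V => // y z Vy Vz Zy Zz.
    have [||g Pg] := HV y z Vy Vz.
    - by apply/eqP => e; apply: Zy; rewrite e.
    - by apply/eqP => e; apply: Zz; rewrite e.
    by exists g; apply: path_sub Pg => u [h /eqP]; exact: h.
  have nW : \forall y \near x, ~ Z y.
    apply: filterS (isoZ x) => y h; have [->//|] := eqVneq y x; exact: h.
  have [V nV HV] := locally_path_connected nW; exists V => // y z Vy Vz _ _.
  exact: HV.
pose A := [set x : S | \forall y \near x, ~ Z y -> reach y].
have oA : open A.
  by rewrite openE => x Ax; exact: near_join.
have key x V : nbhs x V -> (forall y z, V y -> V z -> ~ Z y -> ~ Z z ->
    exists gamma, path_in (~` Z) gamma y z) -> (exists y, [/\ V y, ~ Z y & reach y]) -> A x.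
  move=> nV HV [y [Vy Zy [g Pg]]]; apply: filterS nV => z Vz Zz.
  have [g' Pg'] := HV y z Vy Vz Zy Zz; exists (join g g'); exact: path_join Pg Pg'.
have oAc : open (~` A).
  rewrite openE => x nAx; have [V nV HV] := loc x.
  have [V' nV' oV'] : exists2 V', nbhs x V' & forall y, V' y -> nbhs y V.
    by exists (interior V); [exact: nbhs_interior|].
  apply: filterS nV' => y V'y Ay; apply: nAx; apply: (key x V) => //.
  have h : nbhs y (V `&` (fun y => ~ Z y -> reach y) `&` (fun z => z != y -> ~ Z z)).
    exact: filterI (filterI (oV' _ V'y) Ay) (isoZ y).
  have [z [[Vz hz] iz] zy] := chart_not_isolated h.
  by exists z; split=> //; [exact: iz|apply: hz; exact: iz].
have Ap : A p.
  have [V nV HV] := loc p; apply: (key p V) => //; exists p; split=> //.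
    exact: nbhs_singleton nV.
  by exists (fun=> p); exact: path_const.
have AT : A = [set: S].
  apply: surface_connected; first by exists p.
  - by exists A => //; rewrite setTI.
  - exists A; last by rewrite setTI.
    by rewrite -[A]setCK; exact: open_closedC.
have : A q by rewrite AT.
by move=> /nbhs_singleton/(_ Zq).
Qed.

End Charts.

Section GlobalSection.
Variables (R : realType) (S : riemannSurface R) (B : Type).
Variables (E : S -> (S -> B) -> Prop) (X : set S).
Hypothesis E_uniq : forall p h k, E p h -> E p k ->
  \forall x \near p, germ_eq x h k -> germ_eq p h k.
Hypothesis E_triv : forall p, X p -> exists2 V, nbhs p V &
  forall x h, V x -> X x -> E x h -> exists2 k, germ_eq x k h & forall y, V y -> X y -> E y k.
Hypothesis E_near : forall p h, E p h -> \forall x \near p, E x h.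
Hypothesis E_ext : forall p h k, germ_eq p h k -> E p h -> E p k.
Hypothesis X_open : forall p, X p -> \forall x \near p, X x.
Hypothesis X_path : forall p q, X p -> X q -> exists gamma, path_in X gamma p q.

(** The value at x is that of the continuation of h0 along any path from b to x;
    trivial monodromy makes it independent of the path. *)
Lemma global_section b h0 : X b -> E b h0 ->
  (forall gamma H, path_in X gamma b b -> continues E gamma H -> H 0 = h0 ->
     germ_eq b (H 1) h0) ->
  exists F : S -> B, germ_eq b F h0 /\ forall x, X x -> E x F.
Proof.
move=> Xb Eb loops.
have /choice[sec secP] : forall x, exists k, X x -> exists gamma H,
    [/\ path_in X gamma b x, continues E gamma H, H 0 = h0 & H 1 = k].
  move=> x; have [Xx|Xx] := pselect (X x); last by exists h0.
  have [g Pg] := X_path Xb Xx; have [H cH H0] := continues_exists E_triv Pg Eb.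
  by exists (H 1) => _; exists g, H.
have uniq_end x k gamma H : X x -> path_in X gamma b x -> continues E gamma H ->
    H 0 = h0 -> H 1 = k -> germ_eq x k (sec x).
  move=> Xx Pg cH H0 H1; have [g' [K [Pg' cK K0 K1]]] := secP x Xx.
  have E1 : E x k by have [|] := cH 1 _; [lra|rewrite H1; case: Pg => _ _ ->].
  have Pr := path_rev Pg'; have [L cL L0] := continues_exists E_triv Pr E1.
  have HL : germ_eq x (H 1) (L 0) by rewrite L0 H1; exact: germ_eq_refl.
  have cJ := continues_join Pg Pr cH cL HL.
  have := loops _ _ (path_join Pg Pr) cJ.
  have -> : join H L 0 = h0 by rewrite /join ifT ?invr_ge0// mulr0.
  have -> : join H L 1 = L 1.
    rewrite /join ifF; last by apply/negbTE; rewrite -ltNge; lra.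
    by rewrite mulr1; congr L; lra.
  move=> /(_ erefl) L1.
  have cLr := continues_rev cL.
  have Prr : path_in X (fun s => g' (1 - (1 - s))) b x by exact: path_rev Pr.
  have cK' : continues E (fun s => g' (1 - (1 - s))) K.
    by move: cK; congr continues; apply/funext => s; congr g'; ring.
  have := continues_unique E_uniq Prr cLr cK'; rewrite subr0 K0 => /(_ L1 1).
  rewrite ler01 lexx subrr subr0 L0 K1 => /(_ isT).
  by case: Pg' => _ _ -> _.
exists (fun x => sec x x).
have loc x : X x -> germ_eq x (sec x) (fun y => sec y y).
  move=> Xx; have [g [K [Pg cK K0 K1]]] := secP x Xx.
  have Ex : E x (sec x) by have [|] := cK 1 _; [lra|rewrite K1; case: Pg => _ _ ->].
  have nW : nbhs x (X `&` (fun y => E y (sec x))) by exact: filterI (X_open Xx) (E_near Ex).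
  have [V nV HV] := locally_path_connected nW.
  apply: filterS2 (nV) (nW) => y Vy [Xy _].
  have [g' Pg'] := HV x y (nbhs_singleton nV) Vy.
  have cC : continues E g' (fun=> sec x).
    move=> t t01; split; first by case: Pg' => _ _ _ /(_ t t01)[].
    by apply: nearW => s; exact: germ_eq_refl.
  have Pg2 : path_in X g' x y by apply: path_sub Pg' => u [].
  have KC : germ_eq x (K 1) (sec x) by rewrite K1; exact: germ_eq_refl.
  have cJ := continues_join Pg Pg2 cK cC KC.
  have h := @uniq_end y (sec x) _ _ Xy (path_join Pg Pg2) cJ.
  apply: (nbhs_singleton (h _ _)).
    by rewrite /join ifT ?invr_ge0// mulr0.
  by rewrite /join ifF//; apply/negbTE; rewrite -ltNge; lra.
split.
  apply: germ_eq_trans (germ_eq_sym (loc b Xb)) _; apply: germ_eq_sym.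
  apply: (@uniq_end b h0 (fun=> b) (fun=> h0)) => //; first exact: path_const.
  by move=> t t01; split=> //; apply: nearW => s; exact: germ_eq_refl.
move=> x Xx; apply: E_ext (loc x Xx) _.
have [g [K [Pg cK K0 K1]]] := secP x Xx.
by have [|] := cK 1 _; [lra|rewrite K1; case: Pg => _ _ ->].
Qed.

End GlobalSection.

(** * Holomorphic functions near a point *)

Section HolomorphicToolkit.
Variable R : realType.
Local Notation Co := (R[i]^o).
Implicit Types (f g : Co -> Co) (z : Co).

Lemma hol_ext f g z0 : (\forall z \near z0, f z = g z) ->
  holomorphic_at f z0 -> holomorphic_at g z0.
Proof.
move=> e h; have e' : \forall z \near z0, \forall w \near z, f w = g w by exact: near_join.
by apply: filterS2 e' h => z ew /cdP d; have [] := cd_near ew d.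
Qed.

Lemma hol_at f z0 : holomorphic_at f z0 -> is_derive z0 1 f (derive1 f z0).
Proof. by move=> h; apply: cdP; exact: nbhs_singleton h. Qed.

Lemma hol_cont f z0 : holomorphic_at f z0 -> {for z0, continuous f}.
Proof. by move=> h; exact: cd_cont (hol_at h). Qed.

Lemma hol_id z0 : holomorphic_at (fun z => z) z0.
Proof. by apply/nearC; exists 1 => // z _; have [] := cd_id z. Qed.

Lemma hol_cst (a : R[i]) z0 : holomorphic_at (fun=> a) z0.
Proof. by apply/nearC; exists 1 => // z _; have [] := cd_cst z a. Qed.

Lemma holD f g z0 : holomorphic_at f z0 -> holomorphic_at g z0 ->
  holomorphic_at (fun z => f z + g z) z0.
Proof. by move=> hf hg; apply: filterS2 hf hg => z /cdP a /cdP b; have [] := cdD a b. Qed.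

Lemma holB f g z0 : holomorphic_at f z0 -> holomorphic_at g z0 ->
  holomorphic_at (fun z => f z - g z) z0.
Proof. by move=> hf hg; apply: filterS2 hf hg => z /cdP a /cdP b; have [] := cdB a b. Qed.

Lemma holM f g z0 : holomorphic_at f z0 -> holomorphic_at g z0 ->
  holomorphic_at (fun z => f z * g z) z0.
Proof. by move=> hf hg; apply: filterS2 hf hg => z /cdP a /cdP b; have [] := cdM a b. Qed.

Lemma holX f n z0 : holomorphic_at f z0 -> holomorphic_at (fun z => f z ^+ n) z0.
Proof. by move=> hf; apply: filterS hf => z /cdP a; have [] := cdX n a. Qed.

Lemma neq0_near f z0 : {for z0, continuous f} -> f z0 != 0 -> \forall z \near z0, f z != 0.
Proof.
move=> /contC cf f0; have [|d d0 Hd] := cf (cabs (f z0)); first by rewrite cabs_gt0.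
apply/nearC; exists d => // z /Hd h; apply/eqP => fz.
by move: h; rewrite fz sub0r cabsN ltxx.
Qed.

Lemma holV f z0 : f z0 != 0 -> holomorphic_at f z0 -> holomorphic_at (fun z => (f z)^-1) z0.
Proof.
move=> f0 hf; apply: filterS2 hf (neq0_near (hol_cont hf) f0) => z /cdP a fz.
by have [] := cdV fz a.
Qed.

Lemma near_cont g z0 (P : Co -> Prop) : {for z0, continuous g} ->
  (\forall w \near g z0, P w) -> \forall z \near z0, P (g z).
Proof.
move=> /contC cg /nearC[e e0 HP]; have [d d0 Hd] := cg e e0.
by apply/nearC; exists d => // z /Hd /HP.
Qed.

Lemma hol_comp f g z0 : holomorphic_at f (g z0) -> holomorphic_at g z0 ->
  holomorphic_at (fun z => f (g z)) z0.
Proof.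
move=> hf hg; have cg := hol_cont hg.
have hf' : \forall z \near z0, derivable f (g z) 1 by exact: near_cont cg hf.
apply: filterS2 hf' hg => z /cdP a /cdP b; by have [] := @cd_comp _ f g z _ _ a b.
Qed.

(** Near z0 the function f - f'(z0) z has a Lipschitz constant smaller than
    |f'(z0)|. *)
Lemma hol_injective f z0 : holomorphic_at f z0 -> derive1 f z0 != 0 ->
  exists2 r : R, 0 < r & forall x y : Co, cabs (x - z0) < r -> cabs (y - z0) < r ->
    f x = f y -> x = y.
Proof.
move=> hf d0; have m0 : 0 < cabs (derive1 f z0) / 4 by rewrite divr_gt0// cabs_gt0.
have /contC/(_ _ m0)[r1 r10 H1] := hol_cont (holomorphic_derive1 hf).
have /nearC[r2 r20 H2] := hf.
exists (Num.min r1 r2); first by rewrite lt_min r10.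
move=> x y xr yr fxy; pose c t := f (y + t%:C * (x - y)) - derive1 f z0 * (y + t%:C * (x - y)).
have := @cv_mvt _ c (fun t => derive1 f (y + t%:C * (x - y)) * (x - y) - derive1 f z0 * (x - y))
  0 1 (cabs (derive1 f z0) / 4 * cabs (x - y)) ler01.
have seg t : 0 <= t <= 1 -> cabs (y + t%:C * (x - y) - z0) < r1 /\ cabs (y + t%:C * (x - y) - z0) < r2.
  by move=> t01; have := segment_disc yr xr t01; rewrite lt_min => /andP[].
move=> H; have {H} := H _ _.
rewrite /c rmorph0 rmorph1 mul0r mul1r addr0 [y + (x - y)]addrC subrK fxy subr0 mulr1.
have -> : f y - derive1 f z0 * x - (f y - derive1 f z0 * y) = - (derive1 f z0 * (x - y)) by ring.
rewrite cabsN cabsM => H; apply/eqP; rewrite -subr_eq0 -cabs_eq0; apply/eqP/le_anti.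
rewrite cabs_ge0 andbT.
have h : cabs (derive1 f z0) * cabs (x - y) <= 2 * (cabs (derive1 f z0) / 4 * cabs (x - y)).
  apply: H => t t01.
    apply: cvB; last exact: cvZ (cv_line y (x - y) t).
    by apply: cv_comp (cv_line y (x - y) t); apply/cdP/H2; have [] := seg t t01.
  rewrite -mulrBl cabsM ler_wpM2r ?cabs_ge0//; apply/ltW/H1; by have [] := seg t t01.
have h2 : cabs (derive1 f z0) * cabs (x - y) <= 0 by lra.
by rewrite -(pmulr_rle0 _ (_ : 0 < cabs (derive1 f z0))) ?cabs_gt0.
Qed.

End HolomorphicToolkit.

(** * Smoothness of the spherical density *)

Section Smooth.
Variable R : realType.
Local Notation Co := (R[i]^o).
Implicit Types (u v : Co -> R) (f : Co -> Co) (V : set Co) (z : Co).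

Definition is_dx u (z : Co) (a : R) := is_derive (0 : R) 1 (fun t : R => u (z + t%:C)) a.
Definition is_dy u (z : Co) (a : R) := is_derive (0 : R) 1 (fun t : R => u (z + t%:C * 'i)) a.

Lemma dxE u z a : is_dx u z a -> dx u z = a.
Proof. by move=> [_ <-]; rewrite /dx derive1E. Qed.

Lemma dyE u z a : is_dy u z a -> dy u z = a.
Proof. by move=> [_ <-]; rewrite /dy derive1E. Qed.

Lemma is_dx_dx u z : derivable (fun t : R => u (z + t%:C)) 0 1 -> is_dx u z (dx u z).
Proof. by move=> h; rewrite /is_dx /dx derive1E; exact: derivableP. Qed.

Lemma is_dy_dy u z : derivable (fun t : R => u (z + t%:C * 'i)) 0 1 -> is_dy u z (dy u z).
Proof. by move=> h; rewrite /is_dy /dy derive1E; exact: derivableP. Qed.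

Lemma near_line_x (z : Co) (P : Co -> Prop) : (\forall w \near z, P w) ->
  \forall t \near (0 : R), P (z + t%:C).
Proof.
move=> /nearC[e e0 H]; apply/nearR; exists e => // t; rewrite subr0 => te.
by apply: H; rewrite addrC addKr cabsR.
Qed.

Lemma near_line_y (z : Co) (P : Co -> Prop) : (\forall w \near z, P w) ->
  \forall t \near (0 : R), P (z + t%:C * 'i).
Proof.
move=> /nearC[e e0 H]; apply/nearR; exists e => // t; rewrite subr0 => te.
by apply: H; rewrite addrC addKr cabsM cabsR cabs_i mulr1.
Qed.

Lemma is_dx_near u v z a : (\forall w \near z, u w = v w) -> is_dx u z a -> is_dx v z a.
Proof. by move=> /near_line_x e; apply: rd_near. Qed.

Lemma is_dy_near u v z a : (\forall w \near z, u w = v w) -> is_dy u z a -> is_dy v z a.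
Proof. by move=> /near_line_y e; apply: rd_near. Qed.

Lemma line_x_deriv f z d : is_derive z 1 f d -> cderiv (fun t => f (z + t%:C)) 0 d.
Proof.
move=> df; have df' : is_derive (z + 0%:C * 1 : Co) 1 f d by rewrite mulr1 addr0.
apply: (@cv_ext _ (fun t => f (z + t%:C * 1))); first by move=> t; rewrite mulr1.
by apply: cv_eq (cv_comp df' (cv_line z 1 0)); rewrite mulr1.
Qed.

Lemma line_y_deriv f z d : is_derive z 1 f d -> cderiv (fun t => f (z + t%:C * 'i)) 0 (d * 'i).
Proof.
move=> df; have df' : is_derive (z + 0%:C * 'i : Co) 1 f d by rewrite mul0r addr0.
exact: cv_comp df' (cv_line z 'i%R 0).
Qed.

Lemma is_dx_Re f z d : is_derive z 1 f d -> is_dx (fun z => Re (f z)) z (Re d).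
Proof. by move=> /line_x_deriv[]. Qed.
Lemma is_dx_Im f z d : is_derive z 1 f d -> is_dx (fun z => Im (f z)) z (Im d).
Proof. by move=> /line_x_deriv[]. Qed.
Lemma is_dy_Re f z d : is_derive z 1 f d -> is_dy (fun z => Re (f z)) z (- Im d).
Proof. by move=> /line_y_deriv[h _]; apply: rd_eq h; rewrite !ReImE /=; ring. Qed.
Lemma is_dy_Im f z d : is_derive z 1 f d -> is_dy (fun z => Im (f z)) z (Re d).
Proof. by move=> /line_y_deriv[_ h]; apply: rd_eq h; rewrite !ReImE /=; ring. Qed.

(** In comparison with Ck, continuity is required of every partial derivative
    up to order n, and not only of the last ones: products can then be treated
    by induction on n. *)
Fixpoint Ck' n V u : Prop := (forall z, V z -> {for z, continuous u}) /\
  if n is n'.+1 then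
    [/\ forall z, V z -> derivable (fun t : R => u (z + t%:C)) 0 1,
        forall z, V z -> derivable (fun t : R => u (z + t%:C * 'i)) 0 1,
        Ck' n' V (dx u) & Ck' n' V (dy u)]
  else True.

Lemma Ck'_Ck n V u : Ck' n V u -> Ck n V u.
Proof.
elim: n u => [|n IH] u; first by case.
by move=> [_ [h1 h2 h3 h4]]; exact: (And4 h1 h2 (IH _ h3) (IH _ h4)).
Qed.

Lemma Ck'_cont n V u : Ck' n V u -> forall z, V z -> {for z, continuous u}.
Proof. by case: n => [|n] []. Qed.

Lemma Ck'_pred n V u : Ck' n.+1 V u -> Ck' n V u.
Proof.
elim: n u => [|n IH] u; first by move=> /Ck'_cont h; split.
by move=> [h [h1 h2 h3 h4]]; exact: (conj h (And4 h1 h2 (IH _ h3) (IH _ h4))).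
Qed.

Lemma Ck'_ext n V u v : open V -> (forall z, V z -> u z = v z) -> Ck' n V u -> Ck' n V v.
Proof.
move=> oV; have nV z : V z -> \forall w \near z, V w by move=> Vz; exact: open_nbhs_nbhs.
elim: n u v => [|n IH] u v uv.
  move=> h; split=> // z Vz W; rewrite -uv// => nW.
  have := Ck'_cont h Vz nW; apply: filterS2 (nV z Vz) => w Vw.
  by rewrite /= uv.
have near_uv z : V z -> \forall w \near z, u w = v w.
  by move=> /nV; apply: filterS => w /uv.
move=> [hc [h1 h2 h3 h4]]; split.
  move=> z Vz W; rewrite -uv// => nW.
  have := hc z Vz W nW; apply: filterS2 (nV z Vz) => w Vw.
  by rewrite /= uv.
split.
- by move=> z Vz; have [] := is_dx_near (near_uv z Vz) (is_dx_dx (h1 z Vz)).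
- by move=> z Vz; have [] := is_dy_near (near_uv z Vz) (is_dy_dy (h2 z Vz)).
- apply: IH h3 => z Vz; apply/esym/dxE.
  exact: is_dx_near (near_uv z Vz) (is_dx_dx (h1 z Vz)).
- apply: IH h4 => z Vz; apply/esym/dyE.
  exact: is_dy_near (near_uv z Vz) (is_dy_dy (h2 z Vz)).
Qed.

Lemma Ck'_intro n V u ux uy : open V -> (forall z, V z -> {for z, continuous u}) ->
  (forall z, V z -> is_dx u z (ux z)) -> (forall z, V z -> is_dy u z (uy z)) ->
  Ck' n V ux -> Ck' n V uy -> Ck' n.+1 V u.
Proof.
move=> oV cu hx hy sx sy; split=> //; split.
- by move=> z /hx[].
- by move=> z /hy[].
- by apply: (Ck'_ext oV _ sx) => z /hx /dxE.
- by apply: (Ck'_ext oV _ sy) => z /hy /dyE.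
Qed.

Lemma Ck'_cst n V (a : R) : open V -> Ck' n V (fun=> a).
Proof.
have c (b : R) z : {for z, continuous (fun=> b : R)}.
  by apply/contCR => e e0; exists 1 => // w _; rewrite subrr normr0.
move=> oV; elim: n a => [|n IH] a; first by split.
apply: (@Ck'_intro _ _ _ (fun=> 0) (fun=> 0)) => //.
- by move=> z _; exact: rd_cst.
- by move=> z _; exact: rd_cst.
Qed.

Lemma Ck'_D n V u v : open V -> Ck' n V u -> Ck' n V v -> Ck' n V (fun z => u z + v z).
Proof.
move=> oV; elim: n u v => [|n IH] u v hu hv.
  by split=> // z Vz; exact: (continuousD (Ck'_cont hu Vz) (Ck'_cont hv Vz)).
have [cu [u1 u2 u3 u4]] := hu; have [cv [v1 v2 v3 v4]] := hv.
apply: (@Ck'_intro _ _ _ (fun z => dx u z + dx v z) (fun z => dy u z + dy v z)) => //.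
- by move=> z Vz; exact: (continuousD (cu z Vz) (cv z Vz)).
- by move=> z Vz; apply: rdD; [exact/is_dx_dx/u1|exact/is_dx_dx/v1].
- by move=> z Vz; apply: rdD; [exact/is_dy_dy/u2|exact/is_dy_dy/v2].
- exact: IH.
- exact: IH.
Qed.

Lemma Ck'_M n V u v : open V -> Ck' n V u -> Ck' n V v -> Ck' n V (fun z => u z * v z).
Proof.
move=> oV; elim: n u v => [|n IH] u v hu hv.
  by split=> // z Vz; exact: (continuousM (Ck'_cont hu Vz) (Ck'_cont hv Vz)).
have [cu [u1 u2 u3 u4]] := hu; have [cv [v1 v2 v3 v4]] := hv.
have hu' := Ck'_pred hu; have hv' := Ck'_pred hv.
apply: (@Ck'_intro _ _ _ (fun z => dx u z * v z + u z * dx v z)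
                         (fun z => dy u z * v z + u z * dy v z)) => //.
- by move=> z Vz; exact: (continuousM (cu z Vz) (cv z Vz)).
- move=> z Vz; apply: rd_eq (rdM (is_dx_dx (u1 z Vz)) (is_dx_dx (v1 z Vz))).
  by rewrite !addr0.
- move=> z Vz; apply: rd_eq (rdM (is_dy_dy (u2 z Vz)) (is_dy_dy (v2 z Vz))).
  by rewrite !mul0r !addr0.
- by apply: Ck'_D => //; exact: IH.
- by apply: Ck'_D => //; exact: IH.
Qed.

Lemma Ck'_V n V u : open V -> (forall z, V z -> u z != 0) -> Ck' n V u ->
  Ck' n V (fun z => (u z)^-1).
Proof.
move=> oV u0; elim: n => [|n IH] hu.
  by split=> // z Vz; exact: (continuousV (u0 z Vz) (Ck'_cont hu Vz)).
have [cu [u1 u2 u3 u4]] := hu; have hu' := IH (Ck'_pred hu).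
have N1 := Ck'_cst n (-1) oV.
apply: (@Ck'_intro _ _ _ (fun z => -1 * dx u z * ((u z)^-1 * (u z)^-1))
                         (fun z => -1 * dy u z * ((u z)^-1 * (u z)^-1))) => //.
- by move=> z Vz; exact: (continuousV (u0 z Vz) (cu z Vz)).
- move=> z Vz; apply: rd_eq (rdV _ (is_dx_dx (u1 z Vz))); rewrite ?addr0 ?u0//.
  by rewrite mulN1r expr2 invfM.
- move=> z Vz; apply: rd_eq (rdV _ (is_dy_dy (u2 z Vz))); rewrite ?mul0r ?addr0 ?u0//.
  by rewrite mulN1r expr2 invfM.
- by do !apply: Ck'_M.
- by do !apply: Ck'_M.
Qed.

Lemma Ck'_holomorphic n V f : open V -> (forall z, V z -> holomorphic_at f z) ->
  Ck' n V (fun z => Re (f z)) /\ Ck' n V (fun z => Im (f z)).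
Proof.
move=> oV; elim: n f => [|n IH] f hf.
  split; split=> // z Vz.
    exact: (continuous_comp (hol_cont (hf z Vz)) (@cont_Re R _)).
  exact: (continuous_comp (hol_cont (hf z Vz)) (@cont_Im R _)).
have [IR II] := IH _ (fun z Vz => holomorphic_derive1 (hf z Vz)).
have N1 := Ck'_cst n (-1) oV.
have cR z : V z -> {for z, continuous (fun z : Co => Re (f z) : R)}.
  by move=> Vz; exact: (continuous_comp (hol_cont (hf z Vz)) (@cont_Re R _)).
have cI z : V z -> {for z, continuous (fun z : Co => Im (f z) : R)}.
  by move=> Vz; exact: (continuous_comp (hol_cont (hf z Vz)) (@cont_Im R _)).
split.
  apply: (@Ck'_intro _ _ _ (fun z => Re (derive1 f z)) (fun z => -1 * Im (derive1 f z))) => //.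
  - by move=> z Vz; exact/is_dx_Re/hol_at/hf.
  - by move=> z Vz; rewrite mulN1r; exact/is_dy_Re/hol_at/hf.
  - exact: Ck'_M.
apply: (@Ck'_intro _ _ _ (fun z => Im (derive1 f z)) (fun z => Re (derive1 f z))) => //.
- by move=> z Vz; exact/is_dx_Im/hol_at/hf.
- by move=> z Vz; exact/is_dy_Im/hol_at/hf.
Qed.

(** The density of the pull-back of the spherical metric by f. *)
Definition spher f (z : Co) : R := 4 * cabs (derive1 f z) ^+ 2 / (1 + cabs (f z) ^+ 2) ^+ 2.

Lemma sphere_den_gt0 (a : R[i]) : 0 < 1 + cabs a ^+ 2.
Proof. by rewrite ltr_pwDl// sqr_ge0. Qed.

Lemma spher_gt0 f z : derive1 f z != 0 -> 0 < spher f z.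
Proof.
move=> h; rewrite /spher divr_gt0 ?exprn_gt0 ?sphere_den_gt0//.
by rewrite mulr_gt0// exprn_gt0// cabs_gt0.
Qed.

(** A rational expression, with nonvanishing denominator, in the real and
    imaginary parts of f and f', which satisfy the Cauchy-Riemann equations. *)
Lemma spher_smooth n V f : open V -> (forall z, V z -> holomorphic_at f z) ->
  Ck' n V (spher f).
Proof.
move=> oV hf; have [P Q] := Ck'_holomorphic n oV hf.
have [A B] := Ck'_holomorphic n oV (fun z Vz => holomorphic_derive1 (hf z Vz)).
have cst a := Ck'_cst n a oV.
have PQ := Ck'_D oV (cst 1) (Ck'_D oV (Ck'_M oV P P) (Ck'_M oV Q Q)).
have PQV := Ck'_V oV _ PQ.
have AB := Ck'_M oV (cst 4) (Ck'_D oV (Ck'_M oV A A) (Ck'_M oV B B)).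
have := Ck'_M oV AB (Ck'_M oV (PQV _) (PQV _)).
have ne z : V z -> 1 + (Re (f z) * Re (f z) + Im (f z) * Im (f z)) != 0.
  by move=> _; rewrite -!expr2 -sqr_cabs gt_eqF// sphere_den_gt0.
move=> /(_ ne ne); apply: Ck'_ext => // z _.
by rewrite /spher !sqr_cabs -!expr2 exprVn.
Qed.

End Smooth.

(** * Curvature of the spherical density *)

Section SphericalDensity.
Variable R : realType.
Local Notation Co := (R[i]^o).
Implicit Types (f g : Co -> Co) (z : Co).

Lemma near_derive1 f g z : (\forall w \near z, f w = g w) ->
  derive1 f z = derive1 g z.
Proof. by move=> e; rewrite !derive1E; exact: near_eq_derive. Qed.

Lemma spher_inv f z : derivable f z 1 -> f z != 0 ->
  spher (fun z => (f z)^-1) z = spher f z.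
Proof.
move=> /cdP df f0; rewrite /spher (cd_derive1 (cdV f0 df)).
rewrite cabs_div cabsN cabsX cabsV.
have m0 : cabs (f z) != 0 by rewrite cabs_eq0.
have m1 : 1 + cabs (f z) ^+ 2 != 0 by rewrite gt_eqF// sphere_den_gt0.
have m2 : 1 + (cabs (f z))^-1 ^+ 2 != 0.
  by rewrite gt_eqF// ltr_pwDl// sqr_ge0.
have m3 : (cabs (f z)) ^+ 2 + 1 != 0 by rewrite addrC.
move: (cabs (f z)) (cabs (derive1 f z)) m0 m1 m2 m3 => m d m0 m1 m2 m3.
by field; rewrite ?m0 ?m1 ?m3 //.
Qed.

Lemma spher_mul (a : R[i]) f z : cabs a = 1 -> derivable f z 1 ->
  spher (fun z => a * f z) z = spher f z.
Proof.
move=> a1 /cdP df; rewrite /spher (cd_derive1 (cdZ a df)).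
by rewrite (cabsM a (derive1 f z)) (cabsM a (f z)) a1 !mul1r.
Qed.

Lemma spher_comp f g z : derivable f (g z) 1 -> derivable g z 1 ->
  spher (fun z => f (g z)) z = spher f (g z) * cabs (derive1 g z) ^+ 2.
Proof.
move=> /cdP df /cdP dg; rewrite /spher (cd_derive1 (@cd_comp _ f g z _ _ df dg)).
move: (derive1 f (g z)) (derive1 g z) => a b; rewrite cabsM exprMn.
by move: (cabs a) (cabs b) (cabs (f (g z))) => x y u; rewrite mulrA mulrAC.
Qed.

(** With f' = A + iB, f'' = C + iD and f = P + iQ, this is the derivative along
   the real axis of half the logarithm of 4 |f'|^2 / (1 + |f|^2)^2. *)
Definition lnd (A B C D P Q : R) : R :=
  (C * A + D * B) / (A ^+ 2 + B ^+ 2) - 2 * ((A * P + B * Q) / (1 + (P ^+ 2 + Q ^+ 2))).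

Definition lnspher_x f z : R :=
  lnd (Re (derive1 f z)) (Im (derive1 f z)) (Re (derive1 (derive1 f) z))
    (Im (derive1 (derive1 f) z)) (Re (f z)) (Im (f z)).
Definition lnspher_y f z : R :=
  lnd (Re (derive1 f z)) (Im (derive1 f z)) (- Im (derive1 (derive1 f) z))
    (Re (derive1 (derive1 f) z)) (Im (f z)) (- Re (f z)).

Lemma sqr_deriv (A : R -> R) (a : R) : is_derive (0 : R) 1 A a ->
  is_derive (0 : R) 1 (fun t => A t ^+ 2) (2 * A 0 * a).
Proof.
move=> dA; apply: (@rd_ext _ (fun t => A t * A t)); first by move=> t; rewrite expr2.
by apply: rd_eq (rdM dA dA); ring.
Qed.

Lemma ln_density_deriv (A B P Q : R -> R) (a b p q : R) :
  is_derive (0 : R) 1 A a -> is_derive (0 : R) 1 B b ->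
  is_derive (0 : R) 1 P p -> is_derive (0 : R) 1 Q q ->
  0 < A 0 ^+ 2 + B 0 ^+ 2 ->
  is_derive (0 : R) 1
    (fun t => ln (4 * (A t ^+ 2 + B t ^+ 2) / (1 + (P t ^+ 2 + Q t ^+ 2)) ^+ 2) / 2)
    ((a * A 0 + b * B 0) / (A 0 ^+ 2 + B 0 ^+ 2)
     - 2 * ((p * P 0 + q * Q 0) / (1 + (P 0 ^+ 2 + Q 0 ^+ 2)))).
Proof.
move=> dA dB dP dQ Npos.
have Mpos : 0 < 1 + (P 0 ^+ 2 + Q 0 ^+ 2) by rewrite ltr_pwDl// addr_ge0// sqr_ge0.
have N := rdM (rd_cst 0 4) (rdD (sqr_deriv dA) (sqr_deriv dB)).
have M := sqr_deriv (rdD (rd_cst 0 1) (rdD (sqr_deriv dP) (sqr_deriv dQ))).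
have M0 : (1 + (P 0 ^+ 2 + Q 0 ^+ 2)) ^+ 2 != 0 by rewrite expf_neq0// gt_eqF.
have S := rdM N (rdV (f := fun t => (1 + (P t ^+ 2 + Q t ^+ 2)) ^+ 2) M0 M).
have Lpos : 0 < 4 * (A 0 ^+ 2 + B 0 ^+ 2) / (1 + (P 0 ^+ 2 + Q 0 ^+ 2)) ^+ 2.
  by rewrite divr_gt0 ?exprn_gt0// mulr_gt0.
have L := rdM (rd_comp (g := fun t => 4 * (A t ^+ 2 + B t ^+ 2) / (1 + (P t ^+ 2 + Q t ^+ 2)) ^+ 2)
  (is_derive1_ln Lpos) S) (rd_cst 0 (2^-1)).
apply: rd_eq L.
move: (A 0) (B 0) (P 0) (Q 0) Npos Mpos => A0 B0 P0 Q0 Npos Mpos.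
by field; rewrite !gt_eqF.
Qed.

Definition lnd' (A B C D P Q a b c d p q : R) : R :=
  (c * A + C * a + (d * B + D * b)) / (A ^+ 2 + B ^+ 2)
  - 2 * (C * A + D * B) * (A * a + B * b) / (A ^+ 2 + B ^+ 2) ^+ 2
  - 2 * ((a * P + A * p + (b * Q + B * q)) / (1 + (P ^+ 2 + Q ^+ 2))
  - 2 * (A * P + B * Q) * (P * p + Q * q) / (1 + (P ^+ 2 + Q ^+ 2)) ^+ 2).

(** The Laplacian of ln |f'| vanishes and that of ln (1 + |f|^2) is
    4 |f'|^2 / (1 + |f|^2)^2. In real coordinates, with E + i F = f''', the third
    derivatives cancel and an identity of rational functions remains. *)
Lemma curvature_identity (A B C D E F P Q : R) :
  0 < A ^+ 2 + B ^+ 2 -> 0 < 1 + (P ^+ 2 + Q ^+ 2) ->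
  - (lnd' A B C D P Q C D E F A B + lnd' A B (- D) C Q (- P) (- D) C (- E) (- F) A (- - B))
  / (4 * (A ^+ 2 + B ^+ 2) / (1 + (P ^+ 2 + Q ^+ 2)) ^+ 2) = 1.
Proof.
move=> Npos Mpos; rewrite /lnd' sqrrN [Q ^+ 2 + P ^+ 2]addrC.
by field; rewrite !gt_eqF.
Qed.

Lemma lnd_deriv (A B C D P Q : R -> R) (a b c d p q : R) :
  is_derive (0 : R) 1 A a -> is_derive (0 : R) 1 B b ->
  is_derive (0 : R) 1 C c -> is_derive (0 : R) 1 D d ->
  is_derive (0 : R) 1 P p -> is_derive (0 : R) 1 Q q ->
  0 < A 0 ^+ 2 + B 0 ^+ 2 ->
  is_derive (0 : R) 1 (fun t => lnd (A t) (B t) (C t) (D t) (P t) (Q t))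
   (lnd' (A 0) (B 0) (C 0) (D 0) (P 0) (Q 0) a b c d p q).
Proof.
move=> dA dB dC dD dP dQ Npos.
have Mpos : 0 < 1 + (P 0 ^+ 2 + Q 0 ^+ 2) by rewrite ltr_pwDl// addr_ge0// sqr_ge0.
have N := rdV (f := fun t => A t ^+ 2 + B t ^+ 2) (lt0r_neq0 Npos) (rdD (sqr_deriv dA) (sqr_deriv dB)).
have M := rdV (f := fun t => 1 + (P t ^+ 2 + Q t ^+ 2)) (lt0r_neq0 Mpos)
  (rdD (rd_cst 0 1) (rdD (sqr_deriv dP) (sqr_deriv dQ))).
have X := rdB (rdM (rdD (rdM dC dA) (rdM dD dB)) N)
  (rdM (rd_cst 0 2) (rdM (rdD (rdM dA dP) (rdM dB dQ)) M)).
apply: rd_eq X; rewrite /lnd'.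
move: (A 0) (B 0) (C 0) (D 0) (P 0) (Q 0) Npos Mpos => A0 B0 C0 D0 P0 Q0 Npos Mpos.
by field; rewrite !gt_eqF.
Qed.

Lemma spherE f : spher f = (fun z => 4 * (Re (derive1 f z) ^+ 2 + Im (derive1 f z) ^+ 2) /
  (1 + (Re (f z) ^+ 2 + Im (f z) ^+ 2)) ^+ 2).
Proof. by apply/funext => z; rewrite /spher !sqr_cabs. Qed.

Lemma derive1_norm_gt0 f z : derive1 f z != 0 ->
  0 < Re (derive1 f z) ^+ 2 + Im (derive1 f z) ^+ 2.
Proof. by move=> d0; rewrite -sqr_cabs exprn_gt0// cabs_gt0. Qed.

Lemma ln_spher_dx f z : derive1 f z != 0 -> holomorphic_at f z ->
  is_dx (fun z => ln (spher f z) / 2) z (lnspher_x f z).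
Proof.
move=> d0 hf; have d1 := hol_at hf; have d2 := hol_at (holomorphic_derive1 hf).
rewrite spherE.
have e : z + 0%:C = z by rewrite addr0.
have := ln_density_deriv (is_dx_Re d2) (is_dx_Im d2) (is_dx_Re d1) (is_dx_Im d1).
rewrite e => /(_ (derive1_norm_gt0 d0)); apply: rd_eq.
rewrite /lnspher_x /lnd.
by congr (_ - 2 * (_ / _)); congr (_ + _); exact: mulrC.
Qed.

Lemma ln_spher_dy f z : derive1 f z != 0 -> holomorphic_at f z ->
  is_dy (fun z => ln (spher f z) / 2) z (lnspher_y f z).
Proof.
move=> d0 hf; have d1 := hol_at hf; have d2 := hol_at (holomorphic_derive1 hf).
rewrite spherE.
have e : z + 0%:C * 'i = z by rewrite mul0r addr0.
have := ln_density_deriv (is_dy_Re d2) (is_dy_Im d2) (is_dy_Re d1) (is_dy_Im d1).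
rewrite e => /(_ (derive1_norm_gt0 d0)); apply: rd_eq.
rewrite /lnspher_y /lnd.
move: (derive1 f z) (derive1 (derive1 f) z) (f z) => [A B] [C D] [P Q] /=.
by congr (_ - 2 * (_ / (_ + _))); ring.
Qed.

Lemma spher_curvature f z : derive1 f z != 0 -> holomorphic_at f z ->
  gauss_curvature (spher f) z = 1.
Proof.
move=> d0 hf; have hf1 := holomorphic_derive1 hf; have hf2 := holomorphic_derive1 hf1.
have nd0 : \forall w \near z, derive1 f w != 0 by exact: neq0_near (hol_cont hf1) d0.
have nhf := hol_near hf.
have ex : \forall w \near z, lnspher_x f w = dx (fun z => ln (spher f z) / 2) w.
  by apply: filterS2 nd0 nhf => w a b; apply/esym/dxE/ln_spher_dx.
have ey : \forall w \near z, lnspher_y f w = dy (fun z => ln (spher f z) / 2) w.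
  by apply: filterS2 nd0 nhf => w a b; apply/esym/dyE/ln_spher_dy.
have d1 := hol_at hf; have d2 := hol_at hf1; have d3 := hol_at hf2.
have zx : z + 0%:C = z by rewrite addr0.
have zy : z + 0%:C * 'i = z by rewrite mul0r addr0.
have X := lnd_deriv (is_dx_Re d2) (is_dx_Im d2) (is_dx_Re d3) (is_dx_Im d3)
  (is_dx_Re d1) (is_dx_Im d1).
rewrite zx in X.
have Y := lnd_deriv (is_dy_Re d2) (is_dy_Im d2) (rdN (is_dy_Im d3)) (is_dy_Re d3)
  (is_dy_Im d1) (rdN (is_dy_Re d1)).
rewrite zy in Y.
have X' := dxE (is_dx_near ex (X (derive1_norm_gt0 d0))).
have Y' := dyE (is_dy_near ey (Y (derive1_norm_gt0 d0))).
have Npos := derive1_norm_gt0 d0.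
have Mpos : 0 < 1 + (Re (f z) ^+ 2 + Im (f z) ^+ 2) by rewrite -sqr_cabs sphere_den_gt0.
rewrite /gauss_curvature X' Y' spherE.
exact: curvature_identity Npos Mpos.
Qed.

End SphericalDensity.

(** * Rigidity of the spherical density *)

Section Rigidity.
Variable R : realType.
Local Notation Co := (R[i]^o).
Implicit Types (f g h : Co -> Co) (z : Co).

Lemma cabs_conj (a : R[i]) : cabs a^* = cabs a.
Proof. by case: a => x y; rewrite !cabsE /= sqrrN. Qed.

Lemma mul_conj (a : R[i]) : a * a^* = (cabs a ^+ 2)%:C.
Proof. by apply: complex_eq; rewrite sqr_cabs; case: a => x y /=; ring. Qed.

Lemma re_dot_le (a b : R[i]) : Re a * Re b + Im a * Im b <= cabs a * cabs b.
Proof.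
rewrite -(cabs_conj a) -cabsM; apply: le_trans (le_trans (ler_norm _) (Re_le _)).
by case: a => x y; case: b => u v; rewrite /= mulNr opprK.
Qed.

(** Along the rays from z0 the energy |h|^2 + |h'|^2 satisfies e' <= k e and
    vanishes at the start. *)
Lemma gronwall_vanishing h h1 h2 (z0 : Co) (K r : R) : 0 < r -> 0 <= K ->
  (forall z, cabs (z - z0) < r -> is_derive z 1 h (h1 z)) ->
  (forall z, cabs (z - z0) < r -> is_derive z 1 h1 (h2 z)) ->
  (forall z, cabs (z - z0) < r -> cabs (h2 z) <= K * (cabs (h z) + cabs (h1 z))) ->
  h z0 = 0 -> h1 z0 = 0 ->
  \forall z \near z0, h z = 0.
Proof.
move=> r0 K0 dh dh' hK h0 h'0; apply/nearC; exists (Num.min r 1).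
  by rewrite lt_min r0 ltr01.
move=> z; rewrite lt_min => /andP[zr z1].
pose c (t : R) : Co := z0 + t%:C * (z - z0).
have cr (t : R) : 0 <= t <= 1 -> cabs (c t - z0) < r.
  by move=> t01; apply: segment_disc => //; rewrite subrr cabs0.
have zeta1 : cabs (z - z0) <= 1 by exact: ltW.
pose e (t : R) := cabs (h (c t)) ^+ 2 + cabs (h1 (c t)) ^+ 2.
pose k := 1 + 3 * K.
pose e' (t : R) := 2 * (Re (h (c t)) * Re (h1 (c t) * (z - z0))
    + Im (h (c t)) * Im (h1 (c t) * (z - z0)))
  + 2 * (Re (h1 (c t)) * Re (h2 (c t) * (z - z0))
    + Im (h1 (c t)) * Im (h2 (c t) * (z - z0))).
have de (t : R) : 0 <= t <= 1 -> is_derive t 1 e (e' t).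
  move=> t01; have := cv_comp (dh _ (cr t t01)) (cv_line z0 (z - z0) t).
  have := cv_comp (dh' _ (cr t t01)) (cv_line z0 (z - z0) t).
  move=> [A B] [P Q].
  have S := rdD (rdD (rdM P P) (rdM Q Q)) (rdD (rdM A A) (rdM B B)).
  apply: (rd_ext _ (rd_eq _ S)); first by move=> s; rewrite /e !sqr_cabs -!expr2.
  rewrite /e' -/(c t); move: (h (c t)) (h1 (c t)) (h1 (c t) * _) (h2 (c t) * _).
  by move=> [P0 Q0] [A0 B0] [p q] [a b] /=; ring.
have e'k (t : R) : 0 <= t <= 1 -> e' t <= k * e t.
  move=> t01; have := hK _ (cr t t01); rewrite /e' /e /k.
  have := re_dot_le (h (c t)) (h1 (c t) * (z - z0)).
  have := re_dot_le (h1 (c t)) (h2 (c t) * (z - z0)).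
  rewrite (cabsM _ (z - z0)) (cabsM _ (z - z0)).
  have := cabs_ge0 (h (c t)); have := cabs_ge0 (h1 (c t)).
  have := cabs_ge0 (h2 (c t)); have := cabs_ge0 (z - z0).
  set u := Re _ * _ + _; set v := Re _ * _ + _.
  move: (cabs (h (c t))) (cabs (h1 (c t))) (cabs (h2 (c t))) (cabs (z - z0)) zeta1 => x w y s s1 s0 y0 w0 x0 hv hu hy.
  have a1 : w * (y * s) <= w * (K * (x + w)).
    by apply: ler_wpM2l => //; rewrite (le_trans _ hy)// ler_piMr.
  have a2 : x * (w * s) <= x * w by apply: ler_wpM2l => //; rewrite ler_piMr.
  have a3 : 2 * (x * w) <= x ^+ 2 + w ^+ 2.
    by have := sqr_ge0 (x - w); rewrite sqrrB; lra.
  have a4 : K * (2 * (x * w)) <= K * (x ^+ 2 + w ^+ 2) by apply: ler_wpM2l.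
  have a5 : 0 <= K * x ^+ 2 by rewrite mulr_ge0// sqr_ge0.
  have a6 : w * (K * (x + w)) = K * (x * w) + K * w ^+ 2 by ring.
  rewrite mulrDr in a4; have -> : (1 + 3 * K) * (x ^+ 2 + w ^+ 2) =
    x ^+ 2 + w ^+ 2 + 3 * (K * x ^+ 2) + 3 * (K * w ^+ 2) by ring.
  lra.
have dE (t : R) : 0 <= t <= 1 -> is_derive t 1 (fun t => e t * expR (- k * t)) ((e' t - k * e t) * expR (- k * t)).
  move=> t01.
  have d1 := rdM (rd_cst t (- k)) (rd_id t).
  apply: rd_eq (rdM (de t t01) (rd_comp (is_derive_expR _) d1)).
  by ring.
have [t tI||t tI] := @MVT_segment R (fun t => e t * expR (- k * t))
   (fun t => (e' t - k * e t) * expR (- k * t)) 0 1 ler01.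
- by apply: dE; rewrite !ltW ?(itvP tI).
- by apply: derivable_within_continuous => t tI; have [] := dE t tI.
have -> : e 0 = 0 by rewrite /e /c rmorph0 mul0r addr0 h0 h'0 cabs0 expr0n addr0.
rewrite mul0r !subr0 mulr1 => E1.
have : e 1 * expR (- k * 1) <= 0.
  rewrite E1 pmulr_lle0 ?expR_gt0// subr_le0; apply: e'k.
  by rewrite ?(itvP tI).
rewrite pmulr_lle0 ?expR_gt0// /e /c rmorph1 mul1r addrC [z0 + _]addrC subrK => e10.
have := sqr_ge0 (cabs (h1 z)) => b0; have := sqr_ge0 (cabs (h z)) => a0.
apply/eqP; rewrite -cabs_eq0 -sqrf_eq0; apply/eqP; lra.
Qed.

(** Half the logarithmic density, phi = ln (2 |f'| / (1 + |f|^2)), satisfies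
    phi_x - i phi_y = f'' / f' - 2 f' conj(f) / (1 + |f|^2). Solved for f'', this
    is a second order differential equation for f with coefficients depending
    only on the density. *)
Lemma lnd_complex (F F1 F2 : R[i]) : F1 != 0 ->
  F2 = F1 * ((lnd (Re F1) (Im F1) (Re F2) (Im F2) (Re F) (Im F)
      +i* (- lnd (Re F1) (Im F1) (- Im F2) (Re F2) (Im F) (- Re F)))
    + (2 / (1 + cabs F ^+ 2))%:C * (F1 * F^*)).
Proof.
move=> d0; have Npos : 0 < Re F1 ^+ 2 + Im F1 ^+ 2 by rewrite -sqr_cabs exprn_gt0// cabs_gt0.
have Mpos : 0 < 1 + (Re F ^+ 2 + Im F ^+ 2) by rewrite -sqr_cabs sphere_den_gt0.
rewrite sqr_cabs; case: F F1 F2 {d0} Npos Mpos => [P Q] [A B] [C D] /= Npos Mpos.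
rewrite /lnd sqrrN [Q ^+ 2 + P ^+ 2]addrC.
by apply: complex_eq => /=; field; rewrite !gt_eqF.
Qed.

Lemma derive1_twice f z : derive1 f z != 0 ->
  derive1 (derive1 f) z = derive1 f z * ((lnspher_x f z +i* (- lnspher_y f z))
    + (2 / (1 + cabs (f z) ^+ 2))%:C * (derive1 f z * (f z)^*)).
Proof. exact: lnd_complex. Qed.

Lemma near_bounded (f : Co -> Co) (z0 : Co) : {for z0, continuous f} ->
  \forall z \near z0, cabs (f z) <= cabs (f z0) + 1.
Proof.
move=> /contC/(_ 1 ltr01)[d d0 Hd]; apply/nearC; exists d => // z /Hd h.
by have := cabs_sub (f z) (f z0); lra.
Qed.

Lemma cont_bounded_near f (z0 : Co) : {for z0, continuous f} ->
  exists2 M, 0 <= M & \forall z \near z0, cabs (f z) <= M.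
Proof.
by move=> /near_bounded h; exists (cabs (f z0) + 1) => //; rewrite addr_ge0// cabs_ge0.
Qed.

(** The nonlinear term of the differential equation is Lipschitz in (f, f') on
    bounded sets. *)
Lemma dot_lipschitz (p q p' q' : R[i]) (b : R) : 0 <= b ->
  cabs p <= b -> cabs q <= b -> cabs p' <= b -> cabs q' <= b ->
  cabs (q * (2 / (1 + cabs p ^+ 2))%:C * (q * p^*) -
        q' * (2 / (1 + cabs p' ^+ 2))%:C * (q' * p'^*)) <=
  (4 * b ^+ 2) * cabs (q - q') + (2 * b ^+ 2 * (1 + 2 * b ^+ 2)) * cabs (p - p').
Proof.
move=> b0 pb qb p'b q'b; set M := 1 + cabs p ^+ 2; set M' := 1 + cabs p' ^+ 2.
have M1 : 1 <= M by rewrite lerDl sqr_ge0.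
have M1' : 1 <= M' by rewrite lerDl sqr_ge0.
have Mp : 0 < M by lra.
have Mp' : 0 < M' by lra.
have Mi : M^-1 <= 1 by rewrite invf_le1.
have Mi' : M'^-1 <= 1 by rewrite invf_le1.
have Mi0 : 0 <= M^-1 by rewrite invr_ge0 ltW.
have Mi0' : 0 <= M'^-1 by rewrite invr_ge0 ltW.
have -> : q * (2 / M)%:C * (q * p^*) - q' * (2 / M')%:C * (q' * p'^*) =
  2%:C * (M^-1%:C * (q - q') * (q + q') * p^*
    + q' ^+ 2 * (M^-1%:C * (p - p')^* + p'^* * (M^-1 - M'^-1)%:C)).
  rewrite !rmorphM !rmorphB /=; ring.
have MM : `|M^-1 - M'^-1| <= 2 * b * cabs (p - p').
  have -> : M^-1 - M'^-1 = (cabs p' - cabs p) * (cabs p' + cabs p) * (M^-1 * M'^-1).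
    have gen (x y : R) : (1 + x ^+ 2)^-1 - (1 + y ^+ 2)^-1 =
        (y - x) * (y + x) * ((1 + x ^+ 2)^-1 * (1 + y ^+ 2)^-1).
      have x0 := sqr_ge0 x; have y0 := sqr_ge0 y.
      by field; rewrite !gt_eqF//; lra.
    exact: gen.
  rewrite normrM (ger0_norm (mulr_ge0 Mi0 Mi0')) normrM.
  have h1 : `|cabs p' - cabs p| <= cabs (p - p').
    by rewrite ler_norml; have := cabs_sub p p'; have := cabs_sub p' p; rewrite (cabs_distC p'); lra.
  have h2 : `|cabs p' + cabs p| <= 2 * b.
    by rewrite ger0_norm ?addr_ge0 ?cabs_ge0//; lra.
  rewrite -[leRHS]mulr1; apply: ler_pM; rewrite ?mulr_ge0//.
    by rewrite [leRHS]mulrC; exact: ler_pM.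
  by rewrite -[leRHS]mulr1; apply: ler_pM.
have q2 : cabs (q' ^+ 2) <= b ^+ 2 by rewrite cabsX; apply: lerXn2r; rewrite ?nnegrE ?cabs_ge0.
rewrite cabsM cabsR ger0_norm//.
have t1 : cabs (M^-1%:C * (q - q') * (q + q') * p^*) <= 2 * b ^+ 2 * cabs (q - q').
  rewrite !cabsM cabs_conj cabsR (ger0_norm Mi0).
  have h1 : cabs (q + q') <= 2 * b by rewrite (le_trans (cabsD _ _))//; lra.
  have -> : 2 * b ^+ 2 * cabs (q - q') = 1 * cabs (q - q') * (2 * b) * b by ring.
  do 3! [apply: ler_pM; rewrite ?mulr_ge0 ?cabs_ge0//].
have t2 : cabs (q' ^+ 2 * (M^-1%:C * (p - p')^* + p'^* * (M^-1 - M'^-1)%:C)) <=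
   b ^+ 2 * (1 + 2 * b ^+ 2) * cabs (p - p').
  rewrite cabsM -mulrA; apply: ler_pM; rewrite ?cabs_ge0//.
  rewrite (le_trans (cabsD _ _))// !cabsM !cabs_conj !cabsR (ger0_norm Mi0) mulrDl mul1r lerD//.
    by rewrite -[leRHS]mul1r ler_wpM2r ?cabs_ge0.
  have -> : 2 * b ^+ 2 * cabs (p - p') = b * (2 * b * cabs (p - p')) by ring.
  by apply: ler_pM; rewrite ?cabs_ge0.
have := cabsD (M^-1%:C * (q - q') * (q + q') * p^*)
  (q' ^+ 2 * (M^-1%:C * (p - p')^* + p'^* * (M^-1 - M'^-1)%:C)).
set X := cabs (_ + _); lra.
Qed.

Lemma second_difference_bound (W p q p' q' : R[i]) (b : R) : 0 <= b ->
  cabs p <= b -> cabs p' <= b -> cabs q <= b -> cabs q' <= b ->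
  cabs (W + (2 / (1 + cabs p ^+ 2))%:C * (q * p^*)) <= b ->
  cabs (q * (W + (2 / (1 + cabs p ^+ 2))%:C * (q * p^*)) -
        q' * (W + (2 / (1 + cabs p' ^+ 2))%:C * (q' * p'^*))) <=
  (b + 2 * b ^+ 2 + (4 * b ^+ 2 + 2 * b ^+ 2 * (1 + 2 * b ^+ 2))) *
    (cabs (p - p') + cabs (q - q')).
Proof.
move=> b0 h1 h2 h3 h4 h5; have b2pos : 0 <= b ^+ 2 by exact: sqr_ge0.
have -> : q * (W + (2 / (1 + cabs p ^+ 2))%:C * (q * p^*)) -
    q' * (W + (2 / (1 + cabs p' ^+ 2))%:C * (q' * p'^*)) =
    (q - q') * W + (q * (2 / (1 + cabs p ^+ 2))%:C * (q * p^*) -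
    q' * (2 / (1 + cabs p' ^+ 2))%:C * (q' * p'^*)).
  move: (_%:C) => u; move: (_%:C) => v; ring.
have Wb : cabs W <= b + 2 * b ^+ 2.
  have := cabs_sub W (- ((2 / (1 + cabs p ^+ 2))%:C * (q * p^*))).
  rewrite opprK cabsN.
  have : cabs ((2 / (1 + cabs p ^+ 2))%:C * (q * p^*)) <= 2 * b ^+ 2.
    rewrite !cabsM cabs_conj cabsR expr2; apply: ler_pM; rewrite ?mulr_ge0 ?cabs_ge0//.
      rewrite ger0_norm; last by rewrite divr_ge0// ltW// sphere_den_gt0.
      by rewrite ler_pdivrMr ?sphere_den_gt0// ler_peMr// lerDl sqr_ge0.
    by apply: ler_pM; rewrite ?cabs_ge0.
  lra.
have L := dot_lipschitz b0 h1 h3 h2 h4.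
rewrite (le_trans (cabsD _ _))// (le_trans (lerD (lexx _) L))// cabsM.
have a1 : cabs (q - q') * cabs W <= cabs (q - q') * (b + 2 * b ^+ 2).
  by apply: ler_wpM2l; rewrite ?cabs_ge0.
have q0 := cabs_ge0 (q - q'); have p0 := cabs_ge0 (p - p').
move: (cabs (p - p')) (cabs (q - q')) (cabs W) p0 q0 a1 {Wb h1 h2 h3 h4 h5 L} => x y w p0 q0 a1.
have -> : (b + 2 * b ^+ 2 + (4 * b ^+ 2 + 2 * b ^+ 2 * (1 + 2 * b ^+ 2))) * (x + y) =
   y * (b + 2 * b ^+ 2) + 4 * b ^+ 2 * y + 2 * b ^+ 2 * (1 + 2 * b ^+ 2) * x
   + ((b + 2 * b ^+ 2) * x + 4 * b ^+ 2 * x + 2 * b ^+ 2 * (1 + 2 * b ^+ 2) * y) by ring.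
have : 0 <= (b + 2 * b ^+ 2) * x + 4 * b ^+ 2 * x + 2 * b ^+ 2 * (1 + 2 * b ^+ 2) * y.
  by rewrite !addr_ge0 ?mulr_ge0 ?addr_ge0 ?mulr_ge0.
lra.
Qed.

Lemma second_difference_bound_eq (F F1 F2 G G1 G2 H H1 H2 : R[i]) (x y x' y' b : R) :
  F1 != 0 -> x = x' -> y = y' ->
  F2 = F1 * ((x +i* (- y)) + (2 / (1 + cabs F ^+ 2))%:C * (F1 * F^*)) ->
  G2 = G1 * ((x' +i* (- y')) + (2 / (1 + cabs G ^+ 2))%:C * (G1 * G^*)) ->
  H = F - G -> H1 = F1 - G1 -> H2 = F2 - G2 -> 0 <= b ->
  cabs F <= b -> cabs G <= b -> cabs F1 <= b -> cabs G1 <= b -> cabs (F2 / F1) <= b ->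
  cabs H2 <= (b + 2 * b ^+ 2 + (4 * b ^+ 2 + 2 * b ^+ 2 * (1 + 2 * b ^+ 2))) *
    (cabs H + cabs H1).
Proof.
move=> F10 <- <- eF eG -> -> -> b0 h1 h2 h3 h4 h5.
have e4 : F2 / F1 = (x +i* (- y)) + (2 / (1 + cabs F ^+ 2))%:C * (F1 * F^*).
  by rewrite eF mulrAC divff// mul1r.
rewrite e4 in h5; rewrite eF eG.
exact: second_difference_bound b0 h1 h2 h3 h4 h5.
Qed.

(** f and g solve the same second order equation f'' = f' (W + N (f, f')), W being
    determined by the density, with the same initial values at z0. *)
Lemma rigidity_normalized f g (z0 : Co) : holomorphic_at f z0 -> holomorphic_at g z0 ->
  derive1 f z0 != 0 -> (\forall z \near z0, spher f z = spher g z) ->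
  f z0 = g z0 -> derive1 f z0 = derive1 g z0 -> \forall z \near z0, f z = g z.
Proof.
move=> hf hg f'0 sfg fg0 fg'0.
have hf1 := holomorphic_derive1 hf; have hg1 := holomorphic_derive1 hg.
have hf2 := holomorphic_derive1 hf1; have hg2 := holomorphic_derive1 hg1.
have g'0 : derive1 g z0 != 0 by rewrite -fg'0.
have nf' := neq0_near (hol_cont hf1) f'0; have ng' := neq0_near (hol_cont hg1) g'0.
have nsp : \forall z \near z0, \forall w \near z, spher f w = spher g w by exact: near_join.
have lnE : \forall z \near z0, lnspher_x f z = lnspher_x g z /\ lnspher_y f z = lnspher_y g z.
  have n2 : \forall z \near z0, holomorphic_at f z /\ holomorphic_at g z.
    exact: filterI (hol_near hf) (hol_near hg).
  have n3 : \forall z \near z0, derive1 f z != 0 /\ derive1 g z != 0.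
    exact: filterI nf' ng'.
  apply: filterS3 n2 n3 nsp => z [hfz hgz] [f'z g'z] sp.
  have sp' : \forall w \near z, ln (spher f w) / 2 = ln (spher g w) / 2.
    by apply: filterS sp => w ->.
  split.
    apply: (rd_unique (is_dx_near sp' (ln_spher_dx f'z hfz))).
    exact: ln_spher_dx.
  apply: (rd_unique (is_dy_near sp' (ln_spher_dy f'z hfz))).
  exact: ln_spher_dy.
have [b1 b10 B1] := cont_bounded_near (hol_cont hf).
have [b2 b20 B2] := cont_bounded_near (hol_cont hg).
have [b3 b30 B3] := cont_bounded_near (hol_cont hf1).
have [b4 b40 B4] := cont_bounded_near (hol_cont hg1).
have [b5 b50 B5] := cont_bounded_near (hol_cont (holM hf2 (holV f'0 hf1))).
pose b := b1 + b2 + b3 + b4 + b5.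
have b0 : 0 <= b by rewrite /b; lra.
have [s1 s2 s3 s4] : [/\ b1 <= b, b2 <= b, b3 <= b & b4 <= b] by rewrite /b; split; lra.
have s5 : b5 <= b by rewrite /b; lra.
have bounds : \forall z \near z0, [/\ cabs (f z) <= b, cabs (g z) <= b,
    cabs (derive1 f z) <= b, cabs (derive1 g z) <= b &
    cabs (derive1 (derive1 f) z / derive1 f z) <= b].
  have B12 : \forall z \near z0, cabs (f z) <= b1 /\ cabs (g z) <= b2 by exact: filterI B1 B2.
  have B34 : \forall z \near z0, cabs (derive1 f z) <= b3 /\ cabs (derive1 g z) <= b4 by exact: filterI B3 B4.
  apply: filterS3 B12 B34 B5 => z [h1 h2] [h3 h4] h5.
  by split; [exact: le_trans h1 s1|exact: le_trans h2 s2|exact: le_trans h3 s3|exact: le_trans h4 s4|exact: le_trans h5 s5].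
pose K := b + 2 * b ^+ 2 + (4 * b ^+ 2 + 2 * b ^+ 2 * (1 + 2 * b ^+ 2)).
have b2pos : 0 <= b ^+ 2 by exact: sqr_ge0.
have K0 : 0 <= K.
  move: b2pos b0; rewrite /K; clear; move: b => b b2pos b0.
  by apply: addr_ge0; [lra|apply: addr_ge0; [lra|apply: mulr_ge0; lra]].
pose h z := f z - g z.
have hh1 : \forall z \near z0, derive1 h z = derive1 f z - derive1 g z.
  by apply: filterS2 hf hg => z /cdP a /cdP c; exact: cd_derive1 (cdB a c).
have hh2 : \forall z \near z0, derive1 (derive1 h) z = derive1 (derive1 f) z - derive1 (derive1 g) z.
  have hh1' : \forall z \near z0, \forall w \near z, derive1 h w = derive1 f w - derive1 g w by exact: near_join.
  apply: filterS3 hf1 hg1 hh1' => z /cdP a /cdP c e.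
  have E := @near_derive1 R (derive1 h) (fun w => derive1 f w - derive1 g w) z e.
  exact: etrans E (cd_derive1 (cdB a c)).
have main : \forall z \near z0, cabs (derive1 (derive1 h) z) <= K * (cabs (h z) + cabs (derive1 h z)).
  have n3 : \forall z \near z0, derive1 f z != 0 /\ derive1 g z != 0 by exact: filterI nf' ng'.
  have n4 : \forall z \near z0, derive1 h z = derive1 f z - derive1 g z /\
      derive1 (derive1 h) z = derive1 (derive1 f) z - derive1 (derive1 g) z by exact: filterI hh1 hh2.
  have n5 : \forall z \near z0, (lnspher_x f z = lnspher_x g z /\ lnspher_y f z = lnspher_y g z) /\
      derive1 f z != 0 /\ derive1 g z != 0 by exact: filterI lnE n3.
  apply: filterS3 n4 n5 bounds => z [e1 e2] [[ex ey] [f'z g'z]] [h1 h2 h3 h4 h5].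
  exact: (second_difference_bound_eq f'z ex ey (derive1_twice f'z) (derive1_twice g'z)
    erefl e1 e2 b0 h1 h2 h3 h4 h5).
have hh := holB hf hg.
have n6 : \forall z \near z0, derivable h z 1 /\ derivable (derive1 h) z 1.
  exact: filterI hh (holomorphic_derive1 hh).
have [r r0 Hr] := (nearC _ _).1 (filterI n6 main).
have : \forall z \near z0, h z = 0.
  apply: (@gronwall_vanishing h _ _ z0 K r r0 K0).
  - by move=> z /Hr[[a _] _]; exact: cdP a.
  - by move=> z /Hr[[_ a] _]; exact: cdP a.
  - by move=> z /Hr[].
  - by rewrite /h fg0 subrr.
  - by rewrite (nbhs_singleton hh1) fg'0 subrr.
by apply: filterS => z /subr0_eq.
Qed.

End Rigidity.

Section RigidityMobius.
Variable R : realType.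
Local Notation Co := (R[i]^o).
Implicit Types (f g h : Co -> Co) (z : Co).

Lemma rotation_den (a : R[i]) : 1 + a^* * a != 0.
Proof.
rewrite mulrC mul_conj -[1]/(1%:C : R[i]) -rmorphD -cabs_eq0 cabsR normr_eq0.
by rewrite gt_eqF// sphere_den_gt0.
Qed.

Lemma rotation_norm (a b : R[i]) :
  cabs (1 + a^* * b) ^+ 2 + cabs (b - a) ^+ 2 = (1 + cabs a ^+ 2) * (1 + cabs b ^+ 2).
Proof. by rewrite !sqr_cabs; case: a => x y; case: b => u v /=; ring. Qed.

(** The rotation of the sphere that takes a to 0. *)
Definition rot (a w : R[i]) : R[i] := (w - a) / (1 + a^* * w).

Lemma cd_rot (a : R[i]) f z (d : Co) : is_derive z 1 f d -> 1 + a^* * f z != 0 ->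
  is_derive z 1 (fun z => rot a (f z) : Co) (d * (1 + a^* * a) / (1 + a^* * f z) ^+ 2).
Proof.
move=> df u0.
have du := cdD (cd_cst z 1) (cdZ a^* df).
have := cdM (cdB df (cd_cst z a)) (@cdV _ (fun z => 1 + a^* * f z) z _ u0 du).
apply: cd_eq; move: (f z) u0 => w u0.
by field.
Qed.

Lemma spher_rot a f z : derivable f z 1 -> 1 + a^* * f z != 0 ->
  spher (fun z => rot a (f z)) z = spher f z.
Proof.
move=> /cdP df u0; rewrite /spher (cd_derive1 (cd_rot df u0)).
move: (derive1 f z) => d; rewrite /rot.
rewrite !cabs_div cabsX cabsM.
have := rotation_norm a (f z).
have -> : cabs (1 + a^* * a) = 1 + cabs a ^+ 2.
  rewrite mulrC mul_conj -[1]/(1%:C : R[i]) -rmorphD cabsR ger0_norm//.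
  by rewrite ltW// sphere_den_gt0.
have U0 : 0 < cabs (1 + a^* * f z) by rewrite cabs_gt0.
have m0 := sphere_den_gt0 a; have k0 := sphere_den_gt0 (f z).
move: (cabs (1 + a^* * f z)) (cabs (f z - a)) (cabs d) U0 => u n e U0.
move: (1 + cabs a ^+ 2) (1 + cabs (f z) ^+ 2) m0 k0 => m k m0 k0 E.
have -> : 1 + (n / u) ^+ 2 = m * k / u ^+ 2 by rewrite -E; field; rewrite gt_eqF.
by field; rewrite !gt_eqF.
Qed.

Lemma unit_ratio (p q u v : R[i]) : p = 0 -> q = 0 -> u != 0 ->
  4 * cabs u ^+ 2 / (1 + cabs p ^+ 2) ^+ 2 = 4 * cabs v ^+ 2 / (1 + cabs q ^+ 2) ^+ 2 ->
  cabs (v / u) = 1.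
Proof.
move=> -> -> u0; rewrite cabs0 expr0n addr0 expr1n !divr1 => E.
have E3 : cabs v = cabs u.
  by apply/eqP; rewrite -(@eqrXn2 _ 2) ?cabs_ge0//; apply/eqP; lra.
by rewrite cabs_div E3 divff// cabs_eq0.
Qed.

(** Rotations of the sphere move f z0 and g z0 to 0 without changing the density;
    a further rotation about 0 adjusts the derivatives at z0. *)
Lemma rigidity f g (z0 : Co) : holomorphic_at f z0 -> holomorphic_at g z0 ->
  derive1 f z0 != 0 -> derive1 g z0 != 0 ->
  (\forall z \near z0, spher f z = spher g z) ->
  exists a b c d : R[i], a * d - b * c != 0 /\
    \forall z \near z0, c * f z + d != 0 /\ g z = (a * f z + b) / (c * f z + d).
Proof.
move=> hf hg f'0 g'0 sfg.
pose a := f z0; pose b := g z0.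
pose F (z : Co) : Co := rot a (f z); pose G (z : Co) : Co := rot b (g z).
have hu (k : Co -> Co) (x : R[i]) : holomorphic_at k z0 -> holomorphic_at (fun z => 1 + x^* * k z) z0.
  move=> hk; exact: (@holD _ (fun=> 1) (fun z => x^* * k z) z0 (hol_cst _ _)
    (@holM _ (fun=> x^*) k z0 (hol_cst _ _) hk)).
have uf0 : 1 + a^* * f z0 != 0 by exact: rotation_den.
have ug0 : 1 + b^* * g z0 != 0 by exact: rotation_den.
have nuf := neq0_near (hol_cont (hu f a hf)) uf0.
have nug := neq0_near (hol_cont (hu g b hg)) ug0.
have hF : holomorphic_at F z0.
  exact: (@holM _ (fun z => f z - a) (fun z => (1 + a^* * f z)^-1) z0
    (@holB _ f (fun=> a) z0 hf (hol_cst _ _)) (@holV _ (fun z => 1 + a^* * f z) z0 uf0 (hu f a hf))).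
have hG : holomorphic_at G z0.
  exact: (@holM _ (fun z => g z - b) (fun z => (1 + b^* * g z)^-1) z0
    (@holB _ g (fun=> b) z0 hg (hol_cst _ _)) (@holV _ (fun z => 1 + b^* * g z) z0 ug0 (hu g b hg))).
have F0 : F z0 = 0 by rewrite /F /rot subrr mul0r.
have G0 : G z0 = 0 by rewrite /G /rot subrr mul0r.
have F'0 : derive1 F z0 != 0.
  rewrite (cd_derive1 (cd_rot (hol_at hf) uf0)).
  exact: (mulf_neq0 (mulf_neq0 f'0 (rotation_den a)) (invr_neq0 (expf_neq0 2 uf0))).
have sF : \forall z \near z0, spher F z = spher f z.
  by apply: filterS2 hf nuf => z df u0; exact: spher_rot.
have sG : \forall z \near z0, spher G z = spher g z.
  by apply: filterS2 hg nug => z dg u0; exact: spher_rot.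
have sFG : \forall z \near z0, spher F z = spher G z.
  by apply: filterS3 sF sG sfg => z -> ->.
pose l := derive1 G z0 / derive1 F z0.
have l1 : cabs l = 1 := unit_ratio F0 G0 F'0 (nbhs_singleton sFG).
have l0 : l != 0 by rewrite -cabs_eq0 l1 oner_eq0.
have hlF : holomorphic_at (fun z => l * F z) z0 by exact: (@holM _ (fun=> l) F z0 (hol_cst _ _) hF).
have dlF := cdZ l (hol_at hF).
have FG : \forall z \near z0, l * F z = G z.
  apply: (@rigidity_normalized _ (fun z => l * F z) G z0 hlF hG).
  - by rewrite (cd_derive1 dlF); exact: mulf_neq0 l0 F'0.
  - by apply: filterS2 hF sFG => z dF <-; exact: spher_mul.
  - by rewrite F0 G0 mulr0.
  - by rewrite (cd_derive1 dlF); exact: (divfK F'0 (derive1 G z0)).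
clearbody l; exists (l + b * a^*), (b - l * a), (a^* - b^* * l), (1 + b^* * l * a); split.
  have -> : (l + b * a^*) * (1 + b^* * l * a) - (b - l * a) * (a^* - b^* * l) =
     l * (1 + a^* * a) * (1 + b^* * b) by ring.
  by rewrite !mulf_neq0// rotation_den.
apply: filterS3 FG nuf nug => z; rewrite /F /G /rot.
move: (f z) (g z) (rotation_den b) => u v rb E u0 v0.
have E1 : 1 - b^* * ((v - b) / (1 + b^* * v)) = (1 + b^* * b) / (1 + b^* * v) by field.
have E2 : (a^* - b^* * l) * u + (1 + b^* * l * a) =
    (1 + a^* * u) * (1 - b^* * ((v - b) / (1 + b^* * v))) by rewrite -E; field.
have E3 : (l + b * a^*) * u + (b - l * a) =
    (1 + a^* * u) * ((v - b) / (1 + b^* * v) + b) by rewrite -E; field.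
have E4 : (v - b) / (1 + b^* * v) + b = v * ((1 + b^* * b) / (1 + b^* * v)) by field.
have E5 : (1 + b^* * b) / (1 + b^* * v) != 0 by rewrite mulf_neq0// invr_eq0.
rewrite E2 E3 E1 E4; split; first by rewrite mulf_neq0.
by field; rewrite rb v0 u0.
Qed.

End RigidityMobius.

(** * Zeros, poles and local primitives of a meromorphic form *)

Section FormLocal.
Variables (R : realType) (S : riemannSurface R) (w : meromorphicForm S).
Local Notation Co := (R[i]^o).
Implicit Types (i j : chart S) (x y p q : S).

Lemma form_zero i j x : dom i x -> dom j x -> w i x = 0 -> w j x = 0.
Proof. by move=> ix jx e; rewrite (form_compat w jx ix) e mul0r. Qed.

(** Because a form has the value 0 at its poles, only the vanishing of the order
    can be read off at the point itself. *)
Lemma has_order_at i p (n : int) : has_order (w i) i p n -> (w i p == 0) = (n != 0).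
Proof.
move=> [h [_ h0 /nbhs_singleton ->]]; rewrite subrr.
have [->|n0] := eqVneq n 0; first by rewrite expr0z mul1r (negbTE h0).
by rewrite exp0rz (negbTE n0) mul0r eqxx.
Qed.

Lemma has_order_near i p (n : int) : dom i p -> has_order (w i) i p n ->
  \forall x \near p, x != p -> w i x != 0.
Proof.
move=> ip [h [hh h0 e]].
apply: filterS3 e (crd_near ip (neq0_near (hol_cont hh) h0)) (dom_near ip) => x -> hx ix xp.
rewrite mulf_neq0// expfz_neq0// subr_eq0; apply: contra_neq xp; exact: crd_inj.
Qed.

Lemma form_nonzero_regular x i (n : int) : dom i x -> w i x != 0 -> ord_form w x n -> n = 0.
Proof.
move=> ix wx [j [jx o]]; apply/eqP; apply: contraNT wx => n0.
by apply/eqP; apply: (form_zero jx ix); apply/eqP; rewrite (has_order_at o).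
Qed.

Hypothesis nonzero : forall i p, dom i p -> exists n, has_order (w i) i p n.

Lemma nonzero_near p : \forall x \near p, x != p -> forall i, dom i x -> w i x != 0.
Proof.
have [i ip] := dom_cover p; have [n o] := nonzero ip.
apply: filterS2 (has_order_near ip o) (dom_near ip) => x h ix xp j jx.
by apply: contra_neq (h xp); exact: form_zero.
Qed.

Lemma poles_isolated : isolated_set (poles w).
Proof.
move=> p; apply: filterS (nonzero_near p) => x h xp [n [n0 o]].
have [i ix] := dom_cover x.
by move: n0; rewrite (form_nonzero_regular ix (h xp i ix) o) ltxx.
Qed.

Lemma zeros_isolated : isolated_set (zeros w).
Proof.
move=> p; apply: filterS (nonzero_near p) => x h xp [n [n0 o]].
have [i ix] := dom_cover x.
by move: n0; rewrite (form_nonzero_regular ix (h xp i ix) o) ltxx.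
Qed.

Lemma regular_order i p : ~ poles w p -> dom i p -> exists n : nat, has_order (w i) i p n%:Z.
Proof.
move=> np ip; have [[n|n] o] := nonzero ip; first by exists n.
by exfalso; apply: np; exists (Negz n); split=> //; exists i.
Qed.

Lemma regular_holomorphic i p : ~ poles w p -> dom i p ->
  holomorphic_at (w i \o crd_inv i : Co -> Co) (crd i p).
Proof.
move=> np ip; have [n [h [hh _ e]]] := regular_order np ip.
have h1 := @holX _ (fun z : Co => z - crd i p) n (crd i p)
  (@holB _ (fun z => z) (fun=> crd i p) _ (hol_id _) (hol_cst _ _)).
have h2 := @holM _ (fun z : Co => (z - crd i p) ^+ n) h _ h1 hh.
apply: (@hol_ext _ _ _ _ _ h2).
apply: filterS2 (crd_inv_near ip e) (chart_image_near ip) => z /= -> [_ ->].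
by rewrite -exprnP.
Qed.

Lemma regular_near p : ~ poles w p -> \forall x \near p, ~ poles w x.
Proof.
move=> np; apply: filterS (poles_isolated p) => x h.
by have [->|] := eqVneq x p.
Qed.

Lemma zerosP i p : ~ poles w p -> dom i p -> zeros w p <-> w i p = 0.
Proof.
move=> np ip; split.
  move=> [n [n0 [j [jp o]]]]; apply: (form_zero jp ip); apply/eqP.
  by rewrite (has_order_at o) gt_eqF.
move=> /eqP wp; have [n o] := regular_order np ip.
exists n%:Z; split; last by exists i.
by rewrite lt_def (_ : _ != _) //; move: wp; rewrite (has_order_at o).
Qed.

Lemma hol_primitive_at (h : Co -> Co) (z0 : Co) : holomorphic_at h z0 ->
  exists F : Co -> Co, \forall z \near z0, is_derive (z : Co) 1 F (h z).
Proof.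
move=> /nearC[r r0 dh].
have inD (z : Co) : Re z0 - r / 3 <= Re z <= Re z0 + r / 3 ->
    Im z0 - r / 3 <= Im z <= Im z0 + r / 3 -> cabs (z - z0) < r.
  move=> h1 h2; rewrite (le_lt_trans (cabs_le _))// !ReImE.
  have : `|Re z - Re z0| <= r / 3 by rewrite ler_norml; lra.
  have : `|Im z - Im z0| <= r / 3 by rewrite ler_norml; lra.
  lra.
have [z zx zy|F HF] := @holomorphic_primitive R h (Re z0 - r / 3) (Re z0 + r / 3)
  (Im z0 - r / 3) (Im z0 + r / 3); first exact/dh/inD.
exists F; apply/nearC; exists (r / 3); first by rewrite divr_gt0.
move=> z zr; have := Re_le (z - z0); have := Im_le (z - z0); rewrite !ReImE !ler_norml => h1 h2.
by apply: HF; lra.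
Qed.

Lemma near_const (F : Co -> Co) (z0 : Co) : (\forall z \near z0, is_derive (z : Co) 1 F 0) ->
  \forall z \near z0, F z = F z0.
Proof.
move=> /nearC[r r0 HF]; apply/nearC; exists r => // z zr; apply/esym.
apply: cd_zero_segment => t t01; apply: HF; apply: segment_disc => //.
by rewrite subrr cabs0.
Qed.

Lemma local_primitive_chart i p (F : S -> R[i]) : dom i p ->
  (\forall x \near p, is_derive (crd i x : Co) 1 (F \o crd_inv i : Co -> Co) (w i x)) ->
  local_primitive w F p.
Proof.
move=> ip h; apply: filterS2 h (dom_near ip) => x dF ix j jx.
by rewrite (form_compat w jx ix); exact: cd_change.
Qed.

Lemma local_primitive_exists p : ~ poles w p -> exists F, local_primitive w F p.
Proof.
move=> np; have [i ip] := dom_cover p.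
have [F HF] := hol_primitive_at (regular_holomorphic np ip).
exists (F \o crd i); apply: (local_primitive_chart ip).
apply: filterS2 (crd_near ip HF) (dom_near ip) => x; rewrite /= => dF ix.
rewrite crdK// in dF; apply: cd_near dF.
by apply: filterS (chart_image_near ix) => z [_ /= ->].
Qed.

Lemma local_primitive_near F p : local_primitive w F p -> \forall x \near p, local_primitive w F x.
Proof. by move=> h; apply: near_join; exact: h. Qed.

Lemma local_primitive_add F p (c : R[i]) : local_primitive w F p ->
  local_primitive w (fun x => F x + c) p.
Proof.
apply: filterS => x dF i ix; apply: cd_eq (cdD (dF i ix) (cd_cst _ c)).
by rewrite addr0.
Qed.

Lemma local_primitive_diff F G p : local_primitive w F p -> local_primitive w G p ->
  \forall x \near p, F x = G x + (F p - G p).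
Proof.
move=> hF hG; have [i ip] := dom_cover p.
have : \forall z \near (crd i p : Co), (F (crd_inv i z) - G (crd_inv i z)) =
    (F (crd_inv i (crd i p)) - G (crd_inv i (crd i p))).
  apply: (@near_const (fun z => F (crd_inv i z) - G (crd_inv i z))).
  have h : \forall x \near p, is_derive (crd i x : Co) 1 (fun z : Co => F (crd_inv i z) - G (crd_inv i z) : Co) 0.
    apply: filterS3 hF hG (dom_near ip) => x dF dG ix.
    by apply: cd_eq (cdB (dF i ix) (dG i ix)); rewrite subrr.
  apply: filterS2 (crd_inv_near ip h) (chart_image_near ip) => z /= dz [_ e].
  by rewrite e in dz.
move=> /(crd_near ip) h; apply: filterS2 h (dom_near ip) => x + ix.
by rewrite !crdK// => <-; rewrite addrC subrK.
Qed.

Lemma local_primitive_uniq p F G : local_primitive w F p -> local_primitive w G p ->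
  \forall x \near p, germ_eq x F G -> germ_eq p F G.
Proof.
move=> hF hG; have d := local_primitive_diff hF hG.
apply: filterS (d) => x ex /nbhs_singleton exx.
have e0 : F p - G p = 0 by move: ex; rewrite exx => /eqP; rewrite -subr_eq0 opprD addrA subrr sub0r oppr_eq0 => /eqP.
by apply: filterS d => y ->; rewrite e0 addr0.
Qed.

Lemma local_primitive_eq_at p F G : local_primitive w F p -> local_primitive w G p ->
  F p = G p -> germ_eq p F G.
Proof.
move=> hF hG e; apply: filterS (local_primitive_diff hF hG) => x ->.
by rewrite e subrr addr0.
Qed.

End FormLocal.

Section FormNonzero.
Variables (R : realType) (S : riemannSurface R) (w : meromorphicForm S).

(** The points near which w vanishes identically form an open and closed set; by
    connectedness it is empty as soon as w has a pole. *)
Lemma form_has_order : poles w !=set0 ->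
  forall i p, dom i p -> exists n, has_order (w i) i p n.
Proof.
move=> [q0 [n0 [_ [i0 [i0q o0]]]]].
pose A := [set x : S | \forall y \near x, forall i, dom i y -> w i y = 0].
have oA : open A by rewrite openE => x Ax; exact: near_join.
have notA i p n : dom i p -> has_order (w i) i p n -> ~ A p.
  move=> ip o Ap; have h : nbhs p (fun y => (y != p -> w i y != 0) /\
      (forall i, dom i y -> w i y = 0) /\ dom i y).
    exact: filterI (has_order_near ip o) (filterI Ap (dom_near ip)).
  have [y [h1 [h2 iy]] yp] := chart_not_isolated h.
  by move: (h1 yp); rewrite (h2 i iy) eqxx.
have dich i p : dom i p -> A p \/ exists n, has_order (w i) i p n.
  move=> ip; have [h|] := form_meromorphic w ip; last by right.
  left; apply: filterS2 h (dom_near ip) => y e iy j jy; exact: form_zero iy jy e.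
have oAc : open (~` A).
  rewrite openE => x nAx; have [i ix] := dom_cover x.
  have [//|[n o]] := dich i x ix.
  apply: filterS2 (has_order_near ix o) (dom_near ix) => y h iy Ay.
  have [e|yx] := eqVneq y x; first by apply: nAx; rewrite -e.
  by move: (h yx); rewrite (nbhs_singleton Ay i iy) eqxx.
move=> i p ip; have [Ap|//] := dich i p ip.
have AT : A = [set: S].
  apply: surface_connected; first by exists p.
  - by exists A => //; rewrite setTI.
  - by exists A; [rewrite -[A]setCK; exact: open_closedC|rewrite setTI].
by exfalso; apply: (notA i0 q0 n0 i0q o0); rewrite AT.
Qed.

End FormNonzero.

(** * Germs of meromorphic functions *)

Section MeromorphicGerms.
Variables (R : realType) (S : riemannSurface R).
Local Notation Co := (R[i]^o).
Implicit Types (i j : chart S) (x y p q : S) (h k : S -> option R[i]) (u v : Co -> Co).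

Lemma sphere_invK : involutive (@sphere_inv R).
Proof.
case=> [a|] /=; last by rewrite eqxx.
by have [->|a0] := eqVneq a 0; rewrite //= invr_eq0 (negbTE a0) invrK.
Qed.

(** The two alternatives are the two standard charts of the sphere; the last
    clause excludes the constant infinity. *)
Definition germ_in i h p u : Prop := holomorphic_at u (crd i p) /\
  ((\forall x \near p, h x = Some (u (crd i x))) \/
   ((\forall x \near p, sphere_inv (h x) = Some (u (crd i x))) /\
    ~ (\forall x \near p, u (crd i x) = 0))).

Lemma germ_in_meromorphic i h p u : dom i p -> germ_in i h p u -> meromorphic_at h p.
Proof. by move=> ip [hu n]; exists i, u. Qed.

Lemma meromorphic_chart i h p : dom i p -> meromorphic_at h p -> exists u, germ_in i h p u.
Proof.
move=> ip [j [u [jp hu n]]]; exists (fun z => u (crd j (crd_inv i z))).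
have e : \forall x \near p, u (crd j (crd_inv i (crd i x))) = u (crd j x).
  by apply: filterS (dom_near ip) => x ix; rewrite crdK.
split.
  have ht : holomorphic_at (crd j \o crd_inv i : Co -> Co) (crd i p).
    exact: transition_holomorphic ip jp.
  have ec : (crd j \o crd_inv i) (crd i p) = crd j p by rewrite /= crdK.
  by rewrite -ec in hu; exact: (@hol_comp _ u (crd j \o crd_inv i) _ hu ht).
case: n => [n|[n nz]]; first by left; apply: filterS2 n e => x -> ->.
right; split; first by apply: filterS2 n e => x -> ->.
by apply: contra_not nz => z; apply: filterS2 z e => x <- ->.
Qed.

(** The identity theorem, read on the surface. *)
Lemma hol_vanish i p u : dom i p -> holomorphic_at u (crd i p) ->
  \forall x \near p, (\forall y \near x, u (crd i y) = 0) -> \forall y \near p, u (crd i y) = 0.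
Proof.
move=> ip hu; apply: filterS2 (crd_near ip (identity_theorem hu)) (dom_near ip) => x H ix ux.
apply: (@crd_near _ _ i p (fun z => u z = 0) ip); apply: H.
apply: filterS2 (crd_inv_near ix ux) (chart_image_near ix) => z.
by move=> uz [_ e]; rewrite e in uz.
Qed.

Lemma germ_eq_inv p h k : germ_eq p (@sphere_inv R \o h) (@sphere_inv R \o k) -> germ_eq p h k.
Proof. by apply: filterS => x /= /(can_inj sphere_invK). Qed.

Lemma holomorphic_uniq i p u v h k : dom i p -> holomorphic_at u (crd i p) ->
  holomorphic_at v (crd i p) -> (\forall x \near p, h x = Some (u (crd i x))) ->
  (\forall x \near p, k x = Some (v (crd i x))) ->
  \forall x \near p, germ_eq x h k -> germ_eq p h k.
Proof.
move=> ip hu hv eh ek; have hd := holB hu hv.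
have eh' := germ_eq_near eh; have ek' := germ_eq_near ek.
apply: filterS3 (hol_vanish ip hd) eh' ek' => x H hx kx e.
have d : \forall y \near p, u (crd i y) - v (crd i y) = 0.
  apply: H; apply: filterS3 hx kx e => y -> -> [->]; exact: subrr.
by apply: filterS3 eh ek d => y -> -> /subr0_eq ->.
Qed.

Lemma holomorphic_inv_uniq i p u v h k : dom i p -> holomorphic_at u (crd i p) ->
  holomorphic_at v (crd i p) -> (\forall x \near p, h x = Some (u (crd i x))) ->
  (\forall x \near p, sphere_inv (k x) = Some (v (crd i x))) ->
  \forall x \near p, germ_eq x h k -> germ_eq p h k.
Proof.
move=> ip hu hv eh ek.
have hd := @holB _ _ (fun=> 1) _ (holM hu hv) (hol_cst _ _).
have eh' := germ_eq_near eh; have ek' := germ_eq_near ek.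
apply: filterS3 (hol_vanish ip hd) eh' ek' => x H hx kx e.
have d : \forall y \near p, u (crd i y) * v (crd i y) - 1 = 0.
  apply: H; apply: filterS3 hx kx e => y ey ky hk.
  move: ky; rewrite -hk ey /=; case: eqP => // /eqP u0 [<-].
  by rewrite divff// subrr.
apply: filterS3 eh ek d => y -> ky /subr0_eq uv.
have v0 : v (crd i y) != 0.
  by apply: contra_eq_neq uv => ->; rewrite mulr0 eq_sym oner_eq0.
rewrite -[k y]sphere_invK ky /= (negbTE v0); congr Some.
by apply: (mulIf v0); rewrite uv mulVf.
Qed.

(** If h is finite at p and k is read in the chart at infinity, h k^-1 - 1
    vanishes identically; the other cases compare two holomorphic functions. *)
Lemma meromorphic_uniq p h k : meromorphic_at h p -> meromorphic_at k p ->
  \forall x \near p, germ_eq x h k -> germ_eq p h k.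
Proof.
have [i ip] := dom_cover p.
have S2 h' k' x : germ_eq x h' k' -> germ_eq x (@sphere_inv R \o h') (@sphere_inv R \o k').
  by apply: filterS => y /= ->.
move=> /(meromorphic_chart ip)[u [hu uh]] /(meromorphic_chart ip)[v [hv vk]].
case: uh vk => [uh|[uh _]] [vk|[vk _]].
- exact: holomorphic_uniq hu hv uh vk.
- exact: holomorphic_inv_uniq hu hv uh vk.
- have H := holomorphic_inv_uniq ip hv hu vk uh.
  by apply: filterS H => x H /germ_eq_sym /H /germ_eq_sym.
- have H := @holomorphic_uniq i p u v (@sphere_inv R \o h) (@sphere_inv R \o k) ip hu hv uh vk.
  by apply: filterS H => x H /S2/H/germ_eq_inv.
Qed.

Lemma meromorphic_near p h : meromorphic_at h p -> \forall x \near p, meromorphic_at h x.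
Proof.
move=> [i [u [ip hu n]]].
have hu' : \forall x \near p, holomorphic_at u (crd i x) by exact: crd_near ip (hol_near hu).
case: n => [n|[n nz]].
  apply: filterS3 (germ_eq_near n) hu' (dom_near ip) => x nx hx ix.
  by exists i, u; split=> //; left.
have nz' : \forall x \near p, ~ (\forall y \near x, u (crd i y) = 0).
  by apply: filterS (hol_vanish ip hu) => x H /H.
have n' := @germ_eq_near _ _ _ _ (@sphere_inv R \o h) _ n.
have hn : \forall x \near p, dom i x /\ holomorphic_at u (crd i x).
  exact: filterI (dom_near ip) hu'.
apply: filterS3 n' nz' hn => x nx zx [ix hx].
by exists i, u; split=> //; right.
Qed.

Lemma meromorphic_ext p h k : germ_eq p h k -> meromorphic_at h p -> meromorphic_at k p.
Proof.
move=> e [i [u [ip hu n]]]; exists i, u; split=> //.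
case: n => [n|[n nz]]; first by left; apply: filterS2 e n => x ->.
by right; split=> //; apply: filterS2 e n => x ->.
Qed.

Definition scale (a : R[i]) h : S -> option R[i] := fun x => omap (fun z => a * z) (h x).

Lemma germ_in_scale i (a : R[i]) h p u : a != 0 -> germ_in i h p u ->
  germ_in i (scale a h) p (fun z => a * u z) \/ germ_in i (scale a h) p (fun z => a^-1 * u z).
Proof.
move=> a0 [hu [n|[n nz]]]; [left|right].
  split; first exact: (@holM _ (fun=> a) u _ (hol_cst _ _) hu).
  by left; apply: filterS n => x; rewrite /scale => ->.
split; first exact: (@holM _ (fun=> a^-1) u _ (hol_cst _ _) hu).
right; split.
  apply: filterS n => x; rewrite /scale; case: (h x) => [b|] /=; last by move=> [<-]; rewrite mulr0.
  by rewrite mulf_eq0 (negbTE a0) /=; case: eqP => // /eqP b0 [<-]; rewrite invfM mulrC.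
apply: contra_not nz; apply: filterS => x /eqP.
by rewrite mulf_eq0 invr_eq0 (negbTE a0) => /eqP.
Qed.

Lemma meromorphic_scale (a : R[i]) p h : a != 0 -> meromorphic_at h p ->
  meromorphic_at (scale a h) p.
Proof.
move=> a0; have [i ip] := dom_cover p => /(meromorphic_chart ip)[u /(germ_in_scale a0)].
by case=> /(germ_in_meromorphic ip).
Qed.

Lemma mobius_sphere_inv (a b c d : R[i]) (w : option R[i]) :
  mobius a b c d (sphere_inv w) = mobius b a d c w.
Proof.
case: w => [z|] /=; last by rewrite !mulr0 !add0r.
have [->|z0] := eqVneq z 0; first by rewrite /= !mulr0 !add0r.
have e (s t : R[i]) : s * z^-1 + t = (t * z + s) / z by rewrite mulrDl mulfK// addrC.
rewrite /= !e mulf_eq0 invr_eq0 (negbTE z0) orbF; case: eqP => // _.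
by rewrite invf_div mulrA mulfVK.
Qed.

Lemma sphere_inv_mobius (a b c d : R[i]) (w : option R[i]) : a * d - b * c != 0 ->
  sphere_inv (mobius a b c d w) = mobius c d a b w.
Proof.
move=> det; case: w => [z|] /=; last first.
  have [c0|c0] := eqVneq c 0.
    have a0 : a != 0 by apply: contra_neq det => ->; rewrite c0 mulr0 mul0r subr0.
    by rewrite /= (negbTE a0) c0 mul0r.
  rewrite /= mulf_eq0 invr_eq0 (negbTE c0) orbF; case: eqP => // _.
  by rewrite invf_div.
have [e|e] := eqVneq (c * z + d) 0.
  have f : a * z + b != 0.
    apply: contra_neq det => f.
    have [c0|c0] := eqVneq c 0.
      by move: e; rewrite c0 mul0r add0r => ->; rewrite !mulr0 subr0.
    have : a * (c * z + d) - c * (a * z + b) = 0 by rewrite e f !mulr0 subr0.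
    by move=> <-; ring.
  by rewrite (negbTE f) e mul0r.
rewrite /= mulf_eq0 invr_eq0 (negbTE e) orbF; case: eqP => // _.
by rewrite invf_div.
Qed.

Definition injective_near (T : Type) p (h : S -> T) := exists2 V, nbhs p V &
  forall x y, V x -> V y -> h x = h y -> x = y.

(** Injectivity excludes that c u + d vanishes identically, in which case the
    composite would be the constant infinity. *)
Lemma meromorphic_mobius_finite i (a b c d : R[i]) p u : dom i p -> holomorphic_at u (crd i p) ->
  a * d - b * c != 0 -> injective_near p (u \o crd i : S -> R[i]) ->
  meromorphic_at (fun x => mobius a b c d (Some (u (crd i x)))) p.
Proof.
move=> ip hu det [V nV inj].
have lin s t : holomorphic_at (fun z => s * u z + t) (crd i p).
  exact: (@holD _ _ (fun=> t) _ (@holM _ (fun=> s) u _ (hol_cst _ _) hu) (hol_cst _ _)).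
have quo s t s' t' : s' * u (crd i p) + t' != 0 ->
    holomorphic_at (fun z => (s * u z + t) / (s' * u z + t')) (crd i p).
  move=> n; have hv := @holV _ (fun z => s' * u z + t') (crd i p) n (lin s' t').
  exact: (@holM _ (fun z => s * u z + t) _ _ (lin s t) hv).
have nz s t : s * u (crd i p) + t != 0 -> \forall x \near p, s * u (crd i x) + t != 0.
  move=> n; apply: (@crd_near _ _ i p (fun z => s * u z + t != 0) ip).
  exact: (@neq0_near _ (fun z => s * u z + t) _ (hol_cont (lin s t)) n).
have [e|e] := eqVneq (c * u (crd i p) + d) 0; last first.
  exists i, (fun z => (a * u z + b) / (c * u z + d)); split; [exact: ip|exact: (quo a b c d e)|].
  by left; apply: filterS (nz _ _ e) => x /negbTE /= ->.
have f : a * u (crd i p) + b != 0.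
  have := sphere_inv_mobius (Some (u (crd i p))) det.
  rewrite /= e eqxx /=; case: eqP => //.
exists i, (fun z => (c * u z + d) / (a * u z + b)); split; [exact: ip|exact: (quo c d a b f)|].
right; split.
  by apply: filterS (nz _ _ f) => x /negbTE nx; rewrite sphere_inv_mobius//= nx.
move=> z; have n : \forall x \near p, (c * u (crd i x) + d) / (a * u (crd i x) + b) = 0 /\
    a * u (crd i x) + b != 0 /\ V x by exact: filterI z (filterI (nz _ _ f) nV).
have [x [/eqP + [nx Vx]] xp] := chart_not_isolated n.
rewrite mulf_eq0 invr_eq0 (negbTE nx) orbF => /eqP ex.
have c0 : c != 0.
  apply: contra_neq det => c0; move: e; rewrite c0 mul0r add0r => ->.
  by rewrite !mulr0 subr0.
move: xp; apply/negP; rewrite negbK; apply/eqP/inj => //; first exact: nbhs_singleton.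
by apply: (mulfI c0); apply: (addIr d); rewrite /= ex e.
Qed.

Lemma meromorphic_mobius (a b c d : R[i]) p h : a * d - b * c != 0 ->
  injective_near p h -> meromorphic_at h p -> meromorphic_at (mobius a b c d \o h) p.
Proof.
move=> det [V nV inj] [i [u [ip hu n]]].
have key k : (\forall x \near p, k x = Some (u (crd i x))) ->
    (forall x y, V x -> V y -> k x = k y -> x = y) ->
    injective_near p (u \o crd i : S -> R[i]).
  move=> ek inj'; exists (fun x => V x /\ k x = Some (u (crd i x))); first exact: filterI.
  move=> x y [Vx ex] [Vy ey] /= e; apply: inj' => //; first by rewrite ex ey e.
case: n => [n|[n _]].
  have := meromorphic_mobius_finite ip hu det (key _ n inj).
  by apply: meromorphic_ext; apply: filterS n => x /= ->.
have inj' x y : V x -> V y -> sphere_inv (h x) = sphere_inv (h y) -> x = y.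
  by move=> Vx Vy /(can_inj sphere_invK); exact: inj.
have det' : b * c - a * d != 0 by rewrite -opprB oppr_eq0.
have := meromorphic_mobius_finite ip hu det' (key (@sphere_inv R \o h) n inj').
apply: meromorphic_ext; apply: filterS n => x /= e.
by rewrite -[h x]sphere_invK e mobius_sphere_inv.
Qed.

Lemma continuation_unique X gamma p q h k k' : path_in X gamma p q ->
  continuation gamma h k -> continuation gamma h k' -> germ_eq q k k'.
Proof.
move=> P [H [cH H0 H1]] [K [cK K0 K1]].
case: (P) => _ g0 g1 _; rewrite g0 g1 in H0 H1 K0 K1.
have e0 : germ_eq p (H 0) (K 0) by apply: filterS2 H0 K0 => x -> ->.
have := continues_unique meromorphic_uniq P cH cK e0 (t := 1).
rewrite g1 ler01 lexx => /(_ isT) e.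
by apply: filterS3 H1 K1 e => x <- <-.
Qed.

Lemma continuation_unique_continues X gamma p q H k : path_in X gamma p q ->
  continues (fun x k => meromorphic_at k x) gamma H -> continuation gamma (H 0) k -> germ_eq q k (H 1).
Proof.
move=> P cH ck; apply: continuation_unique P ck _; exists H; split=> //; exact: germ_eq_refl.
Qed.

End MeromorphicGerms.

(** * The germs exp (int w) *)

Section Potential.
Variables (R : realType) (S : riemannSurface R) (w : meromorphicForm S) (U : S -> R).
Local Notation Co := (R[i]^o).
Local Notation Pl := (poles w).
Implicit Types (i j : chart S) (x y p q b : S) (h k : S -> option R[i]) (X Z : set S)
  (F G v : S -> R[i]) (gamma : R -> S).

(** A horizontal and then a vertical segment lead from z0 to z inside the
    disc. *)
Lemma zero_gradient_const (psi : Co -> R) (z0 : Co) (r : R) :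
  (forall z, cabs (z - z0) < r -> is_dx psi z 0 /\ is_dy psi z 0) ->
  forall z, cabs (z - z0) < r -> psi z = psi z0.
Proof.
move=> H z zr; set a := Re (z - z0); set b := Im (z - z0).
have inD (s t : R) : 0 <= s <= 1 -> 0 <= t <= 1 ->
    cabs (z0 + (s * a)%:C + (t * b)%:C * 'i - z0) < r.
  move=> s01 t01; apply: le_lt_trans zr.
  rewrite -ler_sqr ?nnegrE ?cabs_ge0// !sqr_cabs -/a -/b !ReImE /=.
  have e1 : Re z0 + s * a + (t * b * 0 - 0 * 1) - Re z0 = s * a by ring.
  have e2 : Im z0 + 0 + (t * b * 1 + 0 * 0) - Im z0 = t * b by ring.
  rewrite e1 e2 !exprMn lerD// ler_piMl ?sqr_ge0// expr_le1//; lra.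
have e1 : psi (z0 + (0 * a)%:C) = psi (z0 + (1 * a)%:C).
  apply: (@rd_cst_itv R (fun s => psi (z0 + (s * a)%:C)) 0 1) => // s s01.
  have [|dx _] := H (z0 + (s * a)%:C).
    by have := inD s 0 s01; rewrite mul0r mul0r addr0; apply; rewrite lexx ler01.
  have d : is_derive (s * a) (1 : R) (fun u : R => psi (z0 + u%:C)) 0.
    apply: rd_ext (@rd_shift R (fun u => psi (z0 + (s * a)%:C + u%:C)) (- (s * a)) 0 (s * a) _).
      by move=> u; congr psi; rewrite -addrA -rmorphD /=; congr (_ + _%:C); ring.
    by rewrite subrr.
  have da : is_derive s (1 : R) (fun s => s * a) (1 * a + s * 0) := rdM (rd_id s) (rd_cst s a).
  by have h := @rd_comp R (fun u => psi (z0 + u%:C)) (fun s => s * a) s _ _ d da; rewrite mul0r in h; exact: h.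
have e2 : psi (z0 + (1 * a)%:C + (0 * b)%:C * 'i) = psi (z0 + (1 * a)%:C + (1 * b)%:C * 'i).
  apply: (@rd_cst_itv R (fun s => psi (z0 + (1 * a)%:C + (s * b)%:C * 'i)) 0 1) => // s s01.
  have [|_ dy] := H (z0 + (1 * a)%:C + (s * b)%:C * 'i).
    by apply: inD => //; rewrite lexx ler01.
  have d : is_derive (s * b) (1 : R) (fun u : R => psi (z0 + (1 * a)%:C + u%:C * 'i)) 0.
    apply: rd_ext (@rd_shift R (fun u => psi (z0 + (1 * a)%:C + (s * b)%:C * 'i + u%:C * 'i)) (- (s * b)) 0 (s * b) _).
      move=> u; congr psi; rewrite -[in LHS]addrA -mulrDl -rmorphD /=.
      by congr (_ + _%:C * _); ring.
    by rewrite subrr.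
  have db : is_derive s (1 : R) (fun s => s * b) (1 * b + s * 0) := rdM (rd_id s) (rd_cst s b).
  by have h := @rd_comp R (fun u => psi (z0 + (1 * a)%:C + u%:C * 'i)) (fun s => s * b) s _ _ d db; rewrite mul0r in h; exact: h.
move: e1 e2; rewrite !mul0r !mul1r !addr0 => -> ->; congr psi.
by apply: complex_eq; rewrite !ReImE /=; rewrite /a /b !ReImE; ring.
Qed.

Hypothesis nonzero : forall i p, dom i p -> exists n, has_order (w i) i p n.
Hypothesis U_exact : forall x i, ~ Pl x -> dom i x ->
  is_dx (U \o crd_inv i) (crd i x) (Re (w i x)) /\
  is_dy (U \o crd_inv i) (crd i x) (- Im (w i x)).

(** Both Re F and U have the differential Re w. *)
Lemma potential_diff F p : ~ Pl p -> local_primitive w F p ->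
  \forall x \near p, Re (F x) - U x = Re (F p) - U p.
Proof.
move=> np hF; have [i ip] := dom_cover p.
have nn : \forall x \near p, ~ Pl x /\ forall i, dom i x ->
    is_derive (crd i x : Co) 1 (F \o crd_inv i : Co -> Co) (w i x).
  exact: filterI (regular_near nonzero np) hF.
have [r r0 Hr] := chart_disc ip nn.
have Hpsi := @zero_gradient_const (fun z => Re (F (crd_inv i z)) - U (crd_inv i z)) (crd i p) r.
apply: filterS (disc_nbhs ip r0) => x [ix xr].
have := Hpsi _ _ xr; rewrite !crdK//; apply => z zr.
have [iz ez [nz dF]] := Hr z zr.
have dz := dF i iz; rewrite ez in dz.
have [ux uy] := U_exact nz iz; rewrite ez in ux uy.
split.
  by have h := rdB (is_dx_Re dz) ux; rewrite subrr in h; exact: h.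
by have h := rdB (is_dy_Re dz) uy; rewrite subrr in h; exact: h.
Qed.

(** Primitives normalised by the potential; they are determined up to an
    imaginary constant, so their exponentials have a single-valued modulus. *)
Definition normalized_primitive p F :=
  local_primitive w F p /\ \forall x \near p, Re (F x) = U x.
Local Notation NP := normalized_primitive.

Lemma normalized_primitiveP p F : ~ Pl p -> local_primitive w F p -> Re (F p) = U p -> NP p F.
Proof.
move=> np hF e; split=> //; apply: filterS (potential_diff np hF) => x.
by rewrite e subrr => /subr0_eq.
Qed.

Lemma normalized_primitive_exists p (a : R[i]) : ~ Pl p -> Re a = U p ->
  exists2 F, NP p F & F p = a.
Proof.
move=> np ea; have [F hF] := local_primitive_exists nonzero np.
exists (fun x => F x + (a - F p)); last by rewrite addrC subrK.
by apply: normalized_primitiveP (local_primitive_add _ hF) _ => //; rewrite addrC subrK.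
Qed.

Lemma normalized_primitive_near p F : NP p F -> \forall x \near p, NP x F.
Proof.
move=> [hF e]; have e' : \forall x \near p, \forall y \near x, Re (F y) = U y by exact: near_join.
by apply: filterS2 (local_primitive_near hF) e' => x; split.
Qed.

Lemma normalized_primitive_triv p : ~ Pl p -> exists2 V, nbhs p V &
  forall x F, V x -> ~ Pl x -> NP x F ->
    exists2 G, germ_eq x G F & forall y, V y -> ~ Pl y -> NP y G.
Proof.
move=> np; have [G hG _] := @normalized_primitive_exists p (U p)%:C np erefl.
exists (fun x => NP x G); first exact: normalized_primitive_near.
move=> x F [lx ux] nx [lF uF]; exists (fun y => G y + (F x - G x)).
  by apply: germ_eq_sym; exact: (local_primitive_diff lF lx).
move=> y [ly uy] ny; apply: normalized_primitiveP => //; first exact: (local_primitive_add _ ly).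
rewrite ReD (nbhs_singleton uy) ReD ReN (nbhs_singleton ux) (nbhs_singleton uF).
by rewrite subrr addr0.
Qed.

(** The germs exp F, described by their logarithmic derivative and their
    modulus, without reference to a logarithm. *)
Definition exp_germ p h := ~ Pl p /\ exists v,
  [/\ germ_eq p h (fun x => Some (v x)), (\forall x \near p, cabs (v x) = expR (U x))
    & \forall x \near p, forall i, dom i x ->
        is_derive (crd i x : Co) 1 (v \o crd_inv i : Co -> Co) (w i x * v x)].

Lemma exp_modulus_neq0 v x : cabs (v x) = expR (U x) -> v x != 0.
Proof. by move=> e; rewrite -cabs_eq0 e gt_eqF// expR_gt0. Qed.

Lemma exp_germ_exp p F : ~ Pl p -> NP p F -> exp_germ p (fun x => Some (cexp (F x))).
Proof.
move=> np [hF uF]; split=> //; exists (fun x => cexp (F x)); split.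
- exact: germ_eq_refl.
- by apply: filterS uF => x e; rewrite cabs_cexp e.
apply: filterS hF => x dF i ix.
have d := @cd_comp R (@cexp R) (F \o crd_inv i) (crd i x) _ _ (cd_cexp _) (dF i ix).
by apply: cd_eq d; rewrite /= crdK// mulrC.
Qed.

Lemma exp_germ_near p h : exp_germ p h -> \forall x \near p, exp_germ x h.
Proof.
move=> [np [v [e m d]]].
have m' : \forall x \near p, \forall y \near x, cabs (v y) = expR (U y) by exact: near_join.
have d' : \forall x \near p, \forall y \near x, forall i, dom i y ->
        is_derive (crd i y : Co) 1 (v \o crd_inv i : Co -> Co) (w i y * v y).
  by apply: near_join; exact: d.
have md : \forall x \near p, (\forall y \near x, cabs (v y) = expR (U y)) /\
   (\forall y \near x, forall i, dom i y ->
        is_derive (crd i y : Co) 1 (v \o crd_inv i : Co -> Co) (w i y * v y)).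
  exact: filterI m' d'.
apply: filterS3 (regular_near nonzero np) (germ_eq_near e) md => x nx ex [mx dx'].
by split=> //; exists v.
Qed.

Lemma exp_germ_ext p h k : germ_eq p h k -> exp_germ p h -> exp_germ p k.
Proof.
move=> e [np [v [ev m d]]]; split=> //; exists v; split=> //.
exact: germ_eq_trans (germ_eq_sym e) ev.
Qed.

Lemma quotient_deriv (a v1 v2 : R[i]) : v2 != 0 ->
  a * v1 * v2^-1 + v1 * (- (a * v2) / v2 ^+ 2) = 0.
Proof. by move=> v0; field. Qed.

(** The quotient of two such germs has logarithmic derivative zero and modulus
    one. *)
Lemma exp_germ_compare p h k : exp_germ p h -> exp_germ p k ->
  exists2 a, cabs a = 1 & germ_eq p h (scale a k).
Proof.
move=> [np [v1 [e1 m1 d1]]] [_ [v2 [e2 m2 d2]]]; have [i ip] := dom_cover p.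
have nz2 : \forall x \near p, v2 x != 0 by apply: filterS m2 => x; exact: exp_modulus_neq0.
pose q z := v1 (crd_inv i z) / v2 (crd_inv i z).
have dd : \forall x \near p, is_derive (crd i x : Co) 1 (q : Co -> Co) 0.
  have n : \forall x \near p, dom i x /\ v2 x != 0 by exact: filterI (dom_near ip) nz2.
  apply: filterS3 d1 d2 n => x dx1 dx2 [ix x0].
  have nx : (v2 \o crd_inv i) (crd i x) != 0 by rewrite /= crdK.
  have dV := @cdV R (v2 \o crd_inv i) (crd i x) _ nx (dx2 i ix).
  apply: cd_eq (@cdM R (v1 \o crd_inv i) (fun z => ((v2 \o crd_inv i) z)^-1) (crd i x) _ _ (dx1 i ix) dV).
  by rewrite /= crdK//; exact: quotient_deriv.
have dz : \forall z \near (crd i p : Co), is_derive (z : Co) 1 (q : Co -> Co) 0.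
  apply: filterS2 (crd_inv_near ip dd) (chart_image_near ip) => z /= dz [_ ez].
  by rewrite ez in dz.
have qc := @crd_near _ _ i p (fun z => q z = q (crd i p)) ip (near_const dz).
exists (v1 p / v2 p).
  rewrite cabs_div; rewrite (nbhs_singleton m1) (nbhs_singleton m2) divff// gt_eqF//; exact: expR_gt0.
have n : \forall x \near p, dom i x /\ v2 x != 0 by exact: filterI (dom_near ip) nz2.
have n' : \forall x \near p, h x = Some (v1 x) /\ k x = Some (v2 x) by exact: filterI e1 e2.
apply: filterS3 n n' qc => x [ix x0] [hx kx]; rewrite /q !crdK// => eq.
by rewrite /scale hx kx /= -eq divfK.
Qed.

Lemma exp_germ_scale (a : R[i]) p h : cabs a = 1 -> exp_germ p h -> exp_germ p (scale a h).
Proof.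
move=> a1 [np [v [e m d]]]; split=> //; exists (fun x => a * v x); split.
- by apply: filterS e => x; rewrite /scale => ->.
- by apply: filterS m => x <-; rewrite cabsM a1 mul1r.
apply: filterS d => x d i ix.
by apply: cd_eq (cdZ a (d i ix)); rewrite mulrCA.
Qed.

Lemma exp_germ_holomorphic i p h : dom i p -> exp_germ p h -> exists2 u : Co -> Co,
  holomorphic_at u (crd i p) /\ germ_eq p h (fun x => Some (u (crd i x))) &
  [/\ derive1 u (crd i p) = w i p * u (crd i p), u (crd i p) != 0
    & cabs (u (crd i p)) = expR (U p)].
Proof.
move=> ip [np [v [e m d]]]; exists (v \o crd_inv i).
  split.
    apply: filterS2 (crd_inv_near ip d) (chart_image_near ip) => z dz [iz ez].
    by have := dz i iz; rewrite ez => dz'; exact: (@ex_derive _ _ _ _ _ _ _ dz').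
  by apply: filterS2 e (dom_near ip) => x -> ix; rewrite /= crdK.
split; first by rewrite (cd_derive1 (nbhs_singleton d i ip)) /= crdK.
- by rewrite /= crdK//; exact: exp_modulus_neq0 (nbhs_singleton m).
- by rewrite /= crdK//; exact: nbhs_singleton m.
Qed.

Lemma exp_germ_meromorphic p h : exp_germ p h -> meromorphic_at h p.
Proof.
have [i ip] := dom_cover p => /(exp_germ_holomorphic ip)[u [hu e] _].
by apply: (germ_in_meromorphic ip); split; [exact: hu|left].
Qed.

End Potential.

Section DevelopingGerms.
Variables (R : realType) (S : riemannSurface R) (w : meromorphicForm S) (U : S -> R).
Local Notation Pl := (poles w).
Local Notation M := (fun x h => meromorphic_at h x).
Local Notation exp_germ := (exp_germ w U).
Implicit Types (i j : chart S) (x y p q b : S) (h k : S -> option R[i]) (X Z W : set S)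
  (F : S -> R[i]) (gamma : R -> S).
Hypothesis nonzero : forall i p, dom i p -> exists n, has_order (w i) i p n.
Hypothesis U_exact : forall x i, ~ Pl x -> dom i x ->
  is_dx (U \o crd_inv i) (crd i x) (Re (w i x)) /\
  is_dy (U \o crd_inv i) (crd i x) (- Im (w i x)).

(** The meromorphic germs that are exponentials of normalised primitives
    away from their base point; at a pole of w they are the possible
    extensions of exp (int w). *)
Definition dev_germ p h := meromorphic_at h p /\ \forall x \near p, x != p -> exp_germ x h.

Lemma exp_germ_dev p h : exp_germ p h -> dev_germ p h.
Proof.
move=> e; split; first exact: exp_germ_meromorphic e.
by apply: filterS (exp_germ_near nonzero e).
Qed.

Lemma dev_germ_near p h : dev_germ p h -> \forall x \near p, dev_germ x h.
Proof.
move=> d; have [_ e] := d; apply: filterS e => x e; have [->|xp] := eqVneq x p; first exact: d.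
by apply: exp_germ_dev; exact: e.
Qed.

Lemma dev_germ_ext p h k : germ_eq p h k -> dev_germ p h -> dev_germ p k.
Proof.
move=> e [m d]; split; first exact: meromorphic_ext e m.
apply: filterS2 (germ_eq_near e) d => x ex d xp; exact: exp_germ_ext ex (d xp).
Qed.

Lemma dev_germ_uniq p h k : dev_germ p h -> dev_germ p k ->
  \forall x \near p, germ_eq x h k -> germ_eq p h k.
Proof. by move=> [hm _] [km _]; exact: meromorphic_uniq. Qed.

Lemma unit_neq0 (a : R[i]) : cabs a = 1 -> a != 0.
Proof. by move=> a1; rewrite -cabs_eq0 a1 oner_eq0. Qed.

Lemma dev_germ_scale (a : R[i]) p h : cabs a = 1 -> dev_germ p h -> dev_germ p (scale a h).
Proof.
move=> a1 [m e]; split; first exact: meromorphic_scale (unit_neq0 a1) m.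
by apply: filterS e => x e xp; apply: exp_germ_scale a1 (e xp).
Qed.

(** Two sections over a punctured neighbourhood that agree at one point agree at
    the points of a smaller one, by continuation along paths. *)
Lemma punctured_continuation p W : nbhs p W -> exists2 V, nbhs p V & forall h k,
  (forall x, W x -> x != p -> meromorphic_at h x /\ meromorphic_at k x) ->
  forall y z, V y -> V z -> y != p -> z != p -> germ_eq y h k -> germ_eq z h k.
Proof.
move=> nW; have [V nV HV] := punctured_path_connected nW; exists V => // h k hk y z Vy Vz yp zp e.
have [g P] := HV y z Vy Vz yp zp; have [_ g0 g1 gW] := P.
have c (k' : S -> option R[i]) : (forall x, W x -> x != p -> meromorphic_at k' x) ->
    continues M g (fun=> k').
  move=> H t /gW[Wt /eqP tp]; split; first exact: H.
  by apply/near_within01; exists 1 => // s _ _; exact: germ_eq_refl.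
have ch : continues M g (fun=> h) by apply: c => x Wx xp; exact: (hk x Wx xp).1.
have ck : continues M g (fun=> k) by apply: c => x Wx xp; exact: (hk x Wx xp).2.
have := continues_unique (@meromorphic_uniq R S) P ch ck e (t := 1).
by rewrite g1 ler01 lexx; apply.
Qed.

(** The constant factor is the one found at a nearby point: it is the same at
    all of them, and the identity principle carries the equality to p. *)
Lemma dev_germ_compare p h k : dev_germ p h -> dev_germ p k ->
  exists2 a, cabs a = 1 & germ_eq p h (scale a k).
Proof.
move=> dh dk; have [hm he] := dh; have [km ke] := dk.
have n : \forall x \near p, (x != p -> exp_germ x h /\ exp_germ x k).
  by apply: filterS2 he ke => x a b xp; split; [exact: a|exact: b].
have [V nV HV] := punctured_continuation n.
have nn : nbhs p (fun x => V x /\ (x != p -> exp_germ x h /\ exp_germ x k)).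
  exact: filterI nV n.
have [y [Vy Ey] yp] := chart_not_isolated nn; have [hy ky] := Ey yp.
have [a a1 e] := exp_germ_compare hy ky; exists a => //.
have agree : \forall x \near p, x != p -> germ_eq x h (scale a k).
  apply: filterS nV => x Vx xp; apply: (HV h (scale a k)) e => // z Hz zp.
  have [hz kz] := Hz zp; split; first exact: exp_germ_meromorphic hz.
  by apply: meromorphic_scale (unit_neq0 a1) _; exact: exp_germ_meromorphic kz.
have u : \forall x \near p, (germ_eq x h (scale a k) -> germ_eq p h (scale a k)) /\
    (x != p -> germ_eq x h (scale a k)).
  exact: filterI (meromorphic_uniq hm (meromorphic_scale (unit_neq0 a1) km)) agree.
by have [x [H1 H2] xp] := chart_not_isolated u; exact/H1/H2.
Qed.

Lemma dev_germ_regular p h : ~ Pl p -> dev_germ p h -> exp_germ p h.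
Proof.
move=> np d; have [F hF _] := @normalized_primitive_exists R S w U nonzero U_exact p (U p)%:C np erefl.
have e := exp_germ_exp np hF.
have [a a1 E] := dev_germ_compare d (exp_germ_dev e).
exact: exp_germ_ext (germ_eq_sym E) (exp_germ_scale a1 e).
Qed.

Lemma dev_germ_triv X : (forall p, X p -> exists h, dev_germ p h) ->
  forall p, X p -> exists2 V, nbhs p V & forall x h, V x -> X x -> dev_germ x h ->
    exists2 k, germ_eq x k h & forall y, V y -> X y -> dev_germ y k.
Proof.
move=> HX p Xp; have [k dk] := HX p Xp.
exists (fun x => dev_germ x k); first exact: dev_germ_near.
move=> x h kx _ hx; have [a a1 e] := dev_germ_compare hx kx.
exists (scale a k); first exact: germ_eq_sym.
by move=> y ky _; exact: dev_germ_scale.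
Qed.

Lemma unit_circle_exp (a : R[i]) : cabs a = 1 -> exists t : R, a = cexp ((2 * t)%:C * 'i).
Proof.
move=> a1; have [z ez] := cexp_surj (unit_neq0 a1); exists (Im z / 2); rewrite -ez.
have /expR_inj z0 : expR (Re z) = expR 0 by rewrite -cabs_cexp ez expR0.
congr cexp.
by apply: complex_eq; rewrite !ReImE /= ?z0; field.
Qed.

Section OnDomain.
Variable X : set S.
Hypothesis X_dev : forall p, X p -> exists h, dev_germ p h.

Lemma dev_germ_continues gamma p q h : path_in X gamma p q -> dev_germ p h ->
  exists2 H, continues dev_germ gamma H & H 0 = h.
Proof. exact: (continues_exists (dev_germ_triv X_dev)). Qed.

Lemma continues_meromorphic gamma H : continues dev_germ gamma H -> continues M gamma H.
Proof. by move=> c t /c[[]]. Qed.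

Lemma continuation_dev gamma p q h k : path_in X gamma p q -> dev_germ p h ->
  continuation gamma h k -> dev_germ q k.
Proof.
move=> P d ck; have [H cH H0] := dev_germ_continues P d.
rewrite -H0 in ck; have e := continuation_unique_continues P (continues_meromorphic cH) ck.
apply: (dev_germ_ext (germ_eq_sym e)); have [_ _ g1 _] := P.
by rewrite -{1}g1; apply: (cH 1 _).1; rewrite ler01 lexx.
Qed.

(** The multi-valued function obtained by continuing the germ h at b along all
    paths in X. *)
Definition generated b h : multivalued S := fun q k =>
  exists gamma, path_in X gamma b q /\ continuation gamma h k.

Lemma generated_refl b h : X b -> meromorphic_at h b -> generated b h b h.
Proof.
move=> Xb m; exists (fun=> b); split; first exact: path_const.
exists (fun=> h); split; [|exact: germ_eq_refl|exact: germ_eq_refl].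
by move=> t _; split=> //; apply: filterE => s; exact: germ_eq_refl.
Qed.

Lemma generated_multivalued b h : X b -> dev_germ b h ->
  multivalued_meromorphic X (generated b h).
Proof.
move=> Xb d; exists b, h; split=> //; first exact: d.1.
move=> gamma q P; have [H cH H0] := dev_germ_continues P d.
exists (H 1); exists H; split; [|rewrite H0|]; try exact: germ_eq_refl.
by move=> t t01; have [[]] := cH t t01.
Qed.

Lemma generated_dev b h q k : dev_germ b h -> generated b h q k -> X q /\ dev_germ q k.
Proof.
move=> d [gamma [P c]]; split; last exact: continuation_dev P d c.
by have [_ _ <- Xg] := P; apply: Xg; rewrite ler01 lexx.
Qed.

(** Continuation around a loop leads from a germ exp (int w) to another one with
    the same modulus, hence to a rotation of it. *)
Lemma generated_monodromy b h : dev_germ b h -> monodromy_in X (@U1 R) (generated b h).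
Proof.
move=> d p h' gamma k /(generated_dev d)[Xp d'] P c.
have dk := continuation_dev P d' c.
have [a a1 e] := dev_germ_compare dk d'.
have [t et] := unit_circle_exp a1; rewrite et in e.
by exists (omap (fun w => cexp ((2 * t)%:C * 'i) * w)); first by exists t.
Qed.

(** Analytic continuation across isolated points: the section is proportional
    to a model germ near such a point, with a constant factor since a
    punctured neighbourhood is connected. *)
Lemma dev_section_extension Z (F : S -> option R[i]) : (forall p, X p -> nbhs p X) -> isolated_set Z ->
  (forall x, ~ Z x -> X x -> dev_germ x F) ->
  exists G, (forall x, ~ Z x -> germ_eq x G F) /\ forall x, X x -> dev_germ x G.
Proof.
move=> X_open iZ HF.
have local p : exists k, X p -> dev_germ p k /\ \forall x \near p, x != p -> F x = k x.
  have [Xp|nX] := pselect (X p); last by exists F.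
  have [k0 d0] := X_dev Xp.
  have nW : \forall x \near p, x != p -> dev_germ x F /\ dev_germ x k0.
    have h : \forall x \near p, X x /\ (x != p -> ~ Z x) by exact: filterI (X_open p Xp) (iZ p).
    apply: filterS2 h (dev_germ_near d0) => x [Xx nZ] dx xp; split=> //; exact: HF (nZ xp) Xx.
  have [V nV HV] := punctured_continuation nW.
  have nn : \forall x \near p, V x /\ (x != p -> dev_germ x F /\ dev_germ x k0) by exact: filterI nV nW.
  have [y [Vy Ey] yp] := chart_not_isolated nn; have [Fy ky] := Ey yp.
  have [a a1 e] := dev_germ_compare Fy ky.
  exists (scale a k0) => _; split; first exact: dev_germ_scale.
  apply: filterS nV => x Vx xp; apply: (@nbhs_singleton _ x (fun z => F z = scale a k0 z)).
  apply: (HV F (scale a k0) _ y x) => // z Hz zp; have [Fz kz] := Hz zp.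
  by split; [exact: Fz.1|exact: meromorphic_scale (unit_neq0 a1) kz.1].
have [K HK] := choice local.
have GF x : ~ Z x -> germ_eq x (fun x => if `[<Z x>] then K x x else F x) F.
  move=> nZ; apply: filterS (iZ x) => y h; case: asboolP => // Zy.
  by have [yx|/h//] := eqVneq y x; move: Zy; rewrite yx.
exists (fun x => if `[<Z x>] then K x x else F x); split=> // x Xx.
have [Zx|nZ] := pselect (Z x); last exact: dev_germ_ext (germ_eq_sym (GF x nZ)) (HF x nZ Xx).
have [d e] := HK x Xx; apply: dev_germ_ext d.
apply: filterS2 e (iZ x) => y e nZ; have [->|yx] := eqVneq y x; first by rewrite asboolT.
by rewrite asboolF ?e//; exact: nZ.
Qed.

End OnDomain.
End DevelopingGerms.

(** * Integrals along paths *)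

Section PathIntegrals.
Variables (R : realType) (S : riemannSurface R) (w : meromorphicForm S) (U : S -> R).
Local Notation Pl := (poles w).
Local Notation LP := (fun x F => local_primitive w F x).
Local Notation NP := (normalized_primitive w U).
Local Notation dev_germ := (dev_germ w U).
Implicit Types (i j : chart S) (x y p q b : S) (h k : S -> option R[i]) (X Z W : set S)
  (F : S -> R[i]) (gamma : R -> S).

Lemma in01_1 : 0 <= (1 : R) <= 1. Proof. by rewrite ler01 lexx. Qed.
Lemma in01_0 : 0 <= (0 : R) <= 1. Proof. by rewrite ler01 lexx. Qed.

(** A primitive along a path is the same as a continuation of germs of
    primitives, of which it records the values. *)
Lemma path_integralP X gamma p q (v : R[i]) : path_in X gamma p q ->
  path_integral w gamma v <->
  exists2 H, continues LP gamma H & v = H 1 q - H 0 p.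
Proof.
move=> P; have [_ g0 g1 _] := P; split.
  move=> [Phi [-> HPhi]].
  have [t|H HH] := @choice _ _ (fun t F => 0 <= t <= 1 -> local_primitive w F (gamma t) /\
    \forall s \near within `[0, 1] (nbhs t), Phi s = F (gamma s)).
    have [t01|n] := boolP (0 <= t <= 1); last by exists (fun=> 0).
    by have [F HF] := HPhi t t01; exists F.
  have at_ t : 0 <= t <= 1 -> Phi t = H t (gamma t).
    move=> t01; have [_ /near_within01[d d0 Hd]] := HH t t01.
    by apply: Hd => //; rewrite subrr normr0.
  exists H; last by rewrite -g0 -g1 (at_ 1 in01_1) (at_ 0 in01_0).
  move=> t t01; have [lt /near_within01[d1 d10 H1]] := HH t t01; split=> //.
  have [d2 d20 H2] := path_near P t01 (local_primitive_near lt).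
  apply/near_within01; exists (Num.min d1 d2); first by rewrite lt_min d10.
  move=> s s01; rewrite lt_min => /andP[s1 s2].
  apply: local_primitive_eq_at; [exact: (HH s s01).1|exact: H2|].
  by rewrite -at_// H1.
move=> [H cH ->]; exists (fun t => H t (gamma t)); rewrite g0 g1; split=> // t t01.
have [lt e] := cH t t01; exists (H t); split=> //.
by apply: filterS e => s /nbhs_singleton.
Qed.

Lemma continues_primitive_shift gamma H (a : R[i]) : continues LP gamma H ->
  continues LP gamma (fun t x => H t x + a).
Proof.
move=> c t t01; have [l e] := c t t01; split; first exact: local_primitive_add.
by apply: filterS e => s; apply: filterS => x ->.
Qed.

Lemma continues_primitive_unique X gamma p q H K : path_in X gamma p q ->
  continues LP gamma H -> continues LP gamma K ->
  germ_eq q (H 1) (fun x => K 1 x + (H 0 p - K 0 p)).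
Proof.
move=> P cH cK; have [_ g0 g1 _] := P.
have uniq p' F G : LP p' F -> LP p' G -> \forall x \near p', germ_eq x F G -> germ_eq p' F G.
  exact: local_primitive_uniq.
have e0 : germ_eq p (H 0) (fun x => K 0 x + (H 0 p - K 0 p)).
  have lH := (cH 0 in01_0).1; have lK := (cK 0 in01_0).1; rewrite g0 in lH lK.
  exact: local_primitive_diff lH lK.
have := continues_unique uniq P cH (continues_primitive_shift (H 0 p - K 0 p) cK) e0 in01_1.
by rewrite g1.
Qed.

Lemma path_integral_unique X gamma p q (a b : R[i]) : path_in X gamma p q ->
  path_integral w gamma a -> path_integral w gamma b -> a = b.
Proof.
move=> P /(path_integralP _ P)[H cH ->] /(path_integralP _ P)[K cK ->].
have /nbhs_singleton -> := continues_primitive_unique P cH cK.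
by rewrite -addrA; congr (_ + _); rewrite addrAC subrr sub0r.
Qed.

Hypothesis nonzero : forall i p, dom i p -> exists n, has_order (w i) i p n.
Hypothesis U_exact : forall x i, ~ Pl x -> dom i x ->
  is_dx (U \o crd_inv i) (crd i x) (Re (w i x)) /\
  is_dy (U \o crd_inv i) (crd i x) (- Im (w i x)).

Lemma normalized_continues gamma p q F : path_in (~` Pl) gamma p q -> NP p F ->
  exists2 H, continues NP gamma H & H 0 = F.
Proof. exact: (continues_exists (normalized_primitive_triv nonzero U_exact)). Qed.

Lemma continues_normalized_primitive gamma H : continues NP gamma H -> continues LP gamma H.
Proof. by move=> c t /c[[]]. Qed.

Lemma continues_exp gamma p q H : path_in (~` Pl) gamma p q -> continues NP gamma H ->
  continues dev_germ gamma (fun t x => Some (cexp (H t x))).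
Proof.
move=> [_ _ _ gX] c t t01; have [n e] := c t t01; split.
  by apply: (exp_germ_dev nonzero); apply: exp_germ_exp n; exact: gX.
by apply: filterS e => s; apply: filterS => x ->.
Qed.

Lemma continues_dev_unique X gamma p q H K : path_in X gamma p q ->
  continues dev_germ gamma H -> continues dev_germ gamma K -> germ_eq p (H 0) (K 0) ->
  germ_eq q (H 1) (K 1).
Proof.
move=> P cH cK e; have [_ _ g1 _] := P.
by have := continues_unique (@dev_germ_uniq _ _ w U) P cH cK e in01_1; rewrite g1.
Qed.

(** Exponentiation turns the continuation of primitives into analytic
    continuation, which is unique. *)
Lemma exp_integralP p0 (c : R[i]) F0 : ~ Pl p0 -> NP p0 F0 -> F0 p0 = c -> forall q k,
  exp_integral w p0 c q k <->
  generated (~` Pl) p0 (fun x => Some (cexp (F0 x))) q k.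
Proof.
move=> np n0 F0p q k; split.
  move=> [gamma [v [F [P /(path_integralP _ P)[K cK ev] lF eF ek]]]].
  have [H cH H0] := normalized_continues P n0.
  exists gamma; split=> //; exists (fun t x => Some (cexp (H t x))).
  have [_ g0 g1 _] := P; split.
  - by move=> t t01; have [[m _] e] := continues_exp P cH t01.
  - by rewrite H0; exact: germ_eq_refl.
  - have e := continues_primitive_unique P (continues_normalized_primitive cH) cK.
    have lH : LP q (H 1) by rewrite -{1}g1; exact: (cH 1 in01_1).1.1.
    have e1 : germ_eq q (H 1) F.
      apply: (local_primitive_eq_at lH lF); rewrite (nbhs_singleton e) eF ev H0 F0p.
      by rewrite addrCA; congr (_ + _); rewrite addrC addrA.
    by rewrite g1; apply: filterS2 e1 ek => x -> ->.
move=> [gamma [P ck]]; have [H cH H0] := normalized_continues P n0.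
have [_ g0 g1 _] := P; exists gamma, (H 1 q - H 0 p0), (H 1); split=> //.
- by apply/(path_integralP _ P); exists H => //; exact: continues_normalized_primitive.
- by rewrite -{1}g1; exact: (cH 1 in01_1).1.1.
- by rewrite H0 F0p addrC subrK.
apply: (continuation_unique_continues P (continues_meromorphic (continues_exp P cH))).
by rewrite H0.
Qed.

(** Let F be a primitive near p with exp F = G. Continued along a loop, exp F
    returns to G, so that F changes by an element of 2 pi i Z. *)
Lemma loops_of_section G : (forall x, ~ Pl x -> dev_germ x G) ->
  forall p gamma, path_in (~` Pl) gamma p p ->
    exists n : int, path_integral w gamma ((2 * pi * n%:~R)%:C * 'i).
Proof.
move=> HG p gamma P; have [_ g0 g1 gX] := P.
have np : ~ Pl p by rewrite -g0; apply: gX; exact: in01_0.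
have [_ [v [eG m _]]] := dev_germ_regular nonzero U_exact np (HG p np).
have v0 := exp_modulus_neq0 (nbhs_singleton m); have [a ea] := cexp_surj v0.
have Ra : Re a = U p by apply: expR_inj; rewrite -cabs_cexp ea (nbhs_singleton m).
have [F nF Fp] := normalized_primitive_exists nonzero U_exact np Ra.
have [H cH H0] := normalized_continues P nF; have ce := continues_exp P cH.
have cG : continues dev_germ gamma (fun=> G).
  move=> t t01; split; first by apply: HG; exact: gX.
  by apply: filterE => s; exact: germ_eq_refl.
have dF : dev_germ p (fun x => Some (cexp (F x))).
  exact: (exp_germ_dev nonzero (exp_germ_exp np nF)).
have e0 : germ_eq p G (fun x => Some (cexp (H 0 x))).
  have [l l1 e] := dev_germ_compare (HG p np) dF.
  have l1' : l = 1.
    have := nbhs_singleton e; rewrite (nbhs_singleton eG) /scale /= Fp ea => -[ev].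
    by apply: (mulIf v0); rewrite mul1r -ev.
  by rewrite H0; apply: filterS e => x ->; rewrite l1' /scale /= mul1r.
have e1 := continues_dev_unique P cG ce e0.
have : cexp (H 1 p - H 0 p) = 1.
  have := nbhs_singleton e0; rewrite (nbhs_singleton e1) => /(congr1 (odflt 0)) /= ev.
  by rewrite cexpB ev divff// cexp_neq0.
move=> /cexp_eq1[n en]; exists n; apply/(path_integralP _ P).
by exists H => //; exact: continues_normalized_primitive.
Qed.

(** Continuation along a loop multiplies exp F by exp (int w), which is 1 by
    assumption. *)
Lemma section_of_loops p0 : ~ Pl p0 ->
  (forall p gamma, path_in (~` Pl) gamma p p ->
    exists n : int, path_integral w gamma ((2 * pi * n%:~R)%:C * 'i)) ->
  exists G, forall x, ~ Pl x -> dev_germ x G.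
Proof.
move=> np loops.
have [F nF _] := @normalized_primitive_exists _ _ _ _ nonzero U_exact p0 (U p0)%:C np erefl.
have dev x : ~ Pl x -> exists h, dev_germ x h.
  move=> nx; have [G nG _] := @normalized_primitive_exists _ _ _ _ nonzero U_exact x (U x)%:C nx erefl.
  by exists (fun y => Some (cexp (G y))); exact: (exp_germ_dev nonzero (exp_germ_exp nx nG)).
have dF := exp_germ_dev nonzero (exp_germ_exp np nF).
have [|gamma H P cH H0|G [_ HG]] := global_section (@dev_germ_uniq _ _ w U)
  (dev_germ_triv nonzero (X := ~` Pl) dev) (dev_germ_near nonzero)
  (@dev_germ_ext _ _ w U) (regular_near nonzero) _ np dF.
- by move=> p q; exact: (path_connected_compl (poles_isolated nonzero)).
- have [K cK K0] := normalized_continues P nF.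
  have e0 : germ_eq p0 (H 0) (fun x => Some (cexp (K 0 x))) by rewrite H0 K0; exact: germ_eq_refl.
  have e1 := continues_dev_unique P cH (continues_exp P cK) e0.
  have [n In] := loops p0 gamma P.
  have IK : path_integral w gamma (K 1 p0 - K 0 p0).
    by apply/(path_integralP _ P); exists K => //; exact: continues_normalized_primitive.
  have ev := path_integral_unique P IK In.
  have [_ g0 g1 _] := P.
  have l1 : LP p0 (K 1) by rewrite -{1}g1; exact: (cK 1 in01_1).1.1.
  have e2 : germ_eq p0 (K 1) (fun x => F x + (K 1 p0 - F p0)).
    exact: (local_primitive_diff l1 nF.1).
  apply: filterS2 e1 e2 => x -> ->; rewrite cexpD -K0 ev.
  by rewrite cexp_2piZ mulr1.
by exists G.
Qed.

End PathIntegrals.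

(** * Simple poles and residues *)

Section PrincipalParts.
Variables (R : realType).
Local Notation Co := (R[i]^o).

Lemma cabs_sum (n : nat) (F : 'I_n -> R[i]) : cabs (\sum_(k < n) F k) <= \sum_(k < n) cabs (F k).
Proof.
elim/big_ind2: _ => //; first by rewrite cabs0.
by move=> a b c d h1 h2; apply: le_trans (cabsD _ _) _; exact: lerD.
Qed.

Lemma cabs_small_eq0 (a : R[i]) (B r : R) (z0 : Co) : 0 < r ->
  (forall z, cabs (z - z0) < r -> z != z0 -> cabs a <= cabs (z - z0) * B) -> a = 0.
Proof.
move=> r0 H; apply/eqP; rewrite -cabs_eq0; apply/eqP/le_anti; rewrite cabs_ge0 andbT.
apply/ler_addgt0Pr => e e0; rewrite add0r.
pose t := Num.min (r / 2) (e / (`|B| + 1)); have B1 : 0 < `|B| + 1 by rewrite ltr_wpDl.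
have t0 : 0 < t by rewrite lt_min !divr_gt0.
have ct : cabs (z0 + t%:C - z0) = t by rewrite addrC addrA addNr add0r cabsR gtr0_norm.
apply: le_trans (H (z0 + t%:C) _ _) _.
- by rewrite ct gt_min; apply/orP; left; lra.
- by rewrite -subr_eq0 -cabs_eq0 ct gt_eqF.
rewrite ct; have t1 : t <= e / (`|B| + 1) by rewrite ge_min lexx orbT.
apply: (@le_trans _ _ (t * (`|B| + 1))); last by rewrite -ler_pdivlMr.
by rewrite ler_pM2l//; have := ler_norm B; lra.
Qed.

(** An expansion of pole order greater than one is excluded by the bound
    O(1 / |z - z0|): its leading coefficient is O(|z - z0|). *)
Lemma simple_pole_expansion (f h : Co -> Co) (z0 : Co) (C : R) N (c : nat -> R[i]) :
  holomorphic_at h z0 -> (\forall z \near z0^', f z =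
    \sum_(k < N.+1) c k * (z - z0) ^- k.+1 + h z) ->
  (\forall z \near z0^', cabs (f z) * cabs (z - z0) <= C) ->
  \forall z \near z0^', f z = c 0%N / (z - z0) + h z.
Proof.
move=> hh; elim: N => [|N IH] e bd.
  by apply: filterS e => z ->; rewrite big_ord1.
suff c0 : c N.+1 = 0.
  by apply: IH => //; apply: filterS e => z ->; rewrite big_ord_recr /= c0 mul0r addr0.
have nh : \forall z \near z0^', cabs (h z) <= cabs (h z0) + 1.
  exact: (nbhs_dnbhs (near_bounded (hol_cont hh))).
have n : \forall z \near z0^', [/\ f z = \sum_(k < N.+2) c k * (z - z0) ^- k.+1 + h z,
    cabs (f z) * cabs (z - z0) <= C & cabs (h z) <= cabs (h z0) + 1].
  by apply: filterS3 e bd nh => z; split.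
have [r r0 Hr] := (nearC' _ _).1 n.
pose B := \sum_(k < N.+1) cabs (c k) + (cabs (h z0) + 1).
apply: (@cabs_small_eq0 _ (`|C| + B) (Num.min 1 r) z0); first by rewrite lt_min ltr01.
move=> z; rewrite lt_min => /andP[z1 zr] zz0.
have [ef bf bh] := Hr z zr zz0; rewrite big_ord_recr /= in ef.
have x0 : z - z0 != 0 by rewrite subr_eq0.
set x := z - z0 in z1 ef bf x0 *; have xp : 0 < cabs x by rewrite cabs_gt0.
have le1 m : cabs (x ^+ m) <= 1 by rewrite cabsX exprn_ile1// ?cabs_ge0// ltW.
have ec : c N.+1 = x ^+ N.+2 * f z - x * (\sum_(k < N.+1) c k * x ^+ (N - k) + x ^+ N.+1 * h z).
  rewrite ef mulrDr mulrDr [_ * (_ * x ^- N.+2)]mulrCA divff ?expf_neq0// mulr1.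
  rewrite mulrDr [x * (x ^+ N.+1 * _)]mulrA -exprS !mulr_sumr.
  have -> : \sum_(k < N.+1) x ^+ N.+2 * (c k * x ^- k.+1) = \sum_(k < N.+1) x * (c k * x ^+ (N - k)).
    apply: eq_bigr => k _; rewrite mulrCA [RHS]mulrCA; congr (_ * _).
    have -> : N.+2 = ((N - k).+1 + k.+1)%N by rewrite addSn addnS subnK// -ltnS.
    by rewrite exprD mulfK ?expf_neq0// exprS.
  by ring.
rewrite {1}ec; apply: (le_trans (cabsB _ _)); rewrite [leRHS]mulrDr; apply: lerD.
  rewrite exprS -mulrA cabsM ler_wpM2l ?cabs_ge0// exprS [x * _]mulrC -mulrA cabsM.
  apply: (@le_trans _ _ (1 * C)); last by rewrite mul1r ler_norm.
  by rewrite ler_pM ?cabs_ge0// cabsM mulrC.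
rewrite cabsM ler_wpM2l ?cabs_ge0//; apply: (le_trans (cabsD _ _)); apply: lerD.
  apply: (le_trans (cabs_sum _)); apply: ler_sum => k _.
  by rewrite cabsM ler_piMr ?cabs_ge0.
by rewrite cabsM; apply: le_trans bh; rewrite ler_piMl ?cabs_ge0.
Qed.

End PrincipalParts.

Section Poles.
Variables (R : realType) (S : riemannSurface R) (w : meromorphicForm S).
Local Notation Co := (R[i]^o).
Implicit Types (i j : chart S) (x y p q : S).

Lemma near_punctured i p (Q : Co -> Prop) : dom i p ->
  (\forall z \near (crd i p : Co)^', Q z) -> \forall x \near p, x != p -> Q (crd i x).
Proof.
move=> ip H; have H' : \forall z \near (crd i p : Co), z != crd i p -> Q z by exact: H.
apply: filterS2 (crd_near ip H') (dom_near ip) => x h ix xp; apply: h.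
by apply: contra_neq xp; exact: crd_inj.
Qed.

Lemma punctured_near i p (Q : S -> Prop) : dom i p ->
  (\forall x \near p, x != p -> Q x) -> \forall z \near (crd i p : Co)^', Q (crd_inv i z).
Proof.
move=> ip H; have H' : \forall z \near (crd i p : Co), z != crd i p -> Q (crd_inv i z).
  apply: filterS2 (crd_inv_near ip H) (chart_image_near ip) => z h [iz ez] zp; apply: h.
  by apply: contra_neq zp => e; rewrite -ez e.
exact: H'.
Qed.

Lemma transition_lower i j p : dom i p -> dom j p -> exists2 c : R, 0 < c &
  \forall x \near p, c * cabs (crd i x - crd i p) <= cabs (crd j x - crd j p).
Proof.
move=> ip jp; pose c := cabs (transition' i j p) / 2.
have c0 : 0 < c by rewrite divr_gt0// cabs_gt0; exact: transition_neq0.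
exists c => //; have [r r0 Hr] := (cdiffE _ _ _).1 (cd_transition ip jp) c c0.
apply: filterS (disc_nbhs ip r0) => x [ix xr].
have := Hr _ xr; rewrite /= !crdK// => h.
have := cabs_sub (transition' i j p * (crd i x - crd i p)) (transition' i j p * (crd i x - crd i p) - (crd j x - crd j p)).
have -> : transition' i j p * (crd i x - crd i p) -
   (transition' i j p * (crd i x - crd i p) - (crd j x - crd j p)) = crd j x - crd j p by ring.
rewrite cabs_distC in h; move: h; rewrite cabsM /c.
set X := cabs (crd i x - crd i p); set Y := cabs (_ - _); set T := cabs (transition' i j p).
by lra.
Qed.

Lemma transition_bounded i j p : dom i p -> dom j p ->
  \forall x \near p, cabs (transition' i j x) <= cabs (transition' i j p) + 1.
Proof.
move=> ip jp; have := holomorphic_derive1 (transition_holomorphic ip jp).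
by move=> /hol_cont/near_bounded/(crd_near ip).
Qed.

Lemma linear_bound (a b d x : R[i]) (C : R) : cabs a <= cabs x * C ->
  cabs (a - b - d * x) <= 1 * cabs x -> cabs b <= cabs x * (cabs d + 1 + C).
Proof.
move=> h1 h2; have -> : b = a - d * x - (a - b - d * x) by ring.
have := cabsB (a - d * x) (a - b - d * x); have := cabsB a (d * x).
by rewrite cabsM !mulrDr mulr1; lra.
Qed.

(** The coordinate changes contribute bounded factors. *)
Lemma order_bounded i p (n : nat) : dom i p -> ord_form w p n%:Z ->
  exists C : R, \forall x \near p, cabs (w i x) <= C.
Proof.
move=> ip [j [jp [h [hh h0 e]]]].
have hg := @holM _ (fun z => (z - crd j p) ^+ n) h _
  (@holX _ _ n (crd j p) (@holB _ (fun z => z) (fun=> crd j p) _ (hol_id _) (hol_cst _ _))) hh.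
have b := crd_near jp (near_bounded (hol_cont hg)).
set B := cabs _ + 1 in b; exists (B * (cabs (transition' i j p) + 1)).
have nd : \forall x \near p, dom i x /\ dom j x by exact: filterI (dom_near ip) (dom_near jp).
have nb : \forall x \near p, cabs ((crd j x - crd j p) ^+ n * h (crd j x)) <= B /\
  cabs (transition' i j x) <= cabs (transition' i j p) + 1 by exact: filterI b (transition_bounded ip jp).
apply: filterS3 e nd nb => x ex [ix jx] [b1 b2].
by rewrite (form_compat w ix jx) ex -exprnP cabsM ler_pM ?cabs_ge0.
Qed.

(** A form of negative order in one chart is unbounded in it, one of
    nonnegative order is not. *)
Lemma order_sign p (m n : int) : ord_form w p m -> ord_form w p n -> m < 0 -> n < 0.
Proof.
move=> [i [ip [h [hh h0 e]]]] on m0; rewrite ltNge; apply/negP => n0.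
case: n n0 on => // n _ on; have [C bC] := order_bounded ip on.
case: m m0 e => // m _ e.
have [r r0 Hr] : exists2 r : R, 0 < r & forall z, cabs (z - crd i p) < r -> z != crd i p ->
    cabs (h z) <= cabs (z - crd i p) * `|C|.
  apply/nearC'.
  have n1 : \forall x \near p, x != p -> cabs ((crd i x - crd i p) ^ (Negz m) * h (crd i x)) <= C.
    by apply: filterS2 e bC => x ->.
  have n2 : \forall z \near (crd i p : Co)^', dom i (crd_inv i z) /\ crd i (crd_inv i z) = z.
    by apply: nbhs_dnbhs; exact: chart_image_near.
  have n3 : \forall z \near (crd i p : Co)^', cabs (z - crd i p) < 1 /\ z != crd i p.
    apply/nearC'; exists 1 => //.
  apply: filterS3 (punctured_near ip n1) n2 n3 => z bz [_ ez] [z1 zp]; rewrite ez in bz.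
  have x0 : z - crd i p != 0 by rewrite subr_eq0.
  set x := z - crd i p in bz z1 x0 *.
  have xp : 0 < cabs x by rewrite cabs_gt0.
  have -> : h z = x ^+ m.+1 * (x ^ (Negz m) * h z).
    by rewrite NegzE -exprnN mulrA divff ?mul1r// expf_neq0.
  rewrite cabsM exprS cabsM -mulrA ler_wpM2l ?cabs_ge0//.
  apply: (@le_trans _ _ (1 * `|C|)); last by rewrite mul1r.
  rewrite ler_pM ?cabs_ge0//; first by rewrite cabsX exprn_ile1// ltW.
  by apply: le_trans bz (ler_norm C).
have [r2 r20 Hr2] := (cdiffE _ _ _).1 (hol_at hh) 1 ltr01.
move/negP: h0; apply; apply/eqP.
apply: (@cabs_small_eq0 _ _ (cabs (derive1 h (crd i p)) + 1 + `|C|) (Num.min r r2) (crd i p)).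
  by rewrite lt_min r0.
move=> z; rewrite lt_min => /andP[zr zr2] zp.
have b1 := Hr z zr zp; have b2 := Hr2 z zr2.
exact: linear_bound b1 b2.
Qed.

End Poles.

Section PoleForm.
Variables (R : realType) (S : riemannSurface R) (w : meromorphicForm S).
Local Notation Co := (R[i]^o).
Implicit Types (i j : chart S) (x y p q : S).

Lemma simple_pole_bound i p : ord_form w p (-1) -> dom i p ->
  exists C : R, \forall x \near p, x != p -> cabs (w i x) * cabs (crd i x - crd i p) <= C.
Proof.
move=> [j [jp [h [hh h0 e]]]] ip; have [c c0 lo] := transition_lower ip jp.
pose H := cabs (h (crd j p)) + 1; pose T := cabs (transition' i j p) + 1.
exists (H * T / c).
have bh : \forall x \near p, cabs (h (crd j x)) <= H := crd_near jp (near_bounded (hol_cont hh)).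
have nd : \forall x \near p, dom i x /\ dom j x by exact: filterI (dom_near ip) (dom_near jp).
have nb : \forall x \near p, cabs (transition' i j x) <= T /\
    c * cabs (crd i x - crd i p) <= cabs (crd j x - crd j p).
  exact: filterI (transition_bounded ip jp) lo.
have ne : \forall x \near p, w j x = (crd j x - crd j p) ^ (-1) * h (crd j x) /\
  cabs (h (crd j x)) <= H by exact: filterI e bh.
apply: filterS3 ne nd nb => x [ex bx] [ix jx] [bt lx] xp.
have jn : 0 < cabs (crd j x - crd j p).
  by rewrite cabs_gt0 subr_eq0; apply: contra_neq xp; exact: crd_inj.
rewrite (form_compat w ix jx) ex -exprN1 -exprnN expr1 !cabsM cabsV.
rewrite ler_pdivlMr//.
have -> : (cabs (crd j x - crd j p))^-1 * cabs (h (crd j x)) * cabs (transition' i j x) *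
  cabs (crd i x - crd i p) * c = (cabs (h (crd j x)) * cabs (transition' i j x)) *
  (c * cabs (crd i x - crd i p) / cabs (crd j x - crd j p)) by ring.
rewrite -[leRHS]mulr1 ler_pM ?mulr_ge0 ?invr_ge0 ?cabs_ge0 ?(ltW c0)//.
  by rewrite ler_pM ?cabs_ge0.
by rewrite ler_pdivrMr// mul1r.
Qed.

(** The residue is nonzero, so that it is the leading coefficient of an actual
    expansion; as the pole is simple, the expansion has no further polar
    terms. *)
Lemma pole_form p : ord_form w p (-1) -> Res w p != 0 -> exists i (k : Co -> Co),
  [/\ dom i p, holomorphic_at k (crd i p) &
      \forall x \near p, x != p -> w i x = Res w p / (crd i x - crd i p) + k (crd i x)].
Proof.
move=> o r0; have /(xgetPex (0 : R[i])) : exists r : R[i], [set r : R[i] |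
  exists i (N : nat) (c : nat -> R[i]) (h : R[i]^o -> R[i]^o),
    [/\ dom i p, c 0%N = r, holomorphic_at h (crd i p)
      & \forall x \near p^', w i x =
          \sum_(k < N.+1) c k * (crd i x - crd i p) ^- k.+1 + h (crd i x)]] r.
  apply: contrapT => n; move/eqP: r0; apply; apply: xgetPN => r Pr; apply: n; by exists r.
move=> [i [N [c [h [ip cr hh e]]]]]; rewrite -/(Res w p) in cr.
exists i, h; split=> //.
have [C bC] := simple_pole_bound o ip.
have tr (Q : S -> Prop) : (\forall x \near p, x != p -> Q x) ->
    \forall z \near (crd i p : Co)^', Q (crd_inv i z) /\ crd i (crd_inv i z) = z.
  move=> n; have n2 : \forall z \near (crd i p : Co)^', dom i (crd_inv i z) /\ crd i (crd_inv i z) = z.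
    by apply: nbhs_dnbhs; exact: chart_image_near.
  by apply: filterS2 (punctured_near ip n) n2 => z ? [].
have e' : \forall z \near (crd i p : Co)^', (w i (crd_inv i z) : R[i]) =
    \sum_(k < N.+1) c k * (z - crd i p) ^- k.+1 + h z.
  have ee : \forall x \near p, x != p -> w i x =
          \sum_(k < N.+1) c k * (crd i x - crd i p) ^- k.+1 + h (crd i x) by exact: e.
  by apply: filterS (tr _ ee) => z [-> ->].
have b' : \forall z \near (crd i p : Co)^', cabs (w i (crd_inv i z)) * cabs (z - crd i p) <= C.
  by apply: filterS (tr _ bC) => z [h' ez]; rewrite ez in h'.
have /(near_punctured ip) := @simple_pole_expansion R (w i \o crd_inv i) h (crd i p) C N c hh e' b'.
by rewrite cr => ex; apply: filterS2 ex (dom_near ip) => x ex ix xp; rewrite -ex//= crdK.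
Qed.

End PoleForm.

Section PoleModel.
Variables (R : realType) (S : riemannSurface R) (w : meromorphicForm S) (U : S -> R).
Local Notation Co := (R[i]^o).
Local Notation Pl := (poles w).
Implicit Types (i j : chart S) (x y p q : S) (h : S -> option R[i]).
Hypothesis nonzero : forall i p, dom i p -> exists n, has_order (w i) i p n.
Hypothesis U_exact : forall x i, ~ Pl x -> dom i x ->
  is_dx (U \o crd_inv i) (crd i x) (Re (w i x)) /\
  is_dy (U \o crd_inv i) (crd i x) (- Im (w i x)).

Section Expansion.
Variables (i : chart S) (p : S) (r : R) (k : Co -> Co).
Hypotheses (ip : dom i p) (r0 : r != 0) (hk : holomorphic_at k (crd i p)).
Hypothesis wE : \forall x \near p, x != p -> w i x = r%:C / (crd i x - crd i p) + k (crd i x).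

Lemma log_algebra (z0 z W K E r' : R[i]) : z - z0 != 0 -> r' != 0 -> W = r' / (z - z0) + K ->
  (1 - 0) * E + (z - z0) * (E * (- (r'^-1) * (W - K))) = 0.
Proof. by move=> n1 n2 ->; field; rewrite n1 n2. Qed.

(** Off the pole, U - r ln|z - z(p)| - Re (int k) is locally constant, because
    (z - z(p)) exp (- int (w - k) / r) is. *)
Lemma pole_potential_local (K : Co -> Co) : (\forall z \near (crd i p : Co), is_derive (z : Co) 1 K (k z)) ->
  \forall y \near p, y != p -> \forall x \near y,
    U x - r * ln (cabs (crd i x - crd i p)) - Re (K (crd i x)) =
    U y - r * ln (cabs (crd i y - crd i p)) - Re (K (crd i y)).
Proof.
move=> dK.
have n : \forall y \near p, [/\ dom i y, is_derive (crd i y : Co) 1 K (k (crd i y)), (y != p -> ~ Pl y)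
   & (y != p -> w i y = r%:C / (crd i y - crd i p) + k (crd i y))].
  have n2 : \forall y \near p, dom i y /\ is_derive (crd i y : Co) 1 K (k (crd i y)).
    exact: filterI (dom_near ip) (crd_near ip dK).
  by apply: filterS3 n2 (poles_isolated nonzero p) wE => y []; split.
have n' : \forall y \near p, \forall x \near y, [/\ dom i x, is_derive (crd i x : Co) 1 K (k (crd i x)), (x != p -> ~ Pl x)
   & (x != p -> w i x = r%:C / (crd i x - crd i p) + k (crd i x))] by exact: near_join.
apply: filterS2 n n' => y [iy _ ny _] nx yp; have {}ny := ny yp.
have [F hF] := local_primitive_exists nonzero ny.
have np : \forall x \near y, x != p.
  have : \forall z \near (crd i y : Co), z - crd i p != 0.
    apply: (@neq0_near _ (fun z => z - crd i p)); last first.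
      by rewrite subr_eq0; apply: contra_neq yp; exact: crd_inj.
    exact: (hol_cont (@holB _ (fun z => z) (fun=> crd i p) _ (hol_id _) (hol_cst _ _))).
  by move=> /(crd_near iy); apply: filterS => x; apply: contra_neq => ->; rewrite subrr.
pose E z := cexp (- (r%:C^-1) * (F (crd_inv i z) - K z)).
have dq : \forall x \near y, is_derive (crd i x : Co) 1 (fun z : Co => (z - crd i p) * E z : Co) 0.
  apply: filterS3 hF nx np => x dF [ix dKx _ ex] xp.
  have d1 := @cdB R (fun z => z) (fun=> crd i p) (crd i x) _ _ (cd_id _) (cd_cst _ _).
  have d2 := cdZ (- (r%:C^-1)) (@cdB R (F \o crd_inv i) K (crd i x) _ _ (dF i ix) dKx).
  have d3 := @cd_comp R (@cexp R) _ (crd i x) _ _ (cd_cexp _) d2.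
  have d4 := @cdM R _ _ (crd i x) _ _ d1 d3.
  apply: cd_eq d4; apply: log_algebra (ex xp).
    by rewrite subr_eq0; apply: contra_neq xp; exact: crd_inj.
  by apply: contra_neq r0 => /(congr1 (@complex.Re R)).
have dz : \forall z \near (crd i y : Co), is_derive (z : Co) 1 (fun z : Co => (z - crd i p) * E z : Co) 0.
  apply: filterS2 (crd_inv_near iy dq) (chart_image_near iy) => z /= dz [_ ez].
  by rewrite ez in dz.
have qc := @crd_near _ _ i y (fun z => (z - crd i p) * E z = (crd i y - crd i p) * E (crd i y)) iy (near_const dz).
have nd : \forall x \near y, dom i x /\ x != p by exact: filterI (dom_near iy) np.
apply: filterS3 qc nd (potential_diff nonzero U_exact ny hF) => x qx [ix xp] Ux.
have nz t : dom i t -> t != p -> 0 < cabs (crd i t - crd i p).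
  by move=> it tp; rewrite cabs_gt0 subr_eq0; apply: contra_neq tp; exact: crd_inj.
have lE t : dom i t -> t != p -> ln (cabs ((crd i t - crd i p) * E (crd i t))) =
    ln (cabs (crd i t - crd i p)) - (Re (F t) - Re (K (crd i t))) / r.
  move=> it tp; rewrite cabsM lnM ?posrE ?nz//; last by rewrite cabs_gt0 cexp_neq0.
  rewrite cabs_cexp expRK crdK//; congr (_ + _).
  have -> : - (r%:C^-1) = (- r^-1)%:C :> R[i] by rewrite rmorphN fmorphV.
  by rewrite !ReImE /=; field.
have := congr1 (fun z => ln (cabs z)) qx; rewrite !lE// => eq.
set a := ln _ in eq *; set b := ln (cabs (crd i y - crd i p)) in eq *.
have e1 : r * a - (Re (F x) - Re (K (crd i x))) = r * b - (Re (F y) - Re (K (crd i y))).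
  by move: (congr1 (fun t => r * t) eq); rewrite !mulrBr ![r * (_ / r)]mulrC !divfK.
by move: e1 Ux; lra.
Qed.

(** A locally constant function on a punctured neighbourhood is constant; the
    constant is absorbed in the primitive H. *)
Lemma pole_potential : exists H : Co -> Co,
  (\forall z \near (crd i p : Co), is_derive (z : Co) 1 H (k z)) /\
  \forall x \near p, x != p -> U x = r * ln (cabs (crd i x - crd i p)) + Re (H (crd i x)).
Proof.
have [K dK] := hol_primitive_at hk; have loc := pole_potential_local dK.
pose G x := U x - r * ln (cabs (crd i x - crd i p)) - Re (K (crd i x)).
have [V nV HV] := punctured_path_connected loc.
have [y Vy yp] := chart_not_isolated nV.
have cst x : V x -> x != p -> G x = G y.
  move=> Vx xp; have [g P] := HV y x Vy Vx yp xp; have [_ g0 g1 gW] := P.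
  have : G (g 1) = G (g 0).
    apply: (@unit_interval_locally_constant R (fun t => G (g t) = G (g 0))) => //; last exact: in01_1.
    move=> t t01; have [Wt /eqP tp] := gW t t01; have nt := Wt tp.
    have [d d0 Hd] := path_near P t01 nt; exists d => // a b a01 b01 at_ bt <-.
    by rewrite [LHS](Hd b b01 bt) [RHS](Hd a a01 at_).
  by rewrite g0 g1.
exists (fun z => K z + (G y)%:C); split.
  by apply: filterS dK => z d; apply: cd_eq (cdD d (cd_cst _ _)); rewrite addr0.
apply: filterS nV => x Vx xp; have := cst x Vx xp; rewrite /G ReD /=; lra.
Qed.

Lemma exp_germ_chart y h (v : Co -> Co) : ~ Pl y -> dom i y ->
  (\forall x \near y, h x = Some (v (crd i x))) ->
  (\forall x \near y, cabs (v (crd i x)) = expR (U x)) ->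
  (\forall x \near y, is_derive (crd i x : Co) 1 v (w i x * v (crd i x))) -> exp_germ w U y h.
Proof.
move=> ny iy eh m d; split=> //; exists (fun x => v (crd i x)); split=> //.
apply: filterS2 d (dom_near iy) => x d ix j jx.
have d' : is_derive (crd i x : Co) 1 ((fun x => v (crd i x)) \o crd_inv i : Co -> Co) (w i x * v (crd i x)).
  by apply: cd_near d; apply: filterS (chart_image_near ix) => z [_ /= ->].
have := cd_change ix jx d'; rewrite (form_compat w jx ix).
by move=> d2; apply: cd_eq d2; rewrite mulrAC.
Qed.

End Expansion.

End PoleModel.

(** * Univalent germs and pull-backs of the spherical metric *)

Section Univalent.
Variables (R : realType) (S : riemannSurface R).
Local Notation Co := (R[i]^o).
Implicit Types (i j : chart S) (x y p q : S) (h k : S -> option R[i]).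

(** A function element which, in a chart of the source and one of the two
    standard charts of the sphere, is holomorphic with nonzero derivative. *)
Definition univalent_in i h p := exists u : Co -> Co,
  [/\ holomorphic_at u (crd i p), derive1 u (crd i p) != 0
    & (\forall x \near p, h x = Some (u (crd i x))) \/
      (\forall x \near p, sphere_inv (h x) = Some (u (crd i x)))].

Lemma univalent_meromorphic i h p : dom i p -> univalent_in i h p -> meromorphic_at h p.
Proof.
move=> ip [u [hu du n]]; apply: (germ_in_meromorphic ip (u := u)); split=> //.
case: n => n; [by left|right; split=> // z].
have e : \forall z \near (crd i p : Co), (fun=> 0) z = u z.
  apply: filterS2 (crd_inv_near ip z) (chart_image_near ip) => t.
  by move=> uz [_ et]; rewrite et in uz.
move/eqP: du; apply; apply: cd_derive1; exact: cd_near e (cd_cst _ _).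
Qed.

Lemma univalent_ext i h k p : germ_eq p h k -> univalent_in i h p -> univalent_in i k p.
Proof.
move=> e [u [hu du n]]; exists u; split=> //.
by case: n => n; [left|right]; apply: filterS2 e n => x ->.
Qed.

Lemma univalent_change i j h p : dom i p -> dom j p -> univalent_in i h p -> univalent_in j h p.
Proof.
move=> ip jp [u [hu du n]]; pose T := crd i \o crd_inv j : Co -> Co.
have hT : holomorphic_at T (crd j p) := transition_holomorphic jp ip.
have ec : T (crd j p) = crd i p by rewrite /T /= crdK.
rewrite -ec in hu du.
have hc := @hol_comp _ u T _ hu hT; have dc := cd_derive1 (@cd_comp R u T (crd j p) _ _ (hol_at hu) (cd_transition jp ip)).
have dn := mulf_neq0 du (transition_neq0 jp ip); rewrite -dc in dn.
exists (fun z => u (T z)); split; [exact: hc|exact: dn|].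
have e : \forall x \near p, u (T (crd j x)) = u (crd i x).
  by apply: filterS (dom_near jp) => x jx; rewrite /T /= crdK.
by case: n => n; [left|right]; apply: filterS2 n e => x -> ->.
Qed.

Lemma univalent_scale i (a : R[i]) h p : a != 0 -> univalent_in i h p -> univalent_in i (scale a h) p.
Proof.
have dm (b : R[i]) (u : Co -> Co) : b != 0 -> holomorphic_at u (crd i p) -> derive1 u (crd i p) != 0 ->
    holomorphic_at (fun z => b * u z) (crd i p) /\ derive1 (fun z : Co => b * u z : Co) (crd i p) != 0.
  move=> b0 hu du; split; first exact: (@holM _ (fun=> b) u _ (hol_cst _ _) hu).
  by rewrite (cd_derive1 (cdZ b (hol_at hu))); exact: mulf_neq0 b0 du.
move=> a0 [u [hu du [n|n]]].
  have [h1 h2] := dm a u a0 hu du; exists (fun z => a * u z); split; [exact: h1|exact: h2|].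
  by left; apply: filterS n => x; rewrite /scale => ->.
have a0' : a^-1 != 0 by rewrite invr_eq0.
have [h1 h2] := dm a^-1 u a0' hu du; exists (fun z => a^-1 * u z); split; [exact: h1|exact: h2|].
right; apply: filterS n => x; rewrite /scale; case: (h x) => [b|] /=; last by move=> [<-]; rewrite mulr0.
by rewrite mulf_eq0 (negbTE a0) /=; case: eqP => // /eqP b0 [<-]; rewrite invfM mulrC.
Qed.

Lemma univalent_injective i h p : dom i p -> univalent_in i h p -> injective_near p h.
Proof.
move=> ip [u [hu du n]]; have [r r0 Hr] := hol_injective hu du.
have key k : (\forall x \near p, k x = Some (u (crd i x))) -> injective_near p k.
  move=> e; exists (fun x => k x = Some (u (crd i x)) /\ (dom i x /\ cabs (crd i x - crd i p) < r)).
    exact: filterI e (disc_nbhs ip r0).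
  move=> x y [-> [ix xr]] [-> [iy yr]] /Some_inj e'; apply: (crd_inj ix iy); exact: Hr.
case: n => [/key //|/key[V nV H]]; exists V => // x y Vx Vy e; apply: H => //.
by rewrite e.
Qed.

Lemma pullback_density_finite i h p (u : Co -> Co) : dom i p ->
  (\forall x \near p, h x = Some (u (crd i x))) ->
  pullback_density i h p = spher u (crd i p).
Proof.
move=> ip e; rewrite /pullback_density (nbhs_singleton e) /spher.
have -> : derive1 (fun z : Co => odflt 0 (h (crd_inv i z)) : Co) (crd i p) = derive1 u (crd i p).
  apply: near_derive1.
  by apply: filterS2 (crd_inv_near ip e) (chart_image_near ip) => z /= -> [_ ->].
by [].
Qed.

(** Inversion is an isometry of the sphere, so that the density can be computed
    in the chart at infinity also at points where h is finite. *)
Lemma pullback_density_infinite i h p (u : Co -> Co) : dom i p -> holomorphic_at u (crd i p) ->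
  (\forall x \near p, sphere_inv (h x) = Some (u (crd i x))) ->
  pullback_density i h p = spher u (crd i p).
Proof.
move=> ip hu e; case hp : (h p) => [a|].
  have e0 := nbhs_singleton e; rewrite hp /= in e0.
  have a0 : a != 0 by apply/negP => a0; move: e0; rewrite a0.
  rewrite (negbTE a0) in e0; have /Some_inj eu := e0.
  have u0 : u (crd i p) != 0 by rewrite -eu invr_eq0.
  rewrite -(spher_inv (nbhs_singleton hu) u0); apply: pullback_density_finite => //.
  apply: filterS2 e (crd_near ip (neq0_near (hol_cont hu) u0)) => x ex nx.
  by rewrite -[h x]sphere_invK ex /= (negbTE nx).
have u0 : u (crd i p) = 0.
  by have := nbhs_singleton e; rewrite hp => /Some_inj.
rewrite /pullback_density hp /spher u0 cabs0 expr0n addr0 expr1n divr1.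
have -> : derive1 (fun z : Co => odflt 0 ((@sphere_inv R \o h) (crd_inv i z)) : Co) (crd i p) = derive1 u (crd i p).
  apply: near_derive1.
  by apply: filterS2 (crd_inv_near ip e) (chart_image_near ip) => z /= -> [_ ->].
by [].
Qed.

Lemma univalent_pullback i h p : dom i p -> univalent_in i h p -> exists u : Co -> Co,
  [/\ holomorphic_at u (crd i p), derive1 u (crd i p) != 0 &
      \forall x \near p, pullback_density i h x = spher u (crd i x)].
Proof.
move=> ip [u [hu du n]]; exists u; split=> //.
have nd : \forall x \near p, dom i x /\ holomorphic_at u (crd i x).
  exact: filterI (dom_near ip) (crd_near ip (hol_near hu)).
case: n => n.
  by apply: filterS2 (germ_eq_near n) nd => x e [ix _]; exact: pullback_density_finite.
have n' := @germ_eq_near _ _ _ _ (@sphere_inv R \o h) _ n.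
by apply: filterS2 n' nd => x e [ix hx]; exact: pullback_density_infinite.
Qed.

Lemma pullback_density_scale i (a : R[i]) h p : cabs a = 1 -> dom i p -> meromorphic_at h p ->
  pullback_density i (scale a h) p = pullback_density i h p.
Proof.
move=> a1 ip /(meromorphic_chart ip)[u [hu n]]; have a0 := unit_neq0 a1.
have ai : cabs a^-1 = 1 by rewrite cabsV a1 invr1.
case: n => [n|[n _]].
  rewrite (pullback_density_finite ip n) -(spher_mul a1 (nbhs_singleton hu)).
  by apply: pullback_density_finite => //; apply: filterS n => x; rewrite /scale => ->.
rewrite (pullback_density_infinite ip hu n) -(spher_mul ai (nbhs_singleton hu)).
apply: (pullback_density_infinite ip (@holM _ (fun=> a^-1) u _ (hol_cst _ _) hu)).
apply: filterS n => x; rewrite /scale; case: (h x) => [b|] /=; last by move=> [<-]; rewrite mulr0.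
by rewrite mulf_eq0 (negbTE a0) /=; case: eqP => // /eqP b0 [<-]; rewrite invfM mulrC.
Qed.

Lemma pullback_density_ext i h k p : dom i p -> meromorphic_at h p -> germ_eq p h k ->
  pullback_density i h p = pullback_density i k p.
Proof.
move=> ip /(meromorphic_chart ip)[u [hu n]] e; case: n => [n|[n _]].
  rewrite (pullback_density_finite ip n); apply/esym/pullback_density_finite => //.
  by apply: filterS2 e n => x ->.
rewrite (pullback_density_infinite ip hu n); apply/esym/pullback_density_infinite => //.
by apply: filterS2 e n => x ->.
Qed.

Lemma pullback_density_change i j h p : dom i p -> dom j p -> meromorphic_at h p ->
  pullback_density i h p = pullback_density j h p * cabs (transition' i j p) ^+ 2.
Proof.
move=> ip jp /(meromorphic_chart jp)[u [hu n]]; pose T := crd j \o crd_inv i : Co -> Co.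
have hT : holomorphic_at T (crd i p) := transition_holomorphic ip jp.
have ec : T (crd i p) = crd j p by rewrite /T /= crdK.
have hu' := hu; rewrite -ec in hu'.
have e : \forall x \near p, u (T (crd i x)) = u (crd j x).
  by apply: filterS (dom_near ip) => x ix; rewrite /T /= crdK.
have sc := spher_comp (nbhs_singleton hu') (nbhs_singleton hT); rewrite ec in sc.
have hc := @hol_comp _ u T _ hu' hT.
case: n => [n|[n _]].
  rewrite (pullback_density_finite jp n); apply: (eq_trans _ sc).
  by apply: pullback_density_finite => //; apply: filterS2 n e => x -> ->.
rewrite (pullback_density_infinite jp hu n); apply: (eq_trans _ sc).
by apply: (pullback_density_infinite ip hc); apply: filterS2 n e => x -> ->.
Qed.

End Univalent.

(** * Extension of exp (int w) to the poles of residue 1 and -1 *)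

Section PoleGerm.
Variables (R : realType) (S : riemannSurface R) (w : meromorphicForm S) (U : S -> R).
Local Notation Co := (R[i]^o).
Local Notation Pl := (poles w).
Implicit Types (i j : chart S) (x y p q : S) (h : S -> option R[i]).
Hypothesis nonzero : forall i p, dom i p -> exists n, has_order (w i) i p n.
Hypothesis U_exact : forall x i, ~ Pl x -> dom i x ->
  is_dx (U \o crd_inv i) (crd i x) (Re (w i x)) /\
  is_dy (U \o crd_inv i) (crd i x) (- Im (w i x)).
Variables (i : chart S) (p : S) (r : R) (k : Co -> Co).
Hypotheses (ip : dom i p) (r0 : r != 0) (hk : holomorphic_at k (crd i p)).
Hypothesis wE : \forall x \near p, x != p -> w i x = r%:C / (crd i x - crd i p) + k (crd i x).

Lemma log_deriv_pos (z0 z K E W : R[i]) : z - z0 != 0 -> W = 1 / (z - z0) + K ->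
  (1 - 0) * E + (z - z0) * (E * (1 * K)) = W * ((z - z0) * E).
Proof. by move=> n ->; field. Qed.

Lemma log_deriv_neg (z0 z K E W : R[i]) : z - z0 != 0 -> E != 0 -> W = (- 1) / (z - z0) + K ->
  - ((1 - 0) * E + (z - z0) * (E * (- 1 * K))) / ((z - z0) * E) ^+ 2 = W * ((z - z0) * E)^-1.
Proof. by move=> n n' ->; field; rewrite n n'. Qed.

(** With residue 1 or -1 at p, exp (int w) extends to p by a simple zero or a
    simple pole. *)
Lemma pole_dev_germ : `|r| = 1 -> exists h,
  [/\ dev_germ w U p h, univalent_in i h p & forall a, h p = Some a -> a = 0].
Proof.
move=> r1; have [H [dH UE]] := pole_potential nonzero U_exact ip r0 hk wE.
pose E (z : Co) : Co := cexp (r%:C * H z); pose u (z : Co) : Co := (z - crd i p) * E z.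
have dE (z : Co) d : is_derive z 1 H d -> is_derive z 1 u ((1 - 0) * E z + (z - crd i p) * (E z * (r%:C * d))).
  move=> dd; have d1 := @cdB R (fun z => z) (fun=> crd i p) z _ _ (cd_id _) (cd_cst _ _).
  exact: (@cdM R _ _ z _ _ d1 (@cd_comp R (@cexp R) _ z _ _ (cd_cexp _) (cdZ r%:C dd))).
have hu : holomorphic_at u (crd i p).
  by apply: filterS dH => z /dE d; exact: (@ex_derive _ _ _ _ _ _ _ d).
have du : derive1 u (crd i p) != 0.
  rewrite (cd_derive1 (dE _ _ (nbhs_singleton dH))) subrr mul0r addr0 subr0 mul1r.
  exact: cexp_neq0.
have E0 z : E z != 0 by exact: cexp_neq0.
have n : \forall y \near p, [/\ dom i y, is_derive (crd i y : Co) 1 H (k (crd i y)), (y != p -> ~ Pl y),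
   (y != p -> w i y = r%:C / (crd i y - crd i p) + k (crd i y))
   & (y != p -> U y = r * ln (cabs (crd i y - crd i p)) + Re (H (crd i y)))].
  have n2 : \forall y \near p, dom i y /\ is_derive (crd i y : Co) 1 H (k (crd i y)).
    exact: filterI (dom_near ip) (crd_near ip dH).
  have n3 : \forall y \near p, (y != p -> w i y = r%:C / (crd i y - crd i p) + k (crd i y)) /\
    (y != p -> U y = r * ln (cabs (crd i y - crd i p)) + Re (H (crd i y))) by exact: filterI wE UE.
  by apply: filterS3 n2 (poles_isolated nonzero p) n3 => y [? ?] ? [].
have n' := near_join n.
have away y : dom i y -> y != p -> \forall x \near y, x != p.
  move=> iy yp; have : \forall z \near (crd i y : Co), z - crd i p != 0.
    apply: (@neq0_near _ (fun z => z - crd i p)); last first.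
      by rewrite subr_eq0; apply: contra_neq yp; exact: crd_inj.
    exact: (hol_cont (@holB _ (fun z => z) (fun=> crd i p) _ (hol_id _) (hol_cst _ _))).
  by move=> /(crd_near iy); apply: filterS => x; apply: contra_neq => ->; rewrite subrr.
have nz x : dom i x -> x != p -> crd i x - crd i p != 0.
  by move=> ix xp; rewrite subr_eq0; apply: contra_neq xp; exact: crd_inj.
have up : u (crd i p) = 0 by rewrite /u subrr mul0r.
have [re|re] : r = 1 \/ r = - 1.
  by move: r1; case: (lerP 0 r) => h; [rewrite ger0_norm//; left|rewrite ltr0_norm//; right; lra].
- exists (fun x => Some (u (crd i x))); split; last first.
  + by move=> a; rewrite up => -[].
  + by exists u; split=> //; left; exact: filterE.
  split; first by apply: (germ_in_meromorphic ip (u := u)); split=> //; left; exact: filterE.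
  apply: filterS2 n n' => y [iy _ ny _ _] nx yp.
  apply: (exp_germ_chart (ny yp) iy (v := u)); first exact: filterE.
    apply: filterS2 nx (away y iy yp) => x [ix _ _ _ Ux] xp.
    rewrite Ux// re mul1r expRD lnK ?posrE ?cabs_gt0 ?nz//.
    by rewrite cabsM cabs_cexp re mul1r.
  apply: filterS2 nx (away y iy yp) => x [ix dx _ wx _] xp.
  apply: cd_eq (dE _ _ dx); move: (wx xp); rewrite re; exact: log_deriv_pos (nz x ix xp).
- have hn : \forall x \near p, sphere_inv (sphere_inv (Some (u (crd i x)))) = Some (u (crd i x)).
    by apply: filterE => x; rewrite sphere_invK.
  have un : univalent_in i (fun x => sphere_inv (Some (u (crd i x)))) p by exists u; split=> //; right.
  exists (fun x => sphere_inv (Some (u (crd i x)))); split=> //; last first.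
    by move=> a; rewrite up /= eqxx.
  split; first exact: univalent_meromorphic ip un.
  apply: filterS2 n n' => y [iy _ ny _ _] nx yp.
  apply: (exp_germ_chart (ny yp) iy (v := fun z => (u z)^-1)).
  - apply: filterS2 nx (away y iy yp) => x [ix _ _ _ _] xp /=.
    by rewrite /u mulf_eq0 (negbTE (nz x ix xp)) (negbTE (E0 _)).
  - apply: filterS2 nx (away y iy yp) => x [ix _ _ _ Ux] xp.
    rewrite Ux// re mulN1r expRD expRN lnK ?posrE ?cabs_gt0 ?nz//.
    by rewrite cabsV cabsM invfM cabs_cexp re -expRN; congr (_ * expR _); rewrite !ReImE /=; ring.
  apply: filterS2 nx (away y iy yp) => x [ix dx _ wx _] xp.
  have u0 : u (crd i x) != 0 := mulf_neq0 (nz x ix xp) (E0 _).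
  apply: cd_eq (cdV u0 (dE _ _ dx)); move: (wx xp); rewrite re rmorphN rmorph1.
  exact: log_deriv_neg (nz x ix xp) (E0 _).
Qed.

End PoleGerm.

(** * The metric of curvature one *)

Section IsolatedSets.
Variables (R : realType) (S : riemannSurface R).
Implicit Types (x y p q : S) (Z : set S).

(** If Z were infinite, the cofinite subsets of Z would generate a filter, which
    clusters at some point by compactness; but punctured neighbourhoods avoid
    Z. *)
Lemma compact_isolated_finite Z : compact [set: S] -> isolated_set Z -> finite_set Z.
Proof.
move=> cS iZ; apply: contrapT => nf.
pose F : set_system S := fun A => finite_set (Z `\` A).
have FF : ProperFilter F.
  split; first by rewrite /F setD0.
  split; first by rewrite /F setDT.
    by move=> A B; rewrite /F setDIr finite_setU.
  by move=> A B AB; apply: sub_finite_set => x [Zx nA]; split=> // /AB.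
have [x [_ cl]] := cS F FF (filterT : F setT).
have Fx : F (fun y => Z y /\ y != x).
  apply: sub_finite_set (finite_set1 x) => y [Zy n]; apply: contrapT => yx; apply: n.
  by split=> //; apply/eqP.
by have [y [[Zy yx] h]] := cl _ _ Fx (iZ x); exact: h yx Zy.
Qed.

Lemma finite_isolated Z : finite_set Z -> isolated_set Z.
Proof.
move=> fZ x; have c : closed (Z `\ x).
  apply: compact_closed; first exact: surface_hausdorff.
  by apply: finite_compact; apply: sub_finite_set fZ => y [].
have : nbhs x (~` (Z `\ x)).
  by apply: open_nbhs_nbhs; split; [exact: closed_openC|move=> [_]; exact].
by apply: filterS => y h yx Zy; apply: h; split=> //; apply/eqP.
Qed.

Lemma isolated_setU Z Z' : isolated_set Z -> isolated_set Z' -> isolated_set (Z `|` Z').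
Proof. by move=> a b x; apply: filterS2 (a x) (b x) => y h h' yx [/(h yx)|/(h' yx)]. Qed.

Lemma isolated_sub Z Z' : Z `<=` Z' -> isolated_set Z' -> isolated_set Z.
Proof. by move=> s a x; apply: filterS (a x) => y h yx /s; exact: h. Qed.

Lemma isolated_open Z : isolated_set Z -> forall x, ~ Z x -> nbhs x (~` Z).
Proof.
by move=> iZ x nZ; apply: filterS (iZ x) => y h Zy; have [e|/h//] := eqVneq y x; rewrite e in Zy.
Qed.

End IsolatedSets.

Section LocalSmoothness.
Variable R : realType.
Local Notation Co := (R[i]^o).
Implicit Types (u v : Co -> R) (V W : set Co).

Lemma Ck'_local n V u : (forall z, V z -> exists2 W, W z & Ck' n W u) -> Ck' n V u.
Proof.
elim: n u => [|n IH] u H; split.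
- by move=> z /H[W Wz [c _]]; exact: c.
- by [].
- by move=> z /H[W Wz [c _]]; exact: c.
split.
- by move=> z /H[W Wz [_ [h _ _ _]]]; exact: h.
- by move=> z /H[W Wz [_ [_ h _ _]]]; exact: h.
- by apply: IH => z /H[W Wz [_ [_ _ h _]]]; exists W.
- by apply: IH => z /H[W Wz [_ [_ _ _ h]]]; exists W.
Qed.

Lemma dx_near u v (z : Co) : (\forall t \near z, u t = v t) -> dx u z = dx v z.
Proof.
move=> e; rewrite /dx !derive1E; apply: near_eq_derive => //.
by have := near_line_x e.
Qed.

Lemma dy_near u v (z : Co) : (\forall t \near z, u t = v t) -> dy u z = dy v z.
Proof.
move=> e; rewrite /dy !derive1E; apply: near_eq_derive => //.
by have := near_line_y e.
Qed.

Lemma gauss_curvature_near u v (z : Co) : (\forall t \near z, u t = v t) ->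
  gauss_curvature u z = gauss_curvature v z.
Proof.
move=> e; rewrite /gauss_curvature (nbhs_singleton e).
have e1 : \forall t \near z, ln (u t) / 2 = ln (v t) / 2 by apply: filterS e => t ->.
have e2 : \forall t \near z, \forall s \near t, ln (u s) / 2 = ln (v s) / 2 by exact: near_join.
have ex := dx_near (filterS (fun t h => dx_near h) e2).
have ey := dy_near (filterS (fun t h => dy_near h) e2).
by rewrite ex ey.
Qed.

End LocalSmoothness.

Section Metric.
Variables (R : realType) (S : riemannSurface R) (w : meromorphicForm S) (U : S -> R).
Local Notation Co := (R[i]^o).
Local Notation Pl := (poles w).
Implicit Types (i j : chart S) (x y p q : S) (h k : S -> option R[i]).
Hypothesis nonzero : forall i p, dom i p -> exists n, has_order (w i) i p n.
Hypothesis U_exact : forall x i, ~ Pl x -> dom i x ->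
  is_dx (U \o crd_inv i) (crd i x) (Re (w i x)) /\
  is_dy (U \o crd_inv i) (crd i x) (- Im (w i x)).
Hypothesis simple_poles : third_kind w.
Hypothesis real_residues : forall p, Pl p -> Res w p != 0 /\ Im (Res w p) = 0.

Lemma pole_data p : Pl p -> exists i (r : R) (k : Co -> Co),
  [/\ dom i p, r != 0, Res w p = r%:C, holomorphic_at k (crd i p) &
      \forall x \near p, x != p -> w i x = r%:C / (crd i x - crd i p) + k (crd i x)].
Proof.
move=> Pp; have [r0 rr] := real_residues Pp.
have [i [k [ip hk e]]] := pole_form (simple_poles Pp) r0.
have er : Res w p = (Re (Res w p))%:C by apply: complex_eq.
exists i, (Re (Res w p)), k; split=> //; last by rewrite -er.
by apply: contra_neq r0 => e0; rewrite er e0.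
Qed.

(** The zeros of w and the poles at which exp (int w) has no single-valued
    locally injective extension. *)
Definition singular : set S := [set p | zeros w p \/ (Pl p /\ cabs (Res w p) != 1)].

(** The order has a well-defined sign. *)
Lemma zero_not_pole p : zeros w p -> ~ Pl p.
Proof.
move=> [n [n0 on]] [m [m0 om]].
by have := order_sign om on m0; move=> /lt_trans/(_ n0); rewrite ltxx.
Qed.

Lemma singular_isolated : isolated_set singular.
Proof.
apply: isolated_sub (isolated_setU (zeros_isolated nonzero) (poles_isolated nonzero)).
by move=> p [|[]]; [left|right].
Qed.

Lemma smooth_dev p : (Pl p -> cabs (Res w p) = 1) -> exists h, dev_germ w U p h.
Proof.
move=> H; have [Pp|nP] := pselect (Pl p); last first.
  have [F nF _] := @normalized_primitive_exists _ _ _ _ nonzero U_exact p (U p)%:C nP erefl.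
  by exists (fun y => Some (cexp (F y))); exact: (exp_germ_dev nonzero (exp_germ_exp nP nF)).
have [i [r [k [ip r0 er hk e]]]] := pole_data Pp.
have r1 : `|r| = 1 by rewrite -cabsR -er H.
by have [h [d _ _]] := pole_dev_germ nonzero U_exact ip r0 hk e r1; exists h.
Qed.

Lemma nonsingular_residue p : ~ singular p -> Pl p -> cabs (Res w p) = 1.
Proof.
move=> ns Pp; have [//|n] := eqVneq (cabs (Res w p)) 1.
by exfalso; apply: ns; right.
Qed.

Lemma nonsingular_dev p : ~ singular p -> exists h, dev_germ w U p h.
Proof. by move=> ns; apply: smooth_dev; exact: nonsingular_residue. Qed.

Lemma nonsingular_univalent i p h : ~ singular p -> dev_germ w U p h -> dom i p ->
  univalent_in i h p.
Proof.
move=> ns d ip; have [Pp|nP] := pselect (Pl p); last first.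
  have [u [hu e] [du u0 _]] := exp_germ_holomorphic ip (dev_germ_regular nonzero U_exact nP d).
  exists u; split=> //; last by left.
  have w0 : w i p != 0.
    by apply/eqP => w0; apply: ns; left; apply/(zerosP nonzero nP ip).
  by have n := mulf_neq0 w0 u0; rewrite -du in n.
have [j [r [k [jp r0 er hk e]]]] := pole_data Pp.
have r1 : `|r| = 1 by rewrite -cabsR -er nonsingular_residue.
have [h0 [d0 u0 _]] := pole_dev_germ nonzero U_exact jp r0 hk e r1.
have [a a1 ea] := dev_germ_compare d d0; apply: (univalent_change jp ip).
exact: univalent_ext (germ_eq_sym ea) (univalent_scale (unit_neq0 a1) u0).
Qed.

Lemma smooth_pole_value p h (a : R[i]) : Pl p -> cabs (Res w p) = 1 -> dev_germ w U p h ->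
  h p = Some a -> a = 0.
Proof.
move=> Pp res1 d; have [j [r [k [jp r0 er hk e]]]] := pole_data Pp.
have r1 : `|r| = 1 by rewrite -cabsR -er.
have [h0 [d0 _ H]] := pole_dev_germ nonzero U_exact jp r0 hk e r1.
have [b b1 eb] := dev_germ_compare d d0; rewrite (nbhs_singleton eb) /scale.
by case: (h0 p) H => //= t /(_ t erefl) ->; rewrite mulr0 => -[].
Qed.

Lemma exp_germ_density i p h : dom i p -> exp_germ w U p h ->
  pullback_density i h p = 4 * (cabs (w i p) * expR (U p)) ^+ 2 / (1 + expR (U p) ^+ 2) ^+ 2.
Proof.
move=> ip /(exp_germ_holomorphic ip)[u [_ e] [du _ m]].
by rewrite (pullback_density_finite ip e) /spher du (cabsM (w i p) (u (crd i p))) m.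
Qed.

Section Model.
Variable model : S -> S -> option R[i].
Hypothesis model_dev : forall p, ~ singular p -> dev_germ w U p (model p).

(** The model germ at p is arbitrary among those of exp (int w): they differ by
    rotations, which do not change the density. *)
Definition density i p : R := pullback_density i (model p) p.

Lemma densityE i p h : ~ singular p -> dom i p -> dev_germ w U p h ->
  density i p = pullback_density i h p.
Proof.
move=> ns ip d; have dm := model_dev ns; have [a a1 e] := dev_germ_compare dm d.
rewrite /density (pullback_density_ext ip dm.1 e).
exact: pullback_density_scale a1 ip d.1.
Qed.

Lemma nonsingular_near p : ~ singular p -> \forall x \near p, ~ singular x.
Proof. exact: isolated_open singular_isolated _. Qed.

(** Near p the models at all points can be replaced by the one at p. *)
Lemma density_local i p : ~ singular p -> dom i p -> exists u : Co -> Co,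
  [/\ holomorphic_at u (crd i p), derive1 u (crd i p) != 0 &
      \forall x \near p, density i x = spher u (crd i x)].
Proof.
move=> ns ip; have d := model_dev ns.
have [u [hu du e]] := univalent_pullback ip (nonsingular_univalent ns d ip).
exists u; split; [exact: hu|exact: du|].
have n : \forall x \near p, ~ singular x /\ dom i x.
  exact: filterI (nonsingular_near ns) (dom_near ip).
by apply: filterS3 n (dev_germ_near nonzero d) e => x [nx ix] dx <-; exact: densityE.
Qed.

Lemma density_compat i j x : ~ singular x -> dom i x -> dom j x ->
  density i x = density j x * cabs (transition' i j x) ^+ 2.
Proof. by move=> ns ix jx; exact: pullback_density_change (model_dev ns).1. Qed.

Lemma density_gt0 i x : ~ singular x -> dom i x -> 0 < density i x.
Proof.
move=> ns ix; have [u [_ du e]] := density_local ns ix.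
by rewrite (nbhs_singleton e); exact: spher_gt0.
Qed.

Lemma density_chart i p : ~ singular p -> dom i p -> exists u : Co -> Co,
  [/\ holomorphic_at u (crd i p), derive1 u (crd i p) != 0 &
      \forall z \near (crd i p : Co), density i (crd_inv i z) = spher u z].
Proof.
move=> ns ip; have [u [hu du e]] := density_local ns ip; exists u; split; [exact: hu|exact: du|].
apply: filterS2 (crd_inv_near ip e) (chart_image_near ip) => z.
by move=> ez [_ eq]; rewrite eq in ez.
Qed.

Lemma density_smooth i : smooth_on (crd i @` (dom i `\` singular)) (density i \o crd_inv i).
Proof.
move=> n; apply: Ck'_Ck; apply: Ck'_local => z [p [ip ns] <-].
have [u [hu du e]] := density_chart ns ip.
have n1 : \forall z \near (crd i p : Co), holomorphic_at u z /\ density i (crd_inv i z) = spher u z.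
  exact: filterI (hol_near hu) e.
have n2 := nbhs_interior n1.
exists (interior [set z : Co | holomorphic_at u z /\ density i (crd_inv i z) = spher u z]).
  exact: nbhs_singleton n2.
have oW := @open_interior _ [set z : Co | holomorphic_at u z /\ density i (crd_inv i z) = spher u z].
apply: (Ck'_ext oW (u := spher u)); last first.
  by apply: (@spher_smooth R n _ u oW) => t /interior_subset[hut _]; exact: hut.
by move=> t /interior_subset[_ <-].
Qed.

Lemma density_curvature i x : ~ singular x -> dom i x ->
  gauss_curvature (density i \o crd_inv i) (crd i x) = 1.
Proof.
move=> ns ix; have [u [hu du e]] := density_chart ns ix.
by rewrite (gauss_curvature_near e); exact: spher_curvature.
Qed.

Hypothesis S_compact : compact [set: S].

Definition spherical_metric : conformalMetric S :=
  ConformalMetric (compact_isolated_finite S_compact singular_isolated)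
    density_compat density_gt0 density_smooth.

End Model.
End Metric.

(** * Cone angles *)

Section RealContinuity.
Variable R : realType.
Local Notation Co := (R[i]^o).

Lemma continuous_norm_powR (a t : R) : 0 < a -> {for t, continuous (fun t : R => `|t| `^ a)}.
Proof.
move=> a0; have [->|t0] := eqVneq t 0.
  move=> W HW; have p0 : (0 : R) `^ a = 0 by rewrite powR0// gt_eqF.
  have HW' : nbhs (0 : R) W by move: HW; rewrite /= normr0 p0.
  have [e /= e0 He] := powR_cvg0 a0 HW'.
  apply/nbhs_ballP; exists e => // s; rewrite /ball /= sub0r normrN => se.
  have [->|s0] := eqVneq s 0; first by rewrite normr0 p0; exact: nbhs_singleton.
  by apply: He; rewrite /= ?sub0r ?normrN ?normr_id ?normr_gt0.
apply: (@continuous_comp _ _ _ (fun t : R => `|t|) (fun t => t `^ a) t (@norm_continuous _ _ t)).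
have tp : 0 < `|t| by rewrite normr_gt0.
have d := is_derive1_powR a tp.
by apply/differentiable_continuous/derivable1_diffP; exact: (@ex_derive _ _ _ _ _ _ _ d).
Qed.

Lemma half_log_density (a x : R) : 0 < a ->
  ln (4 * (a * expR x) ^+ 2 / (1 + expR x ^+ 2) ^+ 2) / 2 =
  ln 2 + ln a + x - ln (1 + expR x ^+ 2).
Proof.
move=> a0; have e0 := expR_gt0 x.
have d0 : 0 < 1 + expR x ^+ 2 by rewrite ltr_pwDl// sqr_ge0.
have -> : 4 * (a * expR x) ^+ 2 / (1 + expR x ^+ 2) ^+ 2 = (2 * a * expR x / (1 + expR x ^+ 2)) ^+ 2.
  by field; rewrite gt_eqF.
rewrite lnXn ?divr_gt0 ?mulr_gt0// ln_div ?posrE ?mulr_gt0// lnM ?posrE ?mulr_gt0//.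
rewrite lnM ?posrE// expRK mulr2n; set A := ln _; set B := ln _; set D := ln _; by field.
Qed.

(** The two sides correspond under the isometry w |-> 1/w of the sphere. *)
Lemma log_density_sym (x : R) : x - ln (1 + expR x ^+ 2) = - x - ln (1 + expR (- x) ^+ 2).
Proof.
have e0 := expR_gt0 x.
have d0 : 0 < 1 + expR (- x) ^+ 2 by rewrite ltr_pwDl// sqr_ge0.
have -> : 1 + expR x ^+ 2 = expR x ^+ 2 * (1 + expR (- x) ^+ 2).
  by rewrite expRN; field; rewrite gt_eqF.
rewrite lnM ?posrE ?exprn_gt0// lnXn// expRK mulr2n; ring.
Qed.

Lemma log_modulus_unbounded (a M d : R) (z0 : Co) : 0 < d ->
  (forall z, cabs (z - z0) < d -> z != z0 -> `|a * ln (cabs (z - z0))| <= M) -> a = 0.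
Proof.
move=> d0 H; apply/eqP; apply: contraT => a0; pose K := (`|M| + 1) / `|a|.
pose t := Num.min (d / 2) (expR (- K)).
have t0 : 0 < t by rewrite lt_min divr_gt0// expR_gt0.
have ct : cabs (z0 + t%:C - z0) = t by rewrite addrC addrA addNr add0r cabsR gtr0_norm.
have lt : ln t <= - K by rewrite -[leRHS]expRK ler_ln ?posrE ?expR_gt0// ge_min lexx orbT.
have [] : cabs (z0 + t%:C - z0) < d /\ z0 + t%:C != z0.
  by rewrite -subr_eq0 -cabs_eq0 ct gt_eqF// gt_min; split=> //; apply/orP; left; lra.
move=> /H h /h; rewrite ct normrM leNgt => /negP[].
have K0 : 0 < K by rewrite divr_gt0 ?normr_gt0// ltr_wpDl.
have lt' : K <= `|ln t| by rewrite ler0_norm; lra.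
apply: lt_le_trans (_ : `|M| + 1 <= _); first by have := ler_norm M; lra.
by rewrite mulrC -ler_pdivrMr ?normr_gt0.
Qed.

End RealContinuity.

Section Conical.
Variables (R : realType) (S : riemannSurface R) (w : meromorphicForm S) (U : S -> R).
Local Notation Co := (R[i]^o).
Local Notation Pl := (poles w).
Implicit Types (i j : chart S) (x y p q : S).
Hypothesis nonzero : forall i p, dom i p -> exists n, has_order (w i) i p n.
Hypothesis U_exact : forall x i, ~ Pl x -> dom i x ->
  is_dx (U \o crd_inv i) (crd i x) (Re (w i x)) /\
  is_dy (U \o crd_inv i) (crd i x) (- Im (w i x)).
Hypothesis simple_poles : third_kind w.
Hypothesis real_residues : forall p, Pl p -> Res w p != 0 /\ Im (Res w p) = 0.

Lemma potential_continuous p : ~ Pl p -> {for p, continuous U}.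
Proof.
move=> np; have [F [hF uF] _] := @normalized_primitive_exists _ _ _ _ nonzero U_exact p (U p)%:C np erefl.
have [i ip] := dom_cover p; have dF := nbhs_singleton hF i ip.
have c : {for p, continuous (fun x => Re ((F \o crd_inv i) (crd i x)))}.
  have c : {for (crd i p : Co), continuous (fun z : Co => Re ((F \o crd_inv i : Co -> Co) z) : R)}.
    exact: (continuous_comp (cd_cont dF) (@cont_Re R _)).
  exact: (@continuous_comp _ _ _ (crd i : S -> Co) _ p (crd_continuous ip) c).
move=> W; rewrite /= -(nbhs_singleton uF) => HW.
have e : Re ((F \o crd_inv i) (crd i p)) = Re (F p) by rewrite /= crdK.
rewrite -e in HW.
have HW' : \forall x \near p, W (Re (F (crd_inv i (crd i x)))) by exact: c W HW.
change (\forall x \near p, W (U x)).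
by apply: filterS3 HW' uF (dom_near ip) => x /= Wx <- ix; rewrite crdK in Wx.
Qed.

Variable g : conformalMetric S.
Hypothesis gE : forall p, \forall x \near p, x != p -> forall i, dom i x ->
  g i x = 4 * (cabs (w i x) * expR (U x)) ^+ 2 / (1 + expR (U x) ^+ 2) ^+ 2.

(** Off p the density is 4 |w|^2 e^(2U) / (1 + e^(2U))^2, where U is continuous
    and |w| behaves like |z - z(p)|^n. *)
Lemma conical_zero p (n : nat) : ~ Pl p -> ord_form w p n%:Z -> conical g p (n%:R + 1).
Proof.
move=> nP [i [ip [h [hh h0 e]]]]; split; first by rewrite ltr_wpDl.
exists i, (fun x => ln 2 + ln (cabs (h (crd i x))) + U x - ln (1 + expR (U x) ^+ 2)).
have nh : \forall x \near p, holomorphic_at h (crd i x) /\ h (crd i x) != 0.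
  exact: filterI (crd_near ip (hol_near hh)) (crd_near ip (neq0_near (hol_cont hh) h0)).
have nd : \forall x \near p, dom i x /\ ~ Pl x by exact: filterI (dom_near ip) (regular_near nonzero nP).
split=> //.
  apply: filterS2 nh nd => x [hx h0x] [ix nx]; have cU := potential_continuous nx.
  have c1 : {for x, continuous (fun x => ln (cabs (h (crd i x))))}.
    apply: (@continuous_comp _ _ _ (crd i : S -> Co) (fun z => ln (cabs (h z))) x (crd_continuous ix)).
    apply: (@continuous_comp _ _ _ h (fun z => ln (cabs z)) _ (hol_cont hx)).
    by apply: (@continuous_comp _ _ _ _ _ _ (@cont_cabs R _)); apply: continuous_ln; rewrite cabs_gt0.
  have ce : {for x, continuous (fun x => expR (U x))} := continuous_comp cU (@continuous_expR R _).
  have c2 : {for x, continuous (fun x => ln (1 + expR (U x) ^+ 2))}.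
    have c3 : {for x, continuous (fun x => 1 + expR (U x) * expR (U x))}.
      exact: (continuousD (@cst_continuous _ _ _ _) (continuousM ce ce)).
    by apply: (@continuous_comp _ _ _ _ _ _ c3); apply: continuous_ln; rewrite ltr_pwDl// sqr_ge0.
  exact: (continuousB (continuousD (continuousD (@cst_continuous _ _ _ _) c1) cU) c2).
have goal : \forall x \near p, x != p ->
    ln (g i x) / 2 - (n%:R + 1 - 1) * ln (cabs (crd i x - crd i p)) =
    ln 2 + ln (cabs (h (crd i x))) + U x - ln (1 + expR (U x) ^+ 2).
  have ng : \forall x \near p, (x != p -> forall i, dom i x ->
    g i x = 4 * (cabs (w i x) * expR (U x)) ^+ 2 / (1 + expR (U x) ^+ 2) ^+ 2) /\
    w i x = (crd i x - crd i p) ^ n%:Z * h (crd i x) by exact: filterI (gE p) e.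
  apply: filterS3 ng nh nd => x [gx ex] [_ h0x] [ix _] xp.
  have z0 : 0 < cabs (crd i x - crd i p).
    by rewrite cabs_gt0 subr_eq0; apply: contra_neq xp; exact: crd_inj.
  have hp : 0 < cabs (h (crd i x)) by rewrite cabs_gt0.
  rewrite (gx xp i ix) ex -exprnP cabsM cabsX half_log_density ?mulr_gt0 ?exprn_gt0//.
  rewrite lnM ?posrE ?exprn_gt0// lnXn// -mulr_natl.
  by set A := ln _; set B := ln _; set D := ln _; set E := ln _; ring.
exact: goal.
Qed.

(** Here |w| behaves like 1 / |z - z(p)| and e^U like |z - z(p)|^r, where r is
    the residue. Inversion of the sphere reduces the case r < 0 to r > 0, in
    which 1 + e^(2U) tends to 1. *)
Lemma conical_pole p : Pl p -> conical g p (cabs (Res w p)).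
Proof.
move=> Pp; have [i [r [k [ip r0 er hk wE]]]] := pole_data simple_poles real_residues Pp.
have [H [dH UE]] := pole_potential nonzero U_exact ip r0 hk wE.
rewrite er cabsR; have rp : 0 < `|r| by rewrite normr_gt0.
(* s U tends to minus infinity at p *)
have [s [s1 rs]] : exists s : R, (s = 1 \/ s = -1) /\ `|r| = s * r.
  case: (lerP 0 r) => hr; first by exists 1; rewrite mul1r ger0_norm//; split=> //; left.
  by exists (-1); rewrite mulN1r ltr0_norm//; split=> //; right.
pose z0 := crd i p; pose N (z : Co) : R := (`|cabs (z - z0)| `^ `|r|) * expR (s * Re (H z)).
pose v (z : Co) : R := ln 2 + ln (cabs (r%:C + (z - z0) * k z)) + s * Re (H z) - ln (1 + N z * N z).
split=> //; exists i, (fun x => v (crd i x)).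
have hr : holomorphic_at (fun z => r%:C + (z - z0) * k z) z0.
  have h1 := @holB _ (fun z => z) (fun=> z0) z0 (hol_id _) (hol_cst _ _).
  exact: (@holD _ (fun=> r%:C) _ _ (hol_cst _ _) (@holM _ _ k _ h1 hk)).
have r0' : r%:C + (z0 - z0) * k z0 != 0.
  by rewrite subrr mul0r addr0; apply: contra_neq r0 => /(congr1 (@complex.Re R)).
have nr : \forall z \near (z0 : Co), r%:C + (z - z0) * k z != 0.
  exact: (@neq0_near _ (fun z => r%:C + (z - z0) * k z) _ (hol_cont hr) r0').
split=> //.
  have n : \forall x \near p, dom i x /\ r%:C + (crd i x - z0) * k (crd i x) != 0.
    exact: filterI (dom_near ip) (crd_near ip nr).
  have n' : \forall x \near p, holomorphic_at (fun z => r%:C + (z - z0) * k z) (crd i x) /\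
      is_derive (crd i x : Co) 1 H (k (crd i x)).
    exact: filterI (crd_near ip (hol_near hr)) (crd_near ip dH).
  apply: filterS2 n n' => x [ix nx] [hx dx].
  apply: (@continuous_comp _ _ _ (crd i : S -> Co) v x (crd_continuous ix)).
  have c1 : {for (crd i x : Co), continuous (fun z : Co => ln (cabs (r%:C + (z - z0) * k z)))}.
    apply: (@continuous_comp _ _ _ (fun z : Co => r%:C + (z - z0) * k z : Co) (fun z => ln (cabs z)) (crd i x) (hol_cont hx)).
    by apply: (@continuous_comp _ _ _ _ _ _ (@cont_cabs R _)); apply: continuous_ln; rewrite cabs_gt0.
  have c2 : {for (crd i x : Co), continuous (fun z : Co => s * Re (H z))}.
    exact: (continuousM (@cst_continuous _ _ _ _) (continuous_comp (cd_cont dx) (@cont_Re R _))).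
  have c3 : {for (crd i x : Co), continuous (fun z : Co => `|cabs (z - z0)| `^ `|r|)}.
    have h1 := hol_cont (@holB _ (fun z => z) (fun=> z0) (crd i x) (hol_id _) (hol_cst _ _)).
    apply: (@continuous_comp _ _ _ (fun z : Co => z - z0 : Co) (fun z => `|cabs z| `^ `|r|) _ h1).
    exact: (@continuous_comp _ _ _ (@cabs R : Co -> R) (fun t : R => `|t| `^ `|r|) _ (@cont_cabs R _) (@continuous_norm_powR R _ _ rp)).
  have c4 : {for (crd i x : Co), continuous N}.
    exact: (continuousM c3 (continuous_comp c2 (@continuous_expR R _))).
  have c5 : {for (crd i x : Co), continuous (fun z : Co => ln (1 + N z * N z))}.
    have c6 : {for (crd i x : Co), continuous (fun z : Co => 1 + N z * N z)}.
      exact: (continuousD (@cst_continuous _ _ _ _) (continuousM c4 c4)).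
    by apply: (@continuous_comp _ _ _ _ _ _ c6); apply: continuous_ln; rewrite ltr_pwDl// -expr2 sqr_ge0.
  exact: (continuousB (continuousD (continuousD (@cst_continuous _ _ _ _) c1) c2) c5).
have goal : \forall x \near p, x != p ->
    ln (g i x) / 2 - (`|r| - 1) * ln (cabs (crd i x - crd i p)) = v (crd i x).
  have n1 : \forall x \near p, dom i x /\ r%:C + (crd i x - z0) * k (crd i x) != 0.
    exact: filterI (dom_near ip) (crd_near ip nr).
  have n2 : \forall x \near p, (x != p -> w i x = r%:C / (crd i x - crd i p) + k (crd i x)) /\
     (x != p -> U x = r * ln (cabs (crd i x - crd i p)) + Re (H (crd i x))) by exact: filterI wE UE.
  apply: filterS3 (gE p) n1 n2 => x gx [ix nx] [wx Ux] xp.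
  have zp : crd i x - crd i p != 0 by rewrite subr_eq0; apply: contra_neq xp; exact: crd_inj.
  have z1 : 0 < cabs (crd i x - crd i p) by rewrite cabs_gt0.
  have rk : 0 < cabs (r%:C + (crd i x - z0) * k (crd i x)) by rewrite cabs_gt0.
  have we : w i x = (r%:C + (crd i x - z0) * k (crd i x)) / (crd i x - crd i p).
    by rewrite (wx xp) mulrDl -/z0 [_ * k _]mulrC mulfK.
  rewrite (gx xp i ix) half_log_density; last by rewrite we cabs_div divr_gt0.
  rewrite we cabs_div ln_div ?posrE// /v.
  have NE : N (crd i x) = expR (s * U x).
    rewrite /N ger0_norm ?cabs_ge0// /powR (gt_eqF z1) -expRD rs (Ux xp); congr expR.
    by rewrite -/z0; ring.
  have sym : U x - ln (1 + expR (U x) ^+ 2) = s * U x - ln (1 + expR (s * U x) ^+ 2).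
    by case: s1 => ->; rewrite ?mul1r ?mulN1r//; exact: log_density_sym.
  rewrite NE -expr2 -/z0; rewrite -/z0 in Ux; move: sym; rewrite (Ux xp) rs.
  set A := ln _; set B := ln _; set D := ln _; set L1 := ln _; set L2 := ln _ => sym.
  have -> : B = D + (r * A + Re (H (crd i x))) - s * (r * A + Re (H (crd i x))) by lra.
  ring.
exact: goal.
Qed.

End Conical.

(** * Uniqueness of the metric *)

Section ConformalMetrics.
Variables (R : realType) (S : riemannSurface R).
Local Notation Co := (R[i]^o).
Implicit Types (i j : chart S) (x y p q : S) (g : conformalMetric S).

Lemma dens_continuous g i p : ~ sing g p -> dom i p ->
  {for (crd i p : Co), continuous (g i \o crd_inv i : Co -> R)}.
Proof. by move=> np ip; apply: (dens_smooth g i 0); exists p. Qed.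

Lemma conical_congr g g' p (a : R) :
  (\forall x \near p, x != p -> forall i, dom i x -> g i x = g' i x) ->
  conical g p a -> conical g' p a.
Proof.
move=> e [a0 [i [v [ip cv h]]]]; split=> //; exists i, v; split=> //.
have h' : \forall x \near p, x != p -> ln (g i x) / 2 - (a - 1) * ln (cabs (crd i x - crd i p)) = v x := h.
have goal : \forall x \near p, x != p -> ln (g' i x) / 2 - (a - 1) * ln (cabs (crd i x - crd i p)) = v x.
  by apply: filterS3 e h' (dom_near ip) => x ex hx ix xp; rewrite -(ex xp i ix); exact: hx.
exact: goal.
Qed.

Lemma near_norm_bounded (T : topologicalType) (v : T -> R) (p : T) : {for p, continuous v} ->
  \forall x \near p, `|v x| <= `|v p| + 1.
Proof.
move=> /cvgrPdist_lt/(_ 1 ltr01); apply: filterS => x /ltW h.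
by rewrite -lerBlDl; apply: le_trans (lerB_dist _ _) _; rewrite distrC.
Qed.

(** At an ordinary point the density is continuous and positive, so that the
    logarithmic term of a conical singularity must vanish. *)
Lemma conical_regular g p (a : R) : ~ sing g p -> conical g p a -> a = 1.
Proof.
move=> np [_ [i [v [ip cv h]]]]; have cd := dens_continuous np ip.
have g0 : 0 < (g i \o crd_inv i) (crd i p) by rewrite /= crdK//; exact: dens_gt0.
have cl : {for (crd i p : Co), continuous (fun z : Co => ln ((g i \o crd_inv i) z))}.
  exact: (@continuous_comp _ _ _ (g i \o crd_inv i : Co -> R) (@ln R) _ cd (continuous_ln g0)).
have nl := near_norm_bounded cl; have nv := near_norm_bounded (nbhs_singleton cv).
set M1 := `|ln _| + 1 in nl; set M2 := `|v p| + 1 in nv.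
have h' : \forall x \near p, x != p -> ln (g i x) / 2 - (a - 1) * ln (cabs (crd i x - crd i p)) = v x := h.
have nn : \forall x \near p, x != p -> `|(a - 1) * ln (cabs (crd i x - crd i p))| <= M1 / 2 + M2.
  have nl' : \forall x \near p, `|ln (g i x)| <= M1.
    by apply: filterS2 (crd_near ip nl) (dom_near ip) => x + ix; rewrite /= crdK.
  apply: filterS3 nl' nv h' => x lx vx e xp.
  have -> : (a - 1) * ln (cabs (crd i x - crd i p)) = ln (g i x) / 2 - v x by rewrite -(e xp); ring.
  by move: lx vx; rewrite !ler_norml => /andP[? ?] /andP[? ?]; apply/andP; split; lra.
have n2 : \forall z \near (crd i p : Co)^', dom i (crd_inv i z) /\ crd i (crd_inv i z) = z.
  by apply: nbhs_dnbhs; exact: chart_image_near.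
have [d d0 Hd] : exists2 d : R, 0 < d & forall z, cabs (z - crd i p) < d -> z != crd i p ->
    `|(a - 1) * ln (cabs (z - crd i p))| <= M1 / 2 + M2.
  apply/nearC'; apply: filterS2 (punctured_near ip nn) n2 => z hz [_ ez].
  by rewrite ez in hz.
by apply/eqP; rewrite -subr_eq0; apply/eqP; exact: (log_modulus_unbounded d0 Hd).
Qed.

Lemma dens_punctured_eq g g' i p : ~ sing g p -> ~ sing g' p -> dom i p ->
  (\forall x \near p, x != p -> forall i, dom i x -> g i x = g' i x) -> g i p = g' i p.
Proof.
move=> np np' ip e; have c := dens_continuous np ip; have c' := dens_continuous np' ip.
have n2 : \forall z \near (crd i p : Co)^', dom i (crd_inv i z) by apply: nbhs_dnbhs; apply: filterS (chart_image_near ip) => z [].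
have ez : \forall z \near (crd i p : Co)^', g i (crd_inv i z) = g' i (crd_inv i z).
  by apply: filterS2 (punctured_near ip e) n2 => z h iz; exact: h.
have [r r0 Hr] := (nearC' _ _).1 ez.
apply/eqP; rewrite -subr_eq0 -normr_eq0; apply/eqP/le_anti; rewrite normr_ge0 andbT.
apply/ler_addgt0Pr => t t0; rewrite add0r.
have t2 : 0 < t / 2 by rewrite divr_gt0.
have [d d0 Hd] := (contCR _ _).1 c _ t2; have [d' d0' Hd'] := (contCR _ _).1 c' _ t2.
pose s := Num.min r (Num.min d d') / 2.
have s0 : 0 < s by rewrite divr_gt0// !lt_min r0 d0.
have sm : s < Num.min r (Num.min d d') by rewrite /s; move: s0; rewrite /s; lra.
move: sm; rewrite !lt_min => /and3P[sr sd sd'].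
have cs : cabs (crd i p + s%:C - crd i p) = s by rewrite addrC addrA addNr add0r cabsR gtr0_norm.
have zn : crd i p + s%:C != crd i p by rewrite -subr_eq0 -cabs_eq0 cs gt_eqF.
have e1 := Hr (crd i p + s%:C); rewrite cs in e1; have {}e1 := e1 sr zn.
have a1 := Hd (crd i p + s%:C); rewrite cs /= crdK// in a1; have {}a1 := a1 sd.
have a2 := Hd' (crd i p + s%:C); rewrite cs /= crdK// in a2; have {}a2 := a2 sd'.
rewrite e1 in a1; move: a1 a2; set A := g' i _; rewrite !ltr_norml => /andP[? ?] /andP[? ?].
by rewrite ler_norml; apply/andP; split; lra.
Qed.

End ConformalMetrics.

Section SphericalMetric.
Variables (R : realType) (S : riemannSurface R) (w : meromorphicForm S) (U : S -> R).
Local Notation Pl := (poles w).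
Implicit Types (i j : chart S) (x y p q b : S) (h k : S -> option R[i]).
Hypothesis nonzero : forall i p, dom i p -> exists n, has_order (w i) i p n.
Hypothesis U_exact : forall x i, ~ Pl x -> dom i x ->
  is_dx (U \o crd_inv i) (crd i x) (Re (w i x)) /\
  is_dy (U \o crd_inv i) (crd i x) (- Im (w i x)).
Hypothesis simple_poles : third_kind w.
Hypothesis real_residues : forall p, Pl p -> Res w p != 0 /\ Im (Res w p) = 0.

Lemma spherical_metric_exists : compact [set: S] -> exists g : conformalMetric S,
  [/\ sing g = singular w,
      forall i p h, ~ singular w p -> dom i p -> dev_germ w U p h -> g i p = pullback_density i h p
    & forall i x, ~ singular w x -> dom i x -> gauss_curvature (dens g i \o crd_inv i) (crd i x) = 1].
Proof.
move=> cS; have [p|model Hm] := @choice _ _ (fun p h => ~ singular w p -> dev_germ w U p h).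
  have [s|ns] := pselect (singular w p); first by exists (fun=> None).
  by have [h d] := nonsingular_dev nonzero U_exact simple_poles real_residues ns; exists h.
exists (spherical_metric nonzero U_exact simple_poles real_residues Hm cS); split=> //.
  by move=> i p h; exact: densityE.
by move=> i x; exact: (density_curvature nonzero U_exact simple_poles real_residues Hm).
Qed.

Variable g : conformalMetric S.
Hypothesis g_sing : sing g = singular w.
Hypothesis g_dens : forall i p h, ~ singular w p -> dom i p -> dev_germ w U p h ->
  g i p = pullback_density i h p.
Hypothesis g_curvature : forall i x, ~ singular w x -> dom i x ->
  gauss_curvature (dens g i \o crd_inv i) (crd i x) = 1.

Local Notation formula i x :=
  (4 * (cabs (w i x) * expR (U x)) ^+ 2 / (1 + expR (U x) ^+ 2) ^+ 2).

Lemma spherical_metric_regular i x : ~ singular w x -> ~ Pl x -> dom i x -> g i x = formula i x.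
Proof.
move=> ns nP ix; have [h d] := nonsingular_dev nonzero U_exact simple_poles real_residues ns.
rewrite (g_dens ns ix d); apply: exp_germ_density => //.
exact: (dev_germ_regular nonzero U_exact nP d).
Qed.

Lemma spherical_metric_near p : \forall x \near p, x != p -> forall i, dom i x -> g i x = formula i x.
Proof.
apply: filterS2 (singular_isolated nonzero p) (poles_isolated nonzero p) => x ns nP xp i ix.
exact: spherical_metric_regular (ns xp) (nP xp) ix.
Qed.

(** The zeros of w carry the cone angles 2 pi (order + 1), the poles the
    angles 2 pi |Res|. *)
Lemma spherical_metric_represents (D : S -> R) :
  (forall p, ~ Pl p -> exists n : nat, ord_form w p n%:Z /\ D p = n%:R) ->
  (forall p, Pl p -> D p = cabs (Res w p) - 1) -> represents g D.
Proof.
move=> Dreg Dpole; have near_ := spherical_metric_near; split.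
  rewrite g_sing; apply/seteqP; split=> p.
    move=> [zp|[Pp r1]]; last by rewrite /= Dpole// subr_eq0.
    have nP := zero_not_pole zp; have [n [[j [jp o]] eD]] := Dreg p nP.
    have := (zerosP nonzero nP jp).1 zp => /eqP; rewrite (has_order_at o) /= eD pnatr_eq0.
    by [].
  have [Pp|nP] := pselect (Pl p); first by rewrite /= Dpole// subr_eq0 => r1; right.
  have [n [[j [jp o]] eD]] := Dreg p nP; rewrite /= eD pnatr_eq0 => n0; left.
  by apply/(zerosP nonzero nP jp)/eqP; rewrite (has_order_at o).
move=> p _; have [Pp|nP] := pselect (Pl p).
  have c := conical_pole nonzero U_exact simple_poles real_residues near_ Pp.
  by rewrite (Dpole p Pp) subrK; exact: c.
have [n [on eD]] := Dreg p nP; rewrite eD.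
exact: (conical_zero nonzero U_exact near_ nP on).
Qed.

Lemma spherical_metric_conical : conical_metric_of_curvature_one g.
Proof.
split; last by rewrite g_sing; exact: g_curvature.
have [p|D HD] := @choice _ _ (fun p (d : R) => (~ Pl p -> exists n : nat, ord_form w p n%:Z /\ d = n%:R) /\
    (Pl p -> d = cabs (Res w p) - 1)).
  have [Pp|nP] := pselect (Pl p); first by exists (cabs (Res w p) - 1).
  have [i ip] := dom_cover p; have [n o] := regular_order nonzero nP ip.
  by exists n%:R; split=> // _; exists n; split=> //; exists i.
by exists D; apply: spherical_metric_represents => p; [exact: (HD p).1|exact: (HD p).2].
Qed.

Section Uniqueness.
Variable f : multivalued S.
Hypothesis f_covers : forall x, ~ Pl x -> exists2 h, f x h & exp_germ w U x h.

Lemma pullback_regular g' i x : is_pullback g' f -> ~ sing g' x -> ~ Pl x -> dom i x ->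
  g' i x = formula i x.
Proof.
move=> pb ns nP ix; have [h fh eh] := f_covers nP.
by rewrite (pb x h i fh ns ix); exact: exp_germ_density.
Qed.

(** The pull-back condition prescribes g' off the poles of w and the
    singularities of g'. Its positivity makes the zeros of w singular. At any
    other point one compares the cone angles with those of g: a cone angle
    different from 2 pi cannot occur at an ordinary point of either metric, and
    where both are ordinary they agree by continuity. *)
Lemma spherical_metric_unique g' : (exists D, represents g' D) -> is_pullback g' f ->
  metric_eq g g'.
Proof.
move=> [D [sD cD]] pb.
have near' p : \forall x \near p, x != p -> forall i, dom i x -> g' i x = formula i x.
  apply: filterS2 (finite_isolated (sing_finite g') p) (poles_isolated nonzero p) => x ns nP xp i ix.
  exact: pullback_regular pb (ns xp) (nP xp) ix.
have eqn p : \forall x \near p, x != p -> forall i, dom i x -> g i x = g' i x.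
  by apply: filterS2 (spherical_metric_near p) (near' p) => x e e' xp i ix; rewrite e// e'.
have sE : sing g = sing g'.
  apply/seteqP; split=> p; rewrite g_sing.
    move=> sp; apply: contrapT => ns'; case: sp => [zp|[Pp /eqP r1]].
      have [i ip] := dom_cover p; have nP := zero_not_pole zp.
      have := dens_gt0 ns' ip; rewrite (pullback_regular pb ns' nP ip).
      by rewrite ((zerosP nonzero nP ip).1 zp) cabs0 mul0r expr0n mulr0 mul0r ltxx.
    apply: r1; apply: (conical_regular ns').
    exact: (conical_pole nonzero U_exact simple_poles real_residues near' Pp).
  move=> sp; apply: contrapT; rewrite -g_sing => ns.
  have e : \forall x \near p, x != p -> forall i, dom i x -> g' i x = g i x.
    by apply: filterS (eqn p) => x h xp i ix; rewrite h.
  have := conical_regular ns (conical_congr e (cD p sp)) => /eqP.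
  rewrite -subr_eq0 addrK => /eqP D0; move: sp; rewrite sD /= D0 eqxx //.
by split=> // i x ns ix; apply: dens_punctured_eq => //; rewrite -sE.
Qed.

End Uniqueness.
End SphericalMetric.

(** * Developing maps and reducibility *)

Section DevelopingMap.
Variables (R : realType) (S : riemannSurface R) (w : meromorphicForm S) (U : S -> R).
Local Notation Co := (R[i]^o).
Local Notation Pl := (poles w).
Implicit Types (i j : chart S) (x y p q b : S) (h k : S -> option R[i]).
Hypothesis nonzero : forall i p, dom i p -> exists n, has_order (w i) i p n.
Hypothesis U_exact : forall x i, ~ Pl x -> dom i x ->
  is_dx (U \o crd_inv i) (crd i x) (Re (w i x)) /\
  is_dy (U \o crd_inv i) (crd i x) (- Im (w i x)).
Hypothesis simple_poles : third_kind w.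
Hypothesis real_residues : forall p, Pl p -> Res w p != 0 /\ Im (Res w p) = 0.
Variable g : conformalMetric S.
Hypothesis g_sing : sing g = singular w.
Hypothesis g_dens : forall i p h, ~ singular w p -> dom i p -> dev_germ w U p h ->
  g i p = pullback_density i h p.

Let dev p : (~` singular w) p -> exists h, dev_germ w U p h.
Proof. exact: nonsingular_dev nonzero U_exact simple_poles real_residues p. Qed.

Lemma dev_univalent p h : ~ singular w p -> dev_germ w U p h -> injective_near p h.
Proof.
move=> ns d; have [i ip] := dom_cover p.
exact: univalent_injective ip (nonsingular_univalent nonzero U_exact simple_poles real_residues ns d ip).
Qed.

(** At a pole of w the value of a developing germ is 0 or infinite, so that the
    hypothesis restricts p to regular points. *)
Lemma dev_log_derivative i p h (a : R[i]) : ~ singular w p -> dev_germ w U p h -> dom i p ->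
  h p = Some a -> a != 0 ->
  w i p = derive1 (fun z : Co => odflt 0 (h (crd_inv i z)) : Co) (crd i p) / a.
Proof.
move=> ns d ip hp a0; have [Pp|nP] := pselect (Pl p).
  have e := smooth_pole_value nonzero U_exact simple_poles real_residues Pp (nonsingular_residue ns Pp) d hp.
  by rewrite e eqxx in a0.
have [u [hu e] [du u0 _]] := exp_germ_holomorphic ip (dev_germ_regular nonzero U_exact nP d).
have -> : derive1 (fun z : Co => odflt 0 (h (crd_inv i z)) : Co) (crd i p) = derive1 u (crd i p).
  apply: near_derive1.
  by apply: filterS2 (crd_inv_near ip e) (chart_image_near ip) => z /= -> [_ ->].
have /Some_inj au : Some a = Some (u (crd i p)) by rewrite -hp (nbhs_singleton e).
by rewrite du au mulfK.
Qed.

Section Generated.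
Variables (b : S) (h0 : S -> option R[i]).
Hypotheses (b_ns : ~ singular w b) (h0_dev : dev_germ w U b h0).
Local Notation f := (generated (~` singular w) b h0).

Lemma generated_developing : developing_map g f.
Proof.
rewrite /developing_map g_sing; split.
- exact: (generated_multivalued nonzero dev b_ns h0_dev).
- move=> p h ns /(generated_dev nonzero dev h0_dev)[_ d]; exact: dev_univalent ns d.
- move=> p h i /(generated_dev nonzero dev h0_dev)[ns d] _ ip; exact: g_dens ns ip d.
Qed.

Lemma generated_dlog : is_dlog w f.
Proof.
move=> p h i a /(generated_dev nonzero dev h0_dev)[ns d] ip hp a0.
exact: dev_log_derivative ns d ip hp a0.
Qed.

Lemma generated_multiplicative : Defs.multiplicative g f.
Proof. by rewrite /Defs.multiplicative g_sing; exact: (generated_monodromy nonzero dev h0_dev). Qed.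

End Generated.

(** The equation (a z + b) = l z (c z + d) has three solutions, so that its
    coefficients vanish. *)
Lemma mobius_linear_fix0 (a b c d l z1 z2 z3 : R[i]) : a * d - b * c != 0 -> l != 0 ->
  z1 != z2 -> z1 != z3 -> z2 != z3 ->
  (forall z, z \in [:: z1; z2; z3] -> mobius a b c d (Some z) = Some (l * z)) ->
  mobius a b c d (Some 0) = Some 0.
Proof.
move=> det l0 n12 n13 n23 H.
have root z : z \in [:: z1; z2; z3] -> c * l * z ^+ 2 + (d * l - a) * z - b = 0.
  move=> /H /=; case: eqP => // /eqP nz /Some_inj e.
  have : a * z + b = l * z * (c * z + d) by rewrite -e divfK.
  move=> /eqP; rewrite -subr_eq0 => /eqP e'; rewrite -[RHS]oppr0 -e'; ring.
have r1 := root z1 _; have r2 := root z2 _; have r3 := root z3 _.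
have {}r1 := r1 (mem_head _ _).
have {}r2 := r2 (_ : z2 \in [:: z1; z2; z3]); rewrite !inE eqxx orbT in r2; have {}r2 := r2 isT.
have {}r3 := r3 (_ : z3 \in [:: z1; z2; z3]); rewrite !inE eqxx !orbT in r3; have {}r3 := r3 isT.
have s2 : c * l * (z1 + z2) + (d * l - a) = 0.
  apply: (mulfI (_ : z1 - z2 != 0)); first by rewrite subr_eq0.
  by rewrite mulr0 -[RHS](subrr 0) -{1}r1 -r2; ring.
have s3 : c * l * (z1 + z3) + (d * l - a) = 0.
  apply: (mulfI (_ : z1 - z3 != 0)); first by rewrite subr_eq0.
  by rewrite mulr0 -[RHS](subrr 0) -{1}r1 -r3; ring.
have cl : c * l = 0.
  apply: (mulIf (_ : z2 - z3 != 0)); first by rewrite subr_eq0.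
  by rewrite mul0r -[RHS](subrr 0) -{1}s2 -s3; ring.
have c0 : c = 0 by move/eqP: cl; rewrite mulf_eq0 (negbTE l0) orbF => /eqP.
have e0 : d * l - a = 0 by rewrite -s2 cl mul0r add0r.
have b0 : b = 0 by move: r1; rewrite cl e0 !mul0r add0r sub0r => /eqP; rewrite oppr_eq0 => /eqP.
have d0 : d != 0 by apply: contra_neq det => ->; rewrite b0 mulr0 mul0r subr0.
by rewrite /= c0 b0 !mul0r mulr0 !add0r (negbTE d0) mul0r.
Qed.

Lemma regular_point_exists p0 : ~ Pl p0 -> exists b, ~ singular w b /\ ~ Pl b.
Proof.
move=> np; have n : \forall x \near p0, (x != p0 -> ~ singular w x) /\ ~ Pl x.
  exact: filterI (singular_isolated nonzero p0) (regular_near nonzero np).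
by have [b [h nb] bp] := chart_not_isolated n; exists b; split=> //; exact: h.
Qed.

(** A monodromy map acts on exp (int w) by a rotation; as the germ takes more
    than two values, the map is that rotation, which fixes 0. *)
Lemma monodromy_fixes0 b h0 L : ~ singular w b -> ~ Pl b -> dev_germ w U b h0 ->
  monodromy_group (~` sing g) b h0 L -> L (Some 0) = Some 0.
Proof.
move=> ns nP d [[a [e [c [t [det ->]]]]] [gamma [P ck]]]; rewrite g_sing in P.
have d' := continuation_dev nonzero dev P d ck.
have [l l1 el] := dev_germ_compare d' d; have l0 := unit_neq0 l1.
have [i ib] := dom_cover b.
have [u [hu eu] _] := exp_germ_holomorphic ib (dev_germ_regular nonzero U_exact nP d).
have [V nV inj] := dev_univalent ns d.
have n : \forall x \near b, V x /\ (h0 x = Some (u (crd i x)) /\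
    mobius a e c t (h0 x) = scale l h0 x) by exact: filterI nV (filterI eu el).
have [y Ny yb] := chart_not_isolated n.
have ny : nbhs b (~` [set y]).
  by apply: isolated_open; [exact: finite_isolated|move=> e'; rewrite e' eqxx in yb].
have n' : \forall x \near b, (V x /\ (h0 x = Some (u (crd i x)) /\
    mobius a e c t (h0 x) = scale l h0 x)) /\ x <> y by exact: filterI n ny.
have [z [Nz zy] zb] := chart_not_isolated n'.
have Nb := nbhs_singleton n; have {}zy : z != y by apply/eqP.
have H x : V x /\ (h0 x = Some (u (crd i x)) /\ mobius a e c t (h0 x) = scale l h0 x) ->
    mobius a e c t (Some (u (crd i x))) = Some (l * u (crd i x)).
  by move=> [_ [ex]]; rewrite /scale ex.
have D x x' : V x /\ (h0 x = Some (u (crd i x)) /\ mobius a e c t (h0 x) = scale l h0 x) ->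
    V x' /\ (h0 x' = Some (u (crd i x')) /\ mobius a e c t (h0 x') = scale l h0 x') ->
    x != x' -> u (crd i x) != u (crd i x').
  move=> [Vx [ex _]] [Vx' [ex' _]]; apply: contra_neq => eq; apply: inj => //.
  by rewrite ex ex' eq.
apply: (mobius_linear_fix0 det l0 (D y b Ny Nb yb) (D y z Ny Nz _) (D b z Nb Nz _)).
- by rewrite eq_sym.
- by rewrite eq_sym.
- by move=> s; rewrite !inE => /or3P[] /eqP ->; exact: H.
Qed.

Hypothesis g_conical : conical_metric_of_curvature_one g.
Variable p0 : S.
Hypothesis p0_regular : ~ Pl p0.

Lemma spherical_metric_reducible : reducible g.
Proof.
split=> //; have [b [ns nP]] := regular_point_exists p0_regular; have [h d] := dev ns.
exists (generated (~` singular w) b h), b, h; split; first exact: generated_developing.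
  by apply: generated_refl d.1.
exists (Some 0) => L; exact: monodromy_fixes0.
Qed.

Lemma spherical_metric_character : character_form g w.
Proof.
have red := spherical_metric_reducible.
have [b [ns nP]] := regular_point_exists p0_regular; have [h d] := dev ns.
have dm := generated_developing ns d; have dl := generated_dlog d.
have [tr|ntr] := pselect (trivial_reducible g); [left|right]; split=> //.
  by exists (generated (~` singular w) b h).
by exists (generated (~` singular w) b h); split=> //; exact: generated_multiplicative.
Qed.

End DevelopingMap.

(** * Trivial metrics *)

Section Subpaths.
Variables (R : realType) (S : riemannSurface R).
Implicit Types (gamma : R -> S) (p q x : S) (X : set S) (h k : S -> option R[i]).

Lemma scaled_parameter (t s s0 : R) : 0 <= t <= 1 -> `|t * s - t * s0| <= `|s - s0|.
Proof.
move=> t01; rewrite -mulrBr normrM ler_piMl//.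
by rewrite ger0_norm; lra.
Qed.

Lemma scaled_in01 (t s : R) : 0 <= t <= 1 -> 0 <= s <= 1 -> 0 <= t * s <= 1.
Proof.
move=> /andP[t0 t1] /andP[s0 s1]; rewrite mulr_ge0//=.
by apply: le_trans t1; rewrite ler_piMr.
Qed.

Lemma path_prefix X gamma p q (t : R) : path_in X gamma p q -> 0 <= t <= 1 ->
  path_in X (fun s => gamma (t * s)) p (gamma t).
Proof.
move=> [/within_contP c g0 g1 gX] t01; split; [|by rewrite mulr0|by rewrite mulr1|].
  apply/within_contP => s s01 W HW; have [d d0 Hd] := c (t * s) (scaled_in01 t01 s01) W HW.
  exists d => // s' s01' sd; apply: Hd; first exact: scaled_in01.
  by apply: le_lt_trans sd; exact: scaled_parameter.
by move=> s s01; apply: gX; exact: scaled_in01.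
Qed.

Lemma continuation_prefix gamma h H (t : R) : 0 <= t <= 1 ->
  continues (fun x k => meromorphic_at k x) gamma H -> germ_eq (gamma 0) (H 0) h ->
  continuation (fun s => gamma (t * s)) h (H t).
Proof.
move=> t01 c e; exists (fun s => H (t * s)); rewrite mulr0 mulr1; split=> //; last exact: germ_eq_refl.
move=> s s01; have [m /near_within01[d d0 Hd]] := c (t * s) (scaled_in01 t01 s01); split=> //.
apply/near_within01; exists d => // s' s01' sd; apply: Hd; first exact: scaled_in01.
by apply: le_lt_trans sd; exact: scaled_parameter.
Qed.

(** A multi-valued function has, with each of its elements, the nearby direct
    continuations. *)
Lemma multivalued_near X (f : multivalued S) p h : (forall x, X x -> nbhs x X) ->
  multivalued_meromorphic X f -> X p -> f p h -> meromorphic_at h p ->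
  \forall x \near p, f x h.
Proof.
move=> oX [b [h0 [Xb _ _ fE]]] Xp /fE[g1 [P1 [H [cH H0 H1]]]] hm.
have nW : nbhs p (fun x => X x /\ meromorphic_at h x) by exact: filterI (oX p Xp) (meromorphic_near hm).
have [V nV HV] := locally_path_connected nW.
have Vp := nbhs_singleton nV; apply: filterS nV => x Vx; have [g2 P2] := HV p x Vp Vx.
apply/fE; exists (join g1 g2).
have P2' : path_in X g2 p x by apply: path_sub P2 => y [].
split; first exact: path_join P1 P2'.
have [_ g20 g21 gW] := P2; have [_ g10 g11 _] := P1.
have cK : continues (fun x k => meromorphic_at k x) g2 (fun=> h).
  move=> t /gW[_ m]; split=> //; apply/near_within01; exists 1 => // s _ _; exact: germ_eq_refl.
have e : germ_eq p (H 1) h by rewrite g11 in H1.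
exists (join H (fun=> h)); split; first exact: (continues_join P1 P2' cH cK e).
  have l0 : (0 : R) <= 2^-1 by rewrite invr_ge0.
  by rewrite /join l0 mulr0.
have l1 : ((1 : R) <= 2^-1) = false by apply/negbTE; rewrite -ltNge; lra.
by rewrite /join l1; exact: germ_eq_refl.
Qed.

End Subpaths.

Section ResidueIntegral.
Variables (R : realType) (S : riemannSurface R) (w : meromorphicForm S) (U : S -> R).
Local Notation Co := (R[i]^o).
Local Notation Pl := (poles w).
Implicit Types (i j : chart S) (x y p q b : S) (h k : S -> option R[i]).
Hypothesis nonzero : forall i p, dom i p -> exists n, has_order (w i) i p n.
Hypothesis U_exact : forall x i, ~ Pl x -> dom i x ->
  is_dx (U \o crd_inv i) (crd i x) (Re (w i x)) /\
  is_dy (U \o crd_inv i) (crd i x) (- Im (w i x)).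
Hypothesis simple_poles : third_kind w.
Hypothesis real_residues : forall p, Pl p -> Res w p != 0 /\ Im (Res w p) = 0.

Lemma circle_algebra (r c q E V K W : R[i]) : c != 0 -> W = r / c + K ->
  (W * V * E + V * (E * (- 1 * K))) * ('i * c) * q + V * E * (q * (- (r * 'i))) = 0.
Proof. by move=> c0 ->; field. Qed.

(** A single-valued branch v of exp (int w) near a pole of residue r satisfies
    v'/v = r/z + O(1), so that going around the pole multiplies it by
    exp (2 pi i r). *)
Lemma integer_residue G p : (forall x, ~ Pl x -> dev_germ w U x G) -> Pl p ->
  exists n : int, Res w p = n%:~R.
Proof.
move=> HG Pp; have [i [r [k [ip r0 er hk wE]]]] := pole_data simple_poles real_residues Pp.
have [H dH] := hol_primitive_at hk.
have n : \forall x \near p, [/\ x != p -> exp_germ w U x G,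
    x != p -> w i x = r%:C / (crd i x - crd i p) + k (crd i x) & is_derive (crd i x : Co) 1 H (k (crd i x))].
  apply: filterS3 (poles_isolated nonzero p) wE (crd_near ip dH) => x nP wx dx; split=> // xp.
  by apply: (dev_germ_regular nonzero U_exact (nP xp)); apply: HG; exact: nP.
have [d d0 Hd] := chart_disc ip n.
pose v (z : Co) : Co := odflt 0 (G (crd_inv i z)).
pose q (z : Co) : Co := v z * cexp (- 1 * H z).
have dv z : cabs (z - crd i p) < d -> z != crd i p -> v z != 0 /\ is_derive (z : Co) 1 v (w i (crd_inv i z) * v z).
  move=> zd zp; have [iz ez [eg _ _]] := Hd z zd.
  have zp' : crd_inv i z != p by apply: contra_neq zp => e; rewrite -ez e.
  have [u [hu e] [du u0 _]] := exp_germ_holomorphic iz (eg zp'); rewrite ez in hu du u0.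
  have ev : \forall t \near (z : Co), u t = v t.
    have iz' := chart_image_near iz; rewrite ez in iz'.
    have e' := crd_inv_near iz e; rewrite ez in e'.
    by apply: filterS2 e' iz' => t; rewrite /v => -> [_ ->].
  have uv := nbhs_singleton ev; split; first by rewrite -uv.
  have dz := hol_at hu; rewrite du uv in dz; exact: cd_near ev dz.
pose c t : R[i] := crd i p + circle (d / 2) t.
have d2 : 0 < d / 2 by rewrite divr_gt0.
have cc t : cabs (c t - crd i p) = d / 2 by rewrite /c addrC addrA addNr add0r cabs_circle// ltW.
have cd t : cabs (c t - crd i p) < d by rewrite cc; lra.
have cp t : c t - crd i p != 0 by rewrite -cabs_eq0 cc gt_eqF.
have cp' t : c t != crd i p by rewrite -subr_eq0.
pose phi t : R[i] := q (c t) * cexp (t%:C * (- (r%:C * 'i))).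
have dphi t : cderiv phi t 0.
  have [iz ez [_ ew dk]] := Hd (c t) (cd t).
  have zp' : crd_inv i (c t) != p by apply: contra_neq (cp' t) => e; rewrite -ez e.
  have {}ew := ew zp'; rewrite ez in ew dk.
  have [v0 dvt] := dv (c t) (cd t) (cp' t).
  have dE := @cd_comp R (@cexp R) _ (c t) _ _ (cd_cexp _) (cdZ (- 1) dk).
  have dq := @cdM R v _ (c t) _ _ dvt dE.
  have dc : cderiv c t (0 + 'i * circle (d / 2) t) := cvD (cv_cst t (crd i p)) (cv_circle (d / 2) t).
  have dqc := @cv_comp R q c t _ _ dq dc.
  have de := cv_cexp_i (- (r%:C * 'i)) t.
  apply: cv_eq (cvM dqc de).
  have ec : circle (d / 2) t = c t - crd i p by rewrite /c addrC addrA addNr add0r.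
  by rewrite add0r ec; exact: circle_algebra (cp t) ew.
have e := @cv_cst_itv R phi 0 (2 * pi) _ (fun t _ => dphi t).
have pi0 : 0 <= 2 * pi :> R by rewrite mulr_ge0// pi_ge0.
have {}e := e pi0; have c2 : c (2 * pi) = c 0.
  rewrite /c /circle; congr (_ + _ * _).
  by have := @cexp_2piZ R 1; rewrite mulr1z mulr1 => ->; rewrite rmorph0 mul0r cexp0.
have q0 : q (c 0) != 0 by apply: mulf_neq0 (cexp_neq0 _); exact: (dv (c 0) (cd 0) (cp' 0)).1.
have e1 : cexp ((2 * pi)%:C * (- (r%:C * 'i))) = 1.
  by apply: (mulfI q0); move: e; rewrite /phi c2 rmorph0 mul0r cexp0 => <-; rewrite mulr1.
have [m em] := cexp_eq1 e1; exists (- m); rewrite er.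
have := congr1 (@complex.Im R) em; rewrite !ReImE /= => e2.
have pi1 : 2 * pi != 0 :> R by rewrite mulf_neq0// gt_eqF// pi_gt0.
have e3 : r = - m%:~R by apply: (mulfI pi1); rewrite mulrN; move: e2; rewrite !(mulr0, mul0r, mulr1, addr0, add0r, subr0); lra.
by rewrite e3 rmorphN /= rmorph_int mulrNz.
Qed.

End ResidueIntegral.

Section Triviality.
Variables (R : realType) (S : riemannSurface R) (w : meromorphicForm S) (U : S -> R).
Local Notation Co := (R[i]^o).
Local Notation Pl := (poles w).
Implicit Types (i j : chart S) (x y p q b : S) (h k : S -> option R[i]).
Hypothesis nonzero : forall i p, dom i p -> exists n, has_order (w i) i p n.
Hypothesis U_exact : forall x i, ~ Pl x -> dom i x ->
  is_dx (U \o crd_inv i) (crd i x) (Re (w i x)) /\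
  is_dy (U \o crd_inv i) (crd i x) (- Im (w i x)).
Hypothesis simple_poles : third_kind w.
Hypothesis real_residues : forall p, Pl p -> Res w p != 0 /\ Im (Res w p) = 0.
Variable g : conformalMetric S.
Hypothesis g_sing : sing g = singular w.
Hypothesis g_dens : forall i p h, ~ singular w p -> dom i p -> dev_germ w U p h ->
  g i p = pullback_density i h p.
Variable p0 : S.
Hypothesis p0_regular : ~ Pl p0.

Local Notation single_valued := (forall p gamma, path_in (~` Pl) gamma p p ->
  exists n : int, path_integral w gamma ((2 * pi * n%:~R)%:C * 'i)).

Let dev p : (~` singular w) p -> exists h, dev_germ w U p h.
Proof. exact: nonsingular_dev nonzero U_exact simple_poles real_residues p. Qed.

Let regular_open p : (~` Pl) p -> nbhs p (~` Pl).
Proof. exact: isolated_open (poles_isolated nonzero) p. Qed.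

Let nonsingular_open p : (~` singular w) p -> nbhs p (~` singular w).
Proof. exact: isolated_open (singular_isolated nonzero) p. Qed.

(** Single-valuedness gives a global section of exp (int w), which extends across
    the poles of residue 1 and -1; the developing map that it generates has
    trivial monodromy. *)
Lemma trivial_of_loops : reducible g -> single_valued -> trivial_reducible g.
Proof.
move=> red loops; split=> //.
have [G0 HG0] := section_of_loops nonzero U_exact p0_regular loops.
have [G [_ HG]] := dev_section_extension nonzero dev nonsingular_open (poles_isolated nonzero)
  (fun x nx _ => HG0 x nx).
have [b [ns nP]] := regular_point_exists nonzero p0_regular.
exists (generated (~` singular w) b G).
  exact: (generated_developing nonzero U_exact simple_poles real_residues g_sing g_dens ns (HG b ns)).
rewrite g_sing => p h gamma k [g1 [P1 c1]] P c.
have cG g' p' q' : path_in (~` singular w) g' p' q' -> continues (dev_germ w U) g' (fun=> G).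
  move=> [_ _ _ gX] t t01; split; first by apply: HG; exact: gX.
  by apply: filterE => s; exact: germ_eq_refl.
have e1 := continuation_unique_continues P1 (continues_meromorphic (cG _ _ _ P1)) c1.
have c' : continuation gamma G k.
  have [K [cK K0 K1]] := c; exists K; split=> //.
  by have [_ g0 _ _] := P; rewrite g0 in K0 *; apply: filterS2 K0 e1 => x -> ->.
have e2 := continuation_unique_continues P (continues_meromorphic (cG _ _ _ P)) c'.
by exists id => //; apply: filterS2 e1 e2 => x -> ->.
Qed.

(** Inversion of either side of the relation only permutes the coefficients. *)
Lemma germ_mobius h h' u u' i b (a c d e : R[i]) : a * e - c * d != 0 ->
  (\forall x \near b, h x = Some (u (crd i x))) \/
  (\forall x \near b, sphere_inv (h x) = Some (u (crd i x))) ->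
  (\forall x \near b, h' x = Some (u' (crd i x))) \/
  (\forall x \near b, sphere_inv (h' x) = Some (u' (crd i x))) ->
  (\forall x \near b, Some (u (crd i x)) = mobius a c d e (Some (u' (crd i x)))) ->
  exists a' c' d' e' : R[i], a' * e' - c' * d' != 0 /\
    germ_eq b h (mobius a' c' d' e' \o h').
Proof.
move=> det nh nh' m.
have [a1 [c1 [d1 [e1 [det1 m1]]]]] : exists a1 c1 d1 e1 : R[i], a1 * e1 - c1 * d1 != 0 /\
    \forall x \near b, h x = mobius a1 c1 d1 e1 (Some (u' (crd i x))).
  case: nh => n; first by exists a, c, d, e; split=> //; apply: filterS2 n m => x ->.
  exists d, e, a, c; split; first by rewrite -oppr_eq0 opprB [d * c]mulrC [e * a]mulrC.
  apply: filterS2 n m => x n m; rewrite -[h x]sphere_invK n m; exact: sphere_inv_mobius.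
case: nh' => n; first by exists a1, c1, d1, e1; split=> //; apply: filterS2 n m1 => x /= -> ->.
exists c1, a1, e1, d1; split; first by rewrite -oppr_eq0 opprB.
by apply: filterS2 n m1 => x n1 ->; rewrite -n1 mobius_sphere_inv.
Qed.

(** Two developing maps of g differ by a Moebius transformation, by rigidity
    of the spherical density; so with one of them all are single-valued. *)
Lemma loops_of_trivial : trivial_reducible g -> single_valued.
Proof.
move=> [_ [f [mf lf pf] tf]]; rewrite g_sing in mf lf tf.
have [b [h' [Xb mh' ch' fE]]] := mf.
have fb : f b h' by apply/fE; exact: generated_refl.
have [h0 d0] := dev Xb; have [i ib] := dom_cover b.
have [u [hu du nu]] := nonsingular_univalent nonzero U_exact simple_poles real_residues Xb d0 ib.
have [u' [hu' nu']] := meromorphic_chart ib mh'.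
have {}nu' : (\forall x \near b, h' x = Some (u' (crd i x))) \/
  (\forall x \near b, sphere_inv (h' x) = Some (u' (crd i x))) by case: nu' => [|[]]; [left|right].
have gu : \forall x \near b, g i x = spher u (crd i x).
  have n : \forall x \near b, dom i x /\ holomorphic_at u (crd i x).
    exact: filterI (dom_near ib) (crd_near ib (hol_near hu)).
  have n' : \forall x \near b, dev_germ w U x h0 /\ ~ singular w x.
    exact: filterI (dev_germ_near nonzero d0) (nonsingular_open Xb).
  case: nu => nu.
    apply: filterS3 n n' (germ_eq_near nu) => x [ix _] [dx ns] e.
    by rewrite (g_dens ns ix dx); exact: pullback_density_finite.
  have nu2 := @germ_eq_near _ _ _ _ (@sphere_inv R \o h0) _ nu.
  apply: filterS3 n n' nu2 => x [ix hx] [dx ns] e.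
  by rewrite (g_dens ns ix dx); exact: pullback_density_infinite.
have gu' : \forall x \near b, g i x = spher u' (crd i x).
  have n : \forall x \near b, dom i x /\ holomorphic_at u' (crd i x).
    exact: filterI (dom_near ib) (crd_near ib (hol_near hu')).
  have n' : \forall x \near b, f x h' /\ ~ singular w x.
    exact: filterI (multivalued_near nonsingular_open mf Xb fb mh') (nonsingular_open Xb).
  have dens x : f x h' -> ~ singular w x -> dom i x -> g i x = pullback_density i h' x.
    by move=> fx ns ix; apply: pf => //; rewrite g_sing.
  case: nu' => nu2.
    apply: filterS3 n n' (germ_eq_near nu2) => x [ix _] [fx ns] e.
    by rewrite (dens x)//; exact: pullback_density_finite.
  have nu3 := @germ_eq_near _ _ _ _ (@sphere_inv R \o h') _ nu2.
  apply: filterS3 n n' nu3 => x [ix hx] [fx ns] e.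
  by rewrite (dens x)//; exact: pullback_density_infinite.
have su : \forall x \near b, spher u' (crd i x) = spher u (crd i x).
  by apply: filterS2 gu gu' => x <- <-.
have sz : \forall z \near (crd i b : Co), spher u' z = spher u z.
  apply: filterS2 (crd_inv_near ib su) (chart_image_near ib) => z e [_ ez].
  by rewrite ez in e.
(* the density of g is positive, so that u' is an immersion as well *)
have du' : derive1 u' (crd i b) != 0.
  have := spher_gt0 du; rewrite -(nbhs_singleton sz).
  by apply: contraTneq => e; rewrite /spher e cabs0 expr0n mulr0 mul0r ltxx.
have [a [c [d [e [det m]]]]] := rigidity hu' hu du' du sz.
have mx : \forall x \near b, Some (u (crd i x)) = mobius a c d e (Some (u' (crd i x))).
  by apply: filterS (crd_near ib m) => x [/negbTE n ->]; rewrite /= n.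
have [a1 [c1 [d1 [e1 [det1 hL]]]]] := germ_mobius det nu nu' mx.
have dpole p : (~` Pl) p -> exists h, dev_germ w U p h.
  by move=> nP; apply: smooth_dev nonzero U_exact simple_poles real_residues _ _ => /nP.
have [|gamma H P cH H0|F [_ HF]] := global_section (@dev_germ_uniq _ _ w U)
  (dev_germ_triv nonzero dev) (dev_germ_near nonzero)
  (@dev_germ_ext _ _ w U) nonsingular_open _ Xb d0.
- by move=> p q; exact: (path_connected_compl (singular_isolated nonzero)).
- have [k ck] := ch' gamma b P; have [H' [cH' H'0 H'1]] := ck.
  have [L -> ek] := tf b h' gamma k fb P ck.
  have [_ g0 g1 gX] := P.
  have inj t : 0 <= t <= 1 -> injective_near (gamma t) (H' t).
    move=> t01; apply: lf; first exact: gX.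
    apply/fE; exists (fun s => gamma (t * s)); split; first exact: path_prefix P t01.
    exact: continuation_prefix t01 cH' H'0.
  have cL : continues (fun x k => meromorphic_at k x) gamma (fun t => mobius a1 c1 d1 e1 \o H' t).
    move=> t t01; have [mt et] := cH' t t01; split; first exact: meromorphic_mobius (inj t t01) mt.
    by apply: filterS et => s; apply: filterS => x /= ->.
  rewrite g0 in H'0; rewrite g1 in H'1.
  have e0 : germ_eq b (H 0) (mobius a1 c1 d1 e1 \o H' 0).
    by rewrite H0; apply: filterS2 hL H'0 => x -> /= ->.
  have := continues_unique (@meromorphic_uniq R S) P (continues_meromorphic cH) cL e0 (in01_1 R).
  rewrite g1 => e2; have n : \forall x \near b, H' 1 x = h' x by apply: filterS2 H'1 ek => x -> ->.
  by apply: filterS3 e2 n hL => x -> /= -> ->.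
have [G [_ HG]] := dev_section_extension nonzero dpole regular_open (singular_isolated nonzero)
  (fun x ns _ => HF x ns).
exact: (loops_of_section nonzero U_exact HG).
Qed.

Lemma trivial_residues : trivial_reducible g -> forall p, Pl p -> exists n : int, Res w p = n%:~R.
Proof.
move=> /loops_of_trivial loops p Pp.
have [G HG] := section_of_loops nonzero U_exact p0_regular loops.
exact: (integer_residue nonzero U_exact simple_poles real_residues HG Pp).
Qed.

End Triviality.

(** * The function exp (int w) and the divisor *)

Section ExpIntegral.
Variables (R : realType) (S : riemannSurface R) (w : meromorphicForm S) (U : S -> R).
Local Notation Pl := (poles w).
Implicit Types (i j : chart S) (x y p q b : S) (h k : S -> option R[i]).

(** The potential is normalised so that exp (int w) has modulus e^U for the
    prescribed constant of integration c. *)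
Lemma exact_potential p0 (c : R[i]) : real_part_exact w -> exists2 V : S -> R, V p0 = Re c &
  forall x i, ~ Pl x -> dom i x ->
    is_dx (V \o crd_inv i) (crd i x) (Re (w i x)) /\
    is_dy (V \o crd_inv i) (crd i x) (- Im (w i x)).
Proof.
move=> [u0 Hu]; exists (fun x => u0 x + (Re c - u0 p0)); first by rewrite addrC subrK.
move=> x i nP ix; have [dxu dyu] := Hu x i nP ix.
split; rewrite /is_dx /is_dy.
  have h := rdD dxu (rd_cst 0 (Re c - u0 p0)); rewrite addr0 in h; exact: h.
have h := rdD dyu (rd_cst 0 (Re c - u0 p0)); rewrite addr0 in h; exact: h.
Qed.

Hypothesis nonzero : forall i p, dom i p -> exists n, has_order (w i) i p n.
Hypothesis U_exact : forall x i, ~ Pl x -> dom i x ->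
  is_dx (U \o crd_inv i) (crd i x) (Re (w i x)) /\
  is_dy (U \o crd_inv i) (crd i x) (- Im (w i x)).
Hypothesis simple_poles : third_kind w.
Hypothesis real_residues : forall p, Pl p -> Res w p != 0 /\ Im (Res w p) = 0.
Variables (p0 : S) (c : R[i]).
Hypotheses (p0_regular : ~ Pl p0) (U_p0 : U p0 = Re c).

Lemma exp_integral_generated : exists2 h0, dev_germ w U p0 h0 &
  exp_integral w p0 c = generated (~` Pl) p0 h0.
Proof.
have [F nF Fp] := normalized_primitive_exists nonzero U_exact p0_regular (esym U_p0).
exists (fun x => Some (cexp (F x))).
  exact: (exp_germ_dev nonzero (exp_germ_exp p0_regular nF)).
apply/funext => q; apply/funext => k; apply/propext.
exact: (exp_integralP nonzero U_exact p0_regular nF Fp).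
Qed.

Let dev p : (~` Pl) p -> exists h, dev_germ w U p h.
Proof. by move=> nP; apply: smooth_dev nonzero U_exact simple_poles real_residues _ _ => /nP. Qed.

Lemma exp_integral_dev p h : exp_integral w p0 c p h -> ~ Pl p /\ dev_germ w U p h.
Proof.
by have [h0 d ->] := exp_integral_generated => /(generated_dev nonzero dev d).
Qed.

(** The complement of the poles is path-connected. *)
Lemma exp_integral_covers x : ~ Pl x -> exists2 h, exp_integral w p0 c x h & exp_germ w U x h.
Proof.
move=> nP; have [h0 d ->] := exp_integral_generated.
have [gamma P] := path_connected_compl (poles_isolated nonzero) p0_regular nP.
have [H cH H0] := dev_germ_continues nonzero dev P d.
have fx : generated (~` Pl) p0 h0 x (H 1).
  exists gamma; split=> //; exists H; split; [|by rewrite H0; exact: germ_eq_refl|exact: germ_eq_refl].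
  exact: continues_meromorphic cH.
exists (H 1) => //; have [_ d1] := generated_dev nonzero dev d fx.
exact: (dev_germ_regular nonzero U_exact nP d1).
Qed.

Lemma exp_integral_multivalued : multivalued_meromorphic (~` Pl) (exp_integral w p0 c).
Proof.
have [h0 d ->] := exp_integral_generated.
exact: (generated_multivalued nonzero dev p0_regular d).
Qed.

Lemma exp_integral_univalent : locally_univalent_on (~` (Pl `|` zeros w)) (exp_integral w p0 c).
Proof.
move=> p h np /exp_integral_dev[nP d].
have ns : ~ singular w p by move=> [zp|[Pp _]]; [apply: np; right|].
exact: (dev_univalent nonzero U_exact simple_poles real_residues ns d).
Qed.

Lemma exp_integral_monodromy : monodromy_in (~` Pl) (@U1 R) (exp_integral w p0 c).
Proof.
by have [h0 d ->] := exp_integral_generated; exact: (generated_monodromy nonzero dev d).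
Qed.

End ExpIntegral.

Section Divisor.
Variables (R : realType) (S : riemannSurface R) (w : meromorphicForm S).
Variables (J K : nat) (P : 'I_J -> S) (Q : 'I_K -> S) (alpha : 'I_J -> int).
Hypotheses (Q_inj : injective Q) (PQ : forall j k, P j <> Q k).
Hypothesis alpha1 : forall j, 1 < alpha j.
Implicit Types x : S.

Lemma sum_indicator (V : pzSemiRingType) (a : 'I_K -> V) k :
  \sum_(l < K) a l * (Q k == Q l)%:R = a k.
Proof.
rewrite (bigD1 k)//= eqxx mulr1 big1 ?addr0// => l lk.
by rewrite (inj_eq Q_inj) eq_sym (negbTE lk) mulr0.
Qed.

Lemma sum_zeros_at_pole (V : pzSemiRingType) (a : 'I_J -> V) k :
  \sum_(j < J) a j * (Q k == P j)%:R = 0.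
Proof.
apply: big1 => j _; case: eqP => [e|_]; last by rewrite mulr0.
by case: (PQ (esym e)).
Qed.

Local Notation D0 x := (\sum_(j < J) (alpha j - 1) * (x == P j)%:R - \sum_(k < K) (x == Q k)%:R : int).
Local Notation D1 x := (\sum_(j < J) (alpha j - 1)%:~R * (x == P j)%:R
  + \sum_(k < K) (cabs (Res w (Q k)) - 1) * (x == Q k)%:R : R).

Lemma divisor_at_pole k : D0 (Q k) = -1 /\ D1 (Q k) = cabs (Res w (Q k)) - 1.
Proof.
rewrite !sum_zeros_at_pole (sum_indicator (fun k => cabs (Res w (Q k)) - 1)) !add0r; split=> //.
congr (- _); rewrite -[RHS](sum_indicator (fun=> 1) k).
by apply: eq_bigr => l _; rewrite mul1r.
Qed.

Lemma divisor_off_poles x : (forall k, x <> Q k) -> 0 <= D0 x /\ D1 x = (D0 x)%:~R.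
Proof.
move=> xQ; have z (V : pzSemiRingType) (a : 'I_K -> V) : \sum_(k < K) a k * (x == Q k)%:R = 0.
  by apply: big1 => k _; case: eqP => [/xQ//|_]; rewrite mulr0.
have -> : \sum_(k < K) (x == Q k)%:R = 0%R :> int.
  by apply: etrans (z int (fun=> 1)); apply: eq_bigr => k _; rewrite mul1r.
rewrite z subr0 addr0; split.
  apply: sumr_ge0 => j _; apply: mulr_ge0; last exact: ler0n.
  by rewrite subr_ge0 ltW.
by rewrite rmorph_sum; apply: eq_bigr => j _; rewrite rmorphM /= rmorph_nat.
Qed.

(** The points Q k are exactly the poles, since the order is negative there and
    nowhere else. *)
Lemma canonical_divisor_cases : canonical_divisor w (fun x => D0 x) ->
  (forall x, ~ poles w x -> exists n : nat, ord_form w x n%:Z /\ D1 x = n%:R) /\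
  (forall x, poles w x -> D1 x = cabs (Res w x) - 1).
Proof.
move=> HD; split=> x.
  move=> nP; have xQ k : x <> Q k.
    move=> e; apply: nP; exists (D0 x); split; last exact: HD.
    by rewrite e (divisor_at_pole k).1.
  have [D0x D1x] := divisor_off_poles xQ; rewrite D1x; have := HD x.
  by case: (D0 x) D0x => // n _ o; exists n.
move=> [n [n0 o]]; have D0x : D0 x < 0 by exact: order_sign o (HD x) n0.
have [k ->] : exists k, x = Q k.
  apply: contrapT => ne; have xQ k : x <> Q k by move=> e; apply: ne; exists k.
  by have [] := divisor_off_poles xQ; rewrite leNgt D0x.
exact: (divisor_at_pole k).2.
Qed.

End Divisor.

Theorem theorem1p2 (R : realType) (S : riemannSurface R)
    (w : meromorphicForm S)
    (S_compact : compact [set: S])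
    (w_third_kind : third_kind w)
    (w_poles : poles w !=set0)
    (w_res : forall p, poles w p -> Res w p != 0 /\ complex.Im (Res w p) = 0)
    (w_exact : real_part_exact w)
    (p0 : S) (c : R[i]) (p0_reg : ~ poles w p0) :
  let f := exp_integral w p0 c in
  [/\ multivalued_meromorphic (~` poles w) f,
      locally_univalent_on (~` (poles w `|` zeros w)) f
    & monodromy_in (~` poles w) (@U1 R) f] /\
  exists g : conformalMetric S,
    [/\ [/\ reducible g, character_form g w & is_pullback g f],
        forall g' : conformalMetric S,
          reducible g' -> character_form g' w -> is_pullback g' f ->
          metric_eq g g',
        forall (J K : nat) (P : 'I_J -> S) (Q : 'I_K -> S) (alpha : 'I_J -> int),
          injective P -> injective Q -> (forall j k, P j <> Q k) ->
          (forall j, 1 < alpha j) ->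
          canonical_divisor w (fun x =>
            \sum_(j < J) (alpha j - 1) * (x == P j)%:R
            - \sum_(k < K) (x == Q k)%:R) ->
          represents g (fun x =>
            \sum_(j < J) (alpha j - 1)%:~R * (x == P j)%:R
            + \sum_(k < K) (cabs (Res w (Q k)) - 1) * (x == Q k)%:R),
        trivial_reducible g <->
          (forall p gamma, path_in (~` poles w) gamma p p ->
             exists n : int, path_integral w gamma ((2 * pi * n%:~R)%:C * 'i))
      & trivial_reducible g ->
          forall p, poles w p -> exists n : int, Res w p = n%:~R].
Proof.
move=> f; have nonzero := form_has_order w_poles.
have [U U0 U_exact] := exact_potential p0 c w_exact.
split.
  split.
  - exact: (exp_integral_multivalued nonzero U_exact w_third_kind w_res p0_reg U0).
  - exact: (exp_integral_univalent nonzero U_exact w_third_kind w_res p0_reg U0).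
  - exact: (exp_integral_monodromy nonzero U_exact w_third_kind w_res p0_reg U0).
have [g [g_sing g_dens g_curv]] :=
  spherical_metric_exists nonzero U_exact w_third_kind w_res S_compact.
have con := spherical_metric_conical nonzero U_exact w_third_kind w_res g_sing g_dens g_curv.
have red := spherical_metric_reducible nonzero U_exact w_third_kind w_res g_sing g_dens con p0_reg.
exists g; split.
- split; first exact: red.
  + exact: (spherical_metric_character nonzero U_exact w_third_kind w_res g_sing g_dens con p0_reg).
  + move=> p h i fp; rewrite g_sing => ns ip.
    by have [_ d] := exp_integral_dev nonzero U_exact w_third_kind w_res p0_reg U0 fp; exact: g_dens.
- move=> g' [[rep _] _] _ pb.
  have cov x nx := exp_integral_covers nonzero U_exact w_third_kind w_res p0_reg U0 (x := x) nx.
  exact: (spherical_metric_unique nonzero U_exact w_third_kind w_res g_sing g_dens cov rep pb).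
- move=> J K P Q alpha _ Q_inj PQ alpha1 /(canonical_divisor_cases Q_inj PQ alpha1)[Dreg Dpole].
  exact: (spherical_metric_represents nonzero U_exact w_third_kind w_res g_sing g_dens Dreg Dpole).
- split.
  + exact: (loops_of_trivial nonzero U_exact w_third_kind w_res g_sing g_dens).
  + exact: (trivial_of_loops nonzero U_exact w_third_kind w_res g_sing g_dens p0_reg red).
- exact: (trivial_residues nonzero U_exact w_third_kind w_res g_sing g_dens p0_reg).
Qed.
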